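(* Let $(A,\lambda_A)$ be in $\mathrm{C}_{\mathcal O}$ with $A$ a Gorenstein local ring, and let $M$ be a maximal Cohen–Macaulay $A$-module with $\mu:=\operatorname{rank}_{A_{\mathfrak p_A}}(M_{\mathfrak p_A})\ne 0$. Then $\delta_A(M)=\mu\cdot\delta_A(A)$ if and only if $$M\cong A^{\mu}\oplus W\quad\text{for some $A$-module } W \text{ with } W_{\mathfrak p_A}=0.$$ If moreover $e_A(M)\le\mu\cdot e(A)$, then $M$ is free.
   Context: $\mathcal O$ is a discrete valuation ring with uniformizer $\varpi$. For a finitely generated $\mathcal O$-module $U$, $\operatorname{tors}(U)$ is its torsion submodule and $U^{\mathrm{tf}}:=U/\operatorname{tors}(U)$. $\mathrm{C}_{\mathcal O}$ is the category of pairs $(A,\lambda_A)$ where $A$ is a complete noetherian local $\mathcal O$-algebra and $\lambda_A\colon A\to\mathcal O$ is a surjective map of $\mathcal O$-algebras such that, with $\mathfrak p_A:=\operatorname{Ker}\lambda_A$, the local ring $A_{\mathfrak p_A}$ is regular. Put $c:=\dim A_{\mathfrak p_A}$. $\mathcal O$ is an $A$-module via $\lambda_A$. For a finitely generated $A$-module $M$, the natural map $M\to M/\mathfrak p_AM$ induces a map of $\mathcal O$-modules $\operatorname{Ext}^c_A(\mathcal O,M)^{\mathrm{tf}}\to \operatorname{Ext}^c_A(\mathcal O,M/\mathfrak p_AM)^{\mathrm{tf}}$; its cokernel is the congruence module $\Psi_A(M)$ (of finite length over $\mathcal O$). Put $\Phi_A:=\operatorname{tors}(\mathfrak p_A/\mathfrak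 p_A^2)$. The Wiles defect is $$\delta_A(M):=(\operatorname{rank}_{A_{\mathfrak p_A}}M_{\mathfrak p_A})\cdot\operatorname{length}_{\mathcal O}\Phi_A-\operatorname{length}_{\mathcal O}\Psi_A(M).$$ (For $M$ maximal Cohen–Macaulay, $M_{\mathfrak p_A}$ is free over $A_{\mathfrak p_A}$.) $e_A(M)$ is the Hilbert–Samuel multiplicity of $M$ with respect to the maximal ideal of $A$, and $e(A):=e_A(A)$. The last sentence of the claim is to be read under the equivalent conditions of the preceding sentence. *)

(* Defs.v *)
From HB Require Import structures.
From mathcomp Require Import all_boot all_order all_algebra.
From mathcomp Require Import generic_quotient ring_quotient ring.
From mathcomp Require Import boolp classical_sets.

Set Implicit Arguments.
Unset Strict Implicit.
Unset Printing Implicit Defensive.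

Import GRing.Theory.
Local Open Scope ring_scope.
Local Open Scope quotient_scope.

(* The largest element of S; 0 if S is empty or unbounded. *)
Definition maxnat (S : set nat) : nat :=
  xget 0%N [set n | S n /\ forall k, S k -> (k <= n)%N].

Section Submodules.
Variables (R : nzRingType) (V : lmodType R).

Record submod_type (U : submodClosed V) :=
  SubMod { submod_val :> V; submod_valP : submod_val \in U }.

HB.instance Definition _ U := [isSub for @submod_val U].
HB.instance Definition _ U := [Choice of submod_type U by <:].
HB.instance Definition _ U :=
  [SubChoice_isSubLmodule of submod_type U by <:].

(* The submodule generated by X. *)
Definition mspan (X : set V) : {pred V} := fun x =>
  `[< forall U : submodClosed V, (forall y, X y -> y \in U) -> x \in U >].

Lemma mspan_submod_closed X : subsemimod_closed (mspan X).
Proof.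
split; first split.
- by apply/asboolP => U _; exact: rpred0.
- move=> x y /asboolP hx /asboolP hy; apply/asboolP => U hU.
  by apply: rpredD; [exact: hx|exact: hy].
- move=> a x /asboolP hx; apply/asboolP => U hU.
  by apply: rpredZ; exact: hx.
Qed.

HB.instance Definition _ X :=
  GRing.isSubmodClosed.Build R V (mspan X) (mspan_submod_closed X).

(* For an ideal I and a submodule U this is the submodule I U. *)
Definition smul (I : {pred R}) (U : {pred V}) : submodClosed V :=
  mspan [set x | exists a u, [/\ a \in I, u \in U & x = a *: u]].

(* powmod I n is I^n V *)
Fixpoint powmod (I : {pred R}) (n : nat) : {pred V} :=
  if n is k.+1 then smul I (powmod I k) else predT.

Lemma powmod_submod_closed I n : subsemimod_closed (powmod I n).
Proof.
by case: n => [|n] //=; split; [split; [exact: rpred0|exact: rpredD]|exact: rpredZ].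
Qed.

HB.instance Definition _ I n :=
  GRing.isSubmodClosed.Build R V (powmod I n) (powmod_submod_closed I n).

Definition fin_gen (U : {pred V}) : Prop :=
  exists s : seq V, U =i mspan [set x | x \in s].

Definition mlength : nat :=
  maxnat [set n | exists U : nat -> submodClosed V, forall i, (i < n)%N ->
    {subset U i <= U i.+1} /\ ~ {subset U i.+1 <= U i}].

(* Maximal number of linearly independent elements. Over an integral domain
   this is the dimension after tensoring with the fraction field; for a free
   module over a nonzero commutative ring it is the cardinal of a basis. *)
Definition mrank : nat :=
  maxnat [set n | exists f : 'I_n -> V, forall c : 'I_n -> R,
    \sum_i c i *: f i = 0 -> forall i, c i = 0].

Definition fin_free : Prop :=
  exists n (f : {linear 'rV[R]_n -> V}), bijective f.

End Submodules.

Lemma linear_mspan (R : nzRingType) (V W : lmodType R) (f : {linear V -> W})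
    (X : set V) (Y : set W) :
  (forall x, X x -> Y (f x)) -> forall x, x \in mspan X -> f x \in mspan Y.
Proof.
move=> hXY x /asboolP hx; apply/asboolP => U hU.
pose T : {pred V} := fun z => f z \in U.
have TP : subsemimod_closed T.
  split; first split.
  - by change (is_true (f 0 \in U)); rewrite linear0; exact: rpred0.
  - move=> u v hu hv; change (is_true (f (u + v) \in U)).
    by rewrite linearD; exact: rpredD.
  - move=> a u hu; change (is_true (f (a *: u) \in U)).
    by rewrite linearZ; exact: rpredZ.
pose TC := GRing.isSubmodClosed.Build R V T TP.
pose T' : submodClosed V := HB.pack T TC.
exact: (hx T' (fun y Xy => hU _ (hXY _ Xy))).
Qed.

Definition miso (R : nzRingType) (V W : lmodType R) : Prop :=
  exists f : {linear V -> W}, bijective f.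

Section Quotients.
Variables (R : nzRingType) (V : lmodType R) (U : submodClosed V).

Definition submod_zpred : {pred V} := fun x => x \in U.

Lemma submod_zmod_closed : zmod_closed submod_zpred.
Proof.
split=> [|x y]; rewrite /submod_zpred ?inE; first exact: rpred0.
move=> hx hy; rewrite -scaleN1r; apply: rpredD => //; exact: rpredZ.
Qed.

HB.instance Definition _ :=
  GRing.isZmodClosed.Build V submod_zpred submod_zmod_closed.

Definition modquot : Type := Quotient.quot submod_zpred.
HB.instance Definition _ := GRing.Zmodule.on modquot.

Definition mproj (x : V) : modquot := \pi_(Quotient.quot submod_zpred) x.

Lemma mproj_eq x y : (mproj x = mproj y) <-> (x - y \in U).
Proof.
have E := Quotient.idealrBE submod_zpred x y; rewrite /mproj.
by split=> [/eqP|]; [rewrite -E|move=> h; apply/eqP; rewrite -E].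
Qed.

Lemma mprojK (q : modquot) : mproj (repr q) = q.
Proof. exact: reprK. Qed.

Lemma mprojB x y : mproj (x - y) = mproj x - mproj y.
Proof.
exact: (raddfB (\pi_(Quotient.quot submod_zpred) : {additive _ -> _})).
Qed.

Lemma mprojD x y : mproj (x + y) = mproj x + mproj y.
Proof.
exact: (raddfD (\pi_(Quotient.quot submod_zpred) : {additive _ -> _})).
Qed.

Definition modquot_scale (a : R) (q : modquot) : modquot := mproj (a *: repr q).

Lemma modquot_scaleE a x : modquot_scale a (mproj x) = mproj (a *: x).
Proof.
by apply/mproj_eq; rewrite -scalerBr; apply/rpredZ/mproj_eq; rewrite mprojK.
Qed.

Lemma modquot_scaleA a b q :
  modquot_scale a (modquot_scale b q) = modquot_scale (a * b) q.
Proof. by rewrite -[q]mprojK !modquot_scaleE scalerA. Qed.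

Lemma modquot_scale1 : left_id 1 modquot_scale.
Proof. by move=> q; rewrite -[q]mprojK modquot_scaleE scale1r. Qed.

Lemma modquot_scaleDr : right_distributive modquot_scale +%R.
Proof.
move=> a p q; rewrite -[p]mprojK -[q]mprojK -mprojD !modquot_scaleE.
by rewrite scalerDr mprojD.
Qed.

Lemma modquot_scaleDl q : {morph modquot_scale^~ q : a b / a + b}.
Proof.
by move=> a b; rewrite -[q]mprojK !modquot_scaleE scalerDl mprojD.
Qed.

HB.instance Definition _ := GRing.Zmodule_isLmodule.Build R modquot
  modquot_scaleA modquot_scale1 modquot_scaleDr modquot_scaleDl.

Lemma mproj_linear : linear mproj.
Proof. by move=> a x y; rewrite mprojD -modquot_scaleE. Qed.

HB.instance Definition _ :=
  GRing.isLinear.Build R V modquot *:%R mproj mproj_linear.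

End Quotients.

(* The map V / U -> V' / U' induced by f : V -> V' with f(U) in U'. *)
Section QuotientMap.
Variables (R : nzRingType) (V V' : lmodType R).
Variables (U : submodClosed V) (U' : submodClosed V').
Variables (f : {linear V -> V'}) (fU : forall x, x \in U -> f x \in U').

Definition quotmap_fun of (forall x, x \in U -> f x \in U') :=
  fun q : modquot U => mproj U' (f (repr q)).

Lemma quotmapE x : quotmap_fun fU (mproj U x) = mproj U' (f x).
Proof.
by apply/mproj_eq; rewrite -linearB; apply/fU/mproj_eq; rewrite mprojK.
Qed.

Lemma quotmap_linear : linear (quotmap_fun fU).
Proof.
move=> a p q; rewrite -[p](mprojK) -[q](mprojK) -linearP !quotmapE.
by rewrite !linearP.
Qed.

HB.instance Definition _ :=
  GRing.isLinear.Build R (modquot U) (modquot U') *:%R (quotmap_fun fU)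
    quotmap_linear.

Definition quotmap : {linear modquot U -> modquot U'} := quotmap_fun fU.
End QuotientMap.

Definition coker (R : nzRingType) (V W : lmodType R) (f : {linear V -> W})
  : lmodType R := modquot (mspan [set f x | x in [set: V]]).

Definition restr (R S : nzRingType) (f : {rmorphism R -> S}) (V : lmodType S) :
  Type := V.

Section Restriction.
Variables (R S : nzRingType) (f : {rmorphism R -> S}).

HB.instance Definition _ V := GRing.Zmodule.on (restr f V).

Section RestrLmod.
Variable V : lmodType S.
Definition restr_scale (a : R) (x : restr f V) : restr f V := f a *: (x : V).
Lemma restr_scaleA a b x : restr_scale a (restr_scale b x) = restr_scale (a * b) x.
Proof. by rewrite /restr_scale scalerA rmorphM. Qed.
Lemma restr_scale1 : left_id 1 restr_scale.
Proof. by move=> x; rewrite /restr_scale rmorph1 scale1r. Qed.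
Lemma restr_scaleDr : right_distributive restr_scale +%R.
Proof. by move=> a x y; rewrite /restr_scale scalerDr. Qed.
Lemma restr_scaleDl x : {morph restr_scale^~ x : a b / a + b}.
Proof. by move=> a b; rewrite /restr_scale rmorphD scalerDl. Qed.
HB.instance Definition _ := GRing.Zmodule_isLmodule.Build R (restr f V)
  restr_scaleA restr_scale1 restr_scaleDr restr_scaleDl.
End RestrLmod.

Section RestrMap.
Variables (V W : lmodType S) (g : {linear V -> W}).
Definition restr_fun : restr f V -> restr f W := g.
Lemma restr_fun_linear : linear restr_fun.
Proof. by move=> a x y; rewrite /restr_fun; exact: (linearP g (f a)). Qed.
HB.instance Definition _ :=
  GRing.isLinear.Build R (restr f V) (restr f W) *:%R restr_fun restr_fun_linear.
Definition restr_map : {linear restr f V -> restr f W} := restr_fun.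
End RestrMap.
End Restriction.

Section Denominators.
Variables (R : comNzRingType) (P : prime_idealr R).

Record denom := Denom { denom_val :> R; denomP : denom_val \notin P }.
HB.instance Definition _ := [isSub for denom_val].
HB.instance Definition _ := [Choice of denom by <:].

Lemma denom1_subproof : 1 \notin P. Proof. by rewrite idealr1. Qed.
Definition denom1 : denom := Denom denom1_subproof.

Lemma denomM_subproof (s t : denom) : (s : R) * (t : R) \notin P.
Proof. by rewrite prime_idealrM negb_or !denomP. Qed.
Definition denomM (s t : denom) : denom := Denom (denomM_subproof s t).
End Denominators.

Section LocalizedModule.
Variables (R : comNzRingType) (P : prime_idealr R) (V : lmodType R).
Local Notation den := (denom P).
Local Notation "# s" := (denom_val s) (at level 8, format "# s").

Definition locrel (x y : V * den) : bool :=
  `[< exists u : den, (#u * #(y.2)) *: x.1 = (#u * #(x.2)) *: y.1 >].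

Lemma locrel_equiv : equiv_class_of locrel.
Proof.
split=> [x|x y|y x z].
- by apply/asboolP; exists (denom1 P).
- by apply/asboolP/asboolP => -[u e]; exists u.
move=> /asboolP[u e] /asboolP[w f]; apply/asboolP.
exists (denomM (denomM u w) y.2) => /=.
transitivity ((#w * #(z.2)) *: ((#u * #(y.2)) *: x.1)).
  by rewrite scalerA; congr (_ *: _); ring.
rewrite e; transitivity ((#u * #(x.2)) *: ((#w * #(z.2)) *: y.1)).
  by rewrite !scalerA mulrC.
by rewrite f scalerA; congr (_ *: _); ring.
Qed.

Canonical locrel_canonical := EquivRelPack locrel_equiv.

(* Fractions v / s with s outside of P. *)
Definition locmod : Type := {eq_quot locrel}.
HB.instance Definition _ := Choice.on locmod.

Definition mkfrac (v : V) (s : den) : locmod := \pi_({eq_quot locrel}) (v, s).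

Lemma mkfrac_eq v s w t : (mkfrac v s = mkfrac w t) <->
  exists u : den, (#u * #t) *: v = (#u * #s) *: w.
Proof.
rewrite /mkfrac; split=> [/eqP|h].
  by rewrite eqmodE => /asboolP.
by apply/eqP; rewrite eqmodE; apply/asboolP.
Qed.

Lemma mkfracK (x : locmod) : mkfrac (repr x).1 (repr x).2 = x.
Proof. by rewrite /mkfrac -surjective_pairing; exact: reprK. Qed.

Lemma mkfrac_ind (Q : locmod -> Prop) :
  (forall v s, Q (mkfrac v s)) -> forall x, Q x.
Proof. by move=> h x; rewrite -(mkfracK x). Qed.

Definition loc_add (x y : locmod) : locmod :=
  mkfrac (#(repr y).2 *: (repr x).1 + #(repr x).2 *: (repr y).1)
         (denomM (repr x).2 (repr y).2).
Definition loc_opp (x : locmod) : locmod := mkfrac (- (repr x).1) (repr x).2.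
Definition loc_zero : locmod := mkfrac 0 (denom1 P).

Lemma mkfrac_repr v s : exists u : den,
  (#u * #s) *: (repr (mkfrac v s)).1 = (#u * #(repr (mkfrac v s)).2) *: v.
Proof. by apply/mkfrac_eq; rewrite mkfracK. Qed.

Lemma loc_addE v s w t : loc_add (mkfrac v s) (mkfrac w t) =
  mkfrac (#t *: v + #s *: w) (denomM s t).
Proof.
rewrite /loc_add; apply/mkfrac_eq.
have [u] := mkfrac_repr v s; have [u'] := mkfrac_repr w t.
move: (repr (mkfrac v s)) (repr (mkfrac w t)) => [v' s'] [w' t'] /= e' e.
exists (denomM u u') => /=; rewrite !scalerDr !scalerA; congr (_ + _).
  transitivity ((#u' * #t * #t') *: ((#u * #s) *: v')).
    by rewrite scalerA; congr (_ *: _); ring.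
  by rewrite e scalerA; congr (_ *: _); ring.
transitivity ((#u * #s * #s') *: ((#u' * #t) *: w')).
  by rewrite scalerA; congr (_ *: _); ring.
by rewrite e' scalerA; congr (_ *: _); ring.
Qed.

Lemma loc_oppE v s : loc_opp (mkfrac v s) = mkfrac (- v) s.
Proof.
rewrite /loc_opp; apply/mkfrac_eq; have [u e] := mkfrac_repr v s.
by exists u; rewrite !scalerN e.
Qed.

Lemma loc_addA : associative loc_add.
Proof.
elim/mkfrac_ind => v s; elim/mkfrac_ind => w t; elim/mkfrac_ind => z r.
rewrite !loc_addE; apply/mkfrac_eq; exists (denom1 P) => /=.
rewrite !scalerDr !scalerA !addrA.
by congr (_ *: _ + _ *: _ + _ *: _); ring.
Qed.

Lemma loc_addC : commutative loc_add.
Proof.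
elim/mkfrac_ind => v s; elim/mkfrac_ind => w t; rewrite !loc_addE.
apply/mkfrac_eq; exists (denom1 P) => /=.
by rewrite addrC [#t * _]mulrC.
Qed.

Lemma loc_add0 : left_id loc_zero loc_add.
Proof.
elim/mkfrac_ind => v s; rewrite loc_addE; apply/mkfrac_eq; exists (denom1 P).
by rewrite /= scaler0 add0r !scalerA; congr (_ *: _); ring.
Qed.

Lemma loc_addN : left_inverse loc_zero loc_opp loc_add.
Proof.
elim/mkfrac_ind => v s; rewrite loc_oppE loc_addE; apply/mkfrac_eq.
by exists (denom1 P); rewrite /= scalerN addNr !scaler0.
Qed.

HB.instance Definition _ :=
  GRing.isZmodule.Build locmod loc_addA loc_addC loc_add0 loc_addN.

Lemma mkfracD v s w t :
  mkfrac v s + mkfrac w t = mkfrac (#t *: v + #s *: w) (denomM s t).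
Proof. exact: loc_addE. Qed.
End LocalizedModule.

(* The localization R_P, on the carrier of the localized module (R^o)_P. *)
Section LocalRing.
Variables (R : comNzRingType) (P : prime_idealr R).
Local Notation den := (denom P).
Local Notation "# s" := (denom_val s) (at level 8, format "# s").

Definition locring : Type := locmod P R^o.
HB.instance Definition _ := GRing.Zmodule.on locring.

Definition ringfrac (a : R) (s : den) : locring := mkfrac (a : R^o) s.

Lemma ringfrac_eq a s b t : (ringfrac a s = ringfrac b t) <->
  exists u : den, #u * #t * a = #u * #s * b.
Proof. exact: mkfrac_eq. Qed.

Lemma ringfrac_ind (Q : locring -> Prop) :
  (forall a s, Q (ringfrac a s)) -> forall x, Q x.
Proof. by move=> h x; apply: (@mkfrac_ind R P R^o Q); apply: h. Qed.

Lemma ringfracD a s b t :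
  ringfrac a s + ringfrac b t = ringfrac (#t * a + #s * b) (denomM s t).
Proof. exact: loc_addE. Qed.

Definition num (x : locring) : R := (repr (x : locmod P R^o)).1.
Definition dnm (x : locring) : den := (repr (x : locmod P R^o)).2.

Lemma ringfracK x : ringfrac (num x) (dnm x) = x.
Proof. exact: mkfracK. Qed.

Lemma ringfrac_repr a s : exists u : den,
  #u * #s * num (ringfrac a s) = #u * #(dnm (ringfrac a s)) * a.
Proof. by have [u e] := @mkfrac_repr R P R^o a s; exists u; exact: e. Qed.

Definition loc_one : locring := ringfrac 1 (denom1 P).
Definition loc_mul (x y : locring) : locring :=
  ringfrac (num x * num y) (denomM (dnm x) (dnm y)).

Lemma loc_mulE a s b t :
  loc_mul (ringfrac a s) (ringfrac b t) = ringfrac (a * b) (denomM s t).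
Proof.
rewrite /loc_mul; apply/ringfrac_eq.
have [u e] := ringfrac_repr a s; have [u' e'] := ringfrac_repr b t.
exists (denomM u u') => /=; set a' := num _ in e *; set b' := num _ in e' *.
transitivity ((#u * #s * a') * (#u' * #t * b')); first by ring.
by rewrite e e'; ring.
Qed.

Lemma loc_mulA : associative loc_mul.
Proof.
elim/ringfrac_ind => a s; elim/ringfrac_ind => b t; elim/ringfrac_ind => c r.
by rewrite !loc_mulE; apply/ringfrac_eq; exists (denom1 P) => /=; ring.
Qed.

Lemma loc_mulC : commutative loc_mul.
Proof.
elim/ringfrac_ind => a s; elim/ringfrac_ind => b t.
by rewrite !loc_mulE; apply/ringfrac_eq; exists (denom1 P) => /=; ring.
Qed.

Lemma loc_mul1 : left_id loc_one loc_mul.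
Proof.
elim/ringfrac_ind => a s.
by rewrite loc_mulE; apply/ringfrac_eq; exists (denom1 P) => /=; ring.
Qed.

Lemma loc_mulD : left_distributive loc_mul +%R.
Proof.
elim/ringfrac_ind => a s; elim/ringfrac_ind => b t; elim/ringfrac_ind => c r.
rewrite ringfracD !loc_mulE ringfracD.
by apply/ringfrac_eq; exists (denom1 P) => /=; ring.
Qed.

Lemma loc_one_neq0 : loc_one != 0.
Proof.
apply/eqP => /ringfrac_eq[u]; rewrite /= !mulr1 mulr0 => u0.
by have := denomP u; rewrite u0 idealr0.
Qed.

HB.instance Definition _ := GRing.Zmodule_isComNzRing.Build locring
  loc_mulA loc_mulC loc_mul1 loc_mulD loc_one_neq0.

Lemma ringfracM a s b t :
  ringfrac a s * ringfrac b t = ringfrac (a * b) (denomM s t).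
Proof. exact: loc_mulE. Qed.

Section LocalizedModuleScale.
Variable V : lmodType R.
Implicit Types (x y : locring) (v w : locmod P V).

Definition loc_scale x v : locmod P V :=
  mkfrac (num x *: (repr v).1) (denomM (dnm x) (repr v).2).

Lemma loc_scaleE a s (v : V) t :
  loc_scale (ringfrac a s) (mkfrac v t) = mkfrac (a *: v) (denomM s t).
Proof.
rewrite /loc_scale; apply/mkfrac_eq.
have [u e] := ringfrac_repr a s; have [u' e'] := mkfrac_repr v t.
exists (denomM u u') => /=; set a' := num _ in e *.
move: (repr (mkfrac v t)) e' => [v' t'] /= e'.
transitivity ((#u * #s * a') *: ((#u' * #t) *: v')).
  by rewrite !scalerA; congr (_ *: _); ring.
by rewrite e e' !scalerA; congr (_ *: _); ring.
Qed.

Lemma loc_scaleA x y v : loc_scale x (loc_scale y v) = loc_scale (x * y) v.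
Proof.
elim/ringfrac_ind: x => a s; elim/ringfrac_ind: y => b t.
elim/mkfrac_ind: v => v r; rewrite ringfracM !loc_scaleE.
apply/mkfrac_eq; exists (denom1 P) => /=.
by rewrite !scalerA; congr (_ *: _); ring.
Qed.

Lemma loc_scale1 : left_id 1 loc_scale.
Proof.
elim/mkfrac_ind => v t; rewrite (loc_scaleE 1 (denom1 P)).
by apply/mkfrac_eq; exists (denom1 P); rewrite /= scale1r !mul1r.
Qed.

Lemma loc_scaleDr : right_distributive loc_scale +%R.
Proof.
elim/ringfrac_ind => a s; elim/mkfrac_ind => v t; elim/mkfrac_ind => w r.
rewrite mkfracD !loc_scaleE mkfracD; apply/mkfrac_eq; exists (denom1 P) => /=.
rewrite !scalerDr !scalerA; congr (_ *: _ + _ *: _); ring.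
Qed.

Lemma loc_scaleDl v : {morph loc_scale^~ v : x y / x + y}.
Proof.
elim/ringfrac_ind => a s; elim/ringfrac_ind => b t.
elim/mkfrac_ind: v => v r.
rewrite ringfracD !loc_scaleE mkfracD; apply/mkfrac_eq; exists (denom1 P) => /=.
rewrite scalerDl !scalerDr !scalerA; congr (_ *: _ + _ *: _); ring.
Qed.

HB.instance Definition _ := GRing.Zmodule_isLmodule.Build locring (locmod P V)
  loc_scaleA loc_scale1 loc_scaleDr loc_scaleDl.
End LocalizedModuleScale.
End LocalRing.

Section CommutativeAlgebra.
Variable R : comNzRingType.

(* Elements of idealr R are proper ideals; arbitrary ideals are submodules of
   R^o. *)
Definition maximal_ideal (I : idealr R) : Prop :=
  forall J : idealr R, {subset I <= J} -> {subset J <= I}.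

(* R is a local ring with maximal ideal m. *)
Definition local_ring (m : idealr R) : Prop :=
  maximal_ideal m /\ forall I : idealr R, maximal_ideal I -> I =i m.

Definition noetherian : Prop := forall I : submodClosed R^o, fin_gen I.

Definition ideal_gen (s : seq R) : {pred R} :=
  mspan ([set x | x \in s] : set R^o).

Definition krull_dim : nat :=
  maxnat [set n | exists P : nat -> prime_idealr R, forall i, (i < n)%N ->
    {subset P i <= P i.+1} /\ ~ {subset P i.+1 <= P i}].

Definition regular_local_ring : Prop :=
  noetherian /\ exists m : idealr R, local_ring m /\
    exists s : seq R, size s = krull_dim /\ m =i ideal_gen s.

(* R -> lim R/m^n is bijective. *)
Definition adic_complete (m : idealr R) : Prop :=
  let mpow n : {pred R} := powmod (V := R^o) m n in
  (forall x, (forall n, x \in mpow n) -> x = 0) /\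
  (forall u : nat -> R, (forall n, u n.+1 - u n \in mpow n) ->
     exists l, forall n, l - u n \in mpow n).

Definition injective_module (E : lmodType R) : Prop :=
  forall (U V : lmodType R) (i : {linear U -> V}) (f : {linear U -> E}),
    injective i -> exists g : {linear V -> E}, forall x, g (i x) = f x.

Definition finite_injective_dim (V : lmodType R) : Prop :=
  exists (E : nat -> lmodType R) (aug : {linear V -> E 0%N})
         (d : forall n, {linear E n -> E n.+1}),
    [/\ forall n, injective_module (E n),
        injective aug,
        forall x, d 0%N x = 0 <-> exists v, x = aug v,
        forall n x, d n.+1 x = 0 <-> exists y, x = d n y
      & exists N, forall n, (N < n)%N -> forall x : E n, x = 0].

(* Meant for R noetherian local. *)
Definition gorenstein : Prop := finite_injective_dim R^o.

Section Modules.
Variables (m : idealr R) (V : lmodType R).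

(* seqmul s is (s_0, .., s_k) V *)
Definition seqmul (s : seq R) : {pred V} := smul (mem s) predT.

Definition regular_seq (s : seq R) : Prop :=
  (forall i, (i < size s)%N -> forall v : V,
     s`_i *: v \in seqmul (take i s) -> v \in seqmul (take i s)) /\
  exists v : V, v \notin seqmul s.

Definition depth : nat :=
  maxnat [set n | exists s : seq R,
    [/\ size s = n, {subset s <= m} & regular_seq s]].

Definition max_cohen_macaulay : Prop :=
  [/\ fin_gen (predT : {pred V}), exists v : V, v != 0 & depth = krull_dim].

Definition hilbert_samuel_poly (p : {poly rat}) : Prop :=
  exists N, forall n, (N <= n)%N ->
    p.[n%:R] = (mlength (modquot (powmod (V := V) m n)))%:R.

(* Normalized by the dimension of R, so it is 0 if dim V < dim R. *)
Definition hs_multiplicity : rat :=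
  (krull_dim`!)%:R * (xget 0 (hilbert_samuel_poly : set _))`_krull_dim.
End Modules.
End CommutativeAlgebra.

Definition dvr_uniformizer (O : idomainType) (pi : O) : Prop :=
  [/\ forall I : submodClosed O^o, exists a, I =i ideal_gen [:: a],
      exists2 m : idealr O, local_ring m & m =i ideal_gen [:: pi]
    & pi != 0].

Section Torsion.
Variables (O : idomainType).

Definition tors (V : lmodType O) : {pred V} := fun x =>
  `[< exists2 a : O, a != 0 & a *: x = 0 >].

Lemma tors_submod_closed V : subsemimod_closed (@tors V).
Proof.
split; first split.
- by apply/asboolP; exists 1; rewrite ?oner_eq0 ?scaler0.
- move=> x y /asboolP[a a0 ax] /asboolP[b b0 b_y]; apply/asboolP.
  exists (a * b); first by rewrite mulf_neq0.
  by rewrite scalerDr -[in X in _ + X]scalerA b_y scaler0 mulrC -scalerA ax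
    scaler0 addr0.
- move=> c x /asboolP[a a0 ax]; apply/asboolP; exists a => //.
  by rewrite scalerA mulrC -scalerA ax scaler0.
Qed.

HB.instance Definition _ V :=
  GRing.isSubmodClosed.Build O V (@tors V) (@tors_submod_closed V).

Definition torsion_free_quot (V : lmodType O) : lmodType O := modquot (@tors V).

Section Map.
Variables (V W : lmodType O) (f : {linear V -> W}).
Lemma linear_tors x : x \in @tors V -> f x \in @tors W.
Proof.
by move=> /asboolP[a a0 ax]; apply/asboolP; exists a; rewrite // -linearZ ax linear0.
Qed.
Definition torsion_free_map :
    {linear torsion_free_quot V -> torsion_free_quot W} :=
  quotmap linear_tors.
End Map.
End Torsion.

Record free_resolution (R : comNzRingType) (N : lmodType R) := FreeResolution {
  fr_rank : nat -> nat;
  fr_diff : forall i, 'M[R]_(fr_rank i.+1, fr_rank i);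
  fr_aug : {linear 'rV[R]_(fr_rank 0) -> N};
  fr_aug_surj : forall x, exists v, fr_aug v = x;
  fr_exact0 : forall v, fr_aug v = 0 <-> exists w, v = w *m fr_diff 0;
  fr_exactS : forall i (v : 'rV_(fr_rank i.+1)), v *m fr_diff i = 0 <->
    exists w, v = w *m fr_diff i.+1 }.

(* Ext^i(N, M) as the cohomology of Hom(F, M), where F is a resolution of N by
   finite free modules R^n of row vectors; a homomorphism R^n -> M is encoded
   by the images of the standard basis. Over a noetherian ring such an F exists
   for every finitely generated N, and Ext^i(N, M) does not depend on it. *)
Section Ext.
Variables (R : comNzRingType) (N : lmodType R) (F : free_resolution N).

Section Complex.
Variable M : lmodType R.

Definition cochain (i : nat) : lmodType R := {ffun 'I_(fr_rank F i) -> M}.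

Definition codiff_fun i (z : cochain i) : cochain i.+1 :=
  [ffun j => \sum_k fr_diff F i j k *: z k].

Lemma codiff_linear i : linear (@codiff_fun i).
Proof.
move=> a x y; apply/ffunP => j; rewrite !ffunE scaler_sumr -big_split /=.
by apply: eq_bigr => k _; rewrite !ffunE scalerDr !scalerA mulrC.
Qed.

HB.instance Definition _ i :=
  GRing.isLinear.Build R (cochain i) (cochain i.+1) *:%R (@codiff_fun i)
    (@codiff_linear i).

Definition codiff i : {linear cochain i -> cochain i.+1} := @codiff_fun i.

Definition cocycle (i : nat) : {pred cochain i} := fun z => codiff i z == 0.
Arguments cocycle : clear implicits.

Lemma cocycle_submod_closed i : subsemimod_closed (cocycle i).
Proof.
split; first split.
- by apply/eqP; exact: linear0.
- move=> x y /eqP hx /eqP hy; apply/eqP.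
  by rewrite [LHS]linearD; apply: etrans (congr2 +%R hx hy) (addr0 _).
- move=> a x /eqP hx; apply/eqP.
  by rewrite [LHS]linearZ; apply: etrans (congr1 _ hx) (scaler0 _ _).
Qed.

HB.instance Definition _ i := GRing.isSubmodClosed.Build R (cochain i)
  (cocycle i) (cocycle_submod_closed i).

(* The image of codiff i.-1, which is 0 if i = 0. *)
Definition coboundary (i : nat) : cochain i -> Prop :=
  match i return cochain i -> Prop with
  | 0 => fun z => z = 0
  | j.+1 => fun z => exists y, z = codiff j y
  end.

Definition Ext (i : nat) : lmodType R :=
  modquot (mspan [set z : submod_type (cocycle i) |
                  coboundary (submod_val z)]).
End Complex.

Section Functor.
Variables (M M' : lmodType R) (f : {linear M -> M'}) (i : nat).

Definition cochain_map j (z : cochain M j) : cochain M' j := [ffun k => f (z k)].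

Lemma cochain_map_linear j : linear (@cochain_map j).
Proof. by move=> a x y; apply/ffunP => k; rewrite !ffunE linearP. Qed.

Lemma cochain_map_codiff j (z : cochain M j) :
  codiff M' j (cochain_map z) = cochain_map (codiff M j z).
Proof.
apply/ffunP => k; rewrite !ffunE linear_sum.
by apply: eq_bigr => l _; rewrite ffunE linearZ.
Qed.

Lemma cochain_map0 j : cochain_map (0 : cochain M j) = 0.
Proof. by apply/ffunP => k; rewrite !ffunE linear0. Qed.

Lemma cocycle_map_subproof (z : submod_type (@cocycle M i)) :
  cochain_map (submod_val z) \in @cocycle M' i.
Proof.
have /eqP h : codiff M i (submod_val z) == 0 := submod_valP z.
by apply/eqP; rewrite cochain_map_codiff h cochain_map0.
Qed.

Definition cocycle_fun (z : submod_type (@cocycle M i)) :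
    submod_type (@cocycle M' i) := SubMod (cocycle_map_subproof z).

Lemma cocycle_fun_linear : linear cocycle_fun.
Proof. by move=> a x y; apply: val_inj; exact: cochain_map_linear. Qed.

HB.instance Definition _ := GRing.isLinear.Build R _ _ *:%R
  cocycle_fun cocycle_fun_linear.

Definition cocycle_map :
    {linear submod_type (@cocycle M i) -> submod_type (@cocycle M' i)} :=
  cocycle_fun.

Lemma coboundary_map j (z : cochain M j) :
  coboundary z -> coboundary (cochain_map z).
Proof.
case: j z => [|j] z /=; first by move->; exact: cochain_map0.
by case=> y ->; exists (cochain_map y); rewrite cochain_map_codiff.
Qed.

Lemma ext_map_subproof (z : submod_type (@cocycle M i)) :
  z \in mspan [set z : submod_type (@cocycle M i) |
               coboundary (submod_val z)] ->
  cocycle_map z \in mspan [set z : submod_type (@cocycle M' i) |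
                           coboundary (submod_val z)].
Proof.
apply: linear_mspan => y hy; exact: coboundary_map.
Qed.

Definition Ext_map : {linear Ext M i -> Ext M' i} := quotmap ext_map_subproof.
End Functor.
End Ext.

Section Congruence.
Variables (O : idomainType) (A : comAlgType O) (lam : {lrmorphism A -> O^o}).

Definition ker_ideal : {pred A} := fun a => lam a == 0.

Lemma ker_ideal_closed : idealr_closed ker_ideal.
Proof.
split; rewrite ?/(in_mem _ _) /= /ker_ideal ?rmorph0 ?rmorph1 ?oner_eq0 //.
move=> a x y /eqP hx /eqP hy; apply/eqP.
transitivity (lam a * lam x + lam y); first by rewrite rmorphD rmorphM.
by rewrite hx hy mulr0 addr0.
Qed.

Lemma ker_ideal_prime : prime_idealr_closed ker_ideal.
Proof.
by move=> x y; rewrite !/(in_mem _ _) /= /ker_ideal rmorphM mulf_eq0.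
Qed.

HB.instance Definition _ := isIdealr.Build A ker_ideal ker_ideal_closed.
HB.instance Definition _ :=
  isPrimeIdealrClosed.Build A ker_ideal ker_ideal_prime.

Definition ker_submod : {pred A^o} := ker_ideal.
Lemma ker_submod_closed : subsemimod_closed ker_submod.
Proof.
have [h0 _ h] := ker_ideal_closed; split; first split=> //.
  by move=> x y hx hy; rewrite -[x]mul1r; exact: h.
by move=> a x hx; rewrite -[_ *: x]addr0; exact: h.
Qed.
HB.instance Definition _ :=
  GRing.isSubmodClosed.Build A A^o ker_submod ker_submod_closed.

(* The pair (A, lam) is in C_O, and m is the maximal ideal of A. *)
Definition in_CO (m : idealr A) : Prop :=
  [/\ noetherian A, local_ring m, adic_complete m,
      forall k : O, exists a, lam a = k
    & regular_local_ring (locring ker_ideal)].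

Definition over_O (V : lmodType A) : lmodType O := restr (GRing.in_alg A) V.

(* p / p^2, as the quotient of the A-module p by p . p *)
Definition conormal : lmodType A :=
  modquot (smul ker_ideal (predT : {pred submod_type ker_submod})).

Definition Phi : lmodType O :=
  submod_type (@tors O (over_O conormal)).

(* O as an A-module through lam. *)
Definition O_mod : lmodType A := restr lam (O^o : lmodType O).

Variable F : free_resolution O_mod.

Definition codim : nat := krull_dim (locring ker_ideal).

(* The A-module structure of Ext_A(O, M) factors through lam, so that
   restricting it along O -> A gives the O-module structure. *)
Definition Psi (M : lmodType A) : lmodType O :=
  coker (torsion_free_map (restr_map (GRing.in_alg A)
    (Ext_map F (mproj (smul ker_ideal (predT : {pred M}))) codim))).

(* Phi and Psi have finite length for (A, lam) in C_O and M finitely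
   generated, so that the lengths below are the actual ones. *)
Definition wiles_defect (M : lmodType A) : int :=
  (mrank (locmod ker_ideal M))%:Z * (mlength Phi)%:Z - (mlength (Psi M))%:Z.

End Congruence.

(* Main.v *)
From HB Require Import structures.
Require Import Defs.
From mathcomp Require Import all_boot all_order all_algebra.
From mathcomp Require Import ring_quotient ring zify.
From mathcomp Require Import boolp classical_sets functions.

(** Write p for the kernel of lam, so that O = A/p, and c for the dimension of
    the localization of A at p.

    Choose n_1, .., n_mu in M whose classes form a basis of M/pM modulo torsion.
    The maps a -> a n_j send mu copies of the congruence module of A onto that of
    M (congr_compare), and since the rank of A at p is 1, the defects agree
    exactly when this surjection is injective (isLen_sum, wiles_defect_eq). If M
    is A^mu + W with W vanishing at p, the coordinates of A^mu split it
    (defect_of_free_summand).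

    For the converse, the groups Ext(O, -) are computed from F, and the groups
    Ext(-, A) from an injective resolution of A. As A is Gorenstein, its
    dimension, depth and injective dimension agree (gorenstein_dim), which gives
    the vanishing of Ext(O, A) above degree c (Fvan_of_van). There are sequences
    ys of length c = dim A - 1 in p, regular on A and on M, which generate p at p
    (good_sequence_ex). With their help one sees that reduction modulo p is
    injective on Ext^c(O, M) and on Ext^c(O, A) modulo torsion
    (cob_of_reduction). So the injectivity above means that Ext^c(O, M) is the
    sum of the images of Ext^c(O, A) under the n_j (cocycle_comb). By Rees'
    isomorphism Ext^c(O, X) is the submodule of X/(ys)X killed by p. Let L be
    this submodule for X = A; then the one for X = M is the sum of the n_j L
    (kil_comb), and it has coordinates in L.

    Now use duality over A. The class of the identity in
    Hom(A, A) = Ext^c(A/(ys), A) has a nonzero restriction to Ext^c(L, A), since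
    otherwise a nonzero Ext^{c+1} of the residue field would vanish (dual_class).
    Composed with the coordinates, this restriction extends to classes in
    Ext^c(M/(ys)M, A) = Hom(M, A), because M is maximal Cohen-Macaulay. The
    resulting linear forms g_i satisfy g_i(n_j) = delta_ij modulo the maximal
    ideal (dual_forms), so their matrix is invertible and the n_j span a free
    summand of rank mu. The complement W vanishes at p because the n_j generate
    M at p (free_summand).

    For the last assertion, the lengths of V/m^n V are eventually polynomial in n
    (hilbert_samuel): they count the exponents of monomials which are not
    redundant, and these form the complement of an up-set, so that Dickson's
    lemma applies (count_upset). The lengths are additive for M = A^mu + W
    (hilbert_samuel_split). If W is nonzero, a system of parameters that is
    regular on A and on M is regular on W, and W/(x_1^n, .., x_d^n)W has length
    n^d times that of W/(xs)W (isL_pows). Hence W adds a positive amount to the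
    coefficient of degree d = dim A (hilbert_samuel_growth, growth_coef), and
    e(M) <= mu e(A) forces W = 0. *)

Set Implicit Arguments.
Unset Strict Implicit.
Unset Printing Implicit Defensive.

Import GRing.Theory.
Local Open Scope ring_scope.

(** * Submodules, spans and quotients *)

Section Submodule.
Variables (R : nzRingType) (V : lmodType R).
Implicit Types (P U : V -> Prop).

Definition issub P :=
  [/\ P 0, forall x y, P x -> P y -> P (x + y) & forall a x, P x -> P (a *: x)].

Lemma issubN P x : issub P -> P x -> P (- x).
Proof. by case=> _ _ hZ hx; rewrite -scaleN1r; apply: hZ. Qed.

Lemma issubB P x y : issub P -> P x -> P y -> P (x - y).
Proof. by move=> hP hx hy; case: (hP) => _ hD _; apply: hD hx (issubN hP hy). Qed.

Lemma issubDr P x y : issub P -> P y -> P (x + y) -> P x.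
Proof. by move=> hP hy hxy; rewrite -(addrK y x); apply: issubB. Qed.

Lemma issub_sum P (I : Type) (r : seq I) (Q : pred I) (F : I -> V) :
  issub P -> (forall i, Q i -> P (F i)) -> P (\sum_(i <- r | Q i) F i).
Proof. by case=> h0 hD _ hF; elim/big_ind: _. Qed.

Lemma issub0 : issub (fun x : V => x = 0).
Proof.
by split=> [//|x y -> ->|a x ->]; rewrite ?addr0 ?scaler0.
Qed.

Lemma issubT : issub (fun _ : V => True). Proof. by []. Qed.

Lemma issubI P U : issub P -> issub U -> issub (fun x => P x /\ U x).
Proof.
move=> [a b c] [a' b' c']; split=> // [x y [? ?] [? ?]|k x [? ?]].
  by split; [apply: b|apply: b'].
by split; [apply: c|apply: c'].
Qed.

Definition addsub P U (x : V) := exists2 y, P y & U (x - y).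

Lemma issub_add P U : issub P -> issub U -> issub (addsub P U).
Proof.
move=> [a b c] hU; have [a' b' c'] := hU; split.
- by exists 0; rewrite ?subrr.
- move=> x y [x' hx hx'] [y' hy hy']; exists (x' + y'); first exact: b.
  by rewrite opprD addrACA; apply: b'.
- move=> k x [x' hx hx']; exists (k *: x'); first exact: c.
  by rewrite -scalerBr; apply: c'.
Qed.

Lemma addsubl P U x : issub U -> P x -> addsub P U x.
Proof. by move=> [h0 _ _] hx; exists x; rewrite ?subrr. Qed.

Lemma addsubr P U x : issub P -> U x -> addsub P U x.
Proof. by move=> [h0 _ _] hx; exists 0; rewrite ?subr0. Qed.

Lemma issub_submod (U : submodClosed V) : issub (fun x => x \in U).
Proof.
by split=> [|x y|a x]; [exact: rpred0|exact: rpredD|exact: rpredZ].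
Qed.

Lemma mspanP P x : issub P -> x \in mspan P <-> P x.
Proof.
move=> [h0 hD hZ]; split=> [/asboolP hx|hx]; last by apply/asboolP => U; apply.
have TP : subsemimod_closed [pred x | `[< P x >]].
  split; first split.
  - exact/asboolP.
  - by move=> u v /asboolP hu /asboolP hv; apply/asboolP; apply: hD.
  - by move=> a u /asboolP hu; apply/asboolP; apply: hZ.
pose T' : submodClosed V := HB.pack (fun x => `[< P x >] : bool)
  (GRing.isSubmodClosed.Build R V [pred x | `[< P x >]] TP).
by have /asboolP := hx T' (fun y Py => asboolT Py).
Qed.

(** By recursion on s, so that inductions over generators need no indexing *)
Fixpoint ispan (I : R -> Prop) (s : seq V) (x : V) : Prop :=
  if s is y :: s' then exists2 a, I a & ispan I s' (x - a *: y) else x = 0.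

Definition span := ispan (fun _ => True).

Lemma issub_span s : issub (span s).
Proof.
rewrite /span; elim: s => [|y s [h0 hD hZ]]; first exact: issub0; split=> /=.
- by exists 0; rewrite ?scale0r ?subrr.
- move=> u v [a _ ha] [b _ hb]; exists (a + b) => //.
  by rewrite scalerDl opprD addrACA; apply: hD.
- move=> k u [a _ ha]; exists (k * a) => //.
  by rewrite -scalerA -scalerBr; apply: hZ.
Qed.

Lemma ispan_sub I s P x : issub P -> (forall a y, I a -> y \in s -> P (a *: y)) ->
  ispan I s x -> P x.
Proof.
move=> hP; elim: s x => [|y s ih] x /= hs; first by move->; case: hP.
case=> a ha /ih h; rewrite -[x](subrK (a *: y)); have [_ hD _] := hP.
by apply: hD; [apply: h => b z hb hz|]; apply: hs; rewrite ?inE ?eqxx ?hz ?orbT.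
Qed.

Lemma span_sub s P x : issub P -> (forall y, y \in s -> P y) -> span s x -> P x.
Proof.
by move=> hP hs; apply: ispan_sub => // a y _ /hs; case: hP => _ _; apply.
Qed.

Lemma span_mem s y : y \in s -> span s y.
Proof.
elim: s => // z s ih; rewrite inE /span /= => /predU1P[->|/ih h].
  by exists 1; rewrite ?scale1r ?subrr //; case: (issub_span s).
by exists 0; rewrite ?scale0r ?subr0.
Qed.

Lemma span_mono s t x : {subset s <= t} -> span s x -> span t x.
Proof.
by move=> h; apply: span_sub (issub_span t) _ => y /h; apply: span_mem.
Qed.

Lemma span_cat s t x : span (s ++ t) x -> addsub (span s) (span t) x.
Proof.
apply: span_sub; first exact: issub_add (issub_span _) (issub_span _).
move=> y; rewrite mem_cat => /orP[/span_mem|/span_mem].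
  by apply: addsubl; apply: issub_span.
by apply: addsubr; apply: issub_span.
Qed.

Lemma ispan_sum I s x : ispan I s x -> exists c : 'I_(size s) -> R,
  (forall i, I (c i)) /\ x = \sum_i c i *: s`_i.
Proof.
elim: s x => [|y s ih] x /=; first by move->; exists (fun _ => 0); rewrite big_ord0; split=> // -[].
case=> a ha /ih[c [hc e]].
exists (fun i => oapp c a (unlift ord0 i)); split.
  by move=> i; case: unliftP => [j|] _ /=.
rewrite big_ord_recl /= unlift_none /= -[x](subrK (a *: y)) e addrC.
by congr (_ + _); apply: eq_bigr => i _; rewrite liftK.
Qed.

Lemma span_comb s (c : 'I_(size s) -> R) : span s (\sum_i c i *: s`_i).
Proof.
apply: (issub_sum (P := span s)) => [|i _]; first exact: issub_span.
by have [_ _ hZ] := issub_span s; apply: hZ; apply/span_mem/mem_nth.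
Qed.

Definition fg P := exists s, forall x, P x <-> span s x.

Definition noeth := forall P, issub P -> fg P.

Lemma fin_genP (U : submodClosed V) : fin_gen U <-> fg (fun x => x \in U).
Proof.
have e s x : x \in mspan [set y | y \in s]%classic <-> span s x.
  split=> [/asboolP|]; last first.
    pose T : submodClosed V := mspan [set y | y \in s]%classic.
    apply: (span_sub (issub_submod T)) => y hy.
    by apply/asboolP => W hW; apply: hW.
  rewrite -(mspanP x (issub_span s)); apply => y /= /span_mem.
  by move/(mspanP y (issub_span s)).
split=> -[s hs]; exists s => x.
  by rewrite hs e.
by apply/idP/idP => [/hs/e|/e/hs].
Qed.

Lemma span_map_choice (W : Type) (r : seq V) (Q : V -> W -> Prop) :
  (forall y, y \in r -> exists w, Q y w) ->
  exists t : seq W, size t = size r /\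
    forall i w0, (i < size r)%N -> Q r`_i (nth w0 t i).
Proof.
elim: r => [|y r ih] h; first by exists [::].
have [w hw] := h y (mem_head _ _).
have [|t [st ht]] := ih; first by move=> z hz; apply: h; rewrite inE hz orbT.
by exists (w :: t); split=> /=; [rewrite st|case].
Qed.
End Submodule.
Arguments issub_span {R V} s.
Arguments issub0 {R V}.
Arguments issubT {R V}.

(** The coefficients along the first generator of the elements of P form an
    ideal. Lift its finitely many generators to P; what remains of P lies in the
    span of the other generators. *)
Lemma noeth_span (R : nzRingType) (V : lmodType R) (s : seq V) (P : V -> Prop) :
  noeth R^o -> issub P -> (forall x, P x -> span s x) -> fg P.
Proof.
move=> nR; elim: s P => [|y s ih] P hP hs.
  by exists [::] => x; split=> [/hs//|->]; case: hP.
pose I (a : R^o) := exists2 x, P x & span s (x - a *: y).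
have hI : issub I.
  have [h0 hD hZ] := hP; have [g0 gD gZ] := issub_span s; split.
  - by exists 0; rewrite ?scale0r ?subrr.
  - move=> a b [x hx gx] [z hz gz]; exists (x + z); first exact: hD.
    by rewrite scalerDl opprD addrACA; apply: gD.
  - move=> k a [x hx gx]; exists (k *: x); first exact: hZ.
    by rewrite -scalerA -scalerBr; apply: gZ.
have [t ht] := nR _ hI.
have [|u hu] := ih (fun x => P x /\ span s x) (issubI hP (issub_span s)).
  by move=> x [].
have : forall a, a \in t -> exists x, P x /\ span s (x - a *: y).
  by move=> a /span_mem/ht[x hx gx]; exists x.
case/span_map_choice => r [sr hr].
have Pr x : x \in r -> P x.
  by case/(nthP 0) => i; rewrite sr => /(hr i 0)[h _] <-.
exists (r ++ u) => x; split; last first.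
  apply: span_sub => // z; rewrite mem_cat => /orP[/Pr//|/span_mem/hu[]//].
move=> Px; have [a _ hx] := hs _ Px.
have /ht/ispan_sum[c [_ ea]] : I a by exists x.
pose w : V := \sum_(i < size t) c i *: r`_i.
have hw : span r w.
  by rewrite /w; apply: issub_sum (issub_span r) _ => i _;
     have [_ _ hZ] := issub_span r; apply: hZ; apply: span_mem; apply: mem_nth; rewrite sr.
have Pw : P w by apply: span_sub hw.
rewrite -[x](subrK w); have [_ hD _] := issub_span (r ++ u); apply: hD; last first.
  by apply: span_mono hw => z; rewrite mem_cat => ->.
apply: (span_mono (s := u)); first by move=> z; rewrite mem_cat orbC => ->.
apply/hu; split; first exact: issubB.
have -> : x - w = (x - a *: y) - (w - a *: y) by rewrite opprB addrA subrK.
apply: issubB (issub_span s) hx _.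
rewrite ea /w scaler_suml -sumrB; apply: issub_sum (issub_span s) _ => i _.
rewrite -[in X in _ - X]scalerA -scalerBr; have [_ _ hZ] := issub_span s; apply: hZ.
by have [] := hr i 0 (ltn_ord i).
Qed.

Definition fgm (R : nzRingType) (V : lmodType R) := exists s : seq V, forall x, span s x.

Lemma noeth_fgm (R : nzRingType) (V : lmodType R) : noeth R^o -> fgm V -> noeth V.
Proof. by move=> nR [s hs] P hP; apply: (noeth_span (s := s) nR hP) => x _. Qed.

Lemma noetherianP (R : comNzRingType) : noetherian R -> noeth R^o.
Proof.
move=> nR P hP; have /fin_genP[s hs] := nR (mspan P).
by exists s => x; rewrite -hs mspanP.
Qed.

(** * Linear maps, quotients and submodules as modules *)

Section LinearMaps.
Variable R : nzRingType.
Implicit Types U V W : lmodType R.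

Definition mklin V W (f : V -> W) (fP : linear f) : {linear V -> W} :=
  HB.pack f (GRing.isLinear.Build R V W *:%R f fP).

Lemma injl_linear V W : linear (fun v : V => (v, 0) : V * W).
Proof. by move=> a u v; apply/eqP; rewrite xpair_eqE /= scaler0 addr0 !eqxx. Qed.
Definition injl V W : {linear V -> (V * W)%type} := mklin (@injl_linear V W).

Lemma injr_linear V W : linear (fun v : W => (0, v) : V * W).
Proof. by move=> a u v; apply/eqP; rewrite xpair_eqE /= scaler0 addr0 !eqxx. Qed.
Definition injr V W : {linear W -> (V * W)%type} := mklin (@injr_linear V W).

Lemma projl_linear V W : linear (fun v : V * W => v.1). Proof. by []. Qed.
Definition projl V W : {linear (V * W)%type -> V} := mklin (@projl_linear V W).

Lemma projr_linear V W : linear (fun v : V * W => v.2). Proof. by []. Qed.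
Definition projr V W : {linear (V * W)%type -> W} := mklin (@projr_linear V W).

Definition ses V' V V'' (f : {linear V' -> V}) (g : {linear V -> V''}) :=
  [/\ injective f, forall w, exists v, g v = w &
      forall v, g v = 0 <-> exists u, v = f u].

Lemma ses0 V' V V'' (f : {linear V' -> V}) (g : {linear V -> V''}) u :
  ses f g -> g (f u) = 0.
Proof. by case=> _ _ h; apply/h; exists u. Qed.

Lemma issub_ker V W (f : {linear V -> W}) (P : W -> Prop) :
  issub P -> issub (fun v => P (f v)).
Proof.
move=> [h0 hD hZ]; split; first by rewrite linear0.
  by move=> x y hx hy; rewrite linearD; apply: hD.
by move=> a x hx; rewrite linearZ; apply: hZ.
Qed.

Lemma issub_im V W (f : {linear V -> W}) (P : V -> Prop) :
  issub P -> issub (fun w => exists2 v, P v & w = f v).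
Proof.
move=> [h0 hD hZ]; split; first by exists 0; rewrite ?linear0.
  by move=> x y [v hv ->] [w hw ->]; exists (v + w); rewrite ?linearD //; apply: hD.
by move=> a x [v hv ->]; exists (a *: v); rewrite ?linearZ //; apply: hZ.
Qed.

Lemma span_im V W (f : {linear V -> W}) s x : span s x -> span (map f s) (f x).
Proof.
apply: (span_sub (P := fun x => span (map f s) (f x))).
  exact/issub_ker/issub_span.
by move=> y hy; apply: span_mem; apply: map_f.
Qed.

Lemma fgm_surj V W (f : {linear V -> W}) :
  (forall w, exists v, f v = w) -> fgm V -> fgm W.
Proof.
by move=> hf [s hs]; exists (map f s) => w; have [v <-] := hf w; apply: span_im.
Qed.

Lemma lin_factor V V'' W (g : {linear V -> V''}) (f : {linear V -> W}) :
  (forall w, exists v, g v = w) -> (forall v, g v = 0 -> f v = 0) ->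
  exists h : {linear V'' -> W}, forall v, h (g v) = f v.
Proof.
move=> gS gf; have [r hr] := choice gS.
have e u v : g u = g v -> f u = f v.
  by move=> e; apply/eqP; rewrite -subr_eq0 -linearB gf // linearB e subrr.
have lP : linear (f \o r).
  by move=> a x y /=; rewrite -linearP; apply: e; rewrite linearP !hr.
by exists (mklin lP) => v; apply: e; rewrite hr.
Qed.

Lemma lin_lift V' V W (i : {linear V' -> V}) (f : {linear W -> V}) :
  injective i -> (forall w, exists u, f w = i u) ->
  exists h : {linear W -> V'}, forall w, i (h w) = f w.
Proof.
move=> iI /choice[r hr].
have lP : linear r by move=> a x y; apply: iI; rewrite linearP -!hr linearP.
by exists (mklin lP) => w; rewrite /= -hr.
Qed.

(** For a submodule P the closure mspan P, which modquot asks for, is P. *)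
Definition Qt V (P : V -> Prop) : lmodType R := modquot (mspan P).
Definition qpi V (P : V -> Prop) : {linear V -> Qt P} := mproj (mspan P).

Lemma qpi_surj V (P : V -> Prop) w : exists v, qpi P v = w.
Proof. by exists (repr w); apply: mprojK. Qed.

Lemma qpi0 V (P : V -> Prop) x : issub P -> qpi P x = 0 <-> P x.
Proof.
move=> hP; rewrite -(mspanP _ hP) -[x in x \in _]subr0 -mproj_eq.
by rewrite (_ : mproj _ 0 = 0) //; apply: (linear0 (qpi P)).
Qed.

Definition Sb V (P : V -> Prop) : lmodType R := submod_type (mspan P).
Lemma sbi_linear V (P : V -> Prop) : linear (fun x : Sb P => submod_val x).
Proof. by []. Qed.
Definition sbi V (P : V -> Prop) : {linear Sb P -> V} := mklin (@sbi_linear V P).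

Lemma sbi_inj V (P : V -> Prop) : injective (@sbi V P).
Proof. exact: val_inj. Qed.

Lemma sbiP V (P : V -> Prop) x : issub P -> P x <-> exists u, x = sbi P u.
Proof.
move=> hP; rewrite -(mspanP _ hP); split=> [h|[u ->]]; last exact: submod_valP.
by exists (SubMod h).
Qed.

Lemma sbi_mem V (P : V -> Prop) u : issub P -> P (sbi P u).
Proof. by move=> hP; apply/sbiP => //; exists u. Qed.

Lemma ses_ker V W (g : {linear V -> W}) : (forall w, exists v, g v = w) ->
  ses (sbi (fun v => g v = 0)) g.
Proof.
move=> hg; split=> // [|v]; first exact: sbi_inj.
by rewrite -sbiP //; apply: (issub_ker g issub0).
Qed.

Lemma ses_qt V (P : V -> Prop) : issub P -> ses (sbi P) (qpi P).
Proof.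
move=> hP; split=> [|w|v]; [exact: sbi_inj|exact: qpi_surj|].
by rewrite qpi0 // sbiP.
Qed.

Lemma fgm_sub V (P : V -> Prop) : noeth V -> issub P -> fgm (Sb P).
Proof.
move=> nV hP; have [s hs] := nV P hP.
have : forall y, y \in s -> exists u, y = sbi P u.
  by move=> y /span_mem/hs/(sbiP y hP).
case/span_map_choice => t [st ht]; exists t => x.
have e : map (sbi P) t = s.
  apply: (@eq_from_nth _ 0); rewrite size_map // st => i hi.
  by rewrite (nth_map 0) ?st // -ht.
have /hs : P (sbi P x) by apply: sbi_mem.
rewrite -e => h; have {h}: exists2 u, span t u & sbi P x = sbi P u.
  apply: (span_sub (P := fun y => exists2 u, span t u & y = sbi P u)) h.
    exact/issub_im/issub_span.
  by move=> y /mapP[u hu ->]; exists u => //; apply: span_mem.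
by case=> u hu /sbi_inj ->.
Qed.
End LinearMaps.
Arguments sbi {R V} P.
Arguments qpi {R V} P.

(** * Noetherian induction, primes and regular elements *)

Section NoetherInduction.
Variables (R : nzRingType) (V : lmodType R).

Lemma noeth_ind (Phi : (V -> Prop) -> Prop) : noeth V ->
  (forall P, issub P ->
    (forall P', issub P' -> (forall x, P x -> P' x) -> (exists2 x, P' x & ~ P x) ->
      Phi P') -> Phi P) ->
  forall P, issub P -> Phi P.
Proof.
move=> nV step P0 hP0; apply: contrapT => nPhi.
pose T := {P : V -> Prop | issub P /\ ~ Phi P}.
have next (t : T) : exists t' : T, (forall x, sval t x -> sval t' x) /\
    (exists2 x, sval t' x & ~ sval t x).
  case: t => P [hP nP] /=; apply: contrapT => h; apply: nP; apply: step => //.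
  move=> P' hP' hs hx; apply: contrapT => nP'.
  by apply: h; exists (exist _ P' (conj hP' nP')).
have [f hf] := choice next.
pose g n := sval (iter n f (exist _ P0 (conj hP0 nPhi))).
have gS n x : g n x -> g n.+1 x by have [h _] := hf (iter n f (exist _ P0 (conj hP0 nPhi))); apply: h.
have gM n k x : (n <= k)%N -> g n x -> g k x.
  by move=> /subnK <-; elim: (k - n)%N => // j ih /ih; apply: gS.
have gsub n : issub (g n) by rewrite /g; case: (iter _ _ _) => ? [].
have hU : issub (fun x => exists n, g n x).
  split; first by exists 0%N; have [] := gsub 0%N.
    move=> x y [n hx] [k hy]; exists (maxn n k); have [_ hD _] := gsub (maxn n k).
    by apply: hD; [apply: gM hx|apply: gM hy]; rewrite ?leq_maxl ?leq_maxr.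
  by move=> a x [n hx]; exists n; have [_ _ hZ] := gsub n; apply: hZ.
have [s hs] := nV _ hU.
have [n hn] : exists n, forall y, y \in s -> g n y.
  have : forall y, y \in s -> exists n, g n y by move=> y /span_mem/hs.
  elim: (s) => [|y r ih] h; first by exists 0%N.
  have [|n hn] := ih; first by move=> z hz; apply: h; rewrite inE hz orbT.
  have [k hk] := h y (mem_head _ _); exists (maxn n k) => z; rewrite inE.
  by case/predU1P => [->|/hn hz]; [apply: gM hk|apply: gM hz]; rewrite ?leq_maxl ?leq_maxr.
have [_ [x hx nx]] := hf (iter n f (exist _ P0 (conj hP0 nPhi))).
by apply: nx; apply: (span_sub (gsub n) hn); apply/hs; exists n.+1.
Qed.
End NoetherInduction.

Section Ideals.
Variable R : comNzRingType.
Implicit Types (I Q S : R -> Prop).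

Definition isidl I := issub (I : R^o -> Prop).

Lemma idlM I a x : isidl I -> I x -> I (a * x).
Proof. by case=> _ _ hZ; apply: (hZ a). Qed.

Definition isprime Q := [/\ isidl Q, ~ Q 1 & forall a b, Q (a * b) -> Q a \/ Q b].

Definition isloc Q := isprime Q /\ forall a, ~ Q a -> exists b, b * a = 1.

Lemma proper_le_loc Q I x : isloc Q -> isidl I -> ~ I 1 -> I x -> Q x.
Proof.
move=> [_ hU] hI I1 hx; apply: contrapT => /hU[b e]; apply: I1.
by rewrite -e; apply: idlM.
Qed.

Lemma nprimeM Q a b : isprime Q -> ~ Q a -> ~ Q b -> ~ Q (a * b).
Proof. by case=> _ _ h na nb /h[]. Qed.

Lemma isidl_ann (V : lmodType R) (v : V) : isidl (fun a => a *: v = 0).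
Proof.
split=> [|x y hx hy|a x hx]; first exact: scale0r.
  by rewrite scalerDl hx hy addr0.
by rewrite -[a *: x]/(a * x) -scalerA hx scaler0.
Qed.

(** A maximal ideal among those containing I and disjoint from S is prime. *)
Lemma prime_avoiding S I : noeth R^o -> isidl I -> S 1 ->
    (forall a b, S a -> S b -> S (a * b)) -> (forall a, I a -> ~ S a) ->
  exists Q, [/\ isprime Q, forall a, I a -> Q a & forall a, Q a -> ~ S a].
Proof.
move=> nR hI S1 SM; move: I hI.
apply: (@noeth_ind R R^o (fun I => (forall a, I a -> ~ S a) ->
  exists Q, [/\ isprime Q, forall a, I a -> Q a & forall a, Q a -> ~ S a])) nR _.
move=> I hI ih disj.
case: (pselect (exists2 J, isidl J & [/\ forall a, I a -> J a, exists2 x, J x & ~ I x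
   & forall a, J a -> ~ S a])) => [[J hJ [IJ hx Jd]]|no].
  by have [Q [? h ?]] := ih J hJ IJ hx Jd; exists Q; split=> // a /IJ/h.
exists I; split=> //; split=> //; first by move=> I1; apply: (disj 1).
have big a : ~ I a -> exists r i, I i /\ S (i + r * a).
  move=> na; apply: contrapT => h; apply: no.
  exists (addsub (I : R^o -> Prop) (span ([:: a] : seq R^o))).
    exact: issub_add hI (issub_span _).
  split.
  - by move=> b; apply: addsubl; apply: issub_span.
  - by exists a => //; apply: addsubr => //; apply: span_mem; rewrite inE.
  - move=> b [i hi [r _ /eqP e]] Sb; apply: h; exists r, i; split=> //.
    by move: e; rewrite subr_eq0 subr_eq => /eqP e; rewrite addrC -[r * a]/(r *: (a : R^o)) -e.
move=> a b hab; apply: contrapT => /not_orP[/big[r [i [hi h1]]] /big[r' [j [hj h2]]]].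
apply: (disj _ _ (SM _ _ h1 h2)).
have -> : (i + r * a) * (j + r' * b) = (j + r' * b) * i + (r * a * j + r * r' * (a * b)).
  by ring.
by have [_ hD _] := hI; apply: (hD); [|apply: hD]; apply: idlM.
Qed.

Lemma prime_list_ann (V : lmodType R) Q (vs : seq V) : isprime Q ->
  (forall a, (forall v, v \in vs -> a *: v = 0) -> Q a) ->
  exists2 v, v \in vs & forall a, a *: v = 0 -> Q a.
Proof.
move=> hQ; elim: vs => [|v vs ih] h.
  by have [_ n1 _] := hQ; case: n1; apply: h.
case: (pselect (forall a, a *: v = 0 -> Q a)) => [hv|].
  by exists v; rewrite ?mem_head.
move=> /existsNP[b /not_implyP[hb nb]].
have [|w hw aw] := ih; last by exists w; rewrite // inE hw orbT.
move=> a ha; have [_ _ hQM] := hQ; suff /hQM[//|] : Q (a * b) by [].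
apply: h => w; rewrite inE => /predU1P[->|/ha hw].
  by rewrite -scalerA hb scaler0.
by rewrite mulrC -scalerA hw scaler0.
Qed.

(** The maximal annihilators of nonzero elements are prime. There are finitely
    many of them: the elements having one span a submodule, which is spanned by
    finitely many v_i; any other maximal annihilator contains the intersection
    of the ann(v_i), hence one of them. *)
Lemma zero_divisors_finite_primes (V : lmodType R) : noeth R^o -> noeth V ->
  exists vs : seq V, (forall v : V, v \in vs -> v <> 0 /\ isprime (fun a => a *: v = 0)) /\
    forall a (v : V), v <> 0 -> a *: v = 0 -> exists2 w, w \in vs & a *: w = 0.
Proof.
move=> nR nV.
pose mx (v : V) := v <> 0 /\ forall w : V, w <> 0 ->
  (forall a, a *: v = 0 -> a *: w = 0) -> (forall a, a *: w = 0 -> a *: v = 0).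
have mx_ex (v : V) : v <> 0 -> exists2 w, mx w & forall a, a *: v = 0 -> a *: w = 0.
  have := @noeth_ind R R^o (fun I => forall v : V, v <> 0 ->
    (forall a, I a <-> a *: v = 0) -> exists2 w, mx w & forall a, I a -> a *: w = 0) nR.
  move=> ind v0; have [] := ind _ _ (isidl_ann v) v v0 => // [|w hw h].
    move=> I hI ih u u0 eI.
    case: (pselect (mx u)) => [hu|]; first by exists u => // a /eI.
    rewrite /mx => /not_andP[//|] /existsNP[w /not_implyP[w0 /not_implyP[uw]]].
    move=> /existsNP[b /not_implyP[wb ub]].
    have [|||t ht h] := ih _ (isidl_ann w) _ _ w w0 => //.
    - by move=> a /eI/uw.
    - by exists b => // /eI.
    - by exists t => // a /eI/uw/h.
  by exists w.
have mx_prime (v : V) : mx v -> isprime (fun a => a *: v = 0).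
  move=> [v0 hv]; split; first exact: isidl_ann.
    by rewrite scale1r.
  move=> a b ab; case: (pselect (b *: v = 0)) => [|nb]; [by right|left].
  apply: (hv (b *: v)) => // [c hc|]; last by rewrite scalerA.
  by rewrite scalerA mulrC -scalerA hc scaler0.
pose P x := exists2 vs : seq V, (forall v, v \in vs -> mx v) & span vs x.
have hP : issub P.
  split; first by exists [::].
  - move=> x y [s hs sx] [t ht ty]; exists (s ++ t).
      by move=> v; rewrite mem_cat => /orP[/hs|/ht].
    have [_ hD _] := issub_span (s ++ t); apply: hD.
      by apply: span_mono sx => z; rewrite mem_cat => ->.
    by apply: span_mono ty => z; rewrite mem_cat orbC => ->.
  - by move=> a x [s hs sx]; exists s => //; have [_ _ hZ] := issub_span s; apply: hZ.
have [s hs] := nV P hP.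
have [vs hvs sv] : exists2 vs : seq V, (forall v, v \in vs -> mx v) &
    forall x, x \in s -> span vs x.
  have : forall x, x \in s -> P x by move=> x /span_mem/hs.
  elim: (s) => [|x r ih] h; first by exists [::].
  have [|t ht tr] := ih; first by move=> z hz; apply: h; rewrite inE hz orbT.
  have [u hu ux] := h x (mem_head _ _); exists (u ++ t).
    by move=> v; rewrite mem_cat => /orP[/hu|/ht].
  move=> z; rewrite inE => /predU1P[->|/tr hz].
    by apply: span_mono ux => y; rewrite mem_cat => ->.
  by apply: span_mono hz => y; rewrite mem_cat orbC => ->.
exists vs; split=> [v hv|a v v0 av].
  by split; [have [] := hvs v hv|apply/mx_prime/hvs].
have [w mw hw] := mx_ex v v0.
have hPw : P w by exists [:: w] => [x|]; [rewrite inE => /eqP->|apply: span_mem; rewrite inE].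
have sw : span vs w.
  by move/hs: hPw; apply: span_sub; first exact: issub_span.
have [|u uvs uw] := prime_list_ann (mx_prime w mw) (vs := vs).
  move=> b hb; apply: (span_sub (P := fun x => b *: x = 0)) sw => //.
  split=> [|x y hx hy|c x hx]; first exact: scaler0.
    by rewrite scalerDr hx hy addr0.
  by rewrite scalerA mulrC -scalerA hx scaler0.
exists u => //; have [u0 hu] := hvs u uvs.
by apply: (hu w _ uw); [case: mw|apply: hw].
Qed.

(** Induction on the number of primes: if u + w misses all of them but a new
    one, add to w an element of I that avoids the new prime and lies in the
    others, which is a product of elements chosen for each of these. *)
Lemma prime_avoidance (T : eqType) (Pr : T -> R -> Prop) (s : seq T) I u :
  (forall t, t \in s -> isprime (Pr t)) -> isidl I ->
  (forall t, t \in s -> exists2 a, I a & ~ Pr t a) ->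
  exists2 w, I w & forall t, t \in s -> ~ Pr t (u + w).
Proof.
move=> + hI; have [n] := ubnP (size s); elim: n s => // n ih [|t s] /= sn hs hn.
  by exists 0 => //; have [] := hI.
case: (pselect (exists2 t', t' \in s & forall a, Pr t' a -> Pr t a)).
  case=> t' ht' sub; have mt' : t' \in t :: s by rewrite inE ht' orbT.
  have [| | |w hw h] := ih (rem t' (t :: s)).
  - by rewrite size_rem.
  - by move=> x /mem_rem; apply: hs.
  - by move=> x /mem_rem; apply: hn.
  exists w => // x hx; have [xr|nx] := boolP (x \in rem t' (t :: s)); first exact: h.
  have xt : x = t'.
    by apply/eqP; apply: contraNT nx => nx; have := hx; rewrite (perm_mem (perm_to_rem mt')) inE (negPf nx).
  rewrite xt => /sub; apply: h; rewrite /=; case: eqP => [->//|_]; exact: mem_head.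
move=> nsub; have [| | |w hw h] := ih s.
- exact: sn.
- by move=> x hx; apply: hs; rewrite inE hx orbT.
- by move=> x hx; apply: hn; rewrite inE hx orbT.
case: (pselect (Pr t (u + w))) => [tw|ntw]; last first.
  by exists w => // x; rewrite inE => /predU1P[->//|/h].
have ht := hs t (mem_head _ _).
have [c [hc ct cs]] : exists c, [/\ I c, ~ Pr t c & forall x, x \in s -> Pr x c].
  have {h ih sn} : forall x, x \in s -> isprime (Pr x) /\ exists2 a, Pr x a & ~ Pr t a.
    move=> x hx; split; first by apply: hs; rewrite inE hx orbT.
    apply: contrapT => no; apply: nsub; exists x => // a xa.
    by apply: contrapT => nta; apply: no; exists a.
  elim: (s) => [|x r ihr] h.
    by have [a Ia na] := hn t (mem_head _ _); exists a.
  have [|c [hc ct cr]] := ihr; first by move=> z hz; apply: h; rewrite inE hz orbT.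
  have [[hx _ _] [a xa ta]] := h x (mem_head _ _); exists (a * c); split.
  - exact: idlM.
  - exact: nprimeM.
  - move=> z; rewrite inE => /predU1P[->|hz]; first by rewrite mulrC; apply: idlM.
    apply: idlM; last exact: cr.
    by have [|[]] := h z; first by rewrite inE hz orbT.
exists (w + c); first by have [_ hD _] := hI; apply: hD.
move=> x; rewrite inE addrA => /predU1P[->|hx] hP.
  by apply: ct; have [tI _ _] := ht; apply: (issubDr tI tw); rewrite addrC.
have [|xI _ _] := hs x; first by rewrite inE hx orbT.
by apply: (h x hx); apply: (issubDr xI (cs x hx)).
Qed.

Definition reg_on (V : lmodType R) a := forall v : V, a *: v = 0 -> v = 0.

Lemma regular_in_coset (V : lmodType R) I u : noeth R^o -> noeth V -> isidl I ->
  (forall v : V, (forall a, I a -> a *: v = 0) -> v = 0) ->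
  exists2 w, I w & reg_on V (u + w).
Proof.
move=> nR nV hI hv; have [vs [h1 h2]] := zero_divisors_finite_primes nR nV.
have [|||w hw h] := @prime_avoidance V (fun (v : V) a => a *: v = 0) vs I u.
- by move=> v /h1[].
- exact: hI.
- move=> v /h1[v0 _]; apply: contrapT => no; apply: v0; apply: hv => a ha.
  by apply: contrapT => na; apply: no; exists a.
exists w => // v e; apply: contrapT => v0; have [x hx] := h2 _ _ v0 e.
exact: h.
Qed.

(** * Nakayama's lemma *)

Lemma det_mod Q n (A B : 'M[R]_n) : isidl Q -> (forall i j, Q (A i j - B i j)) ->
  Q (\det A - \det B).
Proof.
move=> hQ hAB; rewrite /determinant -sumrB.
apply: (@issub_sum _ R^o Q _ _ _ _ hQ) => s _; rewrite -mulrBr; apply: idlM => //.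
elim/big_ind2: _ => [|a b c d h h'|i _]; first by rewrite subrr; case: hQ.
  have -> : b * d - a * c = d * (b - a) + a * (d - c) by rewrite !mulrBr [d * b]mulrC [d * a]mulrC addrA subrK.
  by have [_ hD _] := hQ; apply: hD; apply: idlM.
exact: hAB.
Qed.

Lemma cramer_sub (V : lmodType R) (U : V -> Prop) n (T : 'M[R]_n) (e : 'I_n -> V) :
  issub U -> (forall i, U (\sum_j T i j *: e j)) -> forall k, U (\det T *: e k).
Proof.
move=> hU h k; have -> : \det T *: e k = \sum_i (\adj T k i) *: \sum_j T i j *: e j.
  transitivity (\sum_j ((\det T)%:M : 'M_n) k j *: e j).
    rewrite (bigD1 k) //= mxE eqxx mulr1n big1 ?addr0 // => j jk.
    by rewrite mxE eq_sym (negPf jk) mulr0n scale0r.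
  rewrite -mul_adj_mx; under [RHS]eq_bigr do rewrite scaler_sumr.
  rewrite exchange_big; apply: eq_bigr => j _; rewrite mxE scaler_suml.
  by apply: eq_bigr => i _; rewrite scalerA.
by apply: issub_sum => // i _; have [_ _ hZ] := hU; apply: hZ.
Qed.

(** Q P as an inductive predicate, with an induction principle for any Q and P *)
Inductive isum (V : lmodType R) Q (P : V -> Prop) : V -> Prop :=
| isum0 : isum Q P 0
| isumS a v w : Q a -> P v -> isum Q P w -> isum Q P (a *: v + w).

Lemma isum1 (V : lmodType R) Q (P : V -> Prop) a v : Q a -> P v -> isum Q P (a *: v).
Proof. by move=> ha hv; rewrite -[_ *: _]addr0; apply: isumS => //; apply: isum0. Qed.

Lemma issub_isum (V : lmodType R) Q (P : V -> Prop) : isidl Q -> issub (isum Q P).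
Proof.
move=> hQ; split; first exact: isum0.
  move=> x y; elim=> [|a v w ha hv _ ih] hy; first by rewrite add0r.
  by rewrite -addrA; apply: isumS => //; apply: ih.
move=> c x; elim=> [|a v w ha hv _ ih]; first by rewrite scaler0; apply: isum0.
by rewrite scalerDr scalerA; apply: isumS => //; apply: idlM.
Qed.

Lemma isum_sub (V : lmodType R) Q (P U : V -> Prop) x : issub U ->
  (forall a v, Q a -> P v -> U (a *: v)) -> isum Q P x -> U x.
Proof.
move=> hU h; elim=> [|a v w ha hv _ ih]; first by case: hU.
by have [_ hD _] := hU; apply: hD => //; apply: h.
Qed.

Lemma isum_span (V : lmodType R) Q (P : V -> Prop) (s : seq V) x : isidl Q ->
  (forall v, P v -> span s v) -> isum Q P x -> ispan Q s x.
Proof.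
move=> hQ hs.
have hI : issub (ispan Q s).
  elim: (s) => [|y r [h0 hD hZ]]; first exact: issub0.
  have [q0 qD qZ] := hQ; split=> /=; first by exists 0; rewrite ?scale0r ?subrr.
    move=> u v [a ha hu] [b hb hv]; exists (a + b); first exact: qD.
    by rewrite scalerDl opprD addrACA; apply: hD.
  move=> k u [a ha hu]; exists (k * a); first exact: qZ.
  by rewrite -scalerA -scalerBr; apply: hZ.
apply: isum_sub => // a v ha /hs; elim: (s) v => [|y r ih] v /=.
  by move->; rewrite scaler0.
case=> b _ hv; exists (a * b); first by rewrite mulrC; apply: idlM.
by rewrite -scalerA -scalerBr; apply: ih.
Qed.

(** Nakayama's lemma after localization at Q, with denominators cleared: by
    Cramer's rule the determinant of a matrix which is diagonal modulo Q, with
    diagonal entries outside of Q, kills the generators modulo U. *)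
Lemma nakayama_span (V : lmodType R) Q (U : V -> Prop) (s : seq V) : isprime Q -> issub U ->
  (forall y, y \in s -> exists2 c, ~ Q c & exists2 w, ispan Q s w & U (c *: y - w)) ->
  exists2 c, ~ Q c & forall y, span s y -> U (c *: y).
Proof.
move=> hQ hU h; have [qI _ _] := hQ.
have : forall i : 'I_(size s), exists c : R * ('I_(size s) -> R), ~ Q c.1 /\ ((forall j, Q (c.2 j)) /\
    U (c.1 *: s`_i - \sum_j c.2 j *: s`_j)).
  move=> i; have [|c nc [w /ispan_sum[d [hd ->]] hw]] := h s`_i; first exact: mem_nth.
  by exists (c, d).
case/choice => c hc.
pose T := \matrix_(i, j) ((c i).1 *+ (i == j) - (c i).2 j).
pose D := diag_mx (\row_i (c i).1).
exists (\det T).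
  have : Q (\det T - \det D).
    apply: det_mod => // i j; rewrite !mxE addrAC; case: eqVneq => [->|_].
      by rewrite subrr sub0r; apply: (issubN qI); have [_ []] := hc j.
    by rewrite subrr sub0r; apply: (issubN qI); have [_ []] := hc i.
  move=> hd hT.
  have : Q (\det D).
    by rewrite -[\det D](subKr (\det T)); apply: (@issubB _ R^o Q).
  rewrite det_diag; elim/big_ind: _ => [|a b ha hb|i _].
  - by case: hQ.
  - by have [_ _ hM] := hQ; case/hM.
  - by rewrite mxE; case: (hc i).
have hk := @cramer_sub V U _ T (fun i => s`_i) hU.
move=> y; apply: (span_sub (P := fun y => U (\det T *: y))).
  have [u0 uD uZ] := hU; split; first by rewrite scaler0.
    by move=> u v hu hv; rewrite scalerDr; apply: uD.
  by move=> a u hu; rewrite scalerA mulrC -scalerA; apply: uZ.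
move=> z /(nthP 0)[k ks <-]; apply: (hk _ (Ordinal ks)) => i.
have [_ [_ ]] := hc i; congr U; rewrite -sumrN.
under [RHS]eq_bigr do rewrite mxE scalerBl.
rewrite big_split /=; congr (_ + _).
rewrite (bigD1 i) //= eqxx mulr1n big1 ?addr0 // => j.
by rewrite eq_sym => /negPf ->; rewrite mulr0n scale0r.
Qed.

Lemma nakayama (V : lmodType R) Q (P U : V -> Prop) : isprime Q -> issub U -> fg P ->
  (forall v, P v -> exists2 c, ~ Q c & exists2 w, isum Q P w & U (c *: v - w)) ->
  exists2 c, ~ Q c & forall v, P v -> U (c *: v).
Proof.
move=> hQ hU [s hs] h; have [qI _ _] := hQ.
have [|c nc hc] := @nakayama_span V Q U s hQ hU; last by exists c => // v /hs/hc.
move=> y /span_mem/hs/h[c nc [w hw hU']]; exists c => //; exists w => //.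
by apply: isum_span hw => // v /hs.
Qed.

Lemma nakayama_loc (V : lmodType R) Q (P U : V -> Prop) : isloc Q -> issub U -> fg P ->
  (forall v, P v -> exists2 w, isum Q P w & U (v - w)) -> forall v, P v -> U v.
Proof.
move=> [hQ hu] hU hP h v Pv; have [|c /hu[b e] hc] := nakayama hQ hU hP.
  by move=> w /h hw; exists 1; [case: hQ|rewrite scale1r].
rewrite -[v]scale1r -e -scalerA; have [_ _ hZ] := hU; apply: hZ; exact: hc.
Qed.
End Ideals.

(** * Regular sequences and iterated quotients *)

Section Quo.
Variable R : comNzRingType.
Implicit Types (V W X : lmodType R) (xs : seq R).

Lemma scl_linear V (x : R) : linear (fun v : V => x *: v).
Proof. by move=> a u v; rewrite scalerDr !scalerA mulrC. Qed.
Definition scl V (x : R) : {linear V -> V} := mklin (@scl_linear V x).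

Definition mulim V (x : R) (w : V) := exists v, w = x *: v.

Lemma issub_mulim V x : issub (@mulim V x).
Proof.
split; first by exists 0; rewrite scaler0.
  by move=> u w [u' ->] [w' ->]; exists (u' + w'); rewrite scalerDr.
by move=> a u [u' ->]; exists (a *: u'); rewrite !scalerA mulrC.
Qed.

Lemma ses_scl V x : reg_on V x -> ses (scl V x) (qpi (@mulim V x)).
Proof.
move=> hx; split=> [u v /= e|w|v]; last by rewrite qpi0 //; exact: issub_mulim.
  by apply/eqP; rewrite -subr_eq0; apply/eqP/hx; rewrite scalerBr e subrr.
exact: qpi_surj.
Qed.

Lemma linear_comp V W X (g : {linear W -> X}) (f : {linear V -> W}) :
  linear (fun v => g (f v)).
Proof. by move=> a u v; rewrite !linearP. Qed.
Definition lcomp V W X (g : {linear W -> X}) (f : {linear V -> W}) : {linear V -> X} :=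
  mklin (linear_comp g f).

(** V / (xs) V, dividing by one element at a time so that an induction on xs
    peels off the first element. *)
Fixpoint quo xs V : lmodType R :=
  if xs is x :: xs' then quo xs' (Qt (@mulim V x)) else V.

Lemma id_linear V : linear (fun v : V => v). Proof. by []. Qed.
Definition lid V : {linear V -> V} := mklin (@id_linear V).

Fixpoint quoP xs V : {linear V -> quo xs V} :=
  if xs is x :: xs' return {linear V -> quo xs V}
  then lcomp (quoP xs' _) (qpi (@mulim V x)) else lid V.

Fixpoint Reg xs V : Prop :=
  if xs is x :: xs' then reg_on V x /\ Reg xs' (Qt (@mulim V x)) else True.

Lemma quoP_surj xs V w : exists v, quoP xs V v = w.
Proof.
elim: xs V w => [|x xs ih] V w; first by exists w.
by have [v <-] := ih _ w; have [u <-] := qpi_surj v; exists u.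
Qed.

Lemma quoP_mul xs V x v : x \in xs -> quoP xs V (x *: v) = 0.
Proof.
elim: xs V v => // y xs ih V v; rewrite inE => /predU1P[->|hx] /=.
  by rewrite (_ : qpi _ _ = 0) ?linear0 //; apply/qpi0; [exact: issub_mulim|exists v].
by rewrite linearZ ih.
Qed.

Lemma quoP_ker xs V (U : V -> Prop) v : issub U ->
  (forall x u, x \in xs -> U (x *: u)) -> quoP xs V v = 0 -> U v.
Proof.
elim: xs V U v => [|x xs ih] V U v hU h /=; first by case: hU => ? _ _ ->.
move=> e; have [] := ih _ (fun w => exists2 u, U u & w = qpi (@mulim V x) u) _ _ _ e.
- exact: issub_im.
- move=> y w hy; have [u <-] := qpi_surj w; exists (y *: u); last by rewrite linearZ.
  by apply: h; rewrite inE hy orbT.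
move=> u hu /eqP; rewrite -subr_eq0 -linearB => /eqP/qpi0[|u' e'].
  exact: issub_mulim.
rewrite -[v](subrK u) e'; have [_ hD _] := hU; apply: hD => //.
by apply: h; rewrite mem_head.
Qed.

Lemma quo_map xs V W (f : {linear V -> W}) :
  exists g : {linear quo xs V -> quo xs W}, forall v, g (quoP xs V v) = quoP xs W (f v).
Proof.
apply: (lin_factor (g := quoP xs V) (f := lcomp (quoP xs W) f)).
  exact: quoP_surj.
move=> v; apply: (quoP_ker (U := fun v => quoP xs W (f v) = 0)) => [|x u hx].
  exact: (issub_ker (lcomp _ _) issub0).
by rewrite /= linearZ quoP_mul.
Qed.

Lemma quo_ann xs V a (w : quo xs V) : quoP xs R^o a = 0 -> a *: w = 0.
Proof.
move=> ha; have [v <-] := quoP_surj w; rewrite -linearZ.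
apply: (quoP_ker (V := R^o) (xs := xs) (U := fun a => quoP xs V (a *: v) = 0)) ha.
  split=> [|b c hb hc|b c hc]; first by rewrite scale0r linear0.
    by rewrite scalerDl linearD hb hc addr0.
  by rewrite -[b *: c]/(b * c) -scalerA linearZ /= hc scaler0.
by move=> x b hx; rewrite -[x *: b]/(x * b) -scalerA quoP_mul.
Qed.

Lemma fgm_quo xs V : fgm V -> fgm (quo xs V).
Proof. by apply: fgm_surj; apply: quoP_surj. Qed.

Lemma quo_map_retract xs V W (f : {linear V -> W}) (g : {linear W -> V}) :
  (forall v, g (f v) = v) -> exists (f' : {linear quo xs V -> quo xs W})
    (g' : {linear quo xs W -> quo xs V}), forall v, g' (f' v) = v.
Proof.
move=> gf; have [f' hf] := quo_map xs f; have [g' hg] := quo_map xs g.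
by exists f', g' => w; have [v <-] := quoP_surj w; rewrite hf hg gf.
Qed.

Lemma reg_on_inj V W (f : {linear V -> W}) x : injective f -> reg_on W x -> reg_on V x.
Proof.
by move=> fI hx v e; apply: fI; rewrite linear0; apply: hx; rewrite -linearZ e linear0.
Qed.

Lemma Reg_retract xs V W (f : {linear V -> W}) (g : {linear W -> V}) :
  (forall v, g (f v) = v) -> Reg xs W -> Reg xs V.
Proof.
elim: xs V W f g => // x xs ih V W f g gf [hx hxs]; split.
  by apply: (reg_on_inj (f := f)) hx; apply: can_inj gf.
by have [f' [g' h]] := @quo_map_retract [:: x] V W f g gf; apply: (ih _ _ f' g' h).
Qed.

Lemma Reg_rcons xs x V : Reg (rcons xs x) V <-> Reg xs V /\ reg_on (quo xs V) x.
Proof.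
elim: xs V => [|y xs ih] V /=; first by split=> -[].
by rewrite ih; split=> [[? []]|[[]]].
Qed.
End Quo.

(** * Extensions computed from an injective resolution of the ring *)

Lemma fgm_free (R : nzRingType) (V : lmodType R) : fgm V ->
  exists n (f : {linear 'rV[R]_n -> V}), forall v, exists u, f u = v.
Proof.
move=> [s hs]; exists (size s).
have lP : linear (fun u : 'rV[R]_(size s) => \sum_i u 0 i *: s`_i).
  move=> a u v; rewrite scaler_sumr -big_split; apply: eq_bigr => i _.
  by rewrite !mxE scalerDl scalerA.
exists (mklin lP) => v; have /ispan_sum[c [_ ->]] := hs v.
by exists (\row_i c i); apply: eq_bigr => i _; rewrite mxE.
Qed.

Lemma rV_linear (R : nzRingType) (V : lmodType R) n (u : 'I_n -> V) :
  exists f : {linear 'rV[R]_n -> V}, forall v, f v = \sum_i v 0 i *: u i.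
Proof.
have lP : linear (fun v : 'rV[R]_n => \sum_i v 0 i *: u i).
  move=> a v w; rewrite scaler_sumr -big_split; apply: eq_bigr => i _.
  by rewrite !mxE scalerDl scalerA.
by exists (mklin lP).
Qed.

Lemma fgm_ring (R : comNzRingType) : fgm (R^o : lmodType R).
Proof.
exists [:: 1]; rewrite /span /= => x; exists x => //.
by rewrite -[x *: 1]/(x * 1) mulr1 subrr.
Qed.

Lemma fgm_rV (R : nzRingType) n : fgm 'rV[R]_n.
Proof.
pose s := [seq delta_mx 0 i : 'rV[R]_n | i <- enum 'I_n].
exists s => x; rewrite [x]row_sum_delta; have hs := issub_span s.
apply: (@issub_sum _ _ _ _ _ _ _ hs) => i _; have [_ _ hZ] := hs.
by apply: hZ; apply: span_mem; apply: map_f; rewrite mem_enum.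
Qed.

Record injective_resolution (R : comNzRingType) := InjRes {
  ir_mod : nat -> lmodType R;
  ir_aug : {linear R^o -> ir_mod 0%N};
  ir_d : forall n, {linear ir_mod n -> ir_mod n.+1};
  ir_inj : forall n, injective_module (ir_mod n);
  ir_augI : injective ir_aug;
  ir_ex0 : forall x, ir_d 0%N x = 0 <-> exists v, x = ir_aug v;
  ir_exS : forall n x, ir_d n.+1 x = 0 <-> exists y, x = ir_d n y }.

Section InjectiveResolution.
Variables (R : comNzRingType) (J : injective_resolution R).
Local Notation E := (ir_mod J).
Local Notation aug := (ir_aug J).
Local Notation d := (ir_d J).
Let Einj := @ir_inj R J.
Let augI := @ir_augI R J.
Let ex0 := @ir_ex0 R J.
Let exS := @ir_exS R J.
Implicit Types L : lmodType R.

Definition cyc L i (h : L -> E i) := forall v, d i (h v) = 0.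

Definition bnd L i : (L -> E i) -> Prop :=
  match i with
  | 0 => fun h => forall v, h v = 0
  | j.+1 => fun h => exists g : {linear L -> E j}, forall v, h v = d j (g v)
  end.

(** Ext^i(L, R) = 0 *)
Definition van i L := forall h : {linear L -> E i}, cyc h -> bnd h.

Lemma ddE n x : d n.+1 (d n x) = 0. Proof. by apply/exS; exists x. Qed.

Lemma bnd_cyc L i (h : L -> E i) : bnd h -> cyc h.
Proof. by case: i h => [|i] h /=; [move=> e v; rewrite e linear0|case=> g e v; rewrite e ddE]. Qed.

Lemma eq_bnd L i (h h' : L -> E i) : (forall v, h v = h' v) -> bnd h -> bnd h'.
Proof. by move/funext => ->. Qed.

Lemma bnd_comp L L' i (h : L -> E i) (f : {linear L' -> L}) :
  bnd h -> bnd (fun u => h (f u)).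
Proof. by case: i h => [|i] h /= => [e u|[g e]]; [exact: e|exists (lcomp g f) => u; exact: e]. Qed.

Lemma issub_bnd L i : issub (@bnd L i : (L -> E i) -> Prop).
Proof.
case: i => [|i] /=; split=> //.
- by move=> h h' e e' v; rewrite /GRing.add /= e e' addr0.
- by move=> a h e v; rewrite /GRing.scale /= e scaler0.
- by exists (\0 : {linear L -> E i}) => v; rewrite linear0.
- move=> h h' [g e] [g' e']; exists (g \+ g' : {linear L -> E i}) => v.
  by rewrite /= linearD -e -e'.
- move=> a h [g e]; exists (a \*: g : {linear L -> E i}) => v.
  by rewrite /= linearZ -e.
Qed.

Lemma bndD L i (h h' : L -> E i) : bnd h -> bnd h' -> bnd (fun v => h v + h' v).
Proof. by have [_ hD _] := issub_bnd L i; apply: hD. Qed.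

Lemma bndZ L i a (h : L -> E i) : bnd h -> bnd (fun v => a *: h v).
Proof. by have [_ _ hZ] := issub_bnd L i; apply: hZ. Qed.

Section Exact.
Variables (L' L L'' : lmodType R) (f : {linear L' -> L}) (g : {linear L -> L''}).
Hypothesis fg : ses f g.

Lemma ext_inj i (h : {linear L' -> E i}) : exists k : {linear L -> E i},
  forall u, k (f u) = h u.
Proof. by have [fI _ _] := fg; apply: Einj. Qed.

Lemma ses_factor (W : lmodType R) (h : {linear L -> W}) : (forall u, h (f u) = 0) ->
  exists k : {linear L'' -> W}, forall v, k (g v) = h v.
Proof.
have [_ gS gf] := fg; move=> e; apply: lin_factor => // v /gf[u ->]; exact: e.
Qed.

Lemma bnd_extend i (h : L' -> E i) : bnd h ->
  exists q : {linear L -> E i}, bnd q /\ forall u, q (f u) = h u.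
Proof.
case: i h => [|i] h /= => [e|[k e]].
  by exists (\0 : {linear L -> E 0%N}); split=> // u; rewrite e.
have [k' e'] := ext_inj k; exists (lcomp (d i) k'); split; first by exists k'.
by move=> u; rewrite /= e' e.
Qed.

(** Exactness of Ext^i(L'') -> Ext^i(L) -> Ext^i(L'). *)
Lemma ext_middle i (h : {linear L -> E i}) : cyc h -> bnd (fun u => h (f u)) ->
  exists k : {linear L'' -> E i}, cyc k /\ bnd (fun v => h v - k (g v)).
Proof.
move=> hc /bnd_extend[q [qb qf]]; have [_ gS _] := fg.
have [|k hk] := @ses_factor _ (h \- q : {linear L -> E i}).
  by move=> u /=; rewrite qf subrr.
exists k; split.
  by move=> w; have [v <-] := gS w; rewrite hk /= linearB hc (bnd_cyc qb) subrr.
by apply: eq_bnd qb => v; rewrite hk /= subKr.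
Qed.

(** The connecting map on cocycles. *)
Lemma ext_conn i (h : {linear L' -> E i}) : cyc h ->
  exists (h1 : {linear L -> E i}) (k : {linear L'' -> E i.+1}),
    [/\ forall u, h1 (f u) = h u, cyc k & forall v, k (g v) = d i (h1 v)].
Proof.
move=> hc; have [h1 e1] := ext_inj h; have [_ gS _] := fg.
have [|k hk] := @ses_factor _ (lcomp (d i) h1); first by move=> u; rewrite /= e1.
exists h1, k; split=> // w; have [v <-] := gS w.
by rewrite hk /= ddE.
Qed.

Lemma ext_conn_bnd i (h1 : {linear L -> E i}) (k : {linear L'' -> E i.+1}) :
  (forall v, k (g v) = d i (h1 v)) -> bnd k ->
  exists2 h : {linear L -> E i}, cyc h & forall u, h (f u) = h1 (f u).
Proof.
move=> e [k1 e1]; have [_ _ gf] := fg.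
exists (h1 \- lcomp k1 g : {linear L -> E i}).
  by move=> v /=; rewrite linearB -e -e1 subrr.
by move=> u /=; rewrite (ses0 u fg) linear0 subr0.
Qed.

(** Exactness of Ext^i(L) -> Ext^i(L') -> Ext^{i+1}(L''). *)
Lemma ext_right i (k : {linear L'' -> E i.+1}) (q : {linear L -> E i})
    (h : {linear L -> E i}) : cyc h -> (forall v, k (g v) = d i (q v)) ->
  bnd (fun u => q (f u) - h (f u)) -> bnd k.
Proof.
move=> hc e /bnd_extend[b [bb bf]]; have [_ gS _] := fg.
have [|k1 hk] := @ses_factor _ (q \- h \- b : {linear L -> E i}).
  by move=> u /=; rewrite bf subrr.
exists k1 => w; have [v <-] := gS w; rewrite hk e /= !linearB.
by rewrite hc (bnd_cyc bb) !subr0.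
Qed.

Lemma van_middle i : van i L' -> van i L'' -> van i L.
Proof.
move=> h1 h2 h hc; have [|k [kc hk]] := ext_middle hc.
  by apply: (h1 (lcomp h f)) => u; apply: hc.
by apply: eq_bnd (bndD hk (bnd_comp g (h2 k kc))) => v; rewrite subrK.
Qed.

Lemma van_extend i (h : {linear L' -> E i}) : van i.+1 L'' -> cyc h ->
  exists2 k : {linear L -> E i}, cyc k & forall u, k (f u) = h u.
Proof.
move=> hv /ext_conn[h1 [k [e1 kc ek]]].
by have [q qc e] := ext_conn_bnd ek (hv k kc); exists q => // u; rewrite e e1.
Qed.

Lemma van_left i : van i L -> van i.+1 L'' -> van i L'.
Proof.
move=> hL hL'' h /(van_extend hL'')[k /hL kb ek].
by apply: eq_bnd (bnd_comp f kb) => u; rewrite ek.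
Qed.

Lemma van_right i : van i L' -> van i.+1 L -> van i.+1 L''.
Proof.
move=> hL' hL k kc; have [|q e] := hL (lcomp k g); first by move=> v; apply: kc.
apply: (ext_right (q := q) (h := \0 : {linear L -> E i})) => // [v|].
  by rewrite linear0.
apply: eq_bnd (hL' (lcomp q f) _) => u /=; first by rewrite subr0.
by rewrite -e /= (ses0 u fg) linear0.
Qed.
End Exact.

Lemma van_retract L L' i (f : {linear L -> L'}) (g : {linear L' -> L}) :
  (forall v, g (f v) = v) -> van i L' -> van i L.
Proof.
move=> gf hv h hc; have := hv (lcomp h g) (fun v => hc _).
by move/(bnd_comp f); apply: eq_bnd => v /=; rewrite gf.
Qed.

Lemma van_free i n : van i.+1 'rV[R]_n.
Proof.
move=> h hc; have /choice[u hu] : forall k, exists y, h (delta_mx 0 k) = d i y.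
  by move=> k; apply/exS.
have [g hg] := rV_linear u; exists g => v.
rewrite hg [v in LHS]row_sum_delta !linear_sum; apply: eq_bigr => k _.
by rewrite !linearZ hu.
Qed.

Lemma van_quo xs L a : Reg xs L -> (forall i, (a < i)%N -> van i L) ->
  forall i, (a + size xs < i)%N -> van i (quo xs L).
Proof.
elim: xs L a => [|x xs ih] L a /=; first by move=> _ h i; rewrite addn0; apply: h.
move=> [hx hxs] hv i hi; apply: (ih _ a.+1) => //; last by rewrite addSnnS.
by case=> // j hj; apply: (van_right (ses_scl hx)); apply: hv; rewrite // ltnW.
Qed.

(** ** Finite generation *)

(** Ext^i(L, R) is finitely generated. *)
Definition fgE i L := exists s : seq (L -> E i),
  (forall h, h \in s -> exists2 h1 : {linear L -> E i}, cyc h1 & h = h1) /\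
  forall h : {linear L -> E i}, cyc h -> addsub (span s) (@bnd L i) h.

Lemma issub_cocycles L i :
  issub (fun h : L -> E i => exists2 h1 : {linear L -> E i}, cyc h1 & h = h1).
Proof.
split; first by exists (\0 : {linear L -> E i}) => // v; rewrite linear0.
  move=> h h' [k kc ->] [k' kc' ->]; exists (k \+ k' : {linear L -> E i}) => // v.
  by rewrite /= linearD kc kc' addr0.
move=> a h [k kc ->]; exists (a \*: k : {linear L -> E i}) => // v.
by rewrite /= linearZ /= kc scaler0.
Qed.

Hypothesis nR : noeth R^o.

(** In degree 0 a cocycle is a linear form, determined by its values on
    generators; in degree i + 1 dimension shifting along a presentation
    reduces to degree i. *)
Lemma fgE_fgm i L : fgm L -> fgE i L.
Proof.
elim: i L => [|i ih] L hL.
  have [n [p pS]] := fgm_free hL.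
  pose P (v : 'rV[R]_n) := exists g : {linear L -> R^o}, forall k, v 0 k = g (p (delta_mx 0 k)).
  have hP : issub P.
    split; first by exists (\0 : {linear L -> R^o}) => k; rewrite mxE.
      move=> u v [g e] [g' e']; exists (g \+ g' : {linear L -> R^o}) => k.
      by rewrite mxE e e'.
    by move=> a u [g e]; exists (a \*: g : {linear L -> R^o}) => k; rewrite mxE e.
  have [t ht] := noeth_fgm nR (fgm_rV R n) hP.
  have : forall v, v \in t -> exists h : L -> E 0%N, exists2 g : {linear L -> R^o},
      (forall k, v 0 k = g (p (delta_mx 0 k))) & h = fun x => aug (g x).
    by move=> v /span_mem/ht[g e]; exists (fun x => aug (g x)), g.
  case/span_map_choice => s [sz hs]; exists s; split.
    move=> h /(nthP 0)[k]; rewrite sz => hk <-; have [g _ ->] := hs k 0 hk.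
    by exists (lcomp aug g) => // v; apply/ex0; exists (g v).
  move=> h hc; have [|g eg] := @lin_lift R _ _ _ aug h augI.
    by move=> v; apply/ex0.
  have /ht : P (\row_k g (p (delta_mx 0 k))) by exists g => k; rewrite mxE.
  case/ispan_sum => c [_ e]; exists (h : L -> E 0%N); last first.
    by rewrite subrr; have [] := issub_bnd L 0.
  rewrite -sz in c e *.
  suff -> : (h : L -> E 0%N) = \sum_(j < size s) c j *: s`_j by apply: span_comb.
  apply/funext => v; rewrite fct_sumE; have [u <-] := pS v.
  have hd (g' : {linear L -> R^o}) : g' (p u) = \sum_k u 0 k *: g' (p (delta_mx 0 k)).
    by rewrite {1}[u]row_sum_delta !linear_sum; apply: eq_bigr => k _; rewrite !linearZ.
  have -> : h (p u) = aug (\sum_j c j *: \sum_k u 0 k *: (t`_j 0 k : R^o)).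
    rewrite -eg hd; under [in RHS]eq_bigr do rewrite scaler_sumr.
    rewrite exchange_big; congr (aug _); apply: eq_bigr => k _.
    have := congr1 (fun w : 'rV_n => w 0 k) e; rewrite !mxE => ->.
    rewrite summxE scaler_sumr; apply: eq_bigr => j _ /=.
    by rewrite !mxE !scalerA mulrC.
  rewrite linear_sum; apply: eq_bigr => j _; rewrite linearZ; congr (_ *: _).
  have [|g' e' ->] := hs j 0; first by rewrite -sz.
  by rewrite hd; congr (aug _); apply: eq_bigr => k _; rewrite e'.
have [n [p pS]] := fgm_free hL.
have [Z [io [pse hZ]]] : exists (Z : lmodType R) (io : {linear Z -> 'rV[R]_n}),
    ses io p /\ fgm Z.
  exists (Sb (fun v => p v = 0)), (sbi (fun v => p v = 0)); split; first exact: ses_ker.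
  by apply: fgm_sub (noeth_fgm nR (fgm_rV R n)) _; apply: (issub_ker p issub0).
have [t [tc ts]] := ih Z hZ.
pose T (k : Z -> E i) (h : L -> E i.+1) := exists (q : {linear 'rV[R]_n -> E i})
  (h1 : {linear L -> E i.+1}), [/\ cyc h1, h = h1, forall u, q (io u) = k u &
   forall v, h1 (p v) = d i (q v)].
have : forall k, k \in t -> exists h, T k h.
  move=> k /tc[k1 kc ->]; have [q [h [e1 hc e2]]] := ext_conn pse kc.
  by exists h, q, h.
case/span_map_choice => s [sz hs]; exists s; split.
  move=> h /(nthP 0)[k]; rewrite sz => hk <-.
  by have [q [h1 [hc -> _ _]]] := hs k 0 hk; exists h1.
pose P (k : Z -> E i) := exists h, T k h /\ addsub (span s) (@bnd L i.+1) h.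
have hP : issub P.
  have [a0 aD aZ] := issub_add (issub_span s) (issub_bnd L i.+1); split.
  - exists 0; split=> //; exists (\0 : {linear 'rV[R]_n -> E i}), (\0 : {linear L -> E i.+1}).
    by split=> // v; rewrite /= linear0.
  - move=> k k' [h [[q [h1 [hc -> qk hq]]] ha]] [h' [[q' [h1' [hc' -> qk' hq']]] ha']].
    exists ((h1 : L -> E i.+1) + (h1' : L -> E i.+1)); split; last exact: aD.
    exists (q \+ q' : {linear 'rV[R]_n -> E i}), (h1 \+ h1' : {linear L -> E i.+1}).
    split=> // [v|u|v] /=; first by rewrite linearD hc hc' addr0.
      by rewrite qk qk'.
    by rewrite hq hq' linearD.
  - move=> a k [h [[q [h1 [hc -> qk hq]]] ha]].
    exists (a *: (h1 : L -> E i.+1)); split; last exact: aZ.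
    exists (a \*: q : {linear 'rV[R]_n -> E i}), (a \*: h1 : {linear L -> E i.+1}).
    split=> // [v|u|v] /=; first by rewrite linearZ /= hc scaler0.
      by rewrite qk.
    by rewrite hq linearZ.
have Pbnd (k : Z -> E i) : bnd k -> P k.
  move=> /(bnd_extend pse)[q [qb qk]]; exists 0; split.
    exists q, (\0 : {linear L -> E i.+1}); split=> // v /=; first by rewrite linear0.
    by rewrite (bnd_cyc qb).
  by have [] := issub_add (issub_span s) (issub_bnd L i.+1).
have Pspan (k : Z -> E i) : span t k -> P k.
  apply: (span_sub hP) => y /(nthP 0)[j jt <-]; exists s`_j; split; first exact: hs.
  apply: addsubl; first exact: issub_bnd.
  by apply: span_mem; apply: mem_nth; rewrite sz.
move=> h hc; have [|q e] := @van_free i n (lcomp h p); first by move=> v; apply: hc.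
have qc : cyc (lcomp q io).
  by move=> u /=; rewrite -e /= (ses0 u pse) linear0.
have [k hk hb] := ts _ qc.
have : P (lcomp q io).
  rewrite -[X in P X](subrK k); have [_ hD _] := hP; apply: hD; [exact: Pbnd|exact: Pspan].
case=> h' [[q' [h1 [hc' -> qk hq]]] ha].
rewrite -[X in addsub _ _ X](subrK (h1 : L -> E i.+1)).
have [_ aD _] := issub_add (issub_span s) (issub_bnd L i.+1); apply: aD => //.
apply: addsubr; first exact: issub_span.
apply: (@ext_right _ _ _ _ _ pse _ (h \- h1 : {linear L -> E i.+1})
  (q \- q' : {linear 'rV[R]_n -> E i}) (\0 : {linear 'rV[R]_n -> E i})).
- by move=> v; rewrite linear0.
- by move=> v /=; rewrite linearB -e hq.
- apply: (@eq_bnd Z i 0); last by have [] := issub_bnd Z i.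
  by move=> u /=; rewrite qk /= subrr subr0.
Qed.

(** A single element outside of Q annihilates Ext^i(L, R). *)
Definition kill (Q : R -> Prop) i L :=
  exists2 c, ~ Q c & forall h : {linear L -> E i}, cyc h -> bnd (fun v => c *: h v).

Lemma nakayama_ext Q i L : isprime Q -> fgm L ->
  (forall h : {linear L -> E i}, cyc h -> exists2 c, ~ Q c & exists x (k : {linear L -> E i}),
    [/\ Q x, cyc k & bnd (fun v => c *: h v - x *: k v)]) -> kill Q i L.
Proof.
move=> hQ hL hk; have [s [sc ss]] := fgE_fgm i hL.
have fgs : fg (span s) by exists s.
have [|c nc hc] := nakayama hQ (issub_bnd L i) fgs.
  move=> v sv; have [h hc ev] : exists2 h1 : {linear L -> E i}, cyc h1 & v = h1.
    exact: (span_sub (@issub_cocycles L i) sc sv).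
  have [c nc [x [k [hx kc hb]]]] := hk h hc; exists c => //.
  have [k' sk' bk'] := ss k kc; exists (x *: k'); first exact: isum1.
  rewrite ev; apply: eq_bnd (bndD hb (bndZ x bk')) => y.
  change (c *: h y - x *: k y + x *: (k y - k' y) = c *: h y - x *: k' y).
  by rewrite scalerBr addrA subrK.
exists c => // h hh; have [k sk bk] := ss h hh.
apply: eq_bnd (bndD (bndZ c bk) (hc k sk)) => y.
change (c *: (h y - k y) + c *: k y = c *: h y).
by rewrite scalerBr subrK.
Qed.

Lemma kill_loc Q i L : isloc Q -> kill Q i L -> van i L.
Proof.
move=> [_ hU] [c /hU[b e] hk] h /hk/(bndZ b); apply: eq_bnd => v.
by rewrite scalerA e scale1r.
Qed.

Lemma van_kill Q i L : isprime Q -> van i L -> kill Q i L.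
Proof. by move=> [_ n1 _] h; exists 1 => // k /h; apply: eq_bnd => v; rewrite scale1r. Qed.
End InjectiveResolution.

(** * Injective dimension, depth and chains of primes *)

Section Gorenstein.
Variables (R : comNzRingType) (J : injective_resolution R).
Hypothesis nR : noeth R^o.
Local Notation E := (ir_mod J).
Local Notation aug := (ir_aug J).
Local Notation d := (ir_d J).
Implicit Types (L V : lmodType R) (Q I P : R -> Prop).

Definition cyclic I : lmodType R := Qt (I : R^o -> Prop).
Definition one_in I : R^o -> cyclic I := qpi (I : R^o -> Prop).

Lemma fgm_cyclic I : fgm (cyclic I).
Proof. by apply: (fgm_surj (f := qpi (I : R^o -> Prop))) (fgm_ring R); apply: qpi_surj. Qed.

Lemma ses_cyclic I K (a : R) : isidl I -> isidl K -> (forall r, K r <-> I (a * r)) ->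
  exists (f : {linear cyclic K -> cyclic I})
    (g : {linear cyclic I -> cyclic (addsub (I : R^o -> Prop) (span ([:: a] : seq R^o)))}),
  ses f g /\ forall r, f (one_in K r) = a *: one_in I r.
Proof.
move=> hI hK hKI; set I' := addsub _ _.
have hI' : isidl I' by apply: issub_add hI (issub_span _).
have [|r hr|f hf] := @lin_factor R _ _ _ (qpi (K : R^o -> Prop))
    (lcomp (qpi (I : R^o -> Prop)) (scl R^o a)).
- exact: qpi_surj.
- by move/(qpi0 r hK): hr => hr /=; apply/(qpi0 _ hI)/hKI.
have [|r hr|g hg] := @lin_factor R _ _ _ (qpi (I : R^o -> Prop)) (qpi (I' : R^o -> Prop)).
- exact: qpi_surj.
- by move/(qpi0 r hI): hr => hr; apply/(qpi0 _ hI'); apply: addsubl => //; apply: issub_span.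
exists f, g; split; last by move=> r; rewrite [LHS]hf /= linearZ.
split=> [u v e|w|v].
- have : f (u - v) = 0 by rewrite linearB e subrr.
  move: (subr_eq0 u v); have [r <-] := qpi_surj (u - v).
  rewrite hf => h /(qpi0 _ hI)/hKI/(qpi0 _ hK) r0.
  by apply/eqP; rewrite -h r0.
- by have [r <-] := qpi_surj w; exists (qpi (I : R^o -> Prop) r).
- have [r <-] := qpi_surj v; rewrite hg; split.
    move/(qpi0 r hI') => [y hy [b _ /eqP e]].
    exists (qpi (K : R^o -> Prop) b); rewrite hf /=.
    apply/eqP; rewrite -subr_eq0 -linearB; apply/eqP/qpi0 => //.
    move: e; rewrite subr_eq0 => /eqP e; change (I ((r : R) - a * b)).
    have {e} e : (r : R) - y = b * a by exact: e.
    by rewrite mulrC -e subKr.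
  case=> u; have [b <-] := qpi_surj u; rewrite hf /= => /eqP.
  rewrite -subr_eq0 -linearB => /eqP/(qpi0 _ hI) h; apply/(qpi0 _ hI').
  exists (r - a *: b) => //; exists b => //.
  by rewrite subKr -[a *: b]/(a * (b : R)) mulrC subrr.
Qed.

Lemma kill_ann Q i L c : ~ Q c -> (forall x : L, c *: x = 0) -> kill J Q i L.
Proof.
move=> nc h; exists c => // k _; apply: (@eq_bnd _ J L i (fun _ => 0)).
  by move=> v; rewrite -linearZ /= h linear0.
by have [] := issub_bnd J L i.
Qed.

Lemma kill_middle Q i L' L L'' (f : {linear L' -> L}) (g : {linear L -> L''}) :
  isprime Q -> ses f g -> kill J Q i L' -> kill J Q i L'' -> kill J Q i L.
Proof.
move=> hQ fg [c nc hc] [b nb hb]; exists (b * c); first exact: nprimeM.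
move=> h hh; have [||k [kc hk]] := @ext_middle _ J _ _ _ _ _ fg i (c \*: h : {linear L -> E i}).
- by move=> v /=; rewrite linearZ /= hh scaler0.
- by apply: (hc (lcomp h f)) => u; apply: hh.
have h2 := bndD (bndZ b hk) (bnd_comp g (hb k kc)).
by apply: eq_bnd h2 => v /=; rewrite scalerBr subrK scalerA.
Qed.

(** The cokernel of x on Ext^i(L) embeds into Ext^{i+1}(L/xL). If the latter
    vanishes at Q, so does Ext^i(L), by Nakayama's lemma. *)
Lemma kill_step Q i L L'' x (g : {linear L -> L''}) : isprime Q -> Q x ->
  ses (scl L x) g -> fgm L -> kill J Q i.+1 L'' -> kill J Q i L.
Proof.
move=> hQ hx fg hL [c nc hc]; apply: nakayama_ext => // h hh; exists c => //.
have [h1 [k [e1 kc ek]]] := ext_conn fg hh.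
have [||q qc e] := @ext_conn_bnd _ J _ _ _ _ _ fg i (c \*: h1 : {linear L -> E i})
    (c \*: k : {linear L'' -> E i.+1}).
- by move=> v; rewrite /= ek linearZ.
- exact: hc.
exists x, q; split=> //; apply: (@eq_bnd _ J L i (fun _ => 0)).
  move=> v; have -> : c *: h v = q (x *: v) by rewrite -e1; apply/esym/e.
  by rewrite linearZ subrr.
by have [] := issub_bnd J L i.
Qed.

(** Noetherian induction on I. If I is not prime, R/I is an extension of
    R/(I + aR) by R/(I : a), both for larger ideals. If I is a prime strictly
    below Q, an element of Q outside of I is regular on R/I, and kill_step
    climbs one degree. *)
Lemma ext_climb Q : isprime Q -> forall I, isidl I -> forall i,
  ~ kill J Q i (cyclic I) -> exists2 j, (i <= j)%N & ~ kill J Q j (cyclic Q).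
Proof.
move=> hQ; apply: (@noeth_ind R R^o (fun I => forall i,
  ~ kill J Q i (cyclic I) -> exists2 j, (i <= j)%N & ~ kill J Q j (cyclic Q)) nR _).
move=> I hI ih i nk.
have I1 : ~ I 1.
  move=> I1; apply: nk; apply: (@kill_ann _ _ _ 1); first by case: hQ.
  move=> x; have [r <-] := qpi_surj x; rewrite scale1r; apply/qpi0 => //.
  by rewrite -[r]mulr1; apply: idlM.
have big a : ~ I a -> forall j, ~ kill J Q j
    (cyclic (addsub (I : R^o -> Prop) (span ([:: a] : seq R^o)))) ->
    exists2 k, (j <= k)%N & ~ kill J Q k (cyclic Q).
  move=> na j; apply: ih; first by apply: issub_add hI (issub_span _).
    by move=> x; apply: addsubl; apply: issub_span.
  by exists a => //; apply: addsubr => //; apply: span_mem; rewrite inE.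
case: (pselect (forall a b, I (a * b) -> I a \/ I b)) => [prI|]; last first.
  move=> /existsNP[a /existsNP[b /not_implyP[hab /not_orP[na nb]]]].
  have hK : isidl (fun r => I (a * r)).
    have [i0 iD iZ] := hI; split; first by rewrite mulr0.
      by move=> x y hx hy; rewrite mulrDr; apply: iD.
    by move=> c x hx; rewrite -[c *: x]/(c * x) mulrCA; apply: idlM.
  have [f [g [fg _]]] := ses_cyclic hI hK (fun r => iff_refl _).
  case: (pselect (kill J Q i (cyclic (fun r => I (a * r))))) => [k1|nk1]; last first.
    apply: ih nk1; first exact: hK.
      by move=> x hx; apply: idlM.
    by exists b.
  by apply: (big a na) => k2; apply: nk; apply: kill_middle fg k1 k2.
have pI : isprime I by split.
case: (pselect (forall a, I a -> Q a)) => [IQ|]; last first.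
  move=> /existsNP[a /not_implyP[ha na]]; case: nk; apply: (@kill_ann _ _ _ a) => //.
  move=> x; have [r <-] := qpi_surj x; rewrite -linearZ; apply/qpi0 => //.
  by rewrite -[a *: r]/(a * r) mulrC; apply: idlM.
case: (pselect (forall a, Q a -> I a)) => [QI|].
  have e : I = Q by apply/funext => a; apply/propext; split=> [/IQ|/QI].
  by move: nk; rewrite {}e => nk; exists i.
move=> /existsNP[a /not_implyP[ha na]].
have hKI r : I r <-> I (a * r).
  by split=> [|/prI[]//]; apply: idlM.
have [f [g [fg ef]]] := ses_cyclic hI hI hKI.
have fE : f = scl (cyclic I) a :> (cyclic I -> cyclic I).
  by apply/funext => x; have [r <-] := qpi_surj x; rewrite [LHS]ef.
have fg' : ses (scl (cyclic I) a) g.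
  by have [fI gS gf] := fg; split=> //; [rewrite -fE|move=> v; rewrite gf fE].
have [|j hj nj] := big a na i.+1; last by exists j => //; apply: ltnW.
by move=> k2; apply: nk; apply: (kill_step hQ ha fg' (fgm_cyclic _) k2).
Qed.

Lemma ext_climb_strict P Q i : isprime P -> isprime Q -> (forall a, P a -> Q a) ->
  (exists2 a, Q a & ~ P a) -> ~ kill J Q i (cyclic P) ->
  exists2 j, (i < j)%N & ~ kill J Q j (cyclic Q).
Proof.
move=> pP hQ PQ [a ha na] nk; have [hP _ prP] := pP.
have hKP r : P r <-> P (a * r) by split=> [|/prP[]//]; apply: idlM.
have [f [g [fg ef]]] := ses_cyclic hP hP hKP.
have fE : f = scl (cyclic P) a :> (cyclic P -> cyclic P).
  by apply/funext => x; have [r <-] := qpi_surj x; rewrite [LHS]ef.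
have fg' : ses (scl (cyclic P) a) g.
  by have [fI gS gf] := fg; split=> //; [rewrite -fE|move=> v; rewrite gf fE].
have [||j hj nj] := @ext_climb Q hQ (addsub (P : R^o -> Prop) (span ([:: a] : seq R^o))) _ i.+1.
- by apply: issub_add hP (issub_span _).
- by move=> k2; apply: nk; apply: (kill_step hQ ha fg' (fgm_cyclic _) k2).
by exists j.
Qed.

(** Bass: climbing along a chain of n + 1 primes raises the degree n times,
    starting from Hom(R, R) localized at the first prime. *)
Lemma ext_chain n (P : nat -> R -> Prop) : (forall i, (i <= n)%N -> isprime (P i)) ->
  (forall i, (i < n)%N -> (forall a, P i a -> P i.+1 a) /\ exists2 a, P i.+1 a & ~ P i a) ->
  exists2 j, (n <= j)%N & ~ kill J (P n) j (cyclic (P n)).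
Proof.
elim: n => [|n ih] pP hP.
  have p0 := pP 0%N (leqnn _).
  apply: (@ext_climb _ p0 (fun x => x = 0)); first exact: (@issub0 _ R^o).
  move=> [c nc hc].
  have [|x|h hh] := @lin_factor R _ _ _ (qpi (fun x : R^o => x = 0)) aug.
  - exact: qpi_surj.
  - by move/(qpi0 x issub0) => ->; rewrite linear0.
  have : bnd (fun v => c *: h v).
    by apply: hc => v; have [x <-] := qpi_surj v; rewrite hh; apply/ir_ex0; exists x.
  move/(_ (qpi (fun x : R^o => x = 0) 1)); rewrite /= hh -linearZ => e.
  have c0 : c *: (1 : R^o) = 0 by apply: (@ir_augI _ J); rewrite e linear0.
  by apply: nc; move: c0; rewrite -[_ *: _]/(c * 1) mulr1 => ->; have [[]] := p0.
have [| |j hj nj] := ih.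
- by move=> i hi; apply/pP/leqW.
- by move=> i hi; apply/hP/ltnW.
have [h1 h2] := hP n (ltnSn n).
have [|k hk nk] := @ext_climb_strict (P n) (P n.+1) j (pP n (leqnSn _)) (pP _ (leqnn _)) h1 h2.
  by move=> [c nc hc]; apply: nj; exists c => // /h1.
by exists k => //; apply: leq_ltn_trans hj hk.
Qed.

Lemma mulr_linear L (v : L) : linear (fun a : R^o => (a : R) *: v).
Proof. by move=> a x y; rewrite scalerDl -scalerA. Qed.
Definition mulv L (v : L) : {linear R^o -> L} := mklin (mulr_linear v).

Lemma ses_ann L (v : L) : exists f : {linear cyclic (fun a => a *: v = 0) -> L},
  ses f (qpi (span [:: v])) /\ forall r, f (one_in (fun a => a *: v = 0) r) = (r : R) *: v.
Proof.
have hA := isidl_ann v; have hl : issub (span [:: v]) := issub_span _.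
have [|r /(qpi0 r hA)//|f hf] := @lin_factor R _ _ L
    (qpi ((fun a => a *: v = 0) : R^o -> Prop)) (mulv v).
  exact: qpi_surj.
exists f; split; last exact: hf.
split=> [x y e|w|w]; first last.
- rewrite qpi0 //; split=> [[a _ /eqP]|[u ->]].
    by rewrite subr_eq0 => /eqP ->; exists (qpi ((fun a => a *: v = 0) : R^o -> Prop) a); rewrite hf.
  by have [a <-] := qpi_surj u; rewrite hf; exists a; rewrite //= subrr.
- exact: qpi_surj.
have : f (x - y) = 0 by rewrite linearB e subrr.
move: (subr_eq0 x y); have [r <-] := qpi_surj (x - y).
by rewrite hf => h e0; apply/eqP; rewrite -h; apply/eqP/qpi0.
Qed.

Lemma ann_residue m L (v : L) : isloc m -> v <> 0 -> (forall a, m a -> a *: v = 0) ->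
  (fun a => a *: v = 0) = m.
Proof.
move=> [_ um] v0 mv; apply/funext => a; apply/propext; split; last exact: mv.
move=> av; apply: contrapT => /um[b e]; apply: v0.
by rewrite -[v]scale1r -e -scalerA av scaler0.
Qed.

(** A socle element of L embeds the residue field into L. *)
Lemma van_residue m i L (v : L) : isloc m -> v <> 0 -> (forall a, m a -> a *: v = 0) ->
  van J i L -> van J i.+1 (Qt (span [:: v])) -> van J i (cyclic m).
Proof.
move=> lm v0 mv h1 h2; have [f [fg _]] := ses_ann v.
by rewrite (ann_residue lm v0 mv) in f fg; apply: (van_left fg).
Qed.

Lemma van_fgm i : (forall I, isidl I -> van J i (cyclic I)) ->
  forall L, fgm L -> van J i L.
Proof.
move=> hI L [s]; have [n] := ubnP (size s); elim: n L s => // n ih L [|v s] /= sn hs.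
  move=> h _; apply: (@eq_bnd _ J L i (fun _ => 0)).
    by move=> x; rewrite (hs x) linear0.
  by have [] := issub_bnd J L i.
have [f [fg _]] := ses_ann v; apply: (van_middle fg).
  by apply: hI; apply: isidl_ann.
apply: (ih _ (map (qpi (span [:: v])) s)); first by rewrite size_map.
move=> w; have [u <-] := qpi_surj w; have [a _ hu] := hs u.
rewrite -[u](subrK (a *: v)) linearD (_ : qpi _ (a *: v) = 0) ?addr0.
  exact: span_im.
by apply/qpi0; [exact: issub_span|exists a; rewrite //= subrr].
Qed.

Lemma van_ring i : van J i.+1 R^o.
Proof.
have lP : linear (fun a : R^o => \row_(_ < 1) (a : R)).
  by move=> a x y; apply/rowP => k; rewrite !mxE.
have lQ : linear (fun v : 'rV[R]_1 => v 0 0 : R^o) by move=> a x y; rewrite !mxE.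
apply: (@van_retract _ _ _ _ _ (mklin lP) (mklin lQ)); last exact: van_free.
by move=> a /=; rewrite mxE.
Qed.

(** A nonzero element of R/(xs) killed by m embeds the residue field, so that
    Ext^i(R/m) is a quotient of Ext^i(R/(xs)) as long as Ext^{i+1} vanishes;
    the latter group is 0 for i > size xs. Descend from a degree in which
    everything vanishes, using the climbing lemma to reach arbitrary modules. *)
Lemma inj_dim_le_depth (m : R -> Prop) N xs (v : quo xs R^o) : isloc m ->
  (forall i, (N < i)%N -> forall x : E i, x = 0) -> Reg xs R^o ->
  v <> 0 -> (forall a, m a -> a *: v = 0) ->
  forall i L, (size xs < i)%N -> fgm L -> van J i L.
Proof.
move=> lm hN hxs v0 mv; have [pm _] := lm.
have top k : forall i, (size xs < i)%N -> (N < i + k)%N -> forall L, fgm L -> van J i L.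
  elim: k => [|k ih] i hi hk.
    rewrite addn0 in hk; move=> L _ h _; apply: (@eq_bnd _ J L i (fun _ => 0)).
      by move=> x; apply/esym/hN.
    by have [] := issub_bnd J L i.
  have hS j : (i < j)%N -> forall L, fgm L -> van J j L.
    move=> ij; apply: ih; first exact: ltn_trans ij.
    by apply: leq_trans hk _; rewrite addnS -addSn leq_add2r.
  have vk : van J i (cyclic m).
    apply: (van_residue lm v0 mv); last first.
      apply: hS => //; apply: (fgm_surj (f := qpi (span [:: v]))); first exact: qpi_surj.
      exact/fgm_quo/fgm_ring.
    by apply: (van_quo (a := 0%N)) hxs _ _ _ => // -[|j] // _; apply: van_ring.
  apply: van_fgm => I hI; apply: contrapT => nv.
  have [|j ij nj] := @ext_climb m pm I hI i.
    by move=> /(kill_loc lm).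
  apply: nj; apply: van_kill => //; move: ij; rewrite leq_eqVlt => /predU1P[<- //|ij].
  by apply: hS => //; apply: fgm_cyclic.
move=> i L hi hL; apply: (top N.+1) => //.
by rewrite addnS ltnS leq_addl.
Qed.

(** Dividing V by a regular element of m moves the vanishing of Ext one degree
    down, by Nakayama's lemma. *)
Lemma van_depth (m : R -> Prop) t : isloc m ->
  (forall i L, (t < i)%N -> fgm L -> van J i L) ->
  forall xs V i, (forall x, x \in xs -> m x) -> fgm V -> Reg xs V ->
  (t < i + size xs)%N -> van J i V.
Proof.
move=> lm ht; have [pm _] := lm; elim=> [|x xs ih] V i hxs hV /=.
  by rewrite addn0 => _ hi; apply: ht.
move=> [hx hr]; rewrite addnS -addSn => hi.
apply: (kill_loc lm); apply: (kill_step (x := x) pm _ (ses_scl hx) hV).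
  by apply: hxs; rewrite mem_head.
apply: van_kill => //; apply: ih => //; first by move=> y hy; apply: hxs; rewrite inE hy orbT.
by apply: fgm_surj hV; apply: qpi_surj.
Qed.

(** ** The comparison Ext^i(V) -> Ext^{i + n}(V/(x_1, .., x_n)V) *)

(** The connecting map of 0 -> L -> L -> L/xL -> 0 on cocycles *)
Definition conn L i x (h : {linear L -> E i}) (h' : {linear Qt (@mulim R L x) -> E i.+1}) :=
  exists h1 : {linear L -> E i}, (forall u, h1 (x *: u) = h u) /\
    forall v, h' (qpi (@mulim R L x) v) = d i (h1 v).

Fixpoint shft (xs : seq R) i := if xs is _ :: xs' then shft xs' i.+1 else i.

Lemma shftE xs i : shft xs i = (i + size xs)%N.
Proof. by elim: xs i => [|x xs ih] i /=; rewrite ?addn0 // ih addnS addSn. Qed.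

(** The iterated connecting map, as a relation between representing cocycles *)
Fixpoint Theta xs L i : {linear L -> E i} -> {linear quo xs L -> E (shft xs i)} -> Prop :=
  match xs with
  | [::] => fun h h' => bnd (fun v => h' v - h v)
  | x :: xs' => fun h h' => exists h1 : {linear Qt (@mulim R L x) -> E i.+1},
      [/\ cyc h1, conn h h1 & Theta h1 h']
  end.

Lemma Theta_ex xs L i (h : {linear L -> E i}) : Reg xs L -> cyc h ->
  exists2 h' : {linear quo xs L -> E (shft xs i)}, cyc h' & Theta h h'.
Proof.
elim: xs L i h => [|x xs ih] L i h /=.
  move=> _ hh; exists h => //; apply: (@eq_bnd _ J L i (fun _ => 0)).
    by move=> v; rewrite subrr.
  by have [] := issub_bnd J L i.
move=> [hx hr] hh; have [h1 [k [e kc ek]]] := ext_conn (ses_scl hx) hh.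
have [h' hc' ht] := ih _ i.+1 k hr kc; exists h' => //; exists k; split=> //.
by exists h1.
Qed.

(** Each connecting map is onto when Ext^j(L, R) = 0 for j > i. *)
Lemma Theta_surj xs L i (h' : {linear quo xs L -> E (shft xs i)}) : Reg xs L ->
  (forall j, (i < j)%N -> van J j L) -> cyc h' ->
  exists2 h : {linear L -> E i}, cyc h & Theta h h'.
Proof.
elim: xs L i h' => [|x xs ih] L i h' /=.
  move=> _ _ hh; exists h' => //; apply: (@eq_bnd _ J L i (fun _ => 0)).
    by move=> v; rewrite subrr.
  by have [] := issub_bnd J L i.
move=> [hx hr] hv hh.
have [|h1 h1c ht] := ih _ i.+1 h' hr _ hh.
  by case=> // j hj; apply: (van_right (ses_scl hx)); apply: hv => //; apply: ltnW.
have [|q e] := hv i.+1 (ltnSn _) (lcomp h1 (qpi (@mulim R L x))); first by move=> v; apply: h1c.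
exists (lcomp q (scl L x)).
  move=> v /=; rewrite -e /=.
  by rewrite (_ : qpi _ _ = 0) ?linear0 //; apply/qpi0; [exact: issub_mulim|exists v].
by exists h1; split=> //; exists q.
Qed.

Lemma Theta_lin xs L i a (h k : {linear L -> E i}) h' k' :
  Theta h h' -> Theta k k' ->
  @Theta xs L i (a \*: h \+ k : {linear L -> E i}) (a \*: h' \+ k' : {linear _ -> _}).
Proof.
elim: xs L i h k h' k' => [|x xs ih] L i h k h' k' /=.
  move=> /(bndZ a) h1 h2; apply: eq_bnd (bndD h1 h2) => v /=.
  by rewrite scalerBr opprD addrACA.
move=> [h1 [hc [g [e1 e2]] ht]] [k1 [kc [g' [e1' e2']] kt]].
exists (a \*: h1 \+ k1 : {linear _ -> _}); split; last exact: ih.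
  by move=> v /=; rewrite linearP hc kc scaler0 addr0.
exists (a \*: g \+ g' : {linear _ -> _}); split=> u /=; first by rewrite e1 e1'.
by rewrite e2 e2' linearP.
Qed.

Lemma Theta_bnd xs L i (h : {linear L -> E i}) (h' : {linear quo xs L -> E (shft xs i)}) :
  Reg xs L -> Theta h h' -> bnd h -> bnd h'.
Proof.
elim: xs L i h h' => [|x xs ih] L i h h' /=.
  by move=> _ h1 h2; apply: eq_bnd (bndD h1 h2) => v; rewrite subrK.
move=> [hx hr] [h1 [hc [g [e1 e2]] ht]] hb; apply: ih ht _ => //.
apply: (ext_right (ses_scl hx) (q := g) (h := \0 : {linear L -> E i})) => //.
  by move=> v; rewrite linear0.
by apply: eq_bnd hb => u; rewrite /= e1 subr0.
Qed.

Lemma Theta_nat xs L L' i (f : {linear L -> L'}) (f' : {linear quo xs L -> quo xs L'})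
    (h : {linear L' -> E i}) (h' : {linear quo xs L' -> E (shft xs i)}) :
  (forall v, f' (quoP xs L v) = quoP xs L' (f v)) ->
  Theta h h' -> @Theta xs L i (lcomp h f) (lcomp h' f').
Proof.
elim: xs L L' i f f' h h' => [|x xs ih] L L' i f f' h h' /= ef.
  by move=> /(bnd_comp f); apply: eq_bnd => v; rewrite -ef.
move=> [h1 [hc [g [e1 e2]] ht]].
have [f1 e3] := quo_map [:: x] f.
exists (lcomp h1 f1); split.
- by move=> v; apply: hc.
- exists (lcomp g f); split=> [u|v] /=; first by rewrite linearZ e1.
  by have /= -> := e3 v; rewrite e2.
apply: (ih) ht => v; have [u <-] := qpi_surj v.
by rewrite [LHS]ef; have /= -> := e3 u.
Qed.
End Gorenstein.

(** * Krull dimension *)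

Lemma maxnat_in (S : set nat) : S 0%N -> S (maxnat S).
Proof. by move=> S0; rewrite /maxnat; case: xgetP => [n _ []|_]. Qed.

Lemma maxnatE (S : set nat) n : S n -> (forall k, S k -> (k <= n)%N) -> maxnat S = n.
Proof.
move=> hn hk; rewrite /maxnat; case: xgetP => [k _ [Sk mk]|no].
  by apply/eqP; rewrite eqn_leq hk ?mk.
by case: (no n).
Qed.

Section Dimension.
Variable R : comNzRingType.
Implicit Types (P Q : R -> Prop).

Definition prime_chain n (P : nat -> R -> Prop) :=
  (forall i, (i <= n)%N -> isprime (P i)) /\
  forall i, (i < n)%N -> (forall a, P i a -> P i.+1 a) /\ exists2 a, P i.+1 a & ~ P i a.

Lemma isprimeP (P : prime_idealr R) : isprime (fun a => a \in P).
Proof.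
split; first split.
- exact: idealr0.
- by move=> x y hx hy; apply: rpredD.
- by move=> a x hx; apply: idealMr.
- by rewrite idealr1.
- by move=> a b; rewrite prime_idealrM => /orP.
Qed.

Lemma prime_idealr_of P : isprime P -> exists Q : prime_idealr R, forall a, a \in Q <-> P a.
Proof.
move=> [[p0 pD pZ] p1 pM].
pose S : {pred R} := fun a => `[< P a >].
have SI : idealr_closed S.
  split; first exact/asboolP.
    by apply/negP => /asboolP.
  by move=> a x y /asboolP hx /asboolP hy; apply/asboolP/pD => //; apply: (pZ a).
have SP : prime_idealr_closed S.
  by move=> a b /asboolP/pM[h|h]; apply/orP; [left|right]; apply/asboolP.
pose Q : prime_idealr R := HB.pack (S : R -> bool) (isIdealr.Build R S SI)
  (isPrimeIdealrClosed.Build R S SP).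
by exists Q => a; split=> [/asboolP|h]; [|apply/asboolP].
Qed.

Lemma krull_dimE t : (exists P : nat -> _, prime_chain t P) ->
  (forall n (P : nat -> _), prime_chain n P -> (n <= t)%N) -> krull_dim R = t.
Proof.
move=> [P [pP sP]] ht; apply: maxnatE.
  have /choice[Q hQ] : forall i, exists Q : prime_idealr R, (i <= t)%N -> forall a, a \in Q <-> P i a.
    move=> i; case: (leqP i t) => hi.
      by have [Q hQ] := prime_idealr_of (pP i hi); exists Q.
    by have [Q hQ] := prime_idealr_of (pP 0%N isT); exists Q.
  exists Q => i hi; have [h1 [a ha na]] := sP i hi; split.
    by move=> x /(hQ i (ltnW hi))/h1/(hQ _ hi).
  by move=> /(_ a) h; apply/na/(hQ i (ltnW hi))/h/(hQ _ hi).
move=> n [Q hQ]; apply: (ht n (fun i a => a \in Q i)); split=> i hi.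
  exact: isprimeP.
have [h1 h2] := hQ i hi; split=> //.
apply: contrapT => no; apply: h2 => a ha; apply: contrapT => na.
by apply: no; exists a => //; exact/negP.
Qed.

(** A regular sequence on V gives a chain of primes in the support of V: if P
    supports V/xV and s u <> 0 for a lift u and all s outside of P, then also
    s x^n u <> 0, so some prime containing ann(u) and contained in P avoids x. *)
Lemma regular_chain xs (V : lmodType R) P : noeth R^o -> Reg xs V -> isprime P ->
  (exists v : quo xs V, forall s, ~ P s -> s *: v <> 0) ->
  exists Q : nat -> R -> Prop, prime_chain (size xs) Q /\ Q (size xs) = P /\
    exists v : V, forall s, ~ Q 0%N s -> s *: v <> 0.
Proof.
move=> nR; elim: xs V => [|x xs ih] V /=.
  move=> _ pP [v hv]; exists (fun _ => P); split; last by split=> //; exists v.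
  by split=> // i _.
move=> [hx hr] pP /(ih _ hr pP)[Q [[pQ sQ] [QP [v hv]]]].
have [u uv] := qpi_surj v; have p0 := pQ 0%N isT.
have x0 : Q 0%N x.
  apply: contrapT => /hv; apply; rewrite -uv -linearZ; apply/qpi0.
    exact: issub_mulim.
  by exists u.
have su s : ~ Q 0%N s -> s *: u <> 0.
  by move=> /hv ns e; apply: ns; rewrite -uv -linearZ e linear0.
have [|||Q' [pQ' annQ' dQ']] := @prime_avoiding R
    (fun a => exists s n, ~ Q 0%N s /\ a = s * x ^+ n) (fun a => a *: u = 0) nR (isidl_ann u).
- by exists 1, 0%N; rewrite mulr1; split=> //; case: p0.
- move=> a b [s [n [hs ->]]] [s' [n' [hs' ->]]]; exists (s * s'), (n + n')%N.
  by split; [apply: nprimeM|rewrite exprD; ring].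
- move=> a e [s [n [hs ea]]]; apply: (su s hs).
  move: e; rewrite {}ea mulrC; elim: n => [|n ihn]; first by rewrite mul1r.
  by rewrite exprS -mulrA -scalerA => /hx.
exists (fun i => if i is j.+1 then Q j else Q'); split; last first.
  split=> //; exists u => s ns e; apply: ns; exact: annQ'.
split=> [[|i] hi //|[|i] hi]; [exact: pQ| |exact: sQ].
split; last first.
  exists x => // xQ'; apply: (dQ' x) => //; exists 1, 1%N; rewrite mul1r; split=> //.
  by case: p0.
move=> a ha; apply: contrapT => na; apply: (dQ' a ha); exists a, 0%N.
by rewrite mulr1.
Qed.

Lemma quo_ring_supp xs P : isprime P -> (forall x, x \in xs -> P x) ->
  exists v : quo xs R^o, forall s, ~ P s -> s *: v <> 0.
Proof.
move=> [pI _ _] hxs; exists (quoP xs R^o 1) => s ns; rewrite -linearZ => e; apply: ns.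
have: P (s * 1); last by rewrite mulr1.
apply: (quoP_ker (U := (P : R^o -> Prop)) pI) e => x u /hxs hx.
by rewrite -[x *: u]/(x * u) mulrC; apply: idlM.
Qed.

Definition ext_bound (J : injective_resolution R) t :=
  forall i L, (t < i)%N -> fgm L -> van J i L.

Lemma chain_bound J t n (P : nat -> R -> Prop) : noeth R^o -> ext_bound J t -> prime_chain n P -> (n <= t)%N.
Proof.
move=> nR hJ [pP sP]; have [j nj nk] := ext_chain J nR pP sP.
rewrite leqNgt; apply/negP => tn; apply: nk; apply: van_kill; first exact: pP.
by apply: hJ; [apply: leq_trans tn nj|apply: fgm_cyclic].
Qed.

(** The injective dimension bounds the chains of primes (ext_chain). A regular
    sequence that cannot be prolonged leaves a socle element in R/(xs), so the
    injective dimension is at most its length (inj_dim_le_depth); and it gives a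
    chain of primes of the same length (regular_chain). *)
Lemma gorenstein_dim m : noeth R^o -> isloc m -> gorenstein R ->
  exists J t xs, [/\ ext_bound J t, krull_dim R = t, size xs = t,
    forall x, x \in xs -> m x & Reg xs (R^o : lmodType R)].
Proof.
move=> nR lm [E [aug [d [Einj augI ex0 exS [N hN]]]]]; have [pm um] := lm.
pose J := InjRes Einj augI ex0 exS; exists J.
have JN : ext_bound J N.
  move=> i L hi _ h _; apply: (@eq_bnd _ J L i (fun _ => 0)).
    by move=> x; apply/esym/hN.
  by have [] := issub_bnd J L i.
have ub xs : (forall x, x \in xs -> m x) -> Reg xs (R^o : lmodType R) ->
    exists P : nat -> R -> Prop, prime_chain (size xs) P.
  move=> hxs hr; have [P [hP _]] := regular_chain nR hr pm (quo_ring_supp pm hxs).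
  by exists P.
have fgR xs : fgm (quo xs R^o) := fgm_quo xs (fgm_ring R).
have [xs [hxs hr [v [v0 mv]]]] : exists xs, [/\ forall x, x \in xs -> m x,
    Reg xs (R^o : lmodType R) & exists v : quo xs R^o, v <> 0 /\ forall a, m a -> a *: v = 0].
  apply: contrapT => no.
  have long n : exists xs, [/\ size xs = n, forall x, x \in xs -> m x &
      Reg xs (R^o : lmodType R)].
    elim: n => [|n [xs [sz hxs hr]]]; first by exists [::].
    have [im _ _] := pm.
    have [|x hx rx] := @regular_in_coset R (quo xs R^o) m 0 nR (noeth_fgm nR (fgR xs)) im.
      move=> v hv; apply: contrapT => v0; apply: no; exists xs; split=> //.
      by exists v.
    exists (rcons xs x); split; first by rewrite size_rcons sz.
      by move=> y; rewrite mem_rcons inE => /predU1P[->|/hxs].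
    by apply/Reg_rcons; split=> //; rewrite add0r in rx.
  have [xs [sz hxs hr]] := long N.+1; have [P /(chain_bound nR JN)] := ub xs hxs hr.
  by rewrite sz ltnn.
have Jt : ext_bound J (size xs).
  by move=> i L; exact: (@inj_dim_le_depth R J nR m N xs v lm hN hr v0 mv).
exists (size xs), xs; split=> //; apply: krull_dimE; first exact: ub.
by move=> n P; apply: chain_bound nR Jt.
Qed.

(** A prime P above xs is the top of a chain of length size xs; if it were not m,
    the chain could be prolonged by m. *)
Lemma prime_over_sop J m P xs : noeth R^o -> isloc m -> ext_bound J (size xs) ->
  Reg xs (R^o : lmodType R) -> isprime P -> (forall x, x \in xs -> P x) ->
  forall a, m a -> P a.
Proof.
move=> nR lm hJ hr pP hxs a ma; apply: contrapT => na; have [pm _] := lm.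
have [Q [[pQ sQ] [QP _]]] := regular_chain nR hr pP (quo_ring_supp pP hxs).
have : prime_chain (size xs).+1 (fun i => if (i <= size xs)%N then Q i else m).
  split=> i hi; first by case: ifP => // hi'; apply: pQ.
  rewrite ltnS in hi; rewrite hi; case: ltnP => hi'; first exact: sQ.
  have -> : i = size xs by apply/eqP; rewrite eqn_leq hi hi'.
  rewrite QP; split; last by exists a.
  by have [pI p1 _] := pP; move=> x; apply: (proper_le_loc lm).
by move/(chain_bound nR hJ); rewrite ltnn.
Qed.
End Dimension.

(** ** The local ring at a prime *)

Section LocalizedDimension.
Variables (R : comNzRingType) (p : prime_idealr R).
Local Notation S := (locring p).

Lemma ringfrac_split a (s : denom p) : ringfrac a s = ringfrac a (denom1 p) * ringfrac 1 s.
Proof.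
rewrite ringfracM; apply/ringfrac_eq; exists (denom1 p) => /=.
by rewrite !mul1r !mulr1.
Qed.

Lemma ringfrac_cancel a (s : denom p) :
  ringfrac a (denom1 p) = ringfrac a s * ringfrac (denom_val s) (denom1 p).
Proof.
rewrite ringfracM; apply/ringfrac_eq; exists (denom1 p) => /=.
by rewrite !mul1r !mulr1 mulrC.
Qed.

Lemma ringfrac1D (a b : R) :
  ringfrac (a + b) (denom1 p) = ringfrac a (denom1 p) + ringfrac b (denom1 p).
Proof. by rewrite ringfracD; apply/ringfrac_eq; exists (denom1 p) => /=; ring. Qed.

Lemma ringfrac1M (a b : R) :
  ringfrac (a * b) (denom1 p) = ringfrac a (denom1 p) * ringfrac b (denom1 p).
Proof. by rewrite ringfracM; apply/ringfrac_eq; exists (denom1 p) => /=; ring. Qed.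

Definition locmx (x : S) : Prop := num x \in p.

Lemma locmxE a s : locmx (ringfrac a s) <-> a \in p.
Proof.
rewrite /locmx; have [u] := ringfrac_repr a s.
move: (num _) (dnm _) => b t e.
have : (denom_val u * denom_val s * b \in p) = (denom_val u * denom_val t * a \in p) by rewrite e.
by rewrite !prime_idealrM !(negPf (denomP _)) /= => ->.
Qed.

Lemma ringfracP_unit a (s : denom p) : a \notin p -> exists y, y * ringfrac a s = 1.
Proof.
move=> na; exists (ringfrac (denom_val s) (Denom na)); rewrite ringfracM.
by apply/ringfrac_eq; exists (denom1 p) => /=; ring.
Qed.

Lemma isloc_locmx : isloc locmx.
Proof.
split; last first.
  move=> x nx; rewrite -(ringfracK x); apply: ringfracP_unit.
  by apply/negP.
split; first split.
- by apply/(locmxE 0 (denom1 p)); apply: idealr0.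
- move=> x y; rewrite -(ringfracK x) -(ringfracK y) => /locmxE hx /locmxE hy.
  by rewrite ringfracD; apply/locmxE; rewrite rpredD ?idealMr.
- move=> a x; rewrite -(ringfracK x) -(ringfracK a) => /locmxE hx.
  by rewrite -[_ *: _]/(_ * _) ringfracM; apply/locmxE; apply: idealMr.
- by move/(locmxE 1 (denom1 p)); rewrite idealr1.
- move=> x y; rewrite -(ringfracK x) -(ringfracK y) ringfracM => /locmxE.
  by rewrite prime_idealrM => /orP[h|h]; [left|right]; apply/locmxE.
Qed.

Lemma localized_chain : exists P, prime_chain (krull_dim S) P /\
  forall a, P (krull_dim S) a -> a \in p.
Proof.
set c := krull_dim S; have [|Q hQ] := @maxnat_in [set n | exists P : nat -> prime_idealr S,
    forall i, (i < n)%N -> {subset P i <= P i.+1} /\ ~ {subset P i.+1 <= P i}]%classic.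
  by have [Q _] := prime_idealr_of (proj1 isloc_locmx); exists (fun _ => Q).
have up i a (s : denom p) : ringfrac a s \in Q i <-> ringfrac a (denom1 p) \in Q i.
  split=> h; first by rewrite (ringfrac_cancel a s) mulrC; apply: idealMr.
  by rewrite (ringfrac_split a s) mulrC; apply: idealMr.
have sub i a : ringfrac a (denom1 p) \in Q i -> a \in p.
  move=> h; apply/negPn/negP => /(ringfracP_unit (denom1 p))[y e].
  by have := idealr1 (Q i); rewrite -e idealMr.
exists (fun i a => ringfrac a (denom1 p) \in Q i); split; last by move=> a; apply: sub.
split=> i hi; last first.
  have [h1 h2] := hQ i hi; split; first by move=> a; apply: h1.
  apply: contrapT => no; apply: h2 => x; rewrite -(ringfracK x) => /up hx.
  by apply/up; apply: contrapT => nx; apply: no; exists (num x).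
split; first split.
- exact: idealr0.
- by move=> x y hx hy; apply: (eq_ind_r (fun z => z \in Q i) _ (ringfrac1D x y)); apply: rpredD.
- by move=> a x hx; apply: (eq_ind_r (fun z => z \in Q i) _ (ringfrac1M a x)); apply: idealMr.
- by move/sub; rewrite idealr1.
- by move=> a b; rewrite ringfrac1M prime_idealrM => /orP.
Qed.

(** Clearing denominators, generators of the maximal ideal of the local ring
    at p become elements of p that generate p up to elements outside of p. *)
Lemma regular_parameters : regular_local_ring S -> exists zs : seq R,
  [/\ size zs = krull_dim S, forall z, z \in zs -> z \in p &
      forall a, a \in p -> exists2 u, u \notin p & span (zs : seq R^o) (u * a)].
Proof.
move=> [_ [m' [[mm _] [ws [sz mE]]]]].
have [lp lu] := isloc_locmx.
have [Q hQ] := prime_idealr_of lp.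
have m'Q : {subset m' <= Q}.
  move=> x hx; apply/hQ; apply: contrapT => /lu[y e].
  by have := idealr1 m'; rewrite -e idealMr.
have Qm' := mm Q m'Q.
have wm w : w \in ws -> w \in m'.
  by move=> hw; rewrite mE; apply/asboolP => U; apply.
exists (map (@num R p) ws); split; first by rewrite size_map.
  by move=> z /mapP[w /wm/m'Q/hQ hw ->].
move=> a ap.
have : ringfrac a (denom1 p) \in m' by apply/Qm'/hQ/locmxE.
rewrite mE /ideal_gen => h.
have {h} : span (ws : seq S^o) (ringfrac a (denom1 p)).
  move/asboolP: h => h; apply/(mspanP _ (issub_span (ws : seq S^o))); apply: h => y hy.
  by apply/(mspanP _ (issub_span (ws : seq S^o))); apply: span_mem.
pose T (x : S^o) := exists (u b : R), [/\ u \notin p, span (map (@num R p) ws : seq R^o) b &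
   (x : S) * ringfrac u (denom1 p) = ringfrac b (denom1 p)].
have [s0 sD sZ] := issub_span (map (@num R p) ws : seq R^o).
have hT : issub T.
  split.
  - by exists 1, 0; rewrite idealr1 mul0r.
  - move=> x y [u [b [nu hb e]]] [v [b' [nv hb' e']]]; exists (u * v), (v * b + u * b').
    split; first by rewrite prime_idealrM negb_or nu nv.
      by apply: sD; [apply: (sZ v)|apply: (sZ u)].
    rewrite ringfrac1M.
    have -> : (x + y : S) * (ringfrac u (denom1 p) * ringfrac v (denom1 p)) =
       (x * ringfrac u (denom1 p)) * ringfrac v (denom1 p) +
       (y * ringfrac v (denom1 p)) * ringfrac u (denom1 p) by ring.
    rewrite e e' !ringfracM ringfracD; apply/ringfrac_eq; exists (denom1 p) => /=; ring.
  - move=> a' x [u [b [nu hb e]]]; exists (denom_val (dnm a') * u), (num a' * b); split.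
    + by rewrite prime_idealrM negb_or nu denomP.
    + exact: (sZ (num a')).
    rewrite -[a' *: x]/(a' * x).
    rewrite ringfrac1M.
    have -> : a' * x * (ringfrac (denom_val (dnm a')) (denom1 p) * ringfrac u (denom1 p)) =
       (a' * ringfrac (denom_val (dnm a')) (denom1 p)) * (x * ringfrac u (denom1 p)) by ring.
    rewrite -{1}(ringfracK a') -ringfrac_cancel e ringfracM.
    by apply/ringfrac_eq; exists (denom1 p) => /=; ring.
move/(span_sub hT) => [].
  move=> w hw; exists (denom_val (dnm w)), (num w); split; first exact: denomP.
    by apply: span_mem; apply: map_f.
  by rewrite -{1}(ringfracK w) -ringfrac_cancel.
move=> u [b [nu hb]]; rewrite ringfracM => /ringfrac_eq[v /=].
rewrite !mulr1 => e; exists (denom_val v * u).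
  by rewrite prime_idealrM negb_or nu denomP.
by rewrite -mulrA (mulrC u) e; apply: (sZ (denom_val v)).
Qed.
End LocalizedDimension.

(** * Extensions computed from a free resolution *)

Lemma fgm_ffun (R : nzRingType) (M : lmodType R) r : fgm M -> fgm {ffun 'I_r -> M}.
Proof.
move=> [s hs].
have dl k : linear (fun v : M => [ffun j : 'I_r => if j == k then v else 0]).
  move=> a u v; apply/ffunP => j; rewrite !ffunE; case: eqP => // _.
  by rewrite scaler0 addr0.
pose del k : {linear M -> {ffun 'I_r -> M}} := mklin (dl k).
exists [seq del k v | k <- enum 'I_r, v <- s] => z.
have -> : z = \sum_k del k (z k).
  apply/ffunP => j; rewrite sum_ffunE (bigD1 j) //= big1 ?addr0 ?ffunE ?eqxx //.
  by move=> k kj; rewrite ffunE eq_sym (negPf kj).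
apply: issub_sum => [|k _]; first exact: issub_span.
apply: (span_mono (s := map (del k) s)); last exact: span_im.
by move=> x /mapP[v hv ->]; apply/allpairsP; exists (k, v); rewrite mem_enum.
Qed.

Section MatrixAction.
Variables (R : comNzRingType) (M : lmodType R).

Definition mact a b (T : 'M[R]_(a, b)) (z : {ffun 'I_b -> M}) : {ffun 'I_a -> M} :=
  [ffun j => \sum_k T j k *: z k].

Lemma mact_mul a b c (T : 'M[R]_(a, b)) (S : 'M[R]_(b, c)) z :
  mact (T *m S) z = mact T (mact S z).
Proof.
apply/ffunP => i; rewrite !ffunE; under [RHS]eq_bigr do rewrite ffunE scaler_sumr.
rewrite exchange_big; apply: eq_bigr => k _; rewrite mxE scaler_suml.
by apply: eq_bigr => j _; rewrite scalerA.
Qed.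

Lemma mact_scalar a (x : R) (z : {ffun 'I_a -> M}) : mact x%:M z = x *: z.
Proof.
apply/ffunP => i; rewrite !ffunE (bigD1 i) //= mxE eqxx mulr1n big1 ?addr0 // => j ji.
by rewrite mxE eq_sym (negPf ji) mulr0n scale0r.
Qed.

Lemma mactD a b (T S : 'M[R]_(a, b)) z : mact (T + S) z = mact T z + mact S z.
Proof.
apply/ffunP => i; rewrite !ffunE -big_split; apply: eq_bigr => j _.
by rewrite mxE scalerDl.
Qed.

Lemma mact0 a b (T : 'M[R]_(a, b)) : mact T 0 = 0.
Proof. by apply/ffunP => i; rewrite !ffunE big1 // => j _; rewrite ffunE scaler0. Qed.
End MatrixAction.

Section FreeExt.
Variables (R : comNzRingType) (N : lmodType R) (F : free_resolution N).
Implicit Types M X Y : lmodType R.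
Local Notation D := (fr_diff F).
Local Notation "'C' i" := (fun M => cochain F M i) (at level 8, i at level 2, only parsing).
Local Notation dd M i := (codiff F M i).

Definition ccl M i (z : cochain F M i) := codiff F M i z = 0.

Definition cob M i (z : cochain F M i) := coboundary z.

Lemma codiffE M i (z : cochain F M i) : codiff F M i z = mact (D i) z.
Proof. by []. Qed.

Lemma diff_diff i : D i.+1 *m D i = 0.
Proof.
apply/row_matrixP => j; rewrite row_mul row0.
by apply/fr_exactS; exists (delta_mx 0 j); rewrite -rowE.
Qed.

Lemma codiff2 M i (z : cochain F M i) : codiff F M i.+1 (codiff F M i z) = 0.
Proof.
rewrite !codiffE -mact_mul diff_diff; apply/ffunP => j; rewrite !ffunE big1 // => k _.
by rewrite mxE scale0r.
Qed.

Lemma issub_ccl M i : issub (@ccl M i).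
Proof. exact: (issub_ker (codiff F M i) issub0). Qed.

Lemma issub_cob M i : issub (@cob M i).
Proof.
case: i => [|i]; first exact: issub0; rewrite /cob /=.
have [h0 hD hZ] := issub_im (codiff F M i) issubT.
split; first by have [y _ e] := h0; exists y.
  move=> x y [x' hx] [y' hy]; have [z _ e] := hD x y (ex_intro2 _ _ x' I hx) (ex_intro2 _ _ y' I hy).
  by exists z.
by move=> a x [x' hx]; have [z _ e] := hZ a x (ex_intro2 _ _ x' I hx); exists z.
Qed.

Lemma cob_ccl M i (z : cochain F M i) : cob z -> ccl z.
Proof.
case: i z => [|i] z; rewrite /cob /ccl /=; first by move=> ->; rewrite linear0.
by case=> y ->; rewrite codiff2.
Qed.

Local Notation fm f := (cochain_map F f).

Lemma fm_linear M M' (f : {linear M -> M'}) i : linear (@cochain_map R N F M M' f i).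
Proof. exact: cochain_map_linear. Qed.
Definition fml M M' (f : {linear M -> M'}) i : {linear cochain F M i -> cochain F M' i} :=
  mklin (@fm_linear M M' f i).
Arguments fml : simpl never.

Lemma fml_codiff M M' (f : {linear M -> M'}) i (z : cochain F M i) :
  codiff F M' i (fml f i z) = fml f i.+1 (codiff F M i z).
Proof. exact: cochain_map_codiff. Qed.

Lemma fml_ccl M M' (f : {linear M -> M'}) i (z : cochain F M i) : ccl z -> ccl (fml f i z).
Proof. by rewrite /ccl fml_codiff => ->; rewrite linear0. Qed.

Lemma fml_cob M M' (f : {linear M -> M'}) i (z : cochain F M i) : cob z -> cob (fml f i z).
Proof. exact: coboundary_map. Qed.

Lemma fml_comp M M' M'' (f : {linear M -> M'}) (g : {linear M' -> M''}) (h : {linear M -> M''})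
  i z : (forall v, h v = g (f v)) -> fml g i (fml f i z) = fml h i z.
Proof. by move=> e; apply/ffunP => k; rewrite !ffunE e. Qed.

(** Multiplication by an element that kills N is homotopic to zero on F. *)
Lemma ann_cob a M i (z : cochain F M i) : (forall x : N, a *: x = 0) -> ccl z -> cob (a *: z).
Proof.
move=> aN.
have rowlift k j (T : 'M[R]_(k, fr_rank F j.+1)) : T *m D j = 0 ->
    exists S, T = S *m D j.+1.
  move=> h; have /choice[w hw] : forall r, exists w : 'rV[R]_(fr_rank F j.+2), row r T = w *m D j.+1.
    by move=> r; apply/fr_exactS; rewrite -row_mul h row0.
  exists (\matrix_r w r); apply/row_matrixP => r; by rewrite row_mul rowK hw.
have hom : forall j, exists S : 'M[R]_(fr_rank F j, fr_rank F j.+1),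
    match j return 'M[R]_(fr_rank F j, fr_rank F j.+1) -> Prop with
    | 0 => fun S => S *m D 0 = a%:M
    | j'.+1 => fun S => exists S' : 'M[R]_(fr_rank F j', fr_rank F j'.+1),
       S *m D j'.+1 + D j' *m S' = a%:M
    end S.
  elim=> [|j [S hS]].
    have hex (r : 'I_(fr_rank F 0)) : exists w, a *: (delta_mx 0 r : 'rV[R]_(fr_rank F 0)) = w *m D 0.
      by apply/fr_exact0; rewrite linearZ /= aN.
    have [w hw] := choice hex.
    exists (\matrix_r w r); apply/row_matrixP => r; rewrite row_mul rowK -hw.
    by rewrite -scalemx1 linearZ /= row1.
  have [|S1 hS1] := @rowlift _ j (a%:M - D j *m S).
    rewrite mulmxBl mul_scalar_mx -mulmxA; case: j S hS => [|j] S.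
      by move=> ->; rewrite mul_mx_scalar subrr.
    case=> S' e; have -> : S *m D j.+1 = a%:M - D j *m S' by rewrite -e addrK.
    by rewrite mulmxBr mulmxA diff_diff mul0mx subr0 mul_mx_scalar subrr.
  by exists S1, S; rewrite -hS1 subrK.
case: i z => [|i] z zc.
  have [S hS] := hom 0%N.
  by rewrite /cob /= -mact_scalar -hS mact_mul -codiffE zc mact0.
have [S [S' e]] := hom i.+1; exists (mact S' z).
rewrite -mact_scalar -e mactD !mact_mul -codiffE zc mact0 add0r.
by rewrite codiffE.
Qed.

Definition Fvan i M := forall z : cochain F M i, ccl z -> cob z.

Section Exact.
Variables (M' M M'' : lmodType R) (f : {linear M' -> M}) (g : {linear M -> M''}).
Hypothesis fg : ses f g.

Lemma fml_inj i : injective (fml f i).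
Proof.
have [fI _ _] := fg; move=> u v /ffunP e; apply/ffunP => k; apply: fI.
by have := e k; rewrite !ffunE.
Qed.

Lemma fml_surj i z : exists y, fml g i y = z.
Proof.
have [_ gS _] := fg; have /choice[y hy] : forall k, exists v, g v = z k by move=> k; apply: gS.
by exists [ffun k => y k]; apply/ffunP => k; rewrite !ffunE.
Qed.

Lemma fml_exact i z : fml g i z = 0 -> exists y, z = fml f i y.
Proof.
have [_ _ gf] := fg; move=> /ffunP e.
have /choice[y hy] : forall k, exists u, z k = f u.
  by move=> k; apply/gf; have := e k; rewrite !ffunE.
by exists [ffun k => y k]; apply/ffunP => k; rewrite !ffunE.
Qed.

Lemma fml_zero i y : fml g i (fml f i y) = 0.
Proof. by apply/ffunP => k; rewrite !ffunE (ses0 _ fg). Qed.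

Lemma Fext_middle i (z : cochain F M i) : ccl z -> cob (fml g i z) ->
  exists2 y, ccl y & cob (z - fml f i y).
Proof.
move=> zc hz.
have [b [bb hb]] : exists b : cochain F M i, cob b /\ fml g i z = fml g i b.
  case: i z zc hz => [|i] z _ hz; first by exists 0; rewrite hz linear0.
  have [y e] := hz; have [x hx] := fml_surj y.
  by exists (codiff F M i x); rewrite -fml_codiff hx; split=> //; exists x.
have [|y hy] := @fml_exact i (z - b); first by rewrite linearB hb subrr.
exists y; last by rewrite -hy subKr.
by apply: (@fml_inj i.+1); rewrite -fml_codiff -hy linearB zc (cob_ccl bb) subr0 linear0.
Qed.

Lemma Fext_conn i (z : cochain F M'' i) : ccl z ->
  exists u y, [/\ fml g i u = z, ccl y & codiff F M i u = fml f i.+1 y].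
Proof.
move=> zc; have [u hu] := fml_surj z.
have [|y hy] := @fml_exact i.+1 (codiff F M i u); first by rewrite -fml_codiff hu zc.
exists u, y; split=> //; apply: (@fml_inj i.+2).
by rewrite -fml_codiff -hy codiff2 linear0.
Qed.

Lemma Fext_conn_cob i (u : cochain F M i) y : codiff F M i u = fml f i.+1 y -> cob y ->
  exists2 x, ccl x & fml g i x = fml g i u.
Proof.
move=> e [w ew]; exists (u - fml f i w).
  by rewrite /ccl linearB e ew -fml_codiff subrr.
by rewrite linearB fml_zero subr0.
Qed.

Lemma Fext_right i (u : cochain F M i) y : codiff F M i u = fml f i.+1 y ->
  cob (fml g i u) -> cob y.
Proof.
move=> e hu.
have [b [bb hb]] : exists b : cochain F M i, cob b /\ fml g i u = fml g i b.
  case: i u y e hu => [|i] u y _ hu; first by exists 0; rewrite hu linear0.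
  have [x ex] := hu; have [v hv] := fml_surj x.
  by exists (codiff F M i v); rewrite -fml_codiff hv; split=> //; exists v.
have [|w hw] := @fml_exact i (u - b); first by rewrite linearB hb subrr.
exists w; apply: (@fml_inj i.+1).
by rewrite -fml_codiff -hw linearB (cob_ccl bb) subr0.
Qed.
End Exact.

Lemma fml_scl M x i (z : cochain F M i) : fml (scl M x) i z = x *: z.
Proof. by apply/ffunP => k; rewrite !ffunE. Qed.

(** ** Comparison with the injective resolution *)

(** Dimension shifting along F turns Ext^{i+1}(N, R) = 0, as computed from the
    injective resolution, into Ext^1(T, R) = 0 for the i-th syzygy T. So forms on
    the next syzygy extend to the free module that contains it, which says that
    cocycles of Hom(F, R) in degree i + 1 are coboundaries. *)
Lemma Fvan_of_van (J : injective_resolution R) i : van J i.+1 N -> Fvan i.+1 R^o.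
Proof.
move=> hv.
have [T [q [qS qk hT]]] : exists (T : lmodType R) (q : {linear 'rV[R]_(fr_rank F i) -> T}),
    [/\ forall w, exists v, q v = w, forall v, q v = 0 <-> exists w, v = w *m D i &
     forall k, van J (k.+1 + i) N -> van J k.+1 T].
  elim: (i) => [|j [T [q [qS qk hT]]]].
    exists N, (fr_aug F); split=> [w|v|k]; [exact: fr_aug_surj|exact: fr_exact0|].
    by rewrite addn0.
  have pse := ses_ker qS.
  have lP : linear (fun w : 'rV[R]_(fr_rank F j.+1) => w *m D j).
    by move=> a u v; rewrite mulmxDl scalemxAl.
  have [|q' hq'] := @lin_lift R _ _ _ (sbi (fun v => q v = 0)) (mklin lP) (@sbi_inj _ _ _).
    move=> w; apply/sbiP; first exact: (issub_ker q issub0).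
    by apply/qk; exists w.
  exists (Sb (fun v => q v = 0)), q'; split=> [x|v|k hk].
  - have /qk[w e] : q (sbi (fun v => q v = 0) x) = 0 by apply: (sbi_mem _ (issub_ker q issub0)).
    by exists w; apply: (@sbi_inj _ _ (fun v => q v = 0)); rewrite hq' /= -e.
  - rewrite -fr_exactS; split=> [e|e].
      by have := hq' v; rewrite e linear0.
    by apply: (@sbi_inj _ _ (fun v => q v = 0)); rewrite hq' linear0.
  - apply: (van_left pse); first exact: van_free.
    by apply: hT; rewrite addSn -addnS.
move=> z zc; have [h hh] := @rV_linear R R^o _ (fun k => z k : R^o).
have pse := ses_ker qS; set K := (fun v => q v = 0) in pse.
have lP : linear (fun w : 'rV[R]_(fr_rank F i.+1) => w *m D i).
  by move=> a u v; rewrite mulmxDl scalemxAl.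
have [|q' hq'] := @lin_lift R _ _ _ (sbi K) (mklin lP) (@sbi_inj _ _ _).
  move=> w; apply/sbiP; first exact: (issub_ker q issub0).
  by apply/qk; exists w.
have q'S x : exists w, q' w = x.
  have /qk[w e] : q (sbi K x) = 0 by apply: (sbi_mem _ (issub_ker q issub0)).
  by exists w; apply: (@sbi_inj _ _ K); rewrite hq' /= -e.
have [|h' hh'] := @lin_factor R _ _ _ q' h q'S.
  move=> v e; have : v *m D i = 0 by have := hq' v; rewrite e linear0.
  move/fr_exactS => [w ->]; rewrite hh.
  transitivity (\sum_j w 0 j *: codiff F R^o i.+1 z j); last first.
    by rewrite big1 // => j _; rewrite zc ffunE scaler0.
  under [RHS]eq_bigr do rewrite ffunE scaler_sumr.
  rewrite exchange_big; apply: eq_bigr => k _; rewrite mxE scaler_suml.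
  by apply: eq_bigr => j _; rewrite scalerA.
have [||g gc eg] := @van_extend R J _ _ _ _ _ pse 0 (lcomp (ir_aug J) h').
- by apply: hT; rewrite add1n.
- by move=> v; apply/ir_ex0; eexists.
have [|g' eg'] := @lin_lift R _ _ _ (ir_aug J) g (@ir_augI _ J).
  by move=> v; apply/ir_ex0.
exists [ffun k => g' (delta_mx 0 k)]; apply/ffunP => j; rewrite !ffunE.
have -> : z j = h (delta_mx 0 j).
  rewrite hh (bigD1 j) //= big1 => [|k kj]; last by rewrite mxE eqxx (negPf kj) scale0r.
  by rewrite mxE !eqxx scale1r addr0.
rewrite -hh'; apply: (@ir_augI _ J).
have -> : ir_aug J (h' (q' (delta_mx 0 j))) = g (sbi K (q' (delta_mx 0 j))) by rewrite eg.
rewrite hq' -eg' /= -rowE [row j _ in LHS]row_sum_delta linear_sum; congr (ir_aug J _).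
by apply: eq_bigr => k _; rewrite linearZ ffunE mxE.
Qed.
End FreeExt.

(** * Depth and extensions of a quotient that is a discrete valuation ring *)

(** R/p is a discrete valuation ring in which the class of w is a uniformizer. *)
Record dvr_quotient (R : comNzRingType) (m p : R -> Prop) (w : R) : Prop := DvrQuotient {
  dq_loc : isloc m;
  dq_prime : isprime p;
  dq_sub : forall a, p a -> m a;
  dq_unif : m w;
  dq_nunif : ~ p w;
  dq_max : forall a, m a -> exists b, p (a - b * w);
  dq_val : forall a, ~ p a -> exists n u, ~ m u /\ p (a - u * w ^+ n) }.

Section DvrQuotient.
Arguments fml : simpl never.
Variables (R : comNzRingType) (m p : R -> Prop) (w : R).
Hypotheses (nR : noeth R^o) (dq : dvr_quotient m p w).
Variables (N : lmodType R) (F : free_resolution N).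
Hypothesis pN : forall a, p a -> forall x : N, a *: x = 0.
Implicit Types M X Y : lmodType R.

Lemma p_cob a X i (z : cochain F X i) : p a -> ccl z -> cob (a *: z).
Proof. by move=> pa; apply: ann_cob; apply: pN. Qed.

Lemma cclZ X i a (z : cochain F X i) : ccl z -> ccl (a *: z).
Proof. by have [_ _ hZ] := issub_ccl F X i; apply: hZ. Qed.
Lemma cclB X i (y z : cochain F X i) : ccl y -> ccl z -> ccl (y - z).
Proof. exact: issubB (issub_ccl F X i). Qed.
Lemma cobZ X i a (z : cochain F X i) : cob z -> cob (a *: z).
Proof. by have [_ _ hZ] := issub_cob F X i; apply: hZ. Qed.
Lemma cobB X i (y z : cochain F X i) : cob y -> cob z -> cob (y - z).
Proof. exact: issubB (issub_cob F X i). Qed.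
Lemma cobD X i (y z : cochain F X i) : cob y -> cob z -> cob (y + z).
Proof. by have [_ hD _] := issub_cob F X i; apply: hD. Qed.

Lemma cob_unit X i a (z : cochain F X i) : ~ m a -> cob (a *: z) -> cob z.
Proof.
have [[_ um] _ _ _ _ _ _] := dq; move=> /um[b e] /(cobZ b).
by rewrite scalerA e scale1r.
Qed.

Lemma m_cob X i (z : cochain F X i) : ccl z -> cob (w *: z) -> forall a, m a -> cob (a *: z).
Proof.
move=> zc hz a /(dq_max dq)[b hb]; rewrite -[a](subrK (b * w)) scalerDl -scalerA.
by apply: cobD (cobZ _ hz); apply: p_cob.
Qed.

Lemma fgm_qt X (P : X -> Prop) : fgm X -> fgm (Qt P).
Proof. by apply: fgm_surj; apply: qpi_surj. Qed.

Lemma fg_ccl X i : fgm X -> fg (@ccl R N F X i).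
Proof.
by move=> hX; apply: (noeth_fgm nR (fgm_ffun _ hX)); apply: issub_ccl.
Qed.

(** What depth at least n + 1 of X implies for N = R/p: the groups Ext^i(N, X)
    vanish for i < n, and Ext^n(N, X) has no socle. *)
Definition Dp n X := (forall i, (i < n)%N -> Fvan F i X) /\
  forall z : cochain F X n, ccl z -> (forall a, m a -> cob (a *: z)) -> cob z.

Lemma Fvan_nakayama X i x : m x -> reg_on X x -> fgm X ->
  (forall z : cochain F X i, ccl z -> cob (fml F (qpi (@mulim R X x)) i z)) -> Fvan F i X.
Proof.
move=> mx hx hX h z zc; move: z zc.
apply: (nakayama_loc (dq_loc dq) (issub_cob F X i) (fg_ccl i hX)) => z zc.
have [y yc hy] := Fext_middle (ses_scl hx) zc (h z zc).
by exists (x *: y); [apply: isum1|rewrite -fml_scl].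
Qed.

(** A regular sequence in m of length n + 1 on X forces Dp n X, wherever its
    elements lie. An element in p annihilates the Ext groups; an element outside
    of p is a unit times a power of w modulo p, and the descent on that power
    uses that the quotient has no socle. *)
Lemma depth_Dp x0 xs X : fgm X -> (forall x, x \in x0 :: xs -> m x) ->
  Reg (x0 :: xs) X -> Dp (size xs) X.
Proof.
have [lm pp pm mw npw gm val] := dq.
elim: xs x0 X => [|x1 xs ih] x0 X hX mxs [hx0 hr].
  split=> // z zc hz; have := hz x0 (mxs _ (mem_head _ _)); rewrite /cob /= => /ffunP e.
  by apply/ffunP => k; rewrite ffunE; apply: hx0; have := e k; rewrite !ffunE.
set X1 := Qt (@mulim R X x0) in hr.
have mx0 := mxs _ (mem_head _ _).
have fg := ses_scl hx0.
have [|h1 h2] := ih x1 X1 (fgm_qt _ hX) _ hr.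
  by move=> x hx; apply: mxs; rewrite inE hx orbT.
have vn : Fvan F (size xs) X.
  case: (pselect (p x0)) => [px0|nx0].
    move=> z zc; have x0z := p_cob px0 zc.
    case: (size xs) z zc x0z h1 => [|j] z zc x0z h1.
      move: x0z; rewrite /cob /= => /ffunP e; apply/ffunP => k; rewrite ffunE; apply: hx0.
      by have := e k; rewrite !ffunE.
    have [u hu] := x0z; have e : codiff F X j u = fml F (scl X x0) j.+1 z by rewrite fml_scl.
    apply: (Fext_right fg e); apply: (h1 j (ltnSn j)).
    by rewrite /ccl fml_codiff e (fml_zero fg).
  have [k [u [nu hu]]] := val _ nx0.
  apply: (Fvan_nakayama mx0 hx0 hX) => z zc.
  have st j : cob (fml F (qpi (@mulim R X x0)) (size xs) (w ^+ j.+1 *: z)) ->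
      cob (fml F (qpi (@mulim R X x0)) (size xs) (w ^+ j *: z)).
    move=> hj; apply: h2; first by apply/fml_ccl/cclZ.
    apply: m_cob; first by apply/fml_ccl/cclZ.
    by rewrite -linearZ scalerA -exprS.
  have : cob (fml F (qpi (@mulim R X x0)) (size xs) (w ^+ k *: z)).
    apply: (cob_unit nu); rewrite -linearZ scalerA.
    have -> : u * w ^+ k = x0 - (x0 - u * w ^+ k) by rewrite subKr.
    rewrite scalerBl linearB; apply: cobB; last by apply/fml_cob/p_cob.
    rewrite -fml_scl (fml_zero fg); by have [] := issub_cob F X1 (size xs).
  elim: k {hu} => [|k ihk]; first by rewrite expr0 scale1r.
  by move=> /st.
split=> [i|z zc hz].
  rewrite ltnS leq_eqVlt => /predU1P[->//|hi].
  by apply: (Fvan_nakayama mx0 hx0 hX) => z zc; apply: (h1 i hi); apply: fml_ccl.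
have [u hu] := hz x0 mx0; have e : codiff F X (size xs) u = fml F (scl X x0) _ z.
  by rewrite fml_scl.
apply: (Fext_right fg e); apply: h2.
  by rewrite /ccl fml_codiff e (fml_zero fg).
move=> a ma; have [y hy] := hz a ma.
have : ccl (a *: u - x0 *: y).
  by rewrite /ccl linearB !linearZ /= -hu -hy scalerN !scalerA mulrC subrr.
move=> /vn/(fml_cob (qpi (@mulim R X x0))).
by rewrite linearB linearZ -(fml_scl x0 y) (fml_zero fg) subr0.
Qed.

Lemma Fvan_quo X i y : reg_on X y -> Fvan F i X -> Fvan F i.+1 X ->
  Fvan F i (Qt (@mulim R X y)).
Proof.
move=> hy h1 h2 z zc; have [u [z' [<- zc' e]]] := Fext_conn (ses_scl hy) zc.
have [x xc <-] := Fext_conn_cob (ses_scl hy) e (h2 z' zc').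
by apply/fml_cob/h1.
Qed.

Lemma Dp_quo X n y : reg_on X y -> Dp n.+1 X -> Dp n (Qt (@mulim R X y)).
Proof.
move=> hy [h1 h2]; split=> [i hi|z zc hz].
  by apply: Fvan_quo => //; apply: h1; rewrite ?ltnS // ltnW.
have [u [z' [uz zc' e]]] := Fext_conn (ses_scl hy) zc.
have bz' : cob z'.
  apply: h2 => // a ma; apply: (Fext_right (ses_scl hy) (u := a *: u)).
    by rewrite linearZ /= e -linearZ.
  by rewrite linearZ uz; apply: hz.
rewrite -uz; have [x xc <-] := Fext_conn_cob (ses_scl hy) e bz'.
by apply/fml_cob/h1.
Qed.

Lemma Dp_retract X Y n (f : {linear X -> Y}) (g : {linear Y -> X}) :
  (forall v, g (f v) = v) -> Dp n Y -> Dp n X.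
Proof.
move=> gf; have gfE i z : fml F g i (fml F f i z) = z.
  by apply/ffunP => k; rewrite !ffunE gf.
move=> [h1 h2]; split=> [i hi z zc|z zc hz].
  by rewrite -(gfE _ z); apply/fml_cob/(h1 i hi)/fml_ccl.
rewrite -(gfE _ z); apply/fml_cob/h2; first exact: fml_ccl.
by move=> a /hz/(fml_cob f); rewrite linearZ.
Qed.

Lemma Dp_prod X Y n : Dp n X -> Dp n Y -> Dp n (X * Y)%type.
Proof.
pose p1 := projl X Y; pose p2 := projr X Y; pose i1 := injl X Y; pose i2 := injr X Y.
have e i (z : cochain F (X * Y)%type i) : z = fml F i1 i (fml F p1 i z) + fml F i2 i (fml F p2 i z).
  apply/ffunP => k; rewrite !ffunE /=; case: (z k) => a b.
  by apply/eqP; rewrite xpair_eqE /= addr0 add0r !eqxx.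
move=> [h1 h2] [h1' h2']; split=> [i hi z zc|z zc hz]; rewrite (e _ z); apply: cobD.
- by apply/fml_cob/(h1 i hi)/fml_ccl.
- by apply/fml_cob/(h1' i hi)/fml_ccl.
- apply/fml_cob/h2; [exact: fml_ccl|by move=> a /hz/(fml_cob p1); rewrite linearZ].
- apply/fml_cob/h2'; [exact: fml_ccl|by move=> a /hz/(fml_cob p2); rewrite linearZ].
Qed.

(** An element outside of p is a unit times a power of w modulo p, and w acts
    injectively on a module over R/p without socle. *)
Lemma Dp_torsion_free X n a (z : cochain F X n) : Dp n X -> ~ p a -> ccl z ->
  cob (a *: z) -> cob z.
Proof.
move=> [_ h2] /(dq_val dq)[k [u [nu hu]]] zc hz.
have {hz} : cob (w ^+ k *: z).
  apply: (cob_unit nu); rewrite scalerA -[u * _](subKr a) scalerBl.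
  by apply: cobB => //; apply: p_cob.
elim: k {hu} => [|k ih]; first by rewrite expr0 scale1r.
rewrite exprS -scalerA => hz; apply: ih; apply: h2; first exact: cclZ.
by apply: m_cob => //; apply: cclZ.
Qed.

(** ** Cocycles of degree 0 *)

Hypothesis Ncyc : exists e : N, (forall x, exists a, x = a *: e) /\ forall a, a *: e = 0 -> p a.

(** Hom(N, X) consists of the elements of X killed by p, as N is cyclic: al is
    the list of coefficients of the augmentation of F, and be expresses the
    generator of N through F. *)
Lemma degree0 : exists (al be : 'I_(fr_rank F 0) -> R),
  forall X, [/\ forall v : X, (forall a, p a -> a *: v = 0) ->
                  ccl ([ffun k => al k *: v] : cochain F X 0),
    forall v : X, (forall a, p a -> a *: v = 0) -> \sum_k (be k * al k) *: v = v &
    forall z : cochain F X 0, ccl z ->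
      (forall a, p a -> a *: \sum_k be k *: z k = 0) /\
      z = [ffun k => al k *: \sum_k be k *: z k]].
Proof.
have [e [eS eK]] := Ncyc.
have hex (k : 'I_(fr_rank F 0)) : exists a, fr_aug F (delta_mx 0 k) = a *: e by [].
have [al hal] := choice hex; have [b hb] := fr_aug_surj F e.
pose be k := b 0 k; exists al, be => X.
have augE v : fr_aug F v = (\sum_k v 0 k * al k) *: e.
  rewrite [v in LHS]row_sum_delta linear_sum scaler_suml; apply: eq_bigr => k _.
  by rewrite linearZ /= hal scalerA.
have ker0 (z : cochain F X 0) v : ccl z -> fr_aug F v = 0 -> \sum_k v 0 k *: z k = 0.
  move=> zc /fr_exact0[u ->].
  transitivity (\sum_j u 0 j *: codiff F X 0 z j); last first.
    by rewrite big1 // => j _; rewrite zc ffunE scaler0.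
  under [RHS]eq_bigr do rewrite ffunE scaler_sumr.
  rewrite exchange_big; apply: eq_bigr => k _; rewrite mxE scaler_suml.
  by apply: eq_bigr => j _; rewrite scalerA.
split.
- move=> v pv; apply/ffunP => j; rewrite !ffunE.
  under eq_bigr do rewrite ffunE scalerA; rewrite -scaler_suml; apply: pv; apply: eK.
  have := augE (row j (fr_diff F 0)); under eq_bigr do rewrite mxE.
  by move=> <-; apply/fr_exact0; exists (delta_mx 0 j); rewrite -rowE.
- move=> v pv; rewrite -scaler_suml -[RHS]scale1r; apply/eqP; rewrite -subr_eq0 -scalerBl.
  apply/eqP/pv/eK; rewrite scalerBl scale1r -[in X in _ - X]hb augE.
  by rewrite subrr.
move=> z zc; split.
  move=> a pa; rewrite scaler_sumr -[RHS](ker0 z (a *: b) zc); last by rewrite linearZ /= pN.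
  by apply: eq_bigr => k _; rewrite mxE scalerA.
apply/ffunP => k; rewrite ffunE; apply/eqP; rewrite -subr_eq0; apply/eqP.
rewrite -[RHS](ker0 z (delta_mx 0 k - al k *: b) zc); last first.
  by rewrite linearB linearZ /= hb hal subrr.
under [RHS]eq_bigr do rewrite !mxE scalerBl; rewrite sumrB; congr (_ - _).
  rewrite (bigD1 k) //= eqxx scale1r big1 ?addr0 // => j jk.
  by rewrite (negPf jk) scale0r.
by rewrite scaler_sumr; apply: eq_bigr => j _; rewrite scalerA.
Qed.

Lemma Fvan0_reg X : Fvan F 0 X -> forall v : X, (forall a, p a -> a *: v = 0) -> v = 0.
Proof.
move=> h v pv; have [al [be /(_ X)[h1 h2 _]]] := degree0.
rewrite -(h2 v pv) big1 // => k _; have := h _ (h1 v pv); rewrite /cob /= => /ffunP/(_ k).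
by rewrite !ffunE -scalerA => ->; rewrite scaler0.
Qed.

Lemma Dp0_socle X : Dp 0 X -> forall v : X, (forall a, m a -> a *: v = 0) -> v = 0.
Proof.
move=> [_ hs] v mv; have [al [be /(_ X)[h1 h2 _]]] := degree0.
have pv a : p a -> a *: v = 0 by move/(dq_sub dq); apply: mv.
rewrite -(h2 v pv) big1 // => k _.
have := hs _ (h1 v pv); rewrite /cob /= => h.
have /ffunP/(_ k) : ([ffun k => al k *: v] : cochain F X 0) = 0.
  apply: h => a ma; rewrite /cob /=; apply/ffunP => j; rewrite !ffunE.
  by rewrite scalerA mulrC -scalerA mv // scaler0.
by rewrite !ffunE -scalerA => ->; rewrite scaler0.
Qed.

(** ** Rees' isomorphism Ext^0(N, X/(ys)X) = Ext^n(N, X), for ys in p *)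

(** Like Theta, a relation between representing cocycles *)
Fixpoint Rees (ys : seq R) X : cochain F (quo ys X) 0 -> cochain F X (size ys) -> Prop :=
  match ys return cochain F (quo ys X) 0 -> cochain F X (size ys) -> Prop with
  | [::] => fun z e => e = z
  | y :: ys' => fun z e => exists (e1 : cochain F (Qt (@mulim R X y)) (size ys'))
        (u : cochain F X (size ys')),
      [/\ ccl e1, @Rees ys' (Qt (@mulim R X y)) z e1, fml F (qpi (@mulim R X y)) _ u = e1 &
          codiff F X (size ys') u = y *: e]
  end.

Lemma Rees_ex ys X (z : cochain F (quo ys X) 0) : Reg ys X -> ccl z ->
  exists2 e : cochain F X (size ys), ccl e & Rees z e.
Proof.
elim: ys X z => [|y ys ih] X z; first by exists z.
move=> [hy hr] zc; have [e1 ec1 r1] := ih _ z hr zc.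
have [u [e [hu ec he]]] := Fext_conn (ses_scl hy) ec1.
by exists e => //; exists e1, u; split=> //; rewrite he fml_scl.
Qed.

Lemma Rees_surj ys X (e : cochain F X (size ys)) : Reg ys X ->
  (forall y, y \in ys -> p y) -> ccl e ->
  exists2 z : cochain F (quo ys X) 0, ccl z & Rees z e.
Proof.
elim: ys X e => [|y ys ih] X e; first by exists e.
move=> [hy hr] pys ec; have [|u hu] := p_cob (a := y) _ ec.
  by apply: pys; rewrite mem_head.
have ec1 : ccl (fml F (qpi (@mulim R X y)) _ u).
  by rewrite /ccl fml_codiff -hu -fml_scl (fml_zero (ses_scl hy)).
have [|z zc hz] := ih _ _ hr _ ec1; first by move=> x hx; apply: pys; rewrite inE hx orbT.
by exists z => //; exists (fml F (qpi (@mulim R X y)) _ u), u; split.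
Qed.

Lemma Rees_lin ys X a (z z' : cochain F (quo ys X) 0) (e e' : cochain F X (size ys)) :
  Rees z e -> Rees z' e' -> Rees (a *: z + z') (a *: e + e').
Proof.
elim: ys X z z' e e' => [|y ys ih] X z z' e e'; first by move=> /= -> ->.
move=> [e1 [u [ec1 r1 u1 ue]]] [e1' [u' [ec1' r1' u1' ue']]].
exists (a *: e1 + e1'), (a *: u + u'); split; last 2 first.
- by rewrite linearP u1 u1'.
- by rewrite linearP ue ue' scalerDr !scalerA mulrC.
- by have [_ hD hZ] := issub_ccl F (Qt (@mulim R X y)) (size ys); apply: hD => //; apply: hZ.
- exact: ih.
Qed.

Lemma Rees_inj ys X (z : cochain F (quo ys X) 0) (e : cochain F X (size ys)) : Reg ys X ->
  (forall i, (i < size ys)%N -> Fvan F i X) -> Rees z e -> cob e -> z = 0.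
Proof.
elim: ys X z e => [|y ys ih] X z e; first by move=> /= _ _ ->.
move=> [hy hr] hv [e1 [u [ec1 r1 u1 ue]]] eb; apply: (ih _ z e1) => //.
  by move=> i hi; apply: Fvan_quo => //; apply: hv; rewrite // ltnW.
rewrite -u1; have [|x xc <-] := Fext_conn_cob (ses_scl hy) (u := u) _ eb; first by rewrite ue fml_scl.
by apply/fml_cob/hv.
Qed.

Lemma Rees_nat ys X X' (f : {linear X -> X'}) (f' : {linear quo ys X -> quo ys X'})
    (z : cochain F (quo ys X) 0) (e : cochain F X (size ys)) :
  (forall v, f' (quoP ys X v) = quoP ys X' (f v)) ->
  Rees z e -> Rees (fml F f' 0 z) (fml F f (size ys) e).
Proof.
elim: ys X X' f f' z e => [|y ys ih] X X' f f' z e ef.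
  by move=> /= ->; apply/ffunP => k; rewrite !ffunE; exact: (esym (ef (z k))).
move=> [e1 [u [ec1 r1 u1 ue]]]; have [f1 e3] := quo_map [:: y] f.
exists (fml F f1 _ e1), (fml F f _ u); split.
- exact: fml_ccl.
- by apply: ih r1 => v; have [x <-] := qpi_surj v; rewrite [LHS]ef; have /= -> := e3 x.
- by rewrite -u1; apply/ffunP => k; rewrite !ffunE; have /= -> := e3 (u k).
- by rewrite fml_codiff ue linearZ.
Qed.

(** ** Reduction modulo ys *)

(** An element y of p annihilates Ext, so the long exact sequence of
    0 -> X -> X -> X/yX -> 0 breaks into short ones. *)
Lemma red_inj ys X i (e : cochain F X i) : Reg ys X -> (forall y, y \in ys -> p y) ->
  ccl e -> cob (fml F (quoP ys X) i e) -> cob e.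
Proof.
elim: ys X e => [|y ys ih] X e.
  by move=> _ _ _; congr cob; apply/ffunP => k; rewrite !ffunE.
move=> [hy hr] pys ec hb.
have : cob (fml F (qpi (@mulim R X y)) i e).
  apply: (ih _ _ hr); first by move=> x hx; apply: pys; rewrite inE hx orbT.
    exact: fml_ccl.
  by rewrite (fml_comp (h := quoP (y :: ys) X)).
case/(Fext_middle (ses_scl hy) ec) => x xc; rewrite fml_scl => hx.
rewrite -[e](subrK (y *: x)); apply: cobD => //; apply: p_cob => //.
by apply: pys; rewrite mem_head.
Qed.

Lemma red_surj ys X c (z : cochain F (quo ys X) c) : Reg ys X ->
  (forall i, (c < i)%N -> Fvan F i X) -> ccl z ->
  exists2 e : cochain F X c, ccl e & cob (fml F (quoP ys X) c e - z).
Proof.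
elim: ys X z => [|y ys ih] X z.
  move=> _ _ zc; exists z => //.
  have -> : fml F (lid X) c z = z by apply/ffunP => k; rewrite !ffunE.
  by rewrite subrr; have [] := issub_cob F X c.
move=> [hy hr] hv zc.
have [|e1 ec1 hz] := ih _ z hr _ zc.
  by move=> i hi; apply: Fvan_quo => //; apply: hv; rewrite // ltnW.
have [u [y' [hu yc' e]]] := Fext_conn (ses_scl hy) ec1.
have [x xc hx] := Fext_conn_cob (ses_scl hy) e (hv _ (ltnSn c) _ yc').
exists x => //; rewrite -(fml_comp (g := quoP ys _) (f := qpi (@mulim R X y))) //.
by rewrite hx hu.
Qed.

(** Up to s, a surjection whose kernel is killed by s induces isomorphisms on
    Ext; this lemma and the next one are the two halves. *)
Lemma red_kernel_inj Y M'' s i (g : {linear Y -> M''}) (z : cochain F Y i) :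
  (forall x, exists v, g v = x) -> (forall v, g v = 0 -> s *: v = 0) ->
  ccl z -> cob (fml F g i z) -> cob (s *: z).
Proof.
move=> gS gs zc hz; have [y yc hy] := Fext_middle (ses_ker gS) zc hz.
rewrite -[z](subrK (fml F (sbi (fun v => g v = 0)) i y)) scalerDr; apply: cobD; first exact: cobZ.
rewrite -linearZ (_ : s *: y = 0) ?linear0; first by have [] := issub_cob F Y i.
apply/ffunP => k; rewrite !ffunE; apply: (@sbi_inj _ _ (fun v => g v = 0)).
by rewrite linearZ linear0; exact: (gs _ (sbi_mem (y k) (issub_ker g issub0))).
Qed.

Lemma red_kernel_surj Y M'' s i (g : {linear Y -> M''}) (z : cochain F M'' i) :
  (forall x, exists v, g v = x) -> (forall v, g v = 0 -> s *: v = 0) -> ccl z ->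
  exists2 y : cochain F Y i, ccl y & fml F g i y = s *: z.
Proof.
move=> gS gs zc; have [u [y [hu yc e]]] := Fext_conn (ses_ker gS) zc.
exists (s *: u); last by rewrite linearZ hu.
rewrite /ccl linearZ /= e -linearZ (_ : s *: y = 0) ?linear0 //.
apply/ffunP => k; rewrite !ffunE; apply: (@sbi_inj _ _ (fun v => g v = 0)).
by rewrite linearZ linear0; exact: (gs _ (sbi_mem (y k) (issub_ker g issub0))).
Qed.
End DvrQuotient.

(** * Regular parameters that form a regular sequence *)

Lemma seqmulP (R : comNzRingType) (V : lmodType R) (s : seq R) (v : V) :
  v \in seqmul s <-> quoP s V v = 0.
Proof.
split=> [|h]; last first.
  apply: (quoP_ker (U := fun v => v \in seqmul s)) h; first exact: issub_submod.
  by move=> x u hx; apply/asboolP => U; apply; exists x, u.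
have hK := issub_ker (quoP s V) issub0.
move/asboolP => h; apply/(mspanP v hK); apply: h => _ [a [u [ha _ ->]]].
by apply/mspanP => //; apply: quoP_mul.
Qed.

Lemma regular_seq_Reg (R : comNzRingType) (V : lmodType R) s : regular_seq V s -> Reg s V.
Proof.
move=> [h _]; have {h} : forall i, (i < size s)%N -> forall v : V,
    quoP (take i s) V (s`_i *: v) = 0 -> quoP (take i s) V v = 0.
  by move=> i hi v /seqmulP/(h i hi)/seqmulP.
elim: s V => //= x s ih V h; split; first by move=> v; apply: (h 0%N).
apply: ih => i hi v; have [u <-] := qpi_surj v; rewrite -linearZ.
exact: (h i.+1 hi u).
Qed.

Section Selection.
Variables (R : comNzRingType) (m p : R -> Prop) (w : R).
Hypotheses (nR : noeth R^o) (dq : dvr_quotient m p w).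
Variables (N : lmodType R) (F : free_resolution N).
Hypothesis pN : forall a, p a -> forall x : N, a *: x = 0.
Hypothesis Ncyc : exists e : N, (forall x, exists a, x = a *: e) /\ forall a, a *: e = 0 -> p a.
Implicit Types X M : lmodType R.

Definition sqr (I : R -> Prop) : R^o -> Prop := isum I (I : R^o -> Prop).

Lemma sqr_sub I a : isidl I -> sqr I a -> I a.
Proof. by move=> hI; apply: (isum_sub hI) => b c _ hc; apply: (idlM b hI). Qed.

(** Generators of p at p can be moved within their classes modulo p^2 so as to
    form a regular sequence on X, because no associated prime of the successive
    quotients contains p. *)
Lemma select_regular (zs : seq R) X n : fgm X -> (forall z, z \in zs -> p z) ->
  Dp m F (n + size zs) X -> exists ys : seq R, [/\ size ys = size zs, Reg ys X,
    forall y, y \in ys -> p y, Dp m F n (quo ys X) &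
    forall i, (i < size zs)%N -> sqr p (ys`_i - zs`_i)].
Proof.
have [pI _ _] := dq_prime dq.
elim: zs X => [|z zs ih] X hX hz /=; first by rewrite addn0; exists [::].
rewrite addnS => hD; have Y0 : Fvan F 0 X by have [h _] := hD; apply: h.
have [|w' hw' rw] := @regular_in_coset R X (sqr p) z nR (noeth_fgm nR hX) (issub_isum _ pI).
  move=> v hv; apply: (Fvan0_reg pN Ncyc Y0) => a pa.
  apply: (Fvan0_reg pN Ncyc Y0) => b pb; rewrite scalerA.
  by apply: hv; apply: isum1.
have pw' := sqr_sub pI hw'.
have py : p (z + w') by have [_ pD _] := pI; apply: pD => //; apply: hz; rewrite mem_head.
have [x hx|ys [sz hr pys hDq hs]] := ih (Qt (@mulim R X (z + w'))) (fgm_qt _ hX) _ (Dp_quo rw hD).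
  by apply: hz; rewrite inE hx orbT.
exists (z + w' :: ys); split=> //=; first by rewrite sz.
  by move=> y; rewrite inE => /predU1P[->|/pys].
by case=> [|i] hi /=; [rewrite addrAC subrr add0r|apply: hs].
Qed.

(** By Nakayama, a change within the classes modulo p^2 still generates p at p. *)
Lemma generate_up_to (zs ys : seq R) : size ys = size zs ->
  (forall a, p a -> exists2 u, ~ p u & span (zs : seq R^o) (u * a)) ->
  (forall i, (i < size zs)%N -> sqr p (ys`_i - zs`_i)) ->
  exists2 s, ~ p s & forall a, p a -> quoP ys R^o (s * a) = 0.
Proof.
have [pI _ _] := dq_prime dq => sz hz hs.
have hU := issub_ker (quoP ys R^o) issub0.
apply: (nakayama (V := R^o) (P := p) (dq_prime dq) hU (nR pI)) => a /hz[u nu].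
have hT := issub_add (issub_isum (p : R^o -> Prop) pI) hU.
move/(span_sub hT) => []; last by move=> x hx hx'; exists u => //; exists x.
move=> z /(nthP 0)[i hi <-]; exists (- (ys`_i - zs`_i)).
  exact: (issubN (issub_isum (p : R^o -> Prop) pI) (hs i hi)).
rewrite opprK addrC subrK -[ys`_i]mulr1 -[_ * 1]/(ys`_i *: (1 : R^o)).
by apply: quoP_mul; apply: mem_nth; rewrite sz.
Qed.

Lemma quo_sub_p ys a : (forall y, y \in ys -> p y) -> quoP ys R^o a = 0 -> p a.
Proof.
have [pI _ _] := dq_prime dq => hy; apply: (quoP_ker (U := (p : R^o -> Prop)) pI) => x u /hy.
by rewrite -[x *: u]/(x * u) mulrC; apply: idlM.
Qed.

Lemma quo_p_torsion ys s X a (x : quo ys X) : (forall a, p a -> quoP ys R^o (s * a) = 0) ->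
  p a -> s *: (a *: x) = 0.
Proof. by move=> h /h; rewrite scalerA; apply: quo_ann. Qed.

(** The element s is a common denominator for expressing p through ys. *)
Record good_sequence M (ys : seq R) (s : R) : Prop := GoodSequence {
  gs_p : forall y, y \in ys -> p y;
  gs_R : Reg ys (R^o : lmodType R);
  gs_M : Reg ys M;
  gs_s : ~ p s;
  gs_gen : forall a, p a -> quoP ys R^o (s * a) = 0;
  gs_DR : Dp m F (size ys) R^o;
  gs_DM : Dp m F (size ys) M }.

Lemma fgm_prod X Y : fgm X -> fgm Y -> fgm (X * Y)%type.
Proof.
move=> [s hs] [t ht].
pose i1 := injl X Y; pose i2 := injr X Y.
exists (map i1 s ++ map i2 t) => -[x y].
have -> : (x, y) = i1 x + i2 y by apply/eqP; rewrite xpair_eqE /= addr0 add0r !eqxx.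
have [_ hD _] := issub_span (map i1 s ++ map i2 t); apply: hD.
  by apply: (span_mono (s := map i1 s)); [move=> z; rewrite mem_cat => ->|exact: span_im].
by apply: (span_mono (s := map i2 t)); [move=> z; rewrite mem_cat orbC => ->|exact: span_im].
Qed.

(** If more room were left after the selection, R/(ys) would have no nonzero
    element killed by p, but the class of s is one. *)
Lemma good_sequence_ex M (zs : seq R) x0 xs v0 vs : fgm M ->
  (forall z, z \in zs -> p z) ->
  (forall a, p a -> exists2 u, ~ p u & span (zs : seq R^o) (u * a)) ->
  (forall x, x \in x0 :: xs -> m x) -> Reg (x0 :: xs) (R^o : lmodType R) ->
  (forall x, x \in v0 :: vs -> m x) -> Reg (v0 :: vs) M ->
  size vs = size xs -> (size zs <= size xs)%N ->
  size zs = size xs /\ exists ys s, size ys = size zs /\ good_sequence M ys s.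
Proof.
move=> hM pzs hzs mxs hxs mvs hvs sz le.
have DR := depth_Dp nR dq F pN (fgm_ring R) mxs hxs.
have DM := depth_Dp nR dq F pN hM mvs hvs; rewrite sz in DM.
have [|ys [sy hr pys hD hs]] := @select_regular zs (R^o * M)%type (size xs - size zs)
    (fgm_prod (fgm_ring R) hM) pzs.
  by rewrite subnK //; apply: Dp_prod.
have [s ns hs'] := generate_up_to sy hzs hs.
have r1 v : projl R^o M (injl R^o M v) = v by [].
have r2 v : projr R^o M (injr R^o M v) = v by [].
have e : size zs = size xs.
  apply/eqP; rewrite eqn_leq le leqNgt; apply/negP => lt.
  have [f' [g' h]] := quo_map_retract ys r1.
  have := Dp_retract h hD; rewrite -subn_gt0 in lt.
  move=> [/(_ 0%N lt) v _]; apply: ns; apply: (quo_sub_p pys).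
  apply: (Fvan0_reg pN Ncyc v) => a pa.
  by rewrite -linearZ; have := hs' a pa; rewrite mulrC.
split=> //; exists ys, s; split=> //; split=> //.
- exact: Reg_retract r1 hr.
- exact: Reg_retract r2 hr.
- by rewrite sy e.
- by rewrite sy e.
Qed.
End Selection.

(** * Ranks *)

(** Were n > r, pad B with zero columns to a square matrix. A monic polynomial of
    least degree that kills it has constant term 0, as seen in the last column,
    and cancelling the matrix lowers the degree. *)
Lemma independent_rows_le (S : comNzRingType) n r (B : 'M[S]_(n, r)) :
  (forall c : 'rV_n, c *m B = 0 -> c = 0) -> (n <= r)%N.
Proof.
case: n B => // n B hB; rewrite leqNgt; apply/negP => rn.
pose A : 'M[S]_n.+1 := \matrix_(i, j) (if insub (j : nat) is Some k then B i k else 0).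
have A0 i : A i ord_max = 0.
  by rewrite mxE insubF //= ltnNge -ltnS rn.
have Ainj (c : 'rV_n.+1) : c *m A = 0 -> c = 0.
  move=> h; apply: hB; apply/rowP => k.
  have kn : (k < n.+1)%N by apply: leq_trans (ltn_ord k) (ltnW rn).
  move/rowP/(_ (Ordinal kn)): h; rewrite !mxE => h; rewrite -[RHS]h.
  by apply: eq_bigr => j _; rewrite mxE insubT //= => hk; congr (_ * B _ _); apply: val_inj.
have AI (C : 'M[S]_n.+1) : C *m A = 0 -> C = 0.
  move=> h; apply/row_matrixP => i; rewrite row0; apply: Ainj.
  by rewrite -row_mul h row0.
have no k : forall q : {poly S}, q \is monic -> (size q <= k)%N -> horner_mx A q <> 0.
  elim: k => [|k ih] q mq.
    by rewrite leqn0 size_poly_eq0 => /eqP q0; move: mq; rewrite q0 monicE lead_coef0 eq_sym oner_eq0.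
  move=> sq e; have [q1 [c qE]] : exists q1 c, q = q1 * 'X + c%:P.
    by exists (drop_poly 1 q), (q`_0); rewrite -[LHS](poly_take_drop 1) addrC expr1; congr (_ + _);
      apply/polyP => j; rewrite coef_take_poly coefC ltnS leqn0; case: eqP => // ->.
  have hq : horner_mx A q1 *m A + c%:M = 0.
    by rewrite -e qE rmorphD rmorphM /= horner_mx_X horner_mx_C.
  have c0 : c = 0.
    have := congr1 (fun C : 'M_n.+1 => C ord_max ord_max) hq; rewrite !mxE eqxx mulr1n.
    by rewrite big1 ?add0r // => j _; rewrite A0 mulr0.
  rewrite c0 polyC0 addr0 in qE; rewrite c0 in hq; rewrite raddf0 addr0 in hq.
  have mq1 : q1 \is monic by move: mq; rewrite qE !monicE lead_coefMX.
  apply: (ih q1) (AI _ hq) => //.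
  have q10 : q1 != 0 by apply: monic_neq0.
  by move: sq; rewrite qE size_mulX.
apply: (no _ (char_poly A)); [exact: char_poly_monic|exact: leqnn|].
exact: Cayley_Hamilton.
Qed.

Section LocalRank.
Variables (R : comNzRingType) (p : prime_idealr R) (M : lmodType R).
Local Notation S := (locring p).
Local Notation mk1 v := (mkfrac v (denom1 p) : locmod p M).
Local Notation rf1 a := (ringfrac a (denom1 p) : S).

Lemma mk1D (u v : M) : mk1 (u + v) = mk1 u + mk1 v.
Proof.
rewrite mkfracD; apply/mkfrac_eq; exists (denom1 p) => /=.
by rewrite !mulr1 !scale1r.
Qed.

Lemma mk1Z a (v : M) : mk1 (a *: v) = rf1 a *: mk1 v.
Proof.
rewrite [RHS]loc_scaleE; apply/mkfrac_eq; exists (denom1 p) => /=.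
by rewrite !mulr1.
Qed.

Lemma mk1_0 (v : M) : mk1 v = 0 <-> exists2 u, u \notin p & u *: v = 0.
Proof.
rewrite /GRing.zero /= /loc_zero mkfrac_eq /=; split=> [[u]|[u nu e]].
  rewrite scaler0 mulr1 => e; exists (denom_val u) => //; exact: denomP.
by exists (Denom nu); rewrite /= mulr1 scaler0.
Qed.

Lemma locmod_eq0 : (forall x : locmod p M, x = 0) <->
  forall v : M, exists2 u, u \notin p & u *: v = 0.
Proof.
split=> [h v|h x]; first exact/mk1_0.
rewrite -(mkfracK x); move: (repr _) => [v s] /=; have [u nu e] := h v.
rewrite /GRing.zero /= /loc_zero mkfrac_eq /=; exists (Denom nu).
by rewrite /= mulr1 e scaler0.
Qed.

Lemma mk1_sum r (a : 'I_r -> R) (n : 'I_r -> M) :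
  mk1 (\sum_j a j *: n j) = \sum_j rf1 (a j) *: mk1 (n j).
Proof.
elim/big_ind2: _ => [|x1 x2 y1 y2 <- <-|j _]; [|exact: mk1D|exact: mk1Z].
by apply/mk1_0; exists 1; rewrite ?idealr1 ?scaler0.
Qed.

Lemma rf1_unit a : a \notin p -> forall x : S, x * rf1 a = 0 -> x = 0.
Proof.
move=> /(ringfracP_unit (denom1 p))[y e] x h.
by rewrite -[x]mulr1 -e mulrCA h mulr0.
Qed.

(** Expressing an independent family through n_1, .., n_r, with denominators
    cleared, gives a matrix with independent rows. *)
Lemma mrank_locmod r (n : 'I_r -> M) :
  (forall v, exists u, u \notin p /\ exists b, u *: v = \sum_j b j *: n j) ->
  (forall a : 'I_r -> R, \sum_j a j *: n j = 0 -> forall j, exists2 u, u \notin p & u * a j = 0) ->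
  mrank (locmod p M) = r.
Proof.
move=> hgen hind; apply: maxnatE.
  exists (fun j => mk1 (n j)) => c hc.
  pose u := \prod_j denom_val (dnm (c j)).
  have nu : u \notin p.
    rewrite /u; elim/big_ind: _ => [|x y hx hy|j _]; first by rewrite idealr1.
      by rewrite prime_idealrM negb_or hx.
    exact: denomP.
  have : forall j, exists a, c j * rf1 u = rf1 a.
    move=> j; rewrite /u (bigD1 j) //= -{1}(ringfracK (c j)) ringfrac1M mulrA -ringfrac_cancel -ringfrac1M.
    by eexists.
  case/choice => a ha.
  have /mk1_0[u' nu' e] : mk1 (\sum_j a j *: n j) = 0.
    rewrite mk1_sum; transitivity (rf1 u *: \sum_j c j *: mk1 (n j)); last first.
      by rewrite hc scaler0.
    by rewrite scaler_sumr; apply: eq_bigr => j _; rewrite -ha scalerA mulrC.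
  move=> j; apply: (rf1_unit nu); rewrite ha.
  have [|u2 nu2 e2] := hind (fun j => u' * a j) _ j.
    by rewrite -[RHS]e scaler_sumr; apply: eq_bigr => k _; rewrite scalerA.
  apply/ringfrac_eq; exists (denomM (Denom nu2) (Denom nu')) => /=.
  by rewrite !mulr1 mulr0 -mulrA.
move=> k [f hf].
have : forall i, exists ub : R * ('I_r -> R), ub.1 \notin p /\
    rf1 ub.1 *: f i = \sum_j rf1 (ub.2 j) *: mk1 (n j).
  move=> i; rewrite -(mkfracK (f i)); move: (repr _) => [v s] /=.
  have [u [nu [b e]]] := hgen v; exists (denom_val s * u, b); split=> /=.
    by rewrite prime_idealrM negb_or nu denomP.
  rewrite -mk1_sum -e [LHS]loc_scaleE; apply/mkfrac_eq; exists (denom1 p) => /=.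
  by rewrite !scalerA; congr (_ *: _); ring.
case/choice => ub hub.
apply: (@independent_rows_le S k r (\matrix_(i, j) rf1 ((ub i).2 j))) => c hc.
apply/rowP => i; rewrite mxE; have [nu _] := hub i; apply: (rf1_unit nu).
move: i {nu}; apply: (hf (fun i => c 0 i * rf1 (ub i).1)).
under eq_bigr => i _ do rewrite -scalerA (proj2 (hub i)) scaler_sumr.
rewrite exchange_big big1 // => j _.
under eq_bigr => i _ do rewrite scalerA.
rewrite -scaler_suml; move/rowP/(_ j): hc; rewrite !mxE.
by under eq_bigr => i _ do rewrite mxE; move=> ->; rewrite scale0r.
Qed.
End LocalRank.

Section Independence.
Variables (R : comNzRingType) (p : R -> Prop).
Hypotheses (nR : noeth R^o) (pp : isprime p).

(** Let K be the kernel of f and y the first element of ys. By induction f is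
    injective at p modulo y, and y is regular on W, so that K = yK at p and
    Nakayama's lemma applies. *)
Lemma injective_mod_regular ys (V W : lmodType R) (f : {linear V -> W}) : fgm V -> Reg ys W ->
  (forall y, y \in ys -> p y) ->
  (forall v, quoP ys W (f v) = 0 -> exists2 u, ~ p u & quoP ys V (u *: v) = 0) ->
  forall v, f v = 0 -> exists2 u, ~ p u & u *: v = 0.
Proof.
elim: ys V W f => [|y ys ih] V W f hV /=.
  by move=> _ _ h v /h.
move=> [hy hr] pys h.
have [f1 e1] := quo_map [:: y] f; rewrite /= in e1.
have h1 v1 : f1 v1 = 0 -> exists2 u, ~ p u & u *: v1 = 0.
  apply: (ih _ _ f1 _ hr); first by apply: fgm_surj hV; apply: qpi_surj.
    by move=> x hx; apply: pys; rewrite inE hx orbT.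
  move=> x; have [v <-] := qpi_surj x; rewrite e1 => /h[u nu e].
  by exists u; rewrite // -linearZ.
have hK := issub_ker f issub0.
have [|u nu hu] := nakayama pp (@issub0 _ V) (noeth_fgm nR hV hK).
  move=> v fv; have [|u nu] := h1 (qpi (@mulim R V y) v); first by rewrite e1 fv linear0.
  rewrite -linearZ => /qpi0[|v' e]; first exact: issub_mulim.
  exists u => //; exists (y *: v'); last by rewrite e subrr.
  apply: isum1; first by apply: pys; rewrite mem_head.
  have : f (u *: v) = 0 by rewrite linearZ /= fv scaler0.
  by rewrite e linearZ => /hy.
by move=> v /hu e; exists u.
Qed.
End Independence.

(** * Coordinates modulo torsion over a discrete valuation ring *)

Section Coordinates.
Variables (R : comNzRingType) (m p : R -> Prop) (w : R).
Hypothesis dq : dvr_quotient m p w.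
Variable Y : lmodType R.
Hypothesis pY : forall a, p a -> forall y : Y, a *: y = 0.

(** Torsion over R/p *)
Definition ptors (y : Y) := exists2 a, ~ p a & a *: y = 0.

Lemma issub_ptors : issub ptors.
Proof.
have pp := dq_prime dq; split.
- by exists 1; rewrite ?scaler0 //; case: pp.
- move=> x y [a na ax] [b nb b_y]; exists (a * b); first exact: nprimeM.
  by rewrite scalerDr -[in X in _ + X]scalerA b_y scaler0 mulrC -scalerA ax scaler0 addr0.
- by move=> c x [a na ax]; exists a; rewrite // scalerA mulrC -scalerA ax scaler0.
Qed.

Lemma ptorsZ a y : ~ p a -> ptors (a *: y) -> ptors y.
Proof.
move=> na [b nb e]; exists (b * a); last by rewrite -scalerA.
exact: nprimeM (dq_prime dq) nb na.
Qed.

Lemma dvr_div a b : ~ p a -> (exists c, p (b - c * a)) \/ (~ p b /\ exists c, p (a - c * b)).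
Proof.
have [[pI p1 pM] [_ um]] := (dq_prime dq, dq_loc dq).
move=> na; case: (pselect (p b)) => [pb|nb]; first by left; exists 0; rewrite mul0r subr0.
have [k [u [nu hu]]] := dq_val dq na; have [l [v [nv hv]]] := dq_val dq nb.
have [u' eu] := um u nu; have [v' ev] := um v nv.
case: (leqP k l) => kl; [left; exists (v * u' * w ^+ (l - k))|right; split=> //; exists (u * v' * w ^+ (k - l))].
  have -> : b - v * u' * w ^+ (l - k) * a = (b - v * w ^+ l) -
      v * u' * w ^+ (l - k) * (a - u * w ^+ k).
    have -> : w ^+ l = w ^+ (l - k) * w ^+ k by rewrite -exprD subnK.
    have -> : v * (w ^+ (l - k) * w ^+ k) = v * (u' * u) * (w ^+ (l - k) * w ^+ k) by rewrite eu mulr1.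
    by ring.
  by apply: (@issubB _ R^o p); rewrite // ; apply: idlM.
have kl' := ltnW kl.
have -> : a - u * v' * w ^+ (k - l) * b = (a - u * w ^+ k) -
    u * v' * w ^+ (k - l) * (b - v * w ^+ l).
  have -> : w ^+ k = w ^+ (k - l) * w ^+ l by rewrite -exprD subnK.
  have -> : u * (w ^+ (k - l) * w ^+ l) = u * (v' * v) * (w ^+ (k - l) * w ^+ l) by rewrite ev mulr1.
  by ring.
by apply: (@issubB _ R^o p); rewrite // ; apply: idlM.
Qed.

Lemma dvr_divisor (I : eqType) (s : seq I) (a : I -> R) : (exists2 j, j \in s & ~ p (a j)) ->
  exists j, [/\ j \in s, ~ p (a j) & forall k, k \in s -> exists c, p (a k - c * a j)].
Proof.
have [pI p1 pM] := dq_prime dq.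
elim: s => [[]//|i s ih [j0 hj0 nj0]].
case: (pselect (exists2 j, j \in s & ~ p (a j))) => [/ih[j [js nj hj]]|no].
  have [[c hc]|[ni [c hc]]] := dvr_div (a i) nj.
    exists j; split=> //; first by rewrite inE js orbT.
    by move=> k; rewrite inE => /predU1P[->|/hj//]; exists c.
  exists i; split=> //; first by rewrite mem_head.
  move=> k; rewrite inE => /predU1P[->|/hj[d hd]].
    by exists 1; rewrite mul1r subrr; case: pI.
  exists (d * c); have -> : a k - d * c * a i = (a k - d * a j) + d * (a j - c * a i) by ring.
  by have [_ pD _] := pI; apply: pD => //; apply: idlM.
have ji : j0 = i.
  by move: hj0; rewrite inE => /predU1P[//|h]; case: no; exists j0.
exists i; rewrite -ji; split=> //; first by rewrite ji mem_head.
move=> k; rewrite inE => /predU1P[->|hk].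
  by exists 1; rewrite ji mul1r subrr; case: pI.
exists 0; rewrite mul0r subr0; apply: contrapT => nk; apply: no; by exists k.
Qed.

(** In a relation modulo torsion some coefficient divides all others, so that the
    corresponding generator is redundant. A shortest list of generators therefore
    has no such relations. *)
Lemma dvr_basis : fgm Y -> exists r (n : 'I_r -> Y),
  (forall y, exists a : 'I_r -> R, ptors (y - \sum_j a j *: n j)) /\
  forall a : 'I_r -> R, ptors (\sum_j a j *: n j) -> forall j, p (a j).
Proof.
move=> [s hs]; have [t0 tD tZ] := issub_ptors.
pose gen r := exists n : 'I_r -> Y, forall y, exists a : 'I_r -> R, ptors (y - \sum_j a j *: n j).
have ex : exists r, `[< gen r >].
  exists (size s); apply/asboolP; exists (fun j => s`_j) => y.
  by have /ispan_sum[c [_ ->]] := hs y; exists c; rewrite subrr.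
case: (ex_minnP ex) => r /asboolP[n hn] hmin; exists r, n; split=> // a ha j.
apply: contrapT => nj.
have [|j0 [_ nj0 hj0]] := @dvr_divisor _ (enum 'I_r) a; first by exists j; rewrite ?mem_enum.
case: r n hn hmin a ha j nj j0 nj0 hj0 => [|r] n hn hmin a ha j nj j0 nj0 hj0; first by have := ltn_ord j0.
suff /hmin : `[< gen r >] by rewrite ltnn.
apply/asboolP; exists (fun k => n (lift j0 k)).
pose T y := exists a : 'I_r -> R, ptors (y - \sum_k a k *: n (lift j0 k)).
have hT : issub T.
  split.
  - by exists (fun _ => 0); rewrite big1 ?subr0 // => k _; rewrite scale0r.
  - move=> x y [b hb] [c hc]; exists (fun k => b k + c k).
    under eq_bigr do rewrite scalerDl; rewrite big_split opprD addrACA; exact: tD.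
  - move=> c x [b hb]; exists (fun k => c * b k).
    by under eq_bigr do rewrite -scalerA; rewrite -scaler_sumr -scalerBr; apply: tZ.
have [_ TD TZ] := hT.
have Tl k : T (n (lift j0 k)).
  exists (fun l => (l == k)%:R); rewrite (bigD1 k) //= eqxx scale1r big1 ?addr0 ?subrr //.
  by move=> l /negPf ->; rewrite scale0r.
have T0 : T (n j0).
  have : forall k, exists c, p (a k - c * a j0) by move=> k; apply: hj0; rewrite mem_enum.
  case/choice => c hc; exists (fun k => - c (lift j0 k)).
  apply: (ptorsZ nj0); move: ha; rewrite (bigD1_ord j0) //=; congr ptors.
  rewrite scalerBr; congr (_ + _); rewrite scaler_sumr -sumrN; apply: eq_bigr => k _.
  apply/eqP; rewrite -subr_eq0 scaleNr scalerN opprK scalerA -scalerBl mulrC.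
  by apply/eqP/pY.
have Tn k : T (n k) by case: (unliftP j0 k) => [l ->|->].
move=> y; have [b hb] := hn y.
have : T (\sum_k b k *: n k) by apply: issub_sum => // k _; apply: TZ.
case=> c hc; exists c; rewrite -[y](subrK (\sum_k b k *: n k)) -addrA; exact: tD.
Qed.

Variables (RP : lmodType R) (qR : {linear R^o -> RP}).
Hypothesis qR0 : forall a, qR a = 0 <-> p a.

Lemma coordinate_maps r (n : 'I_r -> Y) :
  (forall y, exists a : 'I_r -> R, ptors (y - \sum_j a j *: n j)) ->
  (forall a : 'I_r -> R, ptors (\sum_j a j *: n j) -> forall j, p (a j)) ->
  exists chi : 'I_r -> {linear Y -> RP}, forall y (a : 'I_r -> R),
    ptors (y - \sum_j a j *: n j) -> forall j, chi j y = qR (a j).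
Proof.
move=> /choice[f hf] hind; have [t0 tD tZ] := issub_ptors.
have qRB a b : p (a - b) -> qR a = qR b.
  by move=> /qR0; rewrite linearB => /eqP; rewrite subr_eq0 => /eqP.
have uniq y a : ptors (y - \sum_j a j *: n j) -> forall j, qR (f y j) = qR (a j).
  move=> ha j; apply: qRB; apply: (hind (fun j => f y j - a j)) => {j}.
  under eq_bigr do rewrite scalerBl; rewrite sumrB.
  have -> : \sum_j f y j *: n j - \sum_j a j *: n j =
    (y - \sum_j a j *: n j) - (y - \sum_j f y j *: n j).
    by rewrite opprB [RHS]addrC addrA subrK.
  by apply: issubB => //; exact: issub_ptors.
have lP j : linear (fun y => qR (f y j)).
  move=> a x y; rewrite -linearP; apply: (uniq _ (fun j => a * f x j + f y j)).
  have -> : \sum_i (a * f x i + f y i) *: n i =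
      a *: (\sum_i f x i *: n i) + \sum_i f y i *: n i.
    by under eq_bigr do rewrite scalerDl -scalerA; rewrite big_split scaler_sumr.
  by rewrite opprD addrACA -scalerBr; apply: tD => //; apply: tZ.
by exists (fun j => mklin (lP j)) => y a /uniq.
Qed.
End Coordinates.

(** * Lengths of intervals of submodules *)

Section Length.
Variables (R : nzRingType) (V : lmodType R).
Implicit Types (U : V -> Prop).

Definition lesub U1 U2 := forall x, U1 x -> U2 x.
Definition ltsub U1 U2 := lesub U1 U2 /\ exists2 x, U2 x & ~ U1 x.

Definition has_chain U1 U2 n := exists C : nat -> V -> Prop,
  [/\ forall i, (i <= n)%N -> issub (C i), lesub U1 (C 0%N), lesub (C n) U2 &
      forall i, (i < n)%N -> ltsub (C i) (C i.+1)].

(** Lengths are attached to intervals of submodules rather than to quotient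
    modules. *)
Definition isLen U1 U2 k := has_chain U1 U2 k /\ forall n, has_chain U1 U2 n -> (n <= k)%N.

Lemma isLen_unique U1 U2 k l : isLen U1 U2 k -> isLen U1 U2 l -> k = l.
Proof. by move=> [h1 h2] [h3 h4]; apply/eqP; rewrite eqn_leq h4 ?h2. Qed.

Lemma has_chain0 U1 U2 : issub U1 -> lesub U1 U2 -> has_chain U1 U2 0.
Proof. by move=> h1 h; exists (fun _ => U1); split=> // x. Qed.

Lemma isLen_bounded U1 U2 k : issub U1 -> lesub U1 U2 ->
  (forall n, has_chain U1 U2 n -> (n <= k)%N) -> exists2 l, (l <= k)%N & isLen U1 U2 l.
Proof.
move=> h1 h12 hk; elim: k hk => [|k ih] hk.
  by exists 0%N => //; split=> //; apply: has_chain0.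
case: (pselect (has_chain U1 U2 k.+1)) => [h|no]; first by exists k.+1.
have [|l lk hl] := ih; last by exists l => //; apply: leqW.
move=> n hn; have := hk n hn; rewrite leq_eqVlt => /predU1P[e|//].
by case: no; rewrite -e.
Qed.

Lemma has_chain_sub U1 U2 U2' n : lesub U2 U2' -> has_chain U1 U2 n -> has_chain U1 U2' n.
Proof. by move=> h [C [a b c d]]; exists C; split=> // x /c/h. Qed.

Lemma has_chain_rcons U1 U2 U2' n : issub U2' -> ltsub U2 U2' -> has_chain U1 U2 n ->
  has_chain U1 U2' n.+1.
Proof.
move=> h2 [h [x hx nx]] [C [a b c d]].
exists (fun i => if (i <= n)%N then C i else U2'); split=> [i|||i hi].
- by move=> hi; case: ifP => // /a.
- exact: b.
- by rewrite ltnn.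
rewrite ltnS in hi; rewrite hi; case: ltnP => hi'; first exact: d.
have -> : i = n by apply/eqP; rewrite eqn_leq hi hi'.
by split=> [y /c/h//|]; exists x => // /c.
Qed.

Lemma has_chain_cat U1 U2 U3 a b : has_chain U1 U2 a -> has_chain U2 U3 b ->
  has_chain U1 U3 (a + b).
Proof.
move=> hC [D [d1 d2 d3 d4]].
have h0 : has_chain U1 (D 0%N) a by apply: has_chain_sub hC.
apply: has_chain_sub d3 _.
have : forall i, (i <= b)%N -> has_chain U1 (D i) (a + i).
  elim=> [|i ih] hi; first by rewrite addn0.
  by rewrite addnS; apply: has_chain_rcons (d1 _ hi) (d4 _ hi) (ih (ltnW hi)).
exact.
Qed.

(** A chain meets U2 and its quotient in chains that together have at least
    as many steps. *)
Lemma has_chain_split U1 U2 U3 n : issub U1 -> issub U2 -> lesub U1 U2 -> lesub U2 U3 ->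
  issub U3 -> has_chain U1 U3 n ->
  exists a b, [/\ has_chain U1 U2 a, has_chain U2 U3 b & (n <= a + b)%N].
Proof.
move=> h1 h2 h12 h23 h3 [C [c1 c2 c3 c4]].
have [a [b [ha hb hn]]] : exists a b, [/\ has_chain U1 (fun x => C n x /\ U2 x) a,
    has_chain U2 (addsub (C n) U2) b & (n <= a + b)%N].
  have : forall i, (i <= n)%N -> exists a b, [/\ has_chain U1 (fun x => C i x /\ U2 x) a,
    has_chain U2 (addsub (C i) U2) b & (i <= a + b)%N].
    elim=> [|i ih] hi.
      exists 0%N, 0%N; split=> //; apply: has_chain0 => // x hx.
        by split; [apply: c2|apply: h12].
      by apply: addsubr => //; apply: c1.
    have [a [b [ha hb hn]]] := ih (ltnW hi); have [l [x hx nx]] := c4 i hi.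
    have s1 := c1 _ (ltnW hi); have s2 := c1 _ hi.
    have l1 : lesub (fun x => C i x /\ U2 x) (fun x => C i.+1 x /\ U2 x) by move=> y [/l].
    have l2 : lesub (addsub (C i) U2) (addsub (C i.+1) U2).
      by move=> y [z /l hz h]; exists z.
    case: (pselect (addsub (C i) U2 x)) => [[y hy hxy]|no].
      exists a.+1, b; split=> //; last first.
        exact: has_chain_sub hb.
      apply: has_chain_rcons ha; first exact: issubI.
      split=> //; exists (x - y); first by split=> //; apply: issubB => //; apply: l.
      by move=> [h _]; apply: nx; rewrite -[x](subrK y); have [_ hD _] := s1; apply: hD.
    exists a, b.+1; split; [exact: has_chain_sub ha| |by rewrite addnS].
    apply: has_chain_rcons hb; first exact: issub_add.
    by split=> //; exists x => //; apply: addsubl.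
  exact.
exists a, b; split=> //; first by apply: has_chain_sub ha => x [].
apply: has_chain_sub hb => x [y /c3 hy /h23 hxy]; rewrite -[x](subrK y).
by have [_ hD _] := h3; apply: hD.
Qed.

Lemma isLen_add U1 U2 U3 a b : issub U1 -> issub U2 -> issub U3 -> lesub U1 U2 -> lesub U2 U3 ->
  isLen U1 U2 a -> isLen U2 U3 b -> isLen U1 U3 (a + b).
Proof.
move=> h1 h2 h3 h12 h23 [ha la] [hb lb]; split; first exact: has_chain_cat ha hb.
move=> n hn; have [a' [b' [ha' hb' le]]] := has_chain_split h1 h2 h12 h23 h3 hn.
by apply: leq_trans le _; apply: leq_add; [apply: la|apply: lb].
Qed.

Lemma isLen_sub U1 U2 U3 k : issub U1 -> issub U2 -> issub U3 -> lesub U1 U2 -> lesub U2 U3 ->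
  isLen U1 U3 k -> exists a b, [/\ isLen U1 U2 a, isLen U2 U3 b & k = (a + b)%N].
Proof.
move=> h1 h2 h3 h12 h23 hk.
have [|a _ ha] := isLen_bounded h1 h12 (k := k).
  by move=> n hn; apply: (proj2 hk); apply: has_chain_sub hn.
have [|b _ hb] := isLen_bounded h2 h23 (k := k).
  move=> n [C [c1 c2 c3 c4]]; apply: (proj2 hk); exists C; split=> // x /h12; exact: c2.
exists a, b; split=> //; apply: isLen_unique hk _.
exact: isLen_add h1 h2 h3 h12 h23 ha hb.
Qed.

Lemma chain_mono (C : nat -> V -> Prop) n : (forall i, (i < n)%N -> ltsub (C i) (C i.+1)) ->
  forall i j, (i <= j)%N -> (j <= n)%N -> lesub (C i) (C j).
Proof.
move=> h i j ij jn x; move: jn; rewrite -(subnK ij).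
elim: (j - i)%N => // l ih hl hx; have [le _] := h (l + i)%N hl.
by apply/le/ih => //; apply: ltnW.
Qed.

Lemma has_chain_nil U1 U2 n : lesub U2 U1 -> has_chain U1 U2 n -> n = 0%N.
Proof.
move=> h21 [C [c1 c2 c3 c4]]; case: n c1 c3 c4 => // n c1 c3 c4.
have [_ [x hx nx]] := c4 0%N isT; case: nx; apply/c2/h21/c3.
have : forall j, (j <= n)%N -> C j.+1 x.
  by elim=> // j ih hj; have [l _] := c4 j.+1 hj; apply/l/ih/ltnW.
exact.
Qed.

Lemma isLen_refl U1 U2 : issub U1 -> lesub U1 U2 -> lesub U2 U1 -> isLen U1 U2 0.
Proof.
move=> h1 h12 h21; split; first exact: has_chain0.
by move=> n /(has_chain_nil h21) ->.
Qed.

Lemma isLen_eq0 U1 U2 : issub U2 -> lesub U1 U2 -> isLen U1 U2 0 -> issub U1 -> lesub U2 U1.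
Proof.
move=> h2 h12 [_ h] h1 x hx; apply: contrapT => nx.
have : has_chain U1 U2 1.
  exists (fun i => if i is 0 then U1 else U2); split=> // [[|i]|[|i]] // _.
  by split=> //; exists x.
by move/h.
Qed.

Lemma mlengthE k : isLen (fun x => x = 0) (fun _ => True) k -> mlength V = k.
Proof.
move=> [[C [c1 _ _ c4]] hk]; apply: maxnatE.
  exists (fun i => mspan (C i) : submodClosed V) => i hi.
  have [l [x hx nx]] := c4 i hi; split.
    by move=> y /(mspanP y (c1 i (ltnW hi)))/l/(mspanP y (c1 _ hi)).
  by move=> /(_ x) h; apply: nx; apply/(mspanP x (c1 i (ltnW hi)))/h/(mspanP x (c1 _ hi)).
move=> n [U hU]; apply: hk; exists (fun i x => x \in U i); split=> //.
- by move=> i _; apply: issub_submod.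
- by move=> x ->; apply: rpred0.
move=> i hi; have [h1 h2] := hU i hi; split=> //.
apply: contrapT => no; apply: h2 => x hx; apply: contrapT => nx.
by apply: no; exists x => //; exact/negP.
Qed.
End Length.

(** Preimage and image identify the chains between T and T + f(Z) with those
    between Z /\ f^-1(T) and Z. The ring map g lets f be semilinear, for the
    comparison of lengths over two rings. *)
Lemma isLen_image (R S : nzRingType) (V : lmodType R) (W : lmodType S) (g : R -> S)
    (f : V -> W) (T : W -> Prop) (Z : V -> Prop) k :
  (forall b, exists a, g a = b) -> (forall x y, f (x + y) = f x + f y) ->
  (forall a x, f (a *: x) = g a *: f x) -> issub T -> issub Z ->
  isLen (fun z => Z z /\ T (f z)) Z k <->
  isLen T (addsub T (fun y => exists2 z, Z z & y = f z)) k.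
Proof.
move=> gS fD fZ hT hZ.
have f0 : f 0 = 0 by apply: (@addIr _ (f 0)); rewrite -fD !add0r.
have fB x y : f (x - y) = f x - f y by apply: (@addIr _ (f y)); rewrite -fD !subrK.
have img D : issub D -> issub (fun y => exists2 z, D z & y = f z).
  move=> [d0 dD dZ]; split; first by exists 0.
    by move=> _ _ [x hx ->] [y hy ->]; exists (x + y); rewrite ?fD //; apply: dD.
  by move=> b _ [x hx ->]; have [a <-] := gS b; exists (a *: x); rewrite ?fZ //; apply: dZ.
have pre C : issub C -> issub (fun z => Z z /\ C (f z)).
  move=> [c0 cD cZ]; have [z0 zD zZ] := hZ; split; first by rewrite f0.
    by move=> x y [? ?] [? ?]; rewrite fD; split; [apply: zD|apply: cD].
  by move=> a x [? ?]; rewrite fZ; split; [apply: zZ|apply: cZ].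
have to n : has_chain (fun z => Z z /\ T (f z)) Z n ->
    has_chain T (addsub T (fun y => exists2 z, Z z & y = f z)) n.
  move=> [D [d1 d2 d3 d4]]; have mono := chain_mono d4.
  exists (fun i => addsub T (fun y => exists2 z, D i z & y = f z)); split.
  - by move=> i hi; apply: issub_add hT (img _ (d1 i hi)).
  - by move=> y hy; apply: addsubl => //; apply/img/d1.
  - by move=> y [t ht [z hz e]]; exists t => //; exists z => //; apply: d3.
  move=> i hi; have [l [x hx nx]] := d4 i hi; split.
    by move=> y [t ht [z hz e]]; exists t => //; exists z => //; apply: l.
  exists (f x); first by apply: addsubr => //; exists x.
  move=> [t ht [z hz e]]; apply: nx; have si := d1 i (ltnW hi).
  rewrite -[x](subrK z); have [_ hD _] := si; apply: (hD) => //.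
  apply: (mono 0%N i (leq0n _) (ltnW hi)); apply: d2; split; last first.
    by rewrite fB -e subKr.
  apply: issubB => //; apply: d3; [apply: (mono i.+1 n)|apply: (mono i n)] => //.
  exact: ltnW.
have back n : has_chain T (addsub T (fun y => exists2 z, Z z & y = f z)) n ->
    has_chain (fun z => Z z /\ T (f z)) Z n.
  move=> [C [c1 c2 c3 c4]]; have mono := chain_mono c4.
  exists (fun i z => Z z /\ C i (f z)); split.
  - by move=> i hi; apply/pre/c1.
  - by move=> z [hz hf]; split=> //; apply: c2.
  - by move=> z [].
  move=> i hi; have [l [y hy ny]] := c4 i hi; split; first by move=> z [hz /l].
  have [t ht [z hz e]] : addsub T (fun y => exists2 z, Z z & y = f z) y.
    by apply: c3; apply: (mono i.+1 n).
  have tC j : (j <= n)%N -> C j t by move=> hj; apply: (mono 0%N j) => //; apply: c2.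
  exists z; first by split=> //; rewrite -e; apply: issubB; [exact: c1|by []|exact: tC].
  move=> [_ hf]; apply: ny; rewrite -[y](subrK t) e.
  by have [_ hD _] := c1 i (ltnW hi); apply: hD => //; apply: tC; apply: ltnW.
split=> -[h1 h2]; split; by [apply: to|apply: back|move=> n /back/h2|move=> n /to/h2].
Qed.

Lemma isLen_quotient (R S : nzRingType) (V : lmodType R) (W : lmodType S) (g : R -> S)
    (f : V -> W) (Z : V -> Prop) k :
  (forall b, exists a, g a = b) -> (forall x y, f (x + y) = f x + f y) ->
  (forall a x, f (a *: x) = g a *: f x) -> issub Z -> (forall y, exists2 z, Z z & f z = y) ->
  isLen (fun z => Z z /\ f z = 0) Z k <-> isLen (fun y : W => y = 0) (fun _ => True) k.
Proof.
move=> gS fD fZ hZ fS; rewrite (isLen_image k gS fD fZ issub0 hZ).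
have -> // : addsub (fun y => y = 0) (fun y => exists2 z, Z z & y = f z) = (fun _ => True).
apply/funext => y; apply/propext; split=> // _; exists 0 => //.
by have [z hz <-] := fS y; exists z; rewrite ?subr0.
Qed.

Section LocalLength.
Variables (R : comNzRingType) (m : R -> Prop) (lm : isloc m) (V : lmodType R).
Implicit Types U : V -> Prop.

Lemma isLen_simple U x : issub U -> (forall a, m a -> U (a *: x)) -> ~ U x ->
  isLen U (addsub U (span [:: x])) 1.
Proof.
move=> hU mx nx; have [pm um] := lm; have hs := issub_span [:: x].
have hA := issub_add hU hs.
split.
  apply: (has_chain_rcons hA (U2 := U)); last exact: has_chain0.
  split; first by move=> y; apply: addsubl.
  by exists x => //; apply: addsubr => //; apply: span_mem; rewrite inE.
move=> n [C [c1 c2 c3 c4]]; have mono := chain_mono c4; rewrite leqNgt; apply/negP => n2.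
have [l0 [y hy ny]] := c4 0%N (ltnW n2); have [l1 [z hz nz]] := c4 1%N n2.
have s1 := c1 1%N (ltnW n2); apply: nz.
have [u hu [a _ e]] := c3 y (mono 1%N n (ltnW n2) (leqnn _) y hy).
have na : ~ m a.
  move=> /mx hax; apply: ny; apply: c2; rewrite -[y](subrK u); have [_ hD _] := hU.
  by apply: hD => //; move/eqP: e; rewrite subr_eq0 => /eqP ->.
have cu t : U t -> C 1%N t by move=> /c2; apply: l0.
have cx : C 1%N x.
  have [b eb] := um a na; rewrite -[x]scale1r -eb -scalerA; have [_ _ hZ] := s1; apply: hZ.
  by move/eqP: e; rewrite subr_eq0 => /eqP <-; apply: issubB => //; apply: cu.
have [v hv [b _ e']] := c3 z (mono 2%N n n2 (leqnn _) z hz).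
have [_ hD hZ] := s1; rewrite -[z](subrK v); apply: hD; last exact: cu.
by move/eqP: e'; rewrite subr_eq0 => /eqP ->; apply: hZ.
Qed.

Lemma addsub_absorb U x : issub U -> U x -> addsub U (span [:: x]) = U.
Proof.
move=> hU hx; apply/funext => y; apply/propext; split; last first.
  by apply: addsubl; apply: issub_span.
case=> u hu h; rewrite -[y](subrK u); have [_ hD _] := hU; apply: hD => //.
by apply: (span_sub hU _ h) => z; rewrite inE => /eqP ->.
Qed.

Lemma addsub_cons U x s : issub U ->
  addsub (addsub U (span [:: x])) (span s) = addsub U (span (x :: s)).
Proof.
move=> hU; have hs := issub_span s; have hx := issub_span [:: x]; apply/funext => y; apply/propext; split.
  case=> z [u hu h1] h2; exists u => //; rewrite -[y](subrK z) -addrA.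
  have [_ hD _] := issub_span (x :: s); apply: hD.
    by apply: span_mono h2 => t ht; rewrite inE ht orbT.
  by apply: span_mono h1 => t; rewrite !inE => ->.
case=> u hu [a _ h]; exists (u + a *: x).
  by exists u => //; rewrite addrAC subrr add0r; exists a; rewrite //= subrr.
by rewrite opprD addrA.
Qed.

(** A composition series read off a list s: each entry contributes a step of
    length at most 1 over the span of the previous ones, and nsteps counts the
    proper steps. *)
Fixpoint steps U (s : seq V) : Prop :=
  if s is x :: s' then (forall a, m a -> U (a *: x)) /\ steps (addsub U (span [:: x])) s'
  else True.

Fixpoint nsteps U (s : seq V) : nat :=
  if s is x :: s' then (~~ `[< U x >] + nsteps (addsub U (span [:: x])) s')%N else 0%N.

Lemma isLen_steps U s : issub U -> steps U s -> isLen U (addsub U (span s)) (nsteps U s).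
Proof.
elim: s U => [|x s ih] U hU /=.
  move=> _; have -> : addsub U (span [::]) = U.
    apply/funext => y; apply/propext; split; last by apply: addsubl; apply: issub_span.
    by case=> u hu /eqP; rewrite subr_eq0 => /eqP ->.
  exact: isLen_refl.
move=> [mx hs]; have hx := issub_span [:: x]; have hA := issub_add hU hx.
have := ih _ hA hs; rewrite addsub_cons // => h2.
apply: (isLen_add hU hA _ _ _ _ h2).
- exact: issub_add hU (issub_span _).
- by move=> y; apply: addsubl.
- by rewrite -addsub_cons // => y; apply: addsubl; apply: issub_span.
- case: asboolP => [Ux|nx] /=; last exact: isLen_simple.
  by rewrite addsub_absorb //; apply: isLen_refl.
Qed.
End LocalLength.

Section LengthSum.
Variables (R : comNzRingType) (V W : lmodType R).
Variables (JV ZV : V -> Prop) (JW ZW : W -> Prop).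
Hypotheses (hJV : issub JV) (hZV : issub ZV) (JZV : lesub JV ZV).
Hypotheses (hJW : issub JW) (hZW : issub ZW) (JZW : lesub JW ZW).
Variables (r : nat) (phi : 'I_r -> {linear V -> W}).
Hypothesis phiZ : forall j z, ZV z -> ZW (phi j z).
Hypothesis phiJ : forall j z, JV z -> JW (phi j z).
Hypothesis phiS : forall y, ZW y -> exists z : 'I_r -> V,
  (forall j, ZV (z j)) /\ JW (y - \sum_j phi j (z j)).

(** ZW/JW is a quotient of the sum of r copies of ZV/JV. Filter it by the
    images of the first copies: each step is a quotient of ZV/JV, and the
    length is r times that of ZV/JV only if no step is smaller. *)
Lemma isLen_sum k : isLen JV ZV k -> exists2 l, isLen JW ZW l &
  l = (r * k)%N <-> forall z : 'I_r -> V, (forall j, ZV (z j)) ->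
    JW (\sum_j phi j (z j)) -> forall j, JV (z j).
Proof.
move=> hk.
pose T i (y : W) := exists z : 'I_r -> V, (forall j, ZV (z j)) /\
  JW (y - \sum_(j < r | (j < i)%N) phi j (z j)).
have [z0 zD zZ] := hZV; have [j0 jD jZ] := hJW.
have hT i : issub (T i).
  split.
  - exists (fun _ => 0); split=> //; rewrite big1 ?subr0 // => j _; exact: linear0.
  - move=> x y [a [ha hx]] [b [hb hy]]; exists (fun j => a j + b j); split.
      by move=> j; apply: zD.
    under eq_bigr do rewrite linearD; rewrite big_split opprD addrACA; exact: jD.
  - move=> c x [a [ha hx]]; exists (fun j => c *: a j); split; first by move=> j; apply: zZ.
    by under eq_bigr do rewrite linearZ; rewrite -scaler_sumr -scalerBr; apply: jZ.
have T0 : T 0%N = JW.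
  apply/funext => y; apply/propext; split=> [[z [hz]]|hy]; first by rewrite big1 // subr0.
  by exists (fun _ => 0); split=> [j|]; [exact: z0|rewrite big1 // subr0].
have Tr : T r = ZW.
  apply/funext => y; apply/propext; split=> [[z [hz hy]]|/phiS[z [hz hy]]].
    rewrite -[y](subrK (\sum_(j < r | (j < r)%N) phi j (z j))).
    have [_ wD _] := hZW; apply: (wD); first exact: JZW.
    by apply: issub_sum => // j _; apply/phiZ/hz.
  exists z; split=> //; congr JW: hy; congr (_ - _); apply: eq_bigl => j.
  by rewrite ltn_ord.
pose K (j : 'I_r) (z : V) := ZV z /\ T j (phi j z).
have TS (j : 'I_r) : T j.+1 = addsub (T j) (fun y => exists2 z, ZV z & y = phi j z).
  apply/funext => y; apply/propext.
  have split_sum (z : 'I_r -> V) : \sum_(i < r | (i < j.+1)%N) phi i (z i) =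
      \sum_(i < r | (i < j)%N) phi i (z i) + phi j (z j).
    rewrite (bigD1 j) /= ?ltnSn // addrC; congr (_ + _); apply: eq_bigl => i.
    by rewrite ltnS [RHS]ltn_neqAle andbC.
  split=> [[z [hz]]|[u [z [hz hu]] [z' hz' e]]].
    rewrite split_sum => hy; exists (y - phi j (z j)); last by rewrite subKr; exists (z j).
    by exists z; split=> //; rewrite -addrA -opprD [phi j _ + _]addrC.
  exists (fun i => if i == j then z' else z i); split; first by move=> i; case: ifP.
  rewrite split_sum eqxx -e.
  have -> : \sum_(i < r | (i < j)%N) phi i (if i == j then z' else z i) =
      \sum_(i < r | (i < j)%N) phi i (z i).
    by apply: eq_bigr => i; case: eqP => [->|//]; rewrite ltnn.
  by rewrite opprD opprB addrCA [y + _]addrC subrK addrC.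
have step (j : 'I_r) : exists2 a, isLen (T j) (T j.+1) a & (a <= k)%N /\
    (a = k <-> lesub (K j) JV).
  have JK : lesub JV (K j).
    move=> z hz; split; first exact: JZV.
    by exists (fun _ => 0); split=> //; rewrite big1 ?subr0 => [|i _]; [apply: phiJ|apply: linear0].
  have hK : issub (K j) by apply: issubI => //; apply: (issub_ker (phi j)).
  have [b [a [hb ha e]]] := isLen_sub hJV hK hZV JK (fun z => @proj1 _ _) hk.
  exists a; first by rewrite TS; apply/(isLen_image a (g := id) (f := phi j)) => //;
    [by move=> x; exists x|exact: linearD|by move=> c x; rewrite linearZ].
  rewrite e leq_addl; split=> //; split=> [ea|le].
    have b0 : b = 0%N by apply/eqP; rewrite -(eqn_add2r a) add0n -ea.
    by rewrite b0 in hb; apply: isLen_eq0 hK JK hb hJV.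
  by rewrite (isLen_unique hb (isLen_refl hJV JK le)).
have tot i : (i <= r)%N -> exists2 l, isLen JW (T i) l & (l <= i * k)%N /\
    (l = (i * k)%N <-> forall j : 'I_r, (j < i)%N -> lesub (K j) JV).
  elim: i => [|i ih] hi.
    exists 0%N; first by rewrite T0; apply: isLen_refl.
    by rewrite mul0n.
  have [l hl [lk el]] := ih (ltnW hi); have [a ha [ak ea]] := step (Ordinal hi).
  have TT : lesub (T i) (T i.+1).
    by rewrite (TS (Ordinal hi)) => y hy; apply: addsubl => //; apply: issub_im.
  have JT : lesub JW (T i).
    move=> y hy; exists (fun _ => 0); split=> [j|]; first exact: z0.
    by rewrite big1 ?subr0 // => j _; exact: linear0.
  exists (l + a)%N; first exact: isLen_add hJW (hT i) (hT i.+1) JT TT hl ha.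
  rewrite mulSn addnC; split; first exact: leq_add.
  split=> [e|h].
    have [el' ea'] : l = (i * k)%N /\ a = k.
      by move: e lk ak; move: (i * k)%N => q; lia.
    move=> j; rewrite ltnS leq_eqVlt => /predU1P[ji|]; last by apply: (proj1 el el').
    have -> : j = Ordinal hi by apply: val_inj.
    exact: (proj1 ea ea').
  rewrite (proj2 ea) ?(proj2 el) //; last by apply: (h (Ordinal hi)).
  by move=> j hj; apply: h; apply: ltnW.
have [l hl [_ el]] := tot r (leqnn _); exists l; first by rewrite -Tr.
rewrite el; split=> [h z hz|h j _ z [hz [y [hy hJ]]]].
  have Q i : (i <= r)%N -> JW (\sum_(j < r | (j < i)%N) phi j (z j)) ->
      forall j : 'I_r, (j < i)%N -> JV (z j).
    elim: i => // i ih hi; pose s := Ordinal hi.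
    rewrite (bigD1 s) /= ?ltnSn //.
    under eq_bigl => j do rewrite -val_eqE /= ltnS andbC -ltn_neqAle.
    move=> hJ; have Js : JV (z s).
      apply: (h s hi); split=> //; exists (fun j => - z j); split.
        by move=> j; apply: issubN.
      by under eq_bigr do rewrite linearN; rewrite sumrN opprK.
    have {}hJ : JW (\sum_(j < r | (j < i)%N) phi j (z j)).
      by apply: (issubDr hJW (phiJ s Js)); rewrite addrC.
    move=> j; rewrite ltnS leq_eqVlt => /predU1P[ji|]; last exact: (ih (ltnW hi) hJ).
    by have -> // : j = s; apply: val_inj.
  move=> hJ j; apply: (Q r (leqnn _)) => //.
  by congr JW: hJ; apply: eq_bigl => i; rewrite ltn_ord.
pose z' (i : 'I_r) := if i == j then z else if (i < j)%N then - y i else 0.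
have := h z'; rewrite /z' => /(_ _ _ j); rewrite eqxx; apply.
  by move=> i; case: ifP => // _; case: ifP => // _; apply: issubN.
rewrite (bigD1 j) //= eqxx; congr JW: hJ; congr (_ + _).
rewrite [RHS](bigID (fun i : 'I_r => (i < j)%N)) /= [X in _ = _ + X]big1 ?addr0; last first.
  by move=> i /andP[/negPf -> /negPf ->]; rewrite linear0.
rewrite -sumrN; apply: eq_big => [i|i ij].
  by rewrite andbC; case: ltnP => //= ij; rewrite -val_eqE neq_ltn ij.
by rewrite -val_eqE /= (ltn_eqF ij) ij linearN.
Qed.
End LengthSum.

(** * Comparison of congruence modules *)

Section KilledLength.
Variables (R : comNzRingType) (m : R -> Prop) (lm : isloc m) (V : lmodType R).
Implicit Types U : V -> Prop.

Lemma steps_killed U s : issub U -> (forall x a, x \in s -> m a -> U (a *: x)) -> steps m U s.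
Proof.
elim: s U => // x s ih U hU h; split; first by move=> a; apply: h; rewrite mem_head.
have hx := issub_span [:: x]; apply: ih; first exact: issub_add.
by move=> y a hy ma; apply: addsubl => //; apply: h; rewrite // inE hy orbT.
Qed.

Lemma isLen_killed U U' : issub U -> issub U' -> lesub U U' -> fg U' ->
  (forall a x, m a -> U' x -> U (a *: x)) -> exists l, isLen U U' l.
Proof.
move=> hU hU' le [s hs] h; exists (nsteps U s).
have <- : addsub U (span s) = U'.
  apply/funext => y; apply/propext; split=> [[u hu /hs hy]|/hs hy].
    by rewrite -[y](subrK u); have [_ hD _] := hU'; apply: hD => //; apply: le.
  exact: addsubr.
apply: (isLen_steps lm hU); apply: steps_killed => // x a xs ma.
by apply: h => //; apply/hs/span_mem.
Qed.

(** Filter by the submodules T i of the x with w^i x in U. *)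
Lemma isLen_nilpotent U U' p w k : noeth V -> issub U -> issub U' -> lesub U U' ->
  (forall a, m a -> exists b, p (a - b * w)) -> (forall a x, p a -> U' x -> U (a *: x)) ->
  (forall x, U' x -> U (w ^+ k *: x)) -> exists l, isLen U U' l.
Proof.
move=> nV hU hU' le hm hp hw; have [[u0 uD uZ] [_ _ uZ']] := (hU, hU').
pose T i x := U' x /\ U (w ^+ i *: x).
have hT i : issub (T i).
  apply: issubI => //; split; first by rewrite scaler0.
    by move=> x y hx hy; rewrite scalerDr; apply: uD.
  by move=> a x hx; rewrite scalerA mulrC -scalerA; apply: uZ.
have T0 : T 0%N = U.
  by apply/funext => x; rewrite /T expr0 scale1r; apply/propext; split=> [[]|hx] //; split; first exact: le.
have Tk : T k = U' by apply/funext => x; apply/propext; split=> [[]|hx] //; split; last exact: hw.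
have TS i : lesub (T i) (T i.+1).
  by move=> x [hx' hx]; split; rewrite // exprS -scalerA; apply: uZ.
suff [l] : exists l, isLen U (T k) l by rewrite Tk => ?; exists l.
have leU i : lesub U (T i) by elim: i => [|i ih]; [rewrite T0|move=> x /ih/TS].
elim: (k) => [|i [l hl]]; first by exists 0%N; rewrite T0; apply: isLen_refl.
have [|l' hl'] := isLen_killed (hT i) (hT i.+1) (TS i) (nV _ (hT i.+1)).
  move=> a x /hm[b hb] [hx' hx]; split; first exact: uZ'.
  rewrite -[a](subrK (b * w)) scalerDl scalerDr.
  apply: uD; first by rewrite scalerA mulrC -scalerA; apply: hp => //; apply: uZ'.
  by rewrite scalerA mulrCA -exprSr -scalerA; apply: uZ.
by exists (l + l')%N; apply: (isLen_add hU (hT i) (hT i.+1)).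
Qed.
End KilledLength.

Section Compare.
Variables (R : comNzRingType) (m p : R -> Prop) (w : R).
Hypotheses (nR : noeth R^o) (dq : dvr_quotient m p w).
Variables (N : lmodType R) (F : free_resolution N).
Hypothesis pN : forall a, p a -> forall x : N, a *: x = 0.
Arguments fml : simpl never.
Implicit Types X XP Y M : lmodType R.

(** X -> X/pX, up to isomorphism of the target *)
Definition reduction X XP (q : {linear X -> XP}) :=
  (forall y, exists x, q x = y) /\ forall x, q x = 0 <-> isum p (fun _ => True) x.

Lemma reduction_killed X XP (q : {linear X -> XP}) a (y : XP) : reduction q -> p a -> a *: y = 0.
Proof.
by move=> [qS qK] pa; have [x <-] := qS y; rewrite -linearZ; apply/qK; apply: isum1.
Qed.

(** The congruence module of X in degree c is the module of cocycles of
    Hom(F, X/pX) modulo this submodule: the cocycles that are, up to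
    coboundaries and torsion, reductions of cocycles of Hom(F, X). *)
Definition congr_sub X XP (q : {linear X -> XP}) c (z : cochain F XP c) :=
  ccl z /\ exists2 e : cochain F X c, ccl e & exists2 a, ~ p a & cob (a *: (z - fml F q c e)).

Lemma issub_congr X XP (q : {linear X -> XP}) c : issub (@congr_sub X XP q c).
Proof.
have pp := dq_prime dq; have [z0 zD zZ] := issub_ccl F XP c; have [e0 eD eZ] := issub_ccl F X c.
split.
- split=> //; exists 0 => //; exists 1; first by case: pp.
  by rewrite linear0 subrr scaler0; have [] := issub_cob F XP c.
- move=> x y [xc [e ec [a na ha]]] [yc [e' ec' [b nb hb]]]; split; first exact: zD.
  exists (e + e'); first exact: eD.
  exists (a * b); first exact: nprimeM.
  rewrite (linearD (fml F q c)) opprD addrACA scalerDr; apply: cobD.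
    by rewrite mulrC -scalerA; apply: cobZ.
  by rewrite -scalerA; apply: cobZ.
- move=> k x [xc [e ec [a na ha]]]; split; first exact: zZ.
  exists (k *: e); first exact: eZ.
  by exists a => //; rewrite linearZ -scalerBr scalerA mulrC -scalerA; apply: cobZ.
Qed.

Lemma congr_of_torsion X XP (q : {linear X -> XP}) c (z : cochain F XP c) a :
  ccl z -> ~ p a -> cob (a *: z) -> congr_sub q z.
Proof.
move=> zc na hz; split=> //; exists 0; first by have [] := issub_ccl F X c.
by exists a => //; rewrite linear0 subr0.
Qed.

Lemma ptors_cochain Y r (z : {ffun 'I_r -> Y}) : (forall k, ptors p (z k)) ->
  exists2 a, ~ p a & a *: z = 0.
Proof.
have pp := dq_prime dq => h.
have /choice[f hf] : forall k, exists a, ~ p a /\ a *: z k = 0.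
  by move=> k; have [a na e] := h k; exists a.
exists (\prod_k f k).
  elim/big_ind: _ => [|a b ha hb|k _]; [by case: pp|exact: nprimeM|by case: (hf k)].
apply/ffunP => k; rewrite !ffunE (bigD1 k) //= mulrC -scalerA.
by have [_ ->] := hf k; rewrite scaler0.
Qed.

Section Maps.
Variables (RP M MP : lmodType R) (qR : {linear R^o -> RP}) (qM : {linear M -> MP}).
Variables (r c : nat) (phi : 'I_r -> {linear R^o -> M}) (phiP : 'I_r -> {linear RP -> MP}).
Variable chi : 'I_r -> {linear MP -> RP}.
Hypothesis phiE : forall j a, phiP j (qR a) = qM (phi j a).
Hypothesis chiE : forall y, ptors p (y - \sum_j phiP j (chi j y)).

Lemma chi_cochain i (y : cochain F MP i) : exists2 a, ~ p a &
  a *: (y - \sum_j fml F (phiP j) i (fml F (chi j) i y)) = 0.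
Proof.
apply: ptors_cochain => k; have := chiE (y k); congr (ptors p _).
by rewrite !ffunE sum_ffunE; congr (_ - _); apply: eq_bigr => j _; rewrite !ffunE.
Qed.

(** The maps phi_j send r copies of the congruence module of R onto that of M,
    because every cocycle of Hom(F, M/pM) is up to torsion the combination of its
    coordinates chi_j. *)
Lemma congr_compare k : isLen (@congr_sub _ _ qR c) (@ccl R N F RP c) k ->
  exists2 l, isLen (@congr_sub _ _ qM c) (@ccl R N F MP c) l &
  l = (r * k)%N <-> forall z : 'I_r -> cochain F RP c, (forall j, ccl (z j)) ->
    congr_sub qM (\sum_j fml F (phiP j) c (z j)) -> forall j, congr_sub qR (z j).
Proof.
apply: isLen_sum.
- exact: issub_congr.
- exact: issub_ccl.
- by move=> z [].
- exact: issub_congr.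
- exact: issub_ccl.
- by move=> z [].
- by move=> j z; apply: fml_ccl.
- move=> j z [zc [e ec [a na ha]]]; split; first exact: fml_ccl.
  exists (fml F (phi j) c e); first exact: fml_ccl.
  exists a => //; have := fml_cob (phiP j) ha; congr cob.
  rewrite linearZ linearB; congr (_ *: (_ - _)); apply/ffunP => i.
  by rewrite !ffunE phiE.
move=> y yc; exists (fun j => fml F (chi j) c y); split; first by move=> j; apply: fml_ccl.
have [a na e] := chi_cochain y.
apply: (congr_of_torsion _ _ na); last by rewrite e; have [] := issub_cob F MP c.
apply: cclB => //; apply: issub_sum (issub_ccl F MP c) _ => j _.
exact/fml_ccl/fml_ccl.
Qed.
End Maps.
End Compare.

(** * Reduction of cocycles modulo p *)

Section Splitting.
Variables (R : comNzRingType) (m p : R -> Prop) (w : R).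
Hypotheses (nR : noeth R^o) (dq : dvr_quotient m p w).
Variables (N : lmodType R) (F : free_resolution N).
Hypothesis pN : forall a, p a -> forall x : N, a *: x = 0.
Arguments fml : simpl never.
Variables (ys : seq R) (s : R).
Hypotheses (pys : forall y, y \in ys -> p y) (ns : ~ p s).
Hypothesis sys : forall a, p a -> quoP ys R^o (s * a) = 0.
Local Notation c := (size ys).

Lemma Dp_Reg X : Reg ys X -> Dp m F c X -> Dp m F 0 (quo ys X).
Proof.
rewrite -[X in Dp _ _ X _]add0n; elim: (ys) (0%N) X => [|y zs ih] n X /=; first by rewrite addn0.
by move=> [hy hr] hD; apply: ih => //; apply: (Dp_quo hy); rewrite addnS in hD.
Qed.

Section Reduction.
Variables (X XP : lmodType R) (q : {linear X -> XP}).
Hypotheses (hq : reduction p q) (rX : Reg ys X) (DX : Dp m F c X).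

Lemma reduction_factor : exists g : {linear quo ys X -> XP},
  [/\ forall x, g (quoP ys X x) = q x, forall y, exists v, g v = y &
      forall v, g v = 0 -> s *: v = 0].
Proof.
have [qS qK] := hq.
have [|v|g hg] := @lin_factor _ _ _ _ (quoP ys X) q; first exact: quoP_surj.
  apply: (quoP_ker (U := fun v => q v = 0)); first exact: issub_ker issub0.
  by move=> y u /pys py; apply/qK/isum1.
exists g; split=> // [y|v].
  by have [x <-] := qS y; exists (quoP ys X x).
have [x <-] := quoP_surj v; rewrite hg => /qK.
apply: (@isum_sub _ _ _ _ (fun x => s *: quoP ys X x = 0)).
  exact: (issub_ker (lcomp (scl _ s) (quoP ys X)) issub0).
by move=> a u pa _; rewrite linearZ; apply: quo_p_torsion sys pa.
Qed.

(** Reduction modulo p is injective on Ext^c modulo torsion: the elements ys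
    are divided out one by one, and R/(ys) differs from R/p by s-torsion. *)
Lemma cob_of_reduction e a : ccl e -> ~ p a -> cob (a *: fml F q c e) -> cob e.
Proof.
move=> ec na; have [g [gE gS gK]] := reduction_factor.
rewrite -linearZ -(fml_comp (f := quoP ys X) (g := g)) // => h.
have ec' := cclZ a ec.
have := red_kernel_inj gS gK (fml_ccl _ ec') h; rewrite -linearZ scalerA => h'.
apply: (Dp_torsion_free dq pN DX (nprimeM (dq_prime dq) ns na)) => //.
by apply: (red_inj pN rX pys) => //; apply: cclZ.
Qed.

(** Up to s, a cocycle of Hom(F, X/pX) comes from X/(ys)X, and from there it
    lifts to X because the higher Ext groups vanish. *)
Lemma reduction_surj z : (forall i, (c < i)%N -> Fvan F i X) -> ccl z ->
  @congr_sub _ p N F X XP q c (s *: z).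
Proof.
move=> hv zc; have [g [gE gS gK]] := reduction_factor.
have [y yc hy] := red_kernel_surj gS gK zc.
have [e ec he] := red_surj rX hv yc.
split; first exact: cclZ.
exists e => //; exists 1; first by have [_ n1 _] := dq_prime dq.
rewrite scale1r -hy -(fml_comp (f := quoP ys X) (g := g)) // -linearB -opprB linearN.
exact/(issubN (issub_cob F XP c))/fml_cob.
Qed.

(** It is killed by p and by s, hence by p and a power of w. *)
Lemma congr_finite : fgm X -> (forall i, (c < i)%N -> Fvan F i X) ->
  exists k, isLen (@congr_sub _ p N F X XP q c) (@ccl _ N F XP c) k.
Proof.
move=> hX hv; have [k [u [nu hu]]] := dq_val dq ns.
have fXP : fgm XP by apply: (fgm_surj (f := q)) => //; case: hq.
have hC := issub_congr dq F q c; have [_ uZ] := dq_loc dq; have [_ cD cZ] := hC.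
have pz a z : p a -> ccl z -> @congr_sub _ p N F X XP q c (a *: z).
  move=> pa zc; apply: (@congr_of_torsion _ _ _ F X XP q c _ 1).
  - exact: cclZ.
  - by have [_ n1 _] := dq_prime dq.
  - by rewrite scale1r; exact: (p_cob pN pa zc).
apply: (isLen_nilpotent (dq_loc dq) (p := p) (w := w) (k := k)) => //.
- by apply: noeth_fgm nR _; apply: fgm_ffun.
- exact: issub_ccl.
- by move=> z [].
- exact: dq_max dq.
move=> z zc; have [v ev] := uZ u nu.
rewrite -[_ *: z]scale1r -ev -scalerA; apply: cZ; rewrite scalerA.
rewrite -[u * _](subKr s) scalerBl; apply: (issubB hC); last exact: pz.
exact: reduction_surj.
Qed.
End Reduction.
End Splitting.

(** * Splitting off a free summand *)

Section Summand.
Variables (R : comNzRingType) (m p : R -> Prop) (w : R).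
Hypotheses (nR : noeth R^o) (dq : dvr_quotient m p w).
Variables (N : lmodType R) (F : free_resolution N).
Hypothesis pN : forall a, p a -> forall x : N, a *: x = 0.
Hypothesis Ncyc : exists e : N, (forall x, exists a, x = a *: e) /\ forall a, a *: e = 0 -> p a.
Arguments fml : simpl never.
Variables (M : lmodType R) (fM : fgm M) (ys : seq R) (s : R).
Hypothesis gs : good_sequence m p F M ys s.
Local Notation c := (size ys).
Let pys := gs_p gs.
Let ns := gs_s gs.
Let sys := gs_gen gs.

(* n_1, .., n_r in M is a basis of M/pM modulo torsion, with coordinates chi *)
Variables (RP MP : lmodType R) (qR : {linear R^o -> RP}) (qM : {linear M -> MP}).
Hypotheses (redR : reduction p qR) (redM : reduction p qM).
Variables (r : nat) (n : 'I_r -> M) (chi : 'I_r -> {linear MP -> RP}).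
Hypothesis n_gen : forall y, exists a : 'I_r -> R, ptors p (y - \sum_j a j *: qM (n j)).
Hypothesis chiE : forall y (a : 'I_r -> R), ptors p (y - \sum_j a j *: qM (n j)) ->
  forall j, chi j y = qR (a j).

Lemma reduction_ring a : qR a = 0 <-> p a.
Proof.
have [pI _ _] := dq_prime dq; have [_ ->] := redR; split=> [|pa].
  apply: (isum_sub (U := p : R^o -> Prop) pI) => b v pb _.
  by rewrite -[b *: v]/(b * v) mulrC; apply: idlM.
by rewrite -[a]mulr1 -[a * 1]/(a *: (1 : R^o)); apply: isum1.
Qed.

Lemma chi_comb (a : 'I_r -> R) j : chi j (qM (\sum_i a i *: n i)) = qR (a j).
Proof.
apply: chiE; rewrite linear_sum.
under [X in X - _]eq_bigr do rewrite linearZ.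
by rewrite subrr; have [] := issub_ptors dq MP.
Qed.

Lemma reduced_maps : exists phiP : 'I_r -> {linear RP -> MP},
  forall j a, phiP j (qR a) = qM (mulv (n j) a).
Proof.
have [qS _] := redR.
suff /choice[f hf] : forall j, exists f : {linear RP -> MP}, forall a, f (qR a) = qM (mulv (n j) a).
  by exists f.
move=> j; apply: (lin_factor (g := qR) (f := lcomp qM (mulv (n j)))) => // a /reduction_ring pa.
by rewrite /= linearZ; apply: (reduction_killed _ redM).
Qed.

Lemma generate_locally : exists2 u, ~ p u & forall x, exists a : 'I_r -> R,
  u *: x = \sum_j a j *: n j.
Proof.
pose U x := exists a : 'I_r -> R, x = \sum_j a j *: n j.
have hU : issub U.
  split.
  - by exists (fun _ => 0); rewrite big1 // => j _; rewrite scale0r.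
  - move=> _ _ [a ->] [b ->]; exists (fun j => a j + b j).
    by rewrite -big_split; apply: eq_bigr => j _; rewrite scalerDl.
  - move=> k _ [a ->]; exists (fun j => k * a j).
    by rewrite scaler_sumr; apply: eq_bigr => j _; rewrite scalerA.
have [|u nu hu] := nakayama (P := fun _ => True) (dq_prime dq) hU (noeth_fgm nR fM issubT).
  move=> x _; have [a [b nb]] := n_gen (qM x); have [_ qK] := redM.
  have -> : qM x - \sum_j a j *: qM (n j) = qM (x - \sum_j a j *: n j).
    by rewrite linearB (linear_sum qM); congr (_ - _); apply: eq_bigr => j _; rewrite linearZ.
  rewrite -linearZ => /qK h; exists b => //; exists (b *: (x - \sum_j a j *: n j)) => //.
  rewrite scalerBr opprB addrC subrK; exists (fun j => b * a j).
  by rewrite scaler_sumr; apply: eq_bigr => j _; rewrite scalerA.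
by exists u => // x; apply: hu.
Qed.

Lemma independent_locally (a : 'I_r -> R) : \sum_j a j *: n j = 0 ->
  forall j, exists2 u, ~ p u & u * a j = 0.
Proof.
move=> e j; have [f hf] := rV_linear n.
have [||u nu /rowP/(_ j)] := injective_mod_regular nR (dq_prime dq) (fgm_rV R r) (gs_M gs) pys (f := f) _ (v := \row_j a j); last first.
- by rewrite !mxE => eu; exists u.
- by rewrite hf -[RHS]e; apply: eq_bigr => i _; rewrite mxE.
move=> v hv; exists s => //.
have pv i : p (v 0 i).
  apply/reduction_ring; rewrite -(chi_comb (fun i => v 0 i)) -hf.
  have [g [gE _ _]] := reduction_factor pys sys redM.
  by rewrite -gE hv !linear0.
rewrite [v]row_sum_delta !linear_sum big1 // => i _.
by rewrite 2!linearZ /=; apply: quo_p_torsion sys _.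
Qed.

(** ** Cocycles of maximal length *)

Variable phiP : 'I_r -> {linear RP -> MP}.
Hypothesis phiPE : forall j a, phiP j (qR a) = qM (mulv (n j) a).

Lemma phiP_chi y : ptors p (y - \sum_j phiP j (chi j y)).
Proof.
have [a ha] := n_gen y; congr (ptors p (y - _)): (ha); apply: eq_bigr => j _.
by rewrite (chiE ha) phiPE /= linearZ.
Qed.

Hypothesis lift_basis : forall z : 'I_r -> cochain F RP c, (forall j, ccl (z j)) ->
  congr_sub p qM (\sum_j fml F (phiP j) c (z j)) -> forall j, congr_sub p qR (z j).

(** By lift_basis the coordinates of the reduction of e lift to cocycles with
    values in R. The corresponding combination differs from e by a cocycle whose
    reduction is torsion, and cob_of_reduction applies. *)
Lemma cocycle_comb (e : cochain F M c) : ccl e -> exists2 e' : 'I_r -> cochain F R^o c,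
  forall j, ccl (e' j) & cob (e - \sum_j fml F (mulv (n j)) c (e' j)).
Proof.
move=> ec; have pp := dq_prime dq.
pose z j := fml F (chi j) c (fml F qM c e).
have zc j : ccl (z j) by apply/fml_ccl/fml_ccl.
have [a na ha] := chi_cochain dq phiP_chi (fml F qM c e).
have hz : congr_sub p qM (\sum_j fml F (phiP j) c (z j)).
  split.
    by apply: issub_sum (issub_ccl F MP c) _ => j _; apply: fml_ccl.
  exists e => //; exists a => //; rewrite -opprB scalerN ha oppr0.
  by have [] := issub_cob F MP c.
have hj := lift_basis zc hz.
have /choice[f hf] : forall j, exists f : cochain F R^o c * R,
    [/\ ccl f.1, ~ p f.2 & cob (f.2 *: (z j - fml F qR c f.1))].
  by move=> j; have [_ [e' ec' [b nb hb]]] := hj j; exists (e', b).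
exists (fun j => (f j).1); first by move=> j; have [] := hf j.
have ec' : ccl (e - \sum_j fml F (mulv (n j)) c (f j).1).
  apply: cclB => //; apply: issub_sum (issub_ccl F M c) _ => j _.
  by apply: fml_ccl; have [] := hf j.
pose b := \prod_j (f j).2.
have nb : ~ p (a * b).
  apply: nprimeM => //; rewrite /b; elim/big_ind: _ => [|x y hx hy|j _]; first by case: pp.
    exact: nprimeM.
  by have [] := hf j.
apply: (cob_of_reduction dq pN pys ns sys redM (gs_M gs) (gs_DM gs) ec' nb).
have -> : fml F qM c (e - \sum_j fml F (mulv (n j)) c (f j).1) =
    (fml F qM c e - \sum_j fml F (phiP j) c (z j)) +
    \sum_j fml F (phiP j) c (z j - fml F qR c (f j).1).
  under [X in _ = _ + X]eq_bigr do rewrite linearB.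
  rewrite sumrB addrA subrK linearB linear_sum; congr (_ - _); apply: eq_bigr => j _.
  by apply/ffunP => k; rewrite !ffunE phiPE.
rewrite scalerDr; apply: cobD.
  by rewrite mulrC -scalerA ha scaler0; have [] := issub_cob F MP c.
rewrite scaler_sumr; apply: issub_sum (issub_cob F MP c) _ => j _.
rewrite -linearZ; apply: fml_cob; rewrite /b (bigD1 j) //= mulrCA mulrC -scalerA.
by rewrite -scalerA; apply/cobZ/cobZ; have [] := hf j.
Qed.

(** ** Duality *)

Variables (J : injective_resolution R) (vs : seq R).
Hypotheses (hJ : ext_bound J (size vs)) (ct : size vs = c.+1).
Hypotheses (mvs : forall x, x \in vs -> m x) (rvs : Reg vs M).
Local Notation E := (ir_mod J).
Hypothesis top_m : ~ van J c.+1 (cyclic m).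

Section Dual.
Variable psi : 'I_r -> {linear quo ys R^o -> quo ys M}.
Hypothesis psiE : forall j a, psi j (quoP ys R^o a) = quoP ys M (mulv (n j) a).

(** Hom(R/p, X), as a submodule of X *)
Definition kil (X : lmodType R) (x : X) := forall a, p a -> a *: x = 0.

Lemma issub_kil (X : lmodType R) : issub (@kil X).
Proof.
split=> [a _|x y hx hy a pa|k x hx a pa]; first exact: scaler0.
  by rewrite scalerDr hx // hy // addr0.
by rewrite scalerA mulrC -scalerA hx // scaler0.
Qed.

(** Rees' isomorphism carries cocycle_comb over to M/(ys)M. *)
Lemma kil_comb v : kil v -> exists2 b : 'I_r -> quo ys R^o, forall j, kil (b j) &
  v = \sum_j psi j (b j).
Proof.
move=> hv; have [al [be hab]] := degree0 F pN Ncyc; have [h1 h2 _] := hab (quo ys M).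
have [e ec re] := Rees_ex (gs_M gs) (h1 v hv).
have [e' ec' he] := cocycle_comb ec.
have /choice[z hz] : forall j, exists z : cochain F (quo ys R^o) 0, ccl z /\ Rees z (e' j).
  by move=> j; have [z zc rz] := Rees_surj pN (gs_R gs) pys (ec' j); exists z.
have re2 : Rees ([ffun k => al k *: v] - \sum_j fml F (psi j) 0 (z j))
    (e - \sum_j fml F (mulv (n j)) c (e' j)).
  elim/big_rec2: _ => [|j x y _ rxy]; first by rewrite !subr0.
  have := Rees_lin (-1) (Rees_nat (psiE j) (proj2 (hz j))) rxy.
  by rewrite !scaleN1r addrCA -opprD addrCA -opprD.
have := Rees_inj (gs_M gs) (proj1 (gs_DM gs)) re2 he => /eqP; rewrite subr_eq0 => /eqP e0.
have [_ _ h3] := hab (quo ys R^o).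
exists (fun j => \sum_k be k *: z j k).
  by move=> j a pa; have [h _] := h3 (z j) (proj1 (hz j)); apply: h.
rewrite -(h2 v hv); under eq_bigr => k _ do rewrite -scalerA.
transitivity (\sum_k be k *: (\sum_j fml F (psi j) 0 (z j)) k).
  by rewrite -e0; apply: eq_bigr => k _; rewrite ffunE.
under eq_bigr do rewrite sum_ffunE scaler_sumr.
rewrite exchange_big; apply: eq_bigr => j _; rewrite linear_sum.
by apply: eq_bigr => k _; rewrite linearZ ffunE.
Qed.

Lemma kil_torsion_free (X : lmodType R) (v : X) a : Dp m F 0 X -> kil v -> ~ p a -> a *: v = 0 -> v = 0.
Proof.
move=> hD pv na av; have [al [be /(_ X)[h1 h2 _]]] := degree0 F pN Ncyc.
have h : cob ([ffun k => al k *: v] : cochain F X 0).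
  apply: (Dp_torsion_free dq pN hD na (h1 v pv)); rewrite /cob /=; apply/ffunP => k.
  by rewrite !ffunE scalerA mulrC -scalerA av scaler0.
rewrite -(h2 v pv) big1 // => k _; rewrite /cob /= in h.
by move/ffunP/(_ k): h; rewrite !ffunE -scalerA => ->; rewrite scaler0.
Qed.


(** X modulo the elements killed by p has no socle, because X has none; so it
    has positive depth. *)
Lemma van_kil (X : lmodType R) : fgm X -> Dp m F 0 X -> van J c.+1 (Qt (@kil X)).
Proof.
move=> hX hD; have [lm _ pm _ _ _ _] := dq; have [[mI _ _] _] := lm.
have [|w0 mw0 rw0] := @regular_in_coset R (Qt (@kil X)) m 0 nR (noeth_fgm nR (fgm_qt _ hX)) mI.
  move=> v; have [x <-] := qpi_surj v => h; apply/(qpi0 _ (issub_kil X)) => a pa.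
  apply: (Dp0_socle dq pN Ncyc hD) => b mb; rewrite scalerA mulrC -scalerA.
  by have := h b mb; rewrite -linearZ => /(qpi0 _ (issub_kil X)); apply.
rewrite add0r in rw0.
apply: (van_depth nR lm hJ (xs := [:: w0])) => //.
- by move=> x; rewrite inE => /eqP ->.
- exact: fgm_qt.
- by rewrite ct addn1.
Qed.

Let DR := Dp_Reg (gs_R gs) (gs_DR gs).
Variable hR : {linear quo ys R^o -> E (shft ys 0)}.
Hypothesis ThR : Theta (ir_aug J) hR.
Local Notation B := (quo ys R^o).

Let shft_c : shft ys 0 = c. Proof. by rewrite shftE. Qed.

Lemma fgm_quo_ring : fgm B. Proof. exact: fgm_quo (fgm_ring R). Qed.

Lemma cyc_aug (k : {linear R^o -> E 0}) : cyc k -> exists a, forall x, k x = a *: ir_aug J x.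
Proof.
move=> kc; have /ir_ex0[a ha] := kc 1; exists a => x.
by rewrite -[x in LHS]mulr1 -[x * 1]/(x *: (1 : R^o)) !linearZ ha -!linearZ -[a *: x]/(a * x) mulrC.
Qed.

(** Let L be the submodule of R/(ys) killed by p. If the restriction of hR to L
    were a coboundary, Ext^c(L, R) would vanish, because every class comes from
    R/(ys) and is a multiple of hR there. As w is regular on L, this propagates
    to Ext^{c+1}(L/wL, R), hence to the residue field, which sits inside L/wL. *)
Lemma dual_class : ~ bnd (fun v : Sb (@kil B) => hR (sbi (@kil B) v)).
Proof.
move=> hb; have [lm pp pm mw nw gm _] := dq; have fB := fgm_quo_ring.
have hk := issub_kil B; apply: top_m.
have vL : van J (shft ys 0) (Sb (@kil B)).
  move=> f fc; have [|f2 f2c e2] := van_extend (ses_qt hk) _ fc.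
    by rewrite shft_c; apply: van_kil.
  have [|k kc tk] := Theta_surj (gs_R gs) _ f2c; first by case=> // i _; apply: van_ring.
  have [a ha] := cyc_aug kc; have hf0 : bnd (fun x => (- a) *: ir_aug J x + k x).
    by move=> x; rewrite ha scaleNr addNr.
  have /(bnd_comp (sbi (@kil B))) hf := Theta_bnd (gs_R gs) (Theta_lin (- a) ThR tk) hf0.
  by apply: eq_bnd (bndD hf (bndZ a hb)) => u /=; rewrite e2 addrAC scaleNr addNr add0r.
have nL : noeth B by apply: noeth_fgm.
have fL : fgm (Sb (@kil B)) by apply: fgm_sub.
have kL (v : Sb (@kil B)) a : p a -> a *: v = 0.
  by move=> pa; apply: (@sbi_inj _ _ (@kil B)); rewrite linearZ linear0; apply: (sbi_mem v hk).
have rw : reg_on (Sb (@kil B)) w.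
  move=> v e; apply: (@sbi_inj _ _ (@kil B)); rewrite linear0.
  apply: (kil_torsion_free DR (sbi_mem v hk) nw).
  by rewrite -linearZ e linear0.
have v1 : van J c.+1 (Sb (@kil B)).
  apply: (van_depth nR lm hJ (xs := [:: w])) => //; last by rewrite ct addn1.
  by move=> x; rewrite inE => /eqP ->.
have vQ : van J c.+1 (Qt (@mulim R (Sb (@kil B)) w)).
  by apply: (van_right (ses_scl rw)) => //; rewrite -shft_c.
have [v v0] : exists v : Qt (@mulim R (Sb (@kil B)) w), v <> 0.
  apply: contrapT => no; have h0 (v : Qt (@mulim R (Sb (@kil B)) w)) : v = 0.
    by apply: contrapT => v0; apply: no; exists v.
  have hL (v : Sb (@kil B)) : v = 0.
    apply: (nakayama_loc (V := Sb (@kil B)) (P := fun _ => True) lm issub0 (noeth_fgm nR fL issubT)) => // {}v _.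
    have /qpi0[|v' ->] := h0 (qpi (@mulim R (Sb (@kil B)) w) v); first exact: issub_mulim.
    by exists (w *: v'); [apply: isum1|rewrite subrr].
  have : kil (s *: quoP ys R^o 1).
    by move=> a pa; rewrite scalerA mulrC -scalerA; apply: quo_p_torsion sys pa.
  case/(sbiP _ hk) => u; rewrite (hL u) linear0 -linearZ => /(quo_sub_p dq pys).
  by rewrite -[s *: _]/(s * 1) mulr1.
have [pmm um] := lm; have [im _ _] := pmm.
have mv a : m a -> a *: v = 0.
  have [u <-] := qpi_surj v; move=> /gm[b hbw].
  have wu : w *: qpi (@mulim R (Sb (@kil B)) w) u = 0.
    by rewrite -linearZ; apply/qpi0; [exact: issub_mulim|exists u].
  by rewrite -[a](subrK (b * w)) scalerDl -scalerA wu scaler0 addr0 -linearZ kL // linear0.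
apply: (van_residue lm v0 mv vQ); apply: hJ; first by rewrite ct.
exact/fgm_qt/fgm_qt.
Qed.

Hypothesis hRc : cyc hR.

(** The coordinates on the elements of M/(ys)M killed by p, followed by hR,
    extend to M/(ys)M and come from linear forms on M. These are dual to the
    n_j modulo m, since otherwise a unit multiple of hR would be a coboundary. *)
Lemma dual_forms : exists g : 'I_r -> {linear M -> R^o},
  forall i j, m ((g i (n j) : R) - (i == j)%:R).
Proof.
have [[pmm um] _ _ _ _ _ _] := dq; have hB := issub_kil B; have hY := issub_kil (quo ys M).
have [gB [gBE _ gBK]] := reduction_factor pys sys redR.
have [gY [gYE _ _]] := reduction_factor pys sys redM.
have gBI b : kil b -> gB b = 0 -> b = 0 by move=> kb /gBK; apply: kil_torsion_free DR kb ns.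
have chiY i j b : chi i (gY (psi j b)) = (i == j)%:R *: gB b.
  have [a <-] := quoP_surj b; rewrite psiE gYE gBE.
  have -> : mulv (n j) a = \sum_k ((k == j)%:R * a) *: n k.
    by rewrite (bigD1 j) //= eqxx mul1r big1 ?addr0 // => k /negPf ->; rewrite mul0r scale0r.
  by rewrite chi_comb -linearZ.
suff /choice[g hg] : forall i, exists g : {linear M -> R^o}, forall j, m ((g (n j) : R) - (i == j)%:R).
  by exists g.
move=> i.
have [||dl hdl] := @lin_lift _ _ _ _ (lcomp gB (sbi (@kil B)))
    (lcomp (lcomp (chi i) gY) (sbi (@kil (quo ys M)))).
- move=> u v e; apply: (@sbi_inj _ _ (@kil B)); apply/eqP; rewrite -subr_eq0 -linearB; apply/eqP.
  by apply: gBI; [exact: sbi_mem|rewrite !linearB; apply/eqP; rewrite subr_eq0; apply/eqP].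
- move=> v; have [b kb e] := kil_comb (sbi_mem v hY).
  have /(sbiP _ hB)[u hu] := kb i; exists u.
  change (chi i (gY (sbi (@kil (quo ys M)) v)) = gB (sbi (@kil B) u)).
  rewrite -hu e !linear_sum (bigD1 i) //=.
  rewrite chiY eqxx scale1r big1 ?addr0 // => k.
  by rewrite chiY eq_sym => /negPf ->; rewrite scale0r.
have [||k kc ek] := van_extend (ses_qt hY) (h := lcomp hR (lcomp (sbi (@kil B)) dl)).
- rewrite shft_c; apply: van_kil; [exact: fgm_quo|exact: Dp_Reg (gs_M gs) (gs_DM gs)].
- by move=> v; apply: hRc.
have [lm _ _ _ _ _ _] := dq.
have [|ka kac tk] := Theta_surj (gs_M gs) _ kc.
  case=> // l _; apply: (van_depth nR lm hJ mvs fM rvs).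
  by rewrite addSn ltnS leq_addl.
have [|g hg] := @lin_lift _ _ _ _ (ir_aug J) ka (@ir_augI _ J).
  by move=> v; apply/ir_ex0.
exists g => j; set a := (g (n j) : R); apply: contrapT => /um[b eb]; apply: dual_class.
have t2 := Theta_lin (- a) ThR (Theta_nat (psiE j) tk).
have z2 : bnd (fun x => (- a) *: ir_aug J x + ka (mulv (n j) x)).
  move=> x; rewrite -hg (_ : g (mulv (n j) x) = (x * a : R)); last exact: linearZ.
  by rewrite -linearZ -linearD -[- a *: x]/(- a * x) mulNr mulrC addNr linear0.
have := bnd_comp (sbi (@kil B)) (Theta_bnd (gs_R gs) t2 z2) => h.
apply: eq_bnd (bndZ (- b) h) => u.
change ((- b) *: ((- a) *: hR (sbi (@kil B) u) + k (psi j (sbi (@kil B) u))) = hR (sbi (@kil B) u)).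
have ku := sbi_mem u hB; have kpsi : kil (psi j (sbi (@kil B) u)).
  by move=> x px; rewrite -linearZ ku // linear0.
have [v ev] := proj1 (sbiP _ hY) kpsi; rewrite ev ek.
have dlv : sbi (@kil B) (dl v) = (i == j)%:R *: sbi (@kil B) u.
  have h1 : gB (sbi (@kil B) (dl v)) = chi i (gY (sbi (@kil (quo ys M)) v)) := hdl v.
  apply/eqP; rewrite -subr_eq0; apply/eqP/gBI.
    by apply: (issubB hB (sbi_mem _ hB)); have [_ _ hZ] := hB; apply: hZ.
  by rewrite (linearB gB) linearZ h1 -ev chiY subrr.
have -> : lcomp hR (lcomp (sbi (@kil B)) dl) v = (i == j)%:R *: hR (sbi (@kil B) u).
  by rewrite -linearZ -dlv.
by rewrite -scalerDl scalerA mulNr -mulrN opprD opprK -/a eb scale1r.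
Qed.

End Dual.

(** The matrix of the dual forms is the identity modulo m, hence invertible, so
    that n_1, .., n_r span a free direct summand. *)
Lemma free_summand : exists W : lmodType R, miso M ('rV[R]_r * W)%type /\
  forall v : W, exists2 u, ~ p u & u *: v = 0.
Proof.
have [lm _ _ _ _ _ _] := dq; have [pmm um] := lm; have [im nm1 _] := pmm.
have /choice[psi psiE] : forall j, exists f : {linear quo ys R^o -> quo ys M},
    forall a, f (quoP ys R^o a) = quoP ys M (mulv (n j) a).
  by move=> j; apply: quo_map.
have [|hR hRc ThR] := @Theta_ex _ J ys _ 0 (ir_aug J) (gs_R gs).
  by move=> v; apply/ir_ex0; exists v.
have [g hg] := dual_forms psiE ThR hRc.
pose G : 'M[R]_r := \matrix_(j, i) g i (n j).
have [b eb] : exists b, b * \det G = 1.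
  apply: um => hm; apply: nm1.
  have := det_mod (A := G) (B := 1%:M) im; rewrite det1 => h1.
  rewrite -[1](subKr (\det G)); apply: (@issubB _ R^o m) => //; apply: h1 => i j.
  by rewrite !mxE eq_sym; apply: hg.
have [f hf] := rV_linear n.
have lP : linear (fun x => (\row_i (g i x : R)) *m (b *: \adj G)).
  move=> a x y; rewrite scalemxAl -mulmxDl; congr (_ *m _); apply/rowP => i.
  by rewrite !mxE linearP.
pose pr : {linear M -> 'rV[R]_r} := mklin lP.
have prf v : pr (f v) = v.
  have -> : pr (f v) = v *m G *m (b *: \adj G).
    congr (_ *m _); apply/rowP => i; rewrite !mxE hf linear_sum.
    by apply: eq_bigr => j _; rewrite linearZ mxE.
  by rewrite -scalemxAr -mulmxA mul_mx_adj mul_mx_scalar scalerA eb scale1r.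
have hW := issub_ker pr issub0; pose W := Sb (fun x => pr x = 0).
have resP x : pr (x - f (pr x)) = 0 by rewrite linearB prf subrr.
have l2 : linear (fun x => x - f (pr x)).
  by move=> a x y; rewrite (linearP pr) (linearP f) opprD addrACA -scalerBr.
have [|res hres] := @lin_lift _ _ _ _ (sbi (fun x => pr x = 0)) (mklin l2) (@sbi_inj _ _ _).
  by move=> x; apply/(sbiP _ hW)/resP.
exists W; split.
  have l3 : linear (fun x => (pr x, res x) : ('rV[R]_r * W)%type).
    by move=> a x y; rewrite (linearP pr) (linearP res).
  exists (mklin l3); exists (fun v => f v.1 + sbi (fun x => pr x = 0) v.2) => [x|[v x]].
    change (f (pr x) + sbi (fun x => pr x = 0) (res x) = x).
    by rewrite hres /= addrC subrK.
  have hx : pr (sbi (fun x => pr x = 0) x) = 0 := sbi_mem x hW.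
  have e1 : pr (f v + sbi (fun x => pr x = 0) x) = v by rewrite linearD prf hx addr0.
  change ((pr (f v + sbi (fun x => pr x = 0) x), res (f v + sbi (fun x => pr x = 0) x)) = (v, x)).
  congr (_, _); first exact: e1.
  apply: (@sbi_inj _ _ (fun x => pr x = 0)); rewrite hres.
  change (f v + sbi (fun x => pr x = 0) x - f (pr (f v + sbi (fun x => pr x = 0) x)) = sbi (fun x => pr x = 0) x).
  by rewrite e1 addrC addKr.
have [u nu hu] := generate_locally; move=> x; exists u => //.
have [a ha] := hu (sbi (fun x => pr x = 0) x).
apply: (@sbi_inj _ _ (fun x => pr x = 0)).
transitivity (u *: sbi (fun x => pr x = 0) x); first exact: linearZ.
rewrite linear0 ha.
have <- : f (\row_j a j) = \sum_j a j *: n j.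
  by rewrite hf; apply: eq_bigr => j _; rewrite mxE.
have e : pr (u *: sbi (fun x => pr x = 0) x) = 0.
  have hx : pr (sbi (fun x => pr x = 0) x) = 0 := sbi_mem x hW.
  by transitivity (u *: pr (sbi (fun x => pr x = 0) x)); [exact: linearZ|rewrite hx scaler0].
move: e; rewrite ha (_ : \sum_j _ = f (\row_j a j)); last first.
  by rewrite hf; apply: eq_bigr => j _; rewrite mxE.
by rewrite prf => ->; rewrite linear0.
Qed.
End Summand.

(** * Augmented local algebras over a discrete valuation ring *)

Lemma isloc_local (R : comNzRingType) (m : idealr R) : noeth R^o -> local_ring m ->
  isloc (fun a => a \in m).
Proof.
move=> nR [_ mU].
have im : isidl (fun a => a \in m).
  by split; [exact: idealr0|move=> x y; exact: rpredD|move=> a x; exact: idealMr].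
have sub : forall I, isidl I -> ~ I 1 -> forall a, I a -> a \in m.
  apply: (@noeth_ind R R^o (fun I => ~ I 1 -> forall a, I a -> a \in m) nR _).
  move=> I hI ih I1.
  case: (pselect (exists I', [/\ isidl I', ~ I' 1, forall x, I x -> I' x & exists2 x, I' x & ~ I x])).
    by move=> [I' [hI' I'1 II' hx]] a /II'; apply: ih.
  move=> mx; have [i0 iD iZ] := hI.
  pose S : {pred R} := fun a => `[< I a >].
  have SI : idealr_closed S.
    split; first exact/asboolP.
      by apply/negP => /asboolP.
    by move=> a x y /asboolP hx /asboolP hy; apply/asboolP/iD => //; apply: (iZ a).
  pose T : idealr R := HB.pack (S : R -> bool) (isIdealr.Build R S SI).
  have TI a : a \in T <-> I a by split=> [/asboolP|h]; [|apply/asboolP].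
  have mT : maximal_ideal T.
    move=> T' le a ha; apply/TI; apply: contrapT => na; apply: mx.
    exists (fun a => a \in T'); split; last by exists a.
    - by split; [exact: idealr0|move=> x y; exact: rpredD|move=> b x; exact: idealMr].
    - by rewrite idealr1.
    - by move=> x /TI/le.
  by move=> a /TI; rewrite (mU T mT).
have unit a : a \notin m -> exists b, b * a = 1.
  move=> na; apply: contrapT => no; move/negP: na; apply.
  apply: (sub (span ([:: a] : seq R^o)) (issub_span _)) => [[b _ /eqP]|].
    by rewrite subr_eq0 => /eqP e; apply: no; exists b.
  by apply: (span_mem (V := R^o)); rewrite inE.
split; last by move=> a /negP; apply: unit.
split=> //; first by rewrite idealr1.
move=> a b ab; apply: contrapT => /not_orP[/negP/unit[a' ea] /negP/unit[b' eb]].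
have : 1 \in m; last by rewrite idealr1.
have -> : 1 = a' * b' * (a * b) :> R by rewrite mulrACA ea eb mul1r.
exact: idealMr.
Qed.

Section Uniformizer.
Variables (O : idomainType) (pi : O) (hO : dvr_uniformizer pi).

Lemma noeth_dvr : noeth O^o.
Proof.
have [hI _ _] := hO; apply: noetherianP => I; have [a ha] := hI I.
by exists [:: a : O^o].
Qed.

Lemma dvr_local : exists m : idealr O, isloc (fun a => a \in m) /\
  forall a, a \in m <-> exists b, a = b * pi.
Proof.
have [_ [m lm hm] _] := hO; exists m; split; first exact: isloc_local noeth_dvr lm.
move=> a; rewrite hm; split.
  move=> h.
  pose P (x : O^o) := exists b, x = b * pi.
  have hP : issub P.
    split; first by exists 0; rewrite mul0r.
      by move=> _ _ [b ->] [b' ->]; exists (b + b'); rewrite mulrDl.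
    by move=> k _ [b ->]; exists (k * b); rewrite -[k *: _]/(k * (b * pi)) mulrA.
  move/asboolP: h => h; apply/(mspanP _ hP); apply: h => x /=.
  by rewrite inE => /eqP ->; apply/(mspanP _ hP); exists 1; rewrite mul1r.
move=> [b ->]; apply/asboolP => U hU; rewrite -[b * pi]/(b *: (pi : O^o)).
by apply/rpredZ/hU; rewrite /= inE.
Qed.

(** Divide by pi as often as possible: the ideals of the quotients increase. *)
Lemma dvr_factor a : a != 0 -> exists n u, (exists v, v * u = 1) /\ a = u * pi ^+ n.
Proof.
have [m [[[_ m1 _] um] hm]] := dvr_local; have [_ _ pi0] := hO.
suff ind : forall I : O^o -> Prop, issub I -> forall a, a != 0 -> (forall x, I x <-> exists b, x = b * a) ->
    exists n u, (exists v, v * u = 1) /\ a = u * pi ^+ n.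
  move=> a0; apply: (ind (fun x => exists b, x = b * a)) => //.
  split; first by exists 0; rewrite mul0r.
    by move=> _ _ [b ->] [b' ->]; exists (b + b'); rewrite mulrDl.
  by move=> k _ [b ->]; exists (k * b); rewrite -[k *: _]/(k * (b * a)) mulrA.
apply: (noeth_ind noeth_dvr) => I hI ih {}a a0 eI.
case: (pselect (a \in m)) => [/hm[b eb]|/um hu]; last first.
  by exists 0%N, a; rewrite expr0 mulr1.
have b0 : b != 0 by apply: contraNneq a0 => b0; rewrite eb b0 mul0r.
have [||||n [u [hu e]]] := ih (fun x => exists d, x = d * b) _ _ _ b b0 => //.
- split; first by exists 0; rewrite mul0r.
    by move=> _ _ [d ->] [d' ->]; exists (d + d'); rewrite mulrDl.
  by move=> k _ [d ->]; exists (k * d); rewrite -[k *: _]/(k * (d * b)) mulrA.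
- by move=> x /eI[d ->]; exists (d * pi); rewrite eb -mulrA [pi * b]mulrC.
- exists b; first by exists 1; rewrite mul1r.
  move=> /eI[d e]; apply: m1; apply/hm; exists d; apply: (mulIf b0).
  by rewrite mul1r {1}e eb mulrA mulrAC.
by exists n.+1, u; rewrite exprSr mulrA -e.
Qed.
End Uniformizer.

Lemma mproj0 (R : nzRingType) (V : lmodType R) (U : submodClosed V) x :
  mproj U x = 0 <-> x \in U.
Proof.
have e0 : mproj U 0 = 0 by apply: (linear0 (mproj U : {linear V -> modquot U})).
by rewrite -e0 mproj_eq subr0.
Qed.

Definition ext_class (R : comNzRingType) (N : lmodType R) (F : free_resolution N) (V : lmodType R) i :
  {linear submod_type (@cocycle R N F V i) -> Ext F V i} := mproj _.

Lemma ext_class0 (R : comNzRingType) (N : lmodType R) (F : free_resolution N) (V : lmodType R) i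
  (z : submod_type (@cocycle R N F V i)) : ext_class F V i z = 0 <-> cob (submod_val z).
Proof.
have vl : linear (fun z : submod_type (@cocycle R N F V i) => submod_val z) by [].
by rewrite /ext_class mproj0 (mspanP z (issub_ker (mklin vl) (issub_cob F V i))).
Qed.

Section Augmented.
Variables (O : idomainType) (varpi : O) (hO : dvr_uniformizer varpi).
Variables (A : comAlgType O) (m : idealr A) (lam : {lrmorphism A -> O^o}).
Hypotheses (nA : noetherian A) (lA : local_ring m).
Local Notation p := (fun a : A => a \in ker_ideal lam).
Local Notation mm := (fun a : A => a \in m).
Local Notation w := (varpi%:A : A).

Let nR : noeth A^o := noetherianP nA.

Lemma lamB a b : lam (a - b) = lam a - lam b. Proof. exact: rmorphB. Qed.
Lemma lamM a b : lam (a * b) = (lam a : O) * lam b. Proof. exact: rmorphM. Qed.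
Lemma lam1 : lam 1 = 1 :> O. Proof. exact: rmorph1. Qed.
Lemma lamX a n : lam (a ^+ n) = (lam a : O) ^+ n. Proof. exact: rmorphXn. Qed.
Lemma lamA k : lam k%:A = k :> O.
Proof.
have -> : lam k%:A = k *: (lam 1 : O^o) :> O^o by rewrite linearZ.
by rewrite lam1 -[k *: _]/(k * 1) mulr1.
Qed.

Lemma ker_idealP a : a \in ker_ideal lam <-> lam a = 0.
Proof. by split=> [/eqP|e]; [|apply/eqP]. Qed.

Lemma ker_ideal_sub a : a - (lam a)%:A \in ker_ideal lam.
Proof. by apply/ker_idealP; rewrite lamB lamA subrr. Qed.

Lemma unitA k : (exists v, v * k = 1) -> k%:A \notin m.
Proof.
move=> [v e]; apply/negP => h; have : 1 \in m; last by rewrite idealr1.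
have -> : 1 = v%:A * k%:A :> A by rewrite -scalerAl mul1r scalerA e scale1r.
exact: idealMr.
Qed.

Lemma augmented_dvr_quotient : dvr_quotient mm p w.
Proof.
have lm := isloc_local nR lA; have [pm um] := lm; have [im m1 _] := pm.
have pp := isprimeP (ker_ideal lam : prime_idealr A); have [pI p1 pM] := pp.
have [_ _ pi0] := hO; have [mO [lO hm]] := dvr_local hO; have [[_ mO1 _] umO] := lO.
have pm' a : a \in ker_ideal lam -> a \in m by apply: (proper_le_loc lm pI p1).
have wu b : b * varpi <> 1 by move=> e; apply: mO1; apply/hm; exists b.
split=> //.
- apply: contrapT => /um[b e]; apply: (wu (lam b)).
  by rewrite -[in LHS](lamA varpi) -lamM e lam1.
- by move/ker_idealP; rewrite lamA => e; rewrite e eqxx in pi0.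
- move=> a ma; have /hm[k ek] : lam a \in mO.
    apply: contrapT => /umO[v e]; apply: m1.
    have h : v%:A * a - 1 \in m by apply: pm'; apply/ker_idealP; rewrite lamB lamM lamA e lam1 subrr.
    by rewrite -[1](subKr (v%:A * a)); apply: (@issubB _ A^o mm) => //; apply: idealMr.
  by exists k%:A; apply/ker_idealP; rewrite lamB lamM !lamA ek subrr.
move=> a /ker_idealP/eqP na; have [n [u [hu e]]] := dvr_factor hO na.
exists n, u%:A; split; first by apply/negP/unitA.
by apply/ker_idealP; rewrite lamB lamM lamX !lamA -e subrr.
Qed.

Lemma ker_ideal_kills a : a \in ker_ideal lam -> forall x : O_mod lam, a *: x = 0.
Proof.
move/ker_idealP => e x; have -> : a *: x = (lam a * (x : O) : O_mod lam) by [].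
by rewrite e mul0r.
Qed.

Lemma O_mod_cyclic : exists e : O_mod lam, (forall x, exists a, x = a *: e) /\
  forall a, a *: e = 0 -> a \in ker_ideal lam.
Proof.
have aE (a : A) : a *: (1 : O_mod lam) = lam a.
  by have -> : a *: (1 : O_mod lam) = (lam a * 1 : O_mod lam) by []; rewrite mulr1.
exists 1; split=> [x|a]; last by rewrite aE => /ker_idealP.
by exists (x : O)%:A; rewrite aE lamA.
Qed.

Lemma reduction_mproj (V : lmodType A) :
  reduction p (mproj (smul (ker_ideal lam) (predT : {pred V})) : {linear V -> _}).
Proof.
have [pI _ _] := dq_prime augmented_dvr_quotient.
have hI := issub_isum (fun _ : V => True) pI.
split=> [y|x]; first by exists (repr y); apply: mprojK.
rewrite mproj0.
split=> [/asboolP h|].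
  apply/(mspanP _ hI); apply: h => _ [a [u [ha _ ->]]].
  by apply/(mspanP _ hI); apply: isum1.
apply: (isum_sub (U := fun x => x \in smul (ker_ideal lam) (predT : {pred V}))).
  exact: issub_submod.
by move=> a v ha _; apply/asboolP => U; apply; exists a, v.
Qed.

Variable F : free_resolution (O_mod lam).

Local Notation c := (codim lam).
Local Notation modp V := (modquot (smul (ker_ideal lam) (predT : {pred V}))).
Local Notation qp V := (mproj (smul (ker_ideal lam) (predT : {pred V})) : {linear V -> modp V}).

Definition tf_class (V : lmodType A) (x : Ext F V c) : torsion_free_quot (over_O (Ext F V c)) :=
  mproj _ (x : over_O (Ext F V c)).

Definition psi_class (V : lmodType A) (z : submod_type (@cocycle _ _ F (modp V) c)) : Psi F V :=
  mproj _ (tf_class (ext_class F _ c z)).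

Lemma tf_class0 (V : lmodType A) (z : submod_type (@cocycle _ _ F V c)) :
  tf_class (ext_class F _ c z) = 0 <-> exists2 a, a \notin ker_ideal lam & cob (a *: submod_val z).
Proof.
rewrite /tf_class mproj0; split=> [/asboolP[k k0 e]|[a /negP na h]].
  exists k%:A; first by apply/negP => /ker_idealP; rewrite lamA => e0; rewrite e0 eqxx in k0.
  have {}e : k%:A *: ext_class F V c z = 0 by exact: e.
  by move: e; rewrite -linearZ => /ext_class0.
apply/asboolP; exists (lam a); first by apply/eqP => /ker_idealP.
change ((lam a)%:A *: ext_class F V c z = 0); rewrite -linearZ; apply/ext_class0.
have zc : ccl (submod_val z) by have /eqP := submod_valP z.
change (cob ((lam a)%:A *: submod_val z)); rewrite -[(lam a)%:A](subKr a) scalerBl.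
apply: cobB => //; exact: (p_cob (p := p) ker_ideal_kills (ker_ideal_sub a) zc).
Qed.

Lemma psi_class0 (V : lmodType A) (z : submod_type (@cocycle _ _ F (modp V) c)) :
  psi_class z = 0 <-> @congr_sub _ p _ F _ _ (qp V) c (submod_val z).
Proof.
have zc : ccl (submod_val z) by have /eqP := submod_valP z.
rewrite /psi_class mproj0; set f := torsion_free_map _.
have hU : issub (fun y => exists2 x, True & y = f x) := issub_im f issubT.
have -> : (tf_class (ext_class F _ c z) \in mspan [set f x | x in [set: _]]%classic) <->
    exists2 x, True & tf_class (ext_class F _ c z) = f x.
  split=> [/asboolP h|[x _ e]]; last by apply/asboolP => U; apply; exists x.
  by apply/(mspanP _ hU); apply: h => _ [x _ <-]; apply/(mspanP _ hU); exists x.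
pose X := submod_type (@cocycle _ _ F V c).
have fE (e : X) : f (tf_class (ext_class F _ c e)) = tf_class (ext_class F _ c (cocycle_map F (qp V) c e)).
  rewrite /f /tf_class; etransitivity; first exact: quotmapE.
  congr (mproj _ _).
  exact: (quotmapE (@ext_map_subproof _ _ F _ _ (qp V) c) e).
have tB (x y : submod_type (@cocycle _ _ F (modp V) c)) :
    tf_class (ext_class F _ c x) - tf_class (ext_class F _ c y) = tf_class (ext_class F _ c (x - y)).
  by rewrite /tf_class -mprojB; congr (mproj _ _); rewrite [RHS]linearB.
split=> [[x _ e]|[_ [e ec [a na ha]]]].
  split=> //; move: e; rewrite -[x]mprojK -[repr x : Ext F V c]mprojK.
  move: (repr (repr x : Ext F V c)) => e; have ec : ccl (submod_val e) by have /eqP := submod_valP e.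
  rewrite [mproj _ _](_ : _ = tf_class (ext_class F _ c e)) // fE => /eqP.
  rewrite -subr_eq0 tB => /eqP/tf_class0[a /negP na h].
  by exists (submod_val e) => //; exists a.
have h : e \in @cocycle _ _ F V c by apply/eqP.
exists (tf_class (ext_class F _ c (SubMod h))) => //; rewrite fE; apply/eqP.
by rewrite -subr_eq0 tB; apply/eqP/tf_class0; exists a => //; apply/negP.
Qed.

Lemma tf_classZ (V : lmodType A) k (x : Ext F V c) : tf_class (k%:A *: x) = k *: tf_class x.
Proof.
have h : k%:A *: x = k *: (x : over_O (Ext F V c)) by [].
by rewrite h /tf_class linearZ.
Qed.

Lemma psi_classZ (V : lmodType A) k (z : submod_type (@cocycle _ _ F (modp V) c)) :
  psi_class (k%:A *: z) = k *: psi_class z.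
Proof. by rewrite /psi_class linearZ tf_classZ linearZ. Qed.

(** The congruence module, a quotient of torsion-free quotients of cohomology
    groups, is the quotient of the cocycles by congr_sub. The action of A on it
    factors through lam, so lengths over O and over A agree. *)
Lemma mlength_Psi (V : lmodType A) k :
  isLen (@congr_sub _ p _ F _ _ (qp V) c) (@ccl _ _ F _ c) k -> mlength (Psi F V) = k.
Proof.
move=> hk; pose VP : lmodType A := modp V.
pose Z : lmodType A := submod_type (@cocycle _ _ F VP c).
pose val : Z -> cochain F VP c := @submod_val _ _ _.
have cZ (z : Z) : ccl (val z) by have /eqP := submod_valP z.
have hT := issub_congr augmented_dvr_quotient F (qp V) c; have [t0 tD tZ] := hT.
have hZ : isLen (fun z : Z => True /\ @congr_sub _ p _ F _ _ (qp V) c (val z)) (fun _ => True) k.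
  apply/(@isLen_image A A Z (cochain F VP c) id val (@congr_sub A p _ F V VP (qp V) c) (fun _ => True)) => //.
    by move=> b; exists b.
  congr (isLen _ _ k): hk; apply/funext => x; apply/propext; split.
    move=> hx; exists 0 => //; rewrite subr0.
    have h : x \in @cocycle _ _ F VP c by apply/eqP.
    by exists (SubMod h).
  move=> [y [hy _] [z _ e]]; rewrite -[x](subrK y); have [_ cD _] := issub_ccl F VP c.
  by apply: cD => //; rewrite e.
pose f (z : Z) : Psi F V := psi_class z.
have fD x y : f (x + y) = f x + f y.
  rewrite /f /psi_class /tf_class -mprojD; congr (mproj _ _).
  by rewrite -mprojD; congr (mproj _ _); rewrite [LHS]linearD.
have f0 z : f z = 0 <-> congr_sub p (qp V) (val z) := psi_class0 z.
have fZk k' x : f (k'%:A *: x) = k' *: f x := psi_classZ k' x.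
have fZ a x : f (a *: x) = (lam a : O) *: f x.
  rewrite -fZk; apply: (@addIr _ (- f ((lam a)%:A *: x))); rewrite subrr.
  have fN y : f (- y) = - f y.
    by apply: (@addIr _ (f y)); rewrite -fD !addNr; apply/f0; rewrite /val /=; exact: t0.
  rewrite -fN -fD -scalerBl; apply/f0.
  apply: (@congr_of_torsion _ _ _ F _ _ (qp V) c _ 1).
  - exact/cclZ/cZ.
  - by have [_ ? _] := dq_prime augmented_dvr_quotient.
  - by rewrite scale1r; apply: (p_cob (p := p) ker_ideal_kills (ker_ideal_sub a) (cZ x)).
apply: mlengthE; apply/(@isLen_quotient A O Z (Psi F V) (fun a => lam a : O) f (fun _ => True)) => //.
- by move=> b; exists b%:A; rewrite lamA.
- move=> y; pose y1 : torsion_free_quot (over_O (Ext F VP c)) := repr y.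
  pose y2 : Ext F VP c := repr y1; exists (repr y2) => //.
  have e2 : ext_class F VP c (repr y2) = y2 := mprojK y2.
  have e1 : tf_class y2 = y1 := mprojK y1.
  by rewrite /f /psi_class e2 e1; exact: mprojK.
by congr (isLen _ _ k): hZ; apply/funext => z; apply/propext; split=> -[_ h]; split=> //; apply/f0.
Qed.
End Augmented.

(** * The Wiles defect and free summands *)

Lemma isum_im (R : comNzRingType) (Q : R -> Prop) (V W : lmodType R) (f : {linear V -> W}) v :
  isidl Q -> isum Q (fun _ : V => True) v -> isum Q (fun _ : W => True) (f v).
Proof.
move=> hQ; apply: (isum_sub (U := fun v => isum Q (fun _ : W => True) (f v))); first exact: (issub_ker f (issub_isum _ hQ)).
by move=> a u ha _; rewrite linearZ; apply: isum1.
Qed.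

Lemma miso_split (R : comNzRingType) (M : lmodType R) mu (W : lmodType R) :
  miso M ('rV[R]_mu * W)%type -> exists (n : 'I_mu -> M) (pi : 'I_mu -> {linear M -> R^o})
    (io : {linear W -> M}) (rho : {linear M -> W}),
  [/\ forall i j, pi i (n j) = (i == j)%:R, forall i x, pi i (io x) = 0, forall x, rho (io x) = x &
      forall x, x = \sum_j (pi j x : R) *: n j + io (rho x)].
Proof.
move=> [f [g fK gK]].
have lg : linear g by move=> a x y; apply: (can_inj fK); rewrite linearP !gK.
have li : linear (fun x : W => mklin lg (0, x)).
  by move=> a x y; rewrite -linearP; congr g; apply/eqP; rewrite xpair_eqE /= scaler0 addr0 !eqxx.
have lr : linear (fun x => (f x).2) by move=> a x y; rewrite linearP.
have lp (j : 'I_mu) : linear (fun x => (f x).1 0 j : R^o) by move=> a x y; rewrite linearP !mxE.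
exists (fun j => g (delta_mx 0 j, 0)), (fun j => mklin (lp j)), (mklin li), (mklin lr).
split=> [i j|i x|x|x] /=; rewrite ?gK ?mxE ?eqxx //.
apply: (can_inj fK); rewrite linearD linear_sum gK; under eq_bigr do rewrite linearZ gK.
have e1 : (\sum_j ((f x).1 0 j : R) *: ((delta_mx 0 j, 0) : 'rV[R]_mu * W)).1 = (f x).1.
  by rewrite [RHS]row_sum_delta; elim/big_ind2: _ => [|? ? ? ? <- <-|j _].
have e2 : (\sum_j ((f x).1 0 j : R) *: ((delta_mx 0 j, 0) : 'rV[R]_mu * W)).2 = 0.
  by elim/big_rec: _ => // j y _ e; rewrite /= e scaler0 addr0.
move: e1 e2; case: (\sum_j _) => a b /= -> ->; case: (f x) => a' b' /=.
by apply/eqP; rewrite xpair_eqE /= addr0 add0r !eqxx.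
Qed.

Section Defect.
Variables (O : idomainType) (varpi : O) (hO : dvr_uniformizer varpi).
Variables (A : comAlgType O) (m : idealr A) (lam : {lrmorphism A -> O^o}).
Hypotheses (hA : in_CO lam m) (hG : gorenstein A).
Variable F : free_resolution (O_mod lam).
Local Notation p := (fun a : A => a \in ker_ideal lam).
Local Notation mm := (fun a : A => a \in m).
Local Notation w := (varpi%:A : A).
Local Notation c := (codim lam).
Local Notation modp V := (modquot (smul (ker_ideal lam) (predT : {pred V}))).
Local Notation qp V := (mproj (smul (ker_ideal lam) (predT : {pred V})) : {linear V -> modp V}).
Arguments fml : simpl never.

Let nA : noetherian A. Proof. by have [] := hA. Qed.
Let lA : local_ring m. Proof. by have [] := hA. Qed.
Let nR : noeth A^o := noetherianP nA.
Let dq : dvr_quotient mm p w := augmented_dvr_quotient hO lam nA lA.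
Let pN := @ker_ideal_kills O A lam.
Let red (V : lmodType A) : reduction p (qp V) := reduction_mproj hO lam nA lA V.

Lemma mcm_regular_seq (M : lmodType A) : max_cohen_macaulay m M -> fgm M /\
  exists2 vs : seq A, size vs = krull_dim A & (forall x, x \in vs -> x \in m) /\ Reg vs M.
Proof.
move=> [[s hs] [v v0] hd]; split.
  exists s => x; have /asboolP h : x \in mspan [set y | y \in s]%classic by rewrite -hs.
  by apply/(mspanP x (issub_span s)); apply: h => y /span_mem /(mspanP y (issub_span s)).
rewrite -hd /depth; have [|vs [sz sub reg]] := @maxnat_in [set n | exists s : seq A,
    [/\ size s = n, {subset s <= m} & regular_seq M s]]%classic.
  exists [::]; split=> //; split=> //; exists v; apply: contra v0 => h.
  by apply/eqP; apply/(@seqmulP A M [::] v).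
by exists vs => //; split=> //; apply: regular_seq_Reg.
Qed.

(** The resolution J computes Ext into A, vs witnesses the depth of M, and ys
    generates p at p up to the denominator s. *)
Record mcm_data (M : lmodType A) (J : injective_resolution A) (vs ys : seq A) (s : A) : Prop :=
  McmData {
  md_fgm : fgm M;
  md_bound : ext_bound J (size vs);
  md_size : size vs = (size ys).+1;
  md_vs : forall x, x \in vs -> x \in m;
  md_reg : Reg vs M;
  md_dim : size vs = krull_dim A;
  md_codim : size ys = c;
  md_good : good_sequence mm p F M ys s;
  md_top : ~ van J (size ys).+1 (cyclic mm) }.

(** A chain of c + 1 primes ending at p is prolonged by m, so c + 1 <= dim A,
    which is the depth of A and of M. There is room for a regular sequence of c
    elements that generates p at p, and good_sequence_ex shows that it leaves
    exactly depth 1. *)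
Lemma mcm_data_ex (M : lmodType A) : max_cohen_macaulay m M ->
  exists J vs ys s, mcm_data M J vs ys s.
Proof.
move=> /mcm_regular_seq[hM [vs svs [mvs rvs]]]; have lm := isloc_local nR lA.
have [J [t [xs [hJ kt sxs mxs rxs]]]] := gorenstein_dim nR lm hG.
have [_ _ _ _ hreg] := hA; have [zs [szs pzs hzs]] := regular_parameters hreg.
have [P [[pP sP] hP]] := localized_chain (ker_ideal lam : prime_idealr A).
rewrite -/c in szs pP sP hP.
have hP' : prime_chain c.+1 (fun i => if (i <= c)%N then P i else mm).
  split=> i hi; first by case: ifP => // hi'; [apply: pP|case: lm].
  rewrite ltnS in hi; rewrite hi; case: ltnP => hi'; first exact: sP.
  have -> : i = c by apply/eqP; rewrite eqn_leq hi hi'.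
  split; first by move=> a /hP; apply: (dq_sub dq).
  by exists w; [exact: dq_unif dq|move=> /hP; exact: dq_nunif dq].
have ct := chain_bound nR hJ hP'.
case: xs sxs mxs rxs => [|x0 xs] sxs mxs rxs; first by rewrite -sxs in ct.
case: vs svs mvs rvs => [|v0 vs] svs mvs rvs; first by rewrite -kt -svs in ct.
have [|||e [ys [s [sys gs]]]] := good_sequence_ex nR dq F pN (O_mod_cyclic lam) hM (zs := zs)
    pzs _ mxs rxs mvs rvs.
- by move=> a /hzs[u nu hu]; exists u => //; apply/negP.
- by apply/eqP; rewrite -eqSS; apply/eqP; rewrite -[LHS]/(size (v0 :: vs)) svs kt -sxs.
- by rewrite szs -ltnS -[(size xs).+1]/(size (x0 :: xs)) sxs.
have st : (size ys).+1 = t by rewrite sys e -sxs.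
have tvs : size (v0 :: vs) = t by rewrite svs.
exists J, (v0 :: vs), ys, s; split=> //; rewrite ?tvs //; first by rewrite sys szs.
have [j hj nj] := ext_chain J nR (proj1 hP') (proj2 hP').
rewrite ltnn in nj => v; apply: nj; apply: (van_kill (proj1 lm)).
move: hj; rewrite -szs -sys st leq_eqVlt => /predU1P[<-|hj]; first by rewrite -st.
by apply: hJ => //; apply: fgm_cyclic.
Qed.

Lemma Fvan_above (M : lmodType A) J vs ys s i : mcm_data M J vs ys s -> (size ys < i)%N ->
  Fvan F i A^o.
Proof.
case: i => // i d hi; apply: (@Fvan_of_van _ _ F J); have lm := isloc_local nR lA.
apply: (van_depth nR lm (md_bound d) (xs := [:: w])).
- by move=> x; rewrite inE => /eqP ->; exact: dq_unif dq.
- have [e [he _]] := O_mod_cyclic lam; exists [:: e] => x; have [a ->] := he x.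
  by exists a; rewrite //= subrr.
- split=> // v; have [[e [he hn]] [pI p1 pM]] := (O_mod_cyclic lam, dq_prime dq).
  have [a ->] := he v; rewrite scalerA => /hn/pM[wp|pa]; first by case: (dq_nunif dq).
  by apply: pN.
by rewrite (md_size d) addn1.
Qed.

Section Basis.
Variables (M : lmodType A) (J : injective_resolution A) (vs ys : seq A) (s : A).
Hypothesis d : mcm_data M J vs ys s.
Variables (r : nat) (n : 'I_r -> M) (chi : 'I_r -> {linear modp M -> modp A^o}).
Hypothesis n_gen : forall y, exists a : 'I_r -> A, ptors p (y - \sum_j a j *: qp M (n j)).
Hypothesis chiE : forall y (a : 'I_r -> A), ptors p (y - \sum_j a j *: qp M (n j)) ->
  forall j, chi j y = qp A^o (a j).
Variable phiP : 'I_r -> {linear modp A^o -> modp M}.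
Hypothesis phiPE : forall j (a : A^o), phiP j (qp A^o a) = qp M (mulv (n j) a).

Lemma mrank_basis : mrank (locmod (ker_ideal lam) M) = r.
Proof.
apply: (@mrank_locmod A (ker_ideal lam : prime_idealr A) M r n).
  have [u nu hu] := generate_locally nR dq (md_fgm d) (red M) n_gen.
  by move=> v; exists u; split; [apply/negP|apply: hu].
move=> a e j.
have [u nu hu] := independent_locally nR dq (md_good d) (red A^o) (red M) chiE e j.
by exists u => //; apply/negP.
Qed.

Lemma mlength_Psi_compare : mlength (Psi F M) = (r * mlength (Psi F A^o))%N <->
  forall z : 'I_r -> cochain F (modp A^o) (size ys), (forall j, ccl (z j)) ->
    congr_sub p (qp M) (\sum_j fml F (phiP j) _ (z j)) -> forall j, congr_sub p (qp A^o) (z j).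
Proof.
have gs := md_good d.
have [k hk] := congr_finite nR dq pN (gs_p gs) (gs_s gs) (gs_gen gs) (red A^o) (gs_R gs)
  (fgm_ring A) (fun i => @Fvan_above M J vs ys s i d).
have hchi := phiP_chi n_gen chiE phiPE.
have [l hl cmp] := congr_compare dq (phi := fun j => mulv (n j)) phiPE hchi hk.
have ek : mlength (Psi F A^o) = k.
  by apply: (mlength_Psi hO nA lA); move: hk; rewrite (md_codim d).
have el : mlength (Psi F M) = l.
  by apply: (mlength_Psi hO nA lA); move: hl; rewrite (md_codim d).
split=> [e|/(proj2 cmp) e].
  exact: (proj1 cmp (etrans (esym el) (etrans e (congr1 (muln r) ek)))).
exact: (etrans el (etrans e (congr1 (muln r) (esym ek)))).
Qed.
End Basis.

Lemma mrank_ring : mrank (locmod (ker_ideal lam) A^o) = 1%N.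
Proof.
apply: (@mrank_locmod A (ker_ideal lam : prime_idealr A) A^o 1 (fun _ => 1)).
  by move=> v; exists 1; rewrite idealr1; split=> //; exists (fun _ => v);
    rewrite big_ord1 scale1r -[v *: _]/(v * 1) mulr1.
move=> a; rewrite big_ord1 -[_ *: _]/(a ord0 * 1) mulr1 => e j.
by exists 1; rewrite ?idealr1 // mul1r ord1.
Qed.

Lemma wiles_defect_eq (M : lmodType A) mu : mu = mrank (locmod (ker_ideal lam) M) ->
  wiles_defect F M = mu%:Z * wiles_defect F A^o <->
  mlength (Psi F M) = (mu * mlength (Psi F A^o))%N.
Proof.
move=> e; have arith (x y z : nat) : mu%:Z * x%:Z - y%:Z = mu%:Z * (1%:Z * x%:Z - z%:Z) <-> y = (mu * z)%N.
  by nia.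
have eM : wiles_defect F M = mu%:Z * (mlength (Phi lam))%:Z - (mlength (Psi F M))%:Z.
  exact: (congr1 (fun i : nat => i%:Z * (mlength (Phi lam))%:Z - (mlength (Psi F M))%:Z) (esym e)).
have eA : wiles_defect F A^o = 1%:Z * (mlength (Phi lam))%:Z - (mlength (Psi F A^o))%:Z.
  exact: (congr1 (fun i : nat => i%:Z * (mlength (Phi lam))%:Z - (mlength (Psi F A^o))%:Z) mrank_ring).
have cA := congr1 (fun i => mu%:Z * i) eA.
split=> [h|h]; first exact: (proj1 (arith _ _ _) (etrans (esym eM) (etrans h cA))).
exact: (etrans eM (etrans (proj2 (arith _ _ _) h) (esym cA))).
Qed.

(** ** Equality of the defects produces a free summand *)

Lemma free_summand_of_defect (M : lmodType A) mu : max_cohen_macaulay m M ->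
  mu = mrank (locmod (ker_ideal lam) M) ->
  wiles_defect F M = mu%:Z * wiles_defect F A^o ->
  exists W : lmodType A, miso M ('rV[A]_mu * W)%type /\
    forall x : W, exists2 u, u \notin ker_ideal lam & u *: x = 0.
Proof.
move=> hM hmu /(wiles_defect_eq hmu) hl; have [J [vs [ys [s d]]]] := mcm_data_ex hM.
have pP a : p a -> forall y : modp M, a *: y = 0.
  by move=> pa y; apply: (reduction_killed _ (red M)).
have fP : fgm (modp M) by apply: (fgm_surj (f := qp M)) (md_fgm d); have [] := red M.
have [r [nb [gen ind]]] := dvr_basis dq pP fP.
have /choice[n hn] : forall j, exists x, qp M x = nb j by move=> j; have [hs _] := red M; apply: hs.
have nE : nb = fun j => qp M (n j) by apply/funext => j; rewrite hn.
rewrite {}nE {nb hn} in gen ind.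
have [chi chiE] := coordinate_maps dq (reduction_ring dq (red A^o)) gen ind.
have [phiP phiPE] := reduced_maps dq (red A^o) (red M) n.
have er := mrank_basis d gen chiE; rewrite -hmu in er; subst r.
have cmp := mlength_Psi_compare d gen chiE phiPE.
have [W [iso tors]] := free_summand nR dq pN (O_mod_cyclic lam) (md_fgm d) (md_good d) (red A^o) (red M)
  gen chiE phiPE (proj1 cmp hl) (md_bound d) (md_size d) (md_vs d) (md_reg d) (md_top d).
by exists W; split=> // x; have [u nu e] := tors x; exists u => //; apply/negP.
Qed.

(** Conversely, for M isomorphic to A^mu + W the coordinate forms of A^mu split
    the comparison of congruence modules. *)
Lemma defect_of_free_summand (M : lmodType A) mu (W : lmodType A) : max_cohen_macaulay m M ->
  mu = mrank (locmod (ker_ideal lam) M) -> miso M ('rV[A]_mu * W)%type ->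
  (forall x : W, exists2 u, u \notin ker_ideal lam & u *: x = 0) ->
  wiles_defect F M = mu%:Z * wiles_defect F A^o.
Proof.
move=> hM hmu /miso_split[n [pi [io [rho [pin _ _ xE]]]]] tors; apply/(wiles_defect_eq hmu).
have [J [vs [ys [s d]]]] := mcm_data_ex hM; have [pI _ _] := dq_prime dq.
have sub x : exists2 u, u \notin ker_ideal lam & u *: (x - \sum_j (pi j x : A) *: n j) = 0.
  have [u nu hu] := tors (rho x); exists u => //.
  by rewrite [x in x - _]xE addrC addKr -linearZ hu linear0.
have gen y : exists a : 'I_mu -> A, ptors p (y - \sum_j a j *: qp M (n j)).
  have [hs _] := red M; have [x <-] := hs y; exists (fun j => pi j x).
  have [u nu e] := sub x; exists u; first exact/negP.
  have -> : qp M x - \sum_j (pi j x : A) *: qp M (n j) = qp M (x - \sum_j (pi j x : A) *: n j).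
    by rewrite (linearB (qp M)) (linear_sum (qp M)); congr (_ - _); apply: eq_bigr => j _; rewrite linearZ.
  by rewrite -linearZ e linear0.
have ind (a : 'I_mu -> A) : ptors p (\sum_j a j *: qp M (n j)) -> forall j, p (a j).
  move=> [b nb e] i; have pM : p (b * a i); last by have [_ _ /(_ _ _ pM)[]] := dq_prime dq.
  apply/(reduction_ring dq (red A^o)); have [_ ->] := red A^o.
  have -> : b * a i = pi i (b *: \sum_j a j *: n j).
    rewrite linearZ linear_sum (bigD1 i) // linearZ pin eqxx big1.
      by change (b * a i = b * (a i * 1 + 0)); rewrite addr0 mulr1.
    by move=> j /andP[_ ji]; rewrite linearZ pin eq_sym (negPf ji); exact: scaler0.
  apply: (isum_im (pi i) pI); have [_ <-] := red M.
  rewrite linearZ (linear_sum (qp M)) -[RHS]e; congr (b *: _).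
  by apply: eq_bigr => j _; rewrite linearZ.
have [chi chiE] := coordinate_maps dq (reduction_ring dq (red A^o)) gen ind.
have [phiP phiPE] := reduced_maps dq (red A^o) (red M) n.
apply/(mlength_Psi_compare d gen chiE phiPE) => z zc [_ [e ec [a na ha]]] i.
have [||piP piPE] := @lin_factor _ _ _ _ (qp M) (lcomp (qp A^o) (pi i)); first by have [] := red M.
  have [_ kM] := red M; have [_ kA] := red A^o.
  by move=> x /kM/(isum_im (pi i) pI)/kA.
have piphi j y : piP (phiP j y) = (i == j)%:R *: y.
  have [hs _] := red A^o; have [x <-] := hs y; rewrite phiPE piPE /= linearZ /= pin.
  by rewrite -linearZ -[x *: _]/(x * (i == j)%:R) mulrC.
split=> //; exists (fml F (pi i) _ e); first exact: fml_ccl.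
exists a => //; have := fml_cob piP ha; congr cob.
rewrite linearZ linearB linear_sum; congr (a *: (_ - _)).
  rewrite (bigD1 i) //= big1 => [|j ji]; last first.
    by apply/ffunP => x; rewrite !ffunE piphi eq_sym (negPf ji) scale0r.
  by rewrite addr0; apply/ffunP => x; rewrite !ffunE piphi eqxx scale1r.
by apply/ffunP => x; rewrite !ffunE piPE.
Qed.
End Defect.

(** * Eventually polynomial counting functions *)

Import Order.TTheory Num.Theory.

Definition evpoly (h : nat -> nat) :=
  exists (p : {poly rat}) N, forall n, (N <= n)%N -> (h n)%:R = p.[n%:R].

Lemma evpoly_ext h h' N : (forall n, (N <= n)%N -> h n = h' n) -> evpoly h -> evpoly h'.
Proof.
move=> e [p [K hp]]; exists p, (maxn N K) => n; rewrite geq_max => /andP[hn hk].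
by rewrite -e // hp.
Qed.

Lemma evpolyD h h' : evpoly h -> evpoly h' -> evpoly (fun n => (h n + h' n)%N).
Proof.
move=> [p [K hp]] [p' [K' hp']]; exists (p + p'), (maxn K K') => n; rewrite geq_max => /andP[h1 h2].
by rewrite natrD hornerD hp // hp'.
Qed.

Lemma evpoly0 : evpoly (fun _ => 0%N).
Proof. by exists 0, 0%N => n _; rewrite horner0. Qed.

Lemma evpoly_sum (I : Type) (r : seq I) (h : I -> nat -> nat) :
  (forall i, evpoly (h i)) -> evpoly (fun n => \sum_(i <- r) h i n)%N.
Proof.
move=> hh; elim: r => [|i r ih]; first by apply: (@evpoly_ext _ _ 0) evpoly0 => n _; rewrite big_nil.
by apply: (@evpoly_ext _ _ 0) (evpolyD (hh i) ih) => n _; rewrite big_cons.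
Qed.

Lemma evpoly_shift h k : evpoly h -> evpoly (fun n => h (n - k)%N).
Proof.
move=> [p [K hp]]; exists (p \Po ('X - k%:R%:P)), (K + k)%N => n hn.
rewrite horner_comp !hornerE -natrB ?hp // ?leq_subRL; lia.
Qed.

(** The binomial polynomials form a basis, and each of them is the difference of
    the next one. *)
Lemma poly_sum (p : {poly rat}) : exists P : {poly rat}, forall n : nat, P.[n.+1%:R] - P.[n%:R] = p.[n%:R].
Proof.
pose B k : {poly rat} := \prod_(0 <= i < k) ('X - i%:R%:P).
have BE k n : (B k).[n%:R] = \prod_(i < k) ((n%:R : rat) - i%:R).
  by rewrite /B big_mkord horner_prod; apply: eq_bigr => i _; rewrite !hornerE.
have dB k n : (B k.+1).[n.+1%:R] - (B k.+1).[n%:R] = k.+1%:R * (B k).[n%:R].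
  rewrite !BE big_ord_recl big_ord_recr /= subr0.
  rewrite (_ : \prod_(i < k) (n.+1%:R - (bump 0 i)%:R) = \prod_(i < k) ((n%:R : rat) - i%:R)); last first.
    by apply: eq_bigr => i _; rewrite /bump leq0n add1n -!natr1; ring.
  by rewrite -!natr1; ring.
have [d] := ubnP (size p); elim: d p => // d ih p sp.
have [p0|pn0] := eqVneq p 0; first by exists 0 => n; rewrite p0 !horner0 subr0.
pose k := (size p).-1; pose cf := lead_coef p.
have sB : size (B k) = size p.
  by rewrite /B size_prod_XsubC size_iota subn0 prednK // size_poly_gt0.
have lB : lead_coef (B k) = 1 by apply/eqP; rewrite -monicE monic_prod_XsubC.
have [|P hP] := ih (p - cf *: B k).
  have le : (size (p - cf *: B k)%R <= size p)%N.
    by rewrite (leq_trans (size_polyD _ _)) // geq_max leqnn size_polyN (leq_trans (size_scale_leq _ _)) ?sB.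
  rewrite (leq_trans _ (sp : (size p <= d)%N)) // ltn_neqAle le andbT.
  apply/eqP => e; have : lead_coef (p - cf *: B k) != 0.
    by rewrite lead_coef_eq0 -size_poly_gt0 e size_poly_gt0.
  have lB' : (B k)`_k = 1 by rewrite -lB /lead_coef sB.
  by rewrite /lead_coef e -/k coefB coefZ lB' mulr1 subrr eqxx.
exists (P + (cf / k.+1%:R) *: B k.+1) => n.
rewrite (hornerD P) (hornerD P) !hornerZ opprD addrACA hP -mulrBr dB hornerD hornerN hornerZ.
by rewrite mulrA divfK ?subrK // pnatr_eq0.
Qed.

Lemma evpoly_partial_sum h : evpoly h -> evpoly (fun n => \sum_(j < n) h j)%N.
Proof.
move=> [p [K hp]]; have [P hP] := poly_sum p.
exists (P + ((\sum_(j < K) h j)%N%:R - P.[K%:R])%:P), K => n hn.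
rewrite -(subnKC hn); elim: (n - K)%N => [|i ih]; first by rewrite addn0 hornerD hornerC addrC subrK.
by rewrite addnS big_ord_recr natrD ih hp ?leq_addr // !hornerD !hornerC -hP; ring.
Qed.

(** ** Exponents of given total degree *)

Fixpoint exps e n : seq (seq nat) :=
  if e is e'.+1 then [seq k :: b | k <- iota 0 n.+1, b <- exps e' (n - k)%N]
  else if n is 0 then [:: [::]] else [::].

Lemma exps_slices e n :
  exps e.+1 n = [seq k :: b | k <- iota 0 n.+1, b <- exps e (n - k)%N].
Proof. by []. Qed.

Lemma mem_exps e n a : (a \in exps e n) = (size a == e) && (sumn a == n).
Proof.
elim: e n a => [|e ih] n a; first by case: a n => [|k a] [|n].
rewrite exps_slices; case: a => [|k a].
  by apply/negbTE/negP => /allpairsPdep[? [? [_ _]]].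
apply/allpairsPdep/andP => [[l [b [hl hb [-> ->]]]]|[/eqP[sa] /eqP na]].
  move: hl hb; rewrite mem_iota ih => hl /andP[/eqP <- /eqP e1] /=; split=> //.
  by rewrite e1; apply/eqP; lia.
rewrite /= in na; exists k, a; rewrite mem_iota ih sa eqxx; split=> //; first lia.
by rewrite -na addKn eqxx.
Qed.

Fixpoint ltlex (a b : seq nat) : bool :=
  match a, b with
  | k :: a', l :: b' => (k < l)%N || (k == l) && ltlex a' b'
  | _, _ => false
  end.

Lemma ltlex_irr a : ltlex a a = false.
Proof. by elim: a => //= k a ->; rewrite ltnn eqxx. Qed.

Lemma ltlex_trans : transitive ltlex.
Proof.
move=> y x z; elim: y x z => [|l y ih] [|k x] [|j z] //=.
move=> /orP[h1|/andP[/eqP -> h1]] /orP[h2|/andP[/eqP <- h2]]; apply/orP.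
- by left; apply: ltn_trans h2.
- by left.
- by left.
- by right; rewrite eqxx (ih _ _ h1 h2).
Qed.

Lemma exps_sorted e n : sorted ltlex (exps e n).
Proof.
rewrite (sorted_pairwise ltlex_trans); elim: e n => [|e ih] n; first by case: n.
rewrite exps_slices; elim: (iota 0 n.+1) (iota_ltn_sorted 0 n.+1) => // k r ihr.
rewrite [sorted _ _]/= (path_sortedE ltn_trans) allpairs_cons pairwise_cat => /andP[/allP hk hr].
rewrite ihr // andbT pairwise_map; apply/andP; split.
  apply/allrelP => _ _ /mapP[b hb ->] /allpairsPdep[l [b' [hl hb' ->]]] /=.
  by rewrite hk.
by have := ih (n - k)%N; apply: sub_pairwise => x y /= ->; rewrite eqxx orbT.
Qed.

(** ** Up-sets of exponents *)

Fixpoint upset e (Q : pred (seq nat)) : Prop :=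
  if e is e'.+1 then (forall k b, size b = e' -> Q (k :: b) -> Q (k.+1 :: b)) /\
    forall k, upset e' (fun b => Q (k :: b))
  else True.

(** Dickson's lemma: look at the slices along the first coordinate; those of
    large index are constant from the diagonal on. *)
Lemma upset_chain e (Q : nat -> pred (seq nat)) : (forall i, upset e (Q i)) ->
  (forall i b, size b = e -> Q i b -> Q i.+1 b) ->
  exists K, forall i b, size b = e -> (K <= i)%N -> Q i b -> Q K b.
Proof.
elim: e Q => [|e ih] Q hQ mono.
  case: (pselect (exists i, Q i [::])) => [[K hK]|no].
    by exists K => i b /size0nil -> _ _.
  by exists 0%N => i b /size0nil -> _ h; case: no; exists i.
have monoM i j b : size b = e.+1 -> (i <= j)%N -> Q i b -> Q j b.
  move=> sb /subnK <-; elim: (j - i)%N => // l ihl /ihl; exact: mono.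
have upM i k l b : size b = e -> (k <= l)%N -> Q i (k :: b) -> Q i (l :: b).
  move=> sb /subnK <-; elim: (l - k)%N => // j ihj /ihj; have [h _] := hQ i; exact: h.
have [|i b sb hb|D hD] := ih (fun i b => Q i (i :: b)).
- by move=> i; have [_ h] := hQ i; apply: h.
- by apply: mono; [rewrite /= sb|apply: (upM _ i)].
have /choice[f hf] : forall k, exists K, forall i b, size b = e -> (K <= i)%N -> Q i (k :: b) -> Q K (k :: b).
  move=> k; apply: (ih (fun i b => Q i (k :: b))) => [i|i b sb]; first by have [_ h] := hQ i; apply: h.
  by apply: mono; rewrite /= sb.
pose K := maxn D (\max_(k < D) f k).
exists K => i [|k b] //= [sb] hi hb; case: (ltnP k D) => kD.
  have fk : (f k <= K)%N.
    by rewrite /K leq_max (leq_bigmax (Ordinal kD)) orbT.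
  by apply: (monoM (f k)); rewrite /= ?sb //; apply: (hf k i) => //; apply: leq_trans hi.
have DK : (D <= K)%N by rewrite leq_maxl.
apply: (monoM D); rewrite /= ?sb //; apply: (upM _ D) => //.
apply: (hD (maxn i k)) => //; first by rewrite leq_max kD orbT.
by apply: (monoM i); rewrite /= ?sb ?leq_maxl //; apply: (upM _ k); rewrite // leq_maxr.
Qed.

(** Slice along the first coordinate. Beyond some K all slices are equal, and
    together they contribute a partial sum of the function of one slice. *)
Lemma count_upset e (Q : pred (seq nat)) : upset e Q ->
  evpoly (fun n => count (predC Q) (exps e n)).
Proof.
elim: e Q => [|e ih] Q.
  by move=> _; apply: (@evpoly_ext _ _ 1) evpoly0 => -[].
move=> [up hQ]; pose h k n := count (fun b => ~~ Q (k :: b)) (exps e n).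
have hh k : evpoly (h k) := ih _ (hQ k).
have [k b sb|K hK] := upset_chain (Q := fun k b => Q (k :: b)) hQ; first exact: up.
have hE k n : (K <= k)%N -> h k n = h K n.
  move=> kK; apply: eq_in_count => b; rewrite mem_exps => /andP[/eqP sb _].
  congr negb; apply/idP/idP; first exact: (hK k b sb kK).
  by rewrite -(subnK kK); elim: (k - K)%N => // j ihj /ihj; apply: up.
have e1 n : count (predC Q) [seq k :: b | k <- iota 0 n.+1, b <- exps e (n - k)%N] =
    (\sum_(k <- iota 0 n.+1) h k (n - k)%N)%N.
  elim: (iota 0 n.+1) => [|k r ihr] /=; first by rewrite big_nil.
  by rewrite big_cons count_cat ihr count_map.
apply: (@evpoly_ext (fun n => (\sum_(k <- iota 0 K) h k (n - k) + \sum_(j < (n - K).+1) h K j)%N) _ K).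
  move=> n hn; rewrite exps_slices e1.
  have -> : n.+1 = (K + (n - K).+1)%N by rewrite addnS subnKC.
  rewrite iotaD big_cat /= add0n; congr (_ + _)%N.
  have <- : (\sum_(0 <= i < (n - K).+1) h (K + i)%N (n - (K + i)))%N =
      (\sum_(k <- iota K (n - K).+1) h k (n - k)%N)%N.
    by rewrite -[X in iota X _]addn0 iotaDl big_map /index_iota subn0.
  rewrite big_mkord (reindex_inj rev_ord_inj) /=; apply: eq_bigr => i _.
  by rewrite hE ?leq_addr //; congr (h K _); rewrite subSS; have := ltn_ord i; lia.
apply: evpolyD; first by apply: evpoly_sum => k; apply: evpoly_shift.
have := evpoly_shift K (evpoly_partial_sum (hh K)) => /= h1.
have h2 := evpolyD h1 (evpoly_shift K (hh K)).
by apply: (@evpoly_ext _ _ 0) h2 => n _; rewrite big_ord_recr.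
Qed.

(** * Hilbert-Samuel polynomials *)

Section Powers.
Variables (R : comNzRingType) (m : R -> Prop).
Hypothesis hm : isidl m.

(** m^n V *)
Fixpoint ipow (V : lmodType R) n : V -> Prop :=
  if n is k.+1 then isum m (@ipow V k) else fun _ => True.

Lemma issub_ipow (V : lmodType R) n : issub (@ipow V n).
Proof. by case: n => [|n]; [exact: issubT|exact: issub_isum]. Qed.

Lemma ipow_map (V W : lmodType R) (f : {linear V -> W}) n v : ipow n v -> ipow n (f v).
Proof.
elim: n v => // n ih v.
apply: (isum_sub (U := fun v => ipow n.+1 (f v))); first exact: (issub_ker f (issub_ipow W n.+1)).
by move=> a u ha /ih hu; rewrite linearZ; apply: isum1.
Qed.

Lemma ipowS (V : lmodType R) n (v : V) : ipow n.+1 v -> ipow n v.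
Proof.
have [_ _ hZ] := issub_ipow V n.
by apply: (isum_sub (U := @ipow V n)); [exact: issub_ipow|move=> a u _; apply: hZ].
Qed.

Lemma ipow_le (V : lmodType R) i j (v : V) : (i <= j)%N -> ipow j v -> ipow i v.
Proof. by move=> /subnK <-; elim: (j - i)%N => // l ih /ipowS. Qed.

Lemma ipow_scale (V : lmodType R) z k n (v : V) : m z -> ipow n v -> ipow (k + n) (z ^+ k *: v).
Proof.
move=> hz hv; elim: k => [|k ih]; first by rewrite expr0 scale1r.
by rewrite exprS -scalerA; apply: isum1.
Qed.

(** z_1^a_1 ... z_e^a_e *)
Fixpoint mono (zs : seq R) (a : seq nat) : R :=
  if zs is z :: zs' then (if a is k :: a' then z ^+ k * mono zs' a' else 1) else 1.

Lemma mono_incr zs a i : size a = size zs -> (i < size zs)%N ->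
  mono zs (incr_nth a i) = zs`_i * mono zs a.
Proof.
elim: zs a i => // z zs ih [|k a] [|i] //= [sa] hi; first by rewrite exprS mulrA.
by rewrite ih // mulrCA.
Qed.

Lemma sumn_incr_nth a i : sumn (incr_nth a i) = (sumn a).+1.
Proof.
elim: a i => [|k a ih] [|i] //=; last by rewrite ih addnS.
by elim: i.
Qed.

Lemma size_incr a i e : size a = e -> (i < e)%N -> size (incr_nth a i) = e.
Proof. by move=> <- hi; rewrite size_incr_nth hi. Qed.

Lemma ltlex_incr a b i : ltlex a b -> (i < size a)%N -> size a = size b ->
  ltlex (incr_nth a i) (incr_nth b i).
Proof.
elim: a b i => [|k a ih] [|l b] [|i] //= h hi [sz].
by case/orP: h => [->//|/andP[-> h]]; rewrite ih ?orbT.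
Qed.

Lemma upset_incr e (Q : pred (seq nat)) :
  (forall i b, (i < e)%N -> size b = e -> Q b -> Q (incr_nth b i)) -> upset e Q.
Proof.
elim: e Q => // e ih Q h; split; first by move=> k b sb; apply: (h 0%N); rewrite //= sb.
move=> k; apply: ih => i b hi sb; apply: (h i.+1) => //=; by rewrite sb.
Qed.

Lemma addsub_rcons (V : lmodType R) (U : V -> Prop) s x : issub U ->
  addsub (addsub U (span s)) (span [:: x]) = addsub U (span (rcons s x)).
Proof.
move=> hU; have [_ uD _] := hU; apply/funext => y; apply/propext; rewrite -cats1; split.
  case=> z [u hu h1] h2; exists u => //; rewrite -[y](subrK z) -addrA.
  have [_ hD _] := issub_span (s ++ [:: x]); apply: hD.
    by apply: span_mono h2 => t ht; rewrite mem_cat ht orbT.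
  by apply: span_mono h1 => t ht; rewrite mem_cat ht.
case=> u hu /span_cat[v hv h]; exists (u + v).
  by exists u => //; rewrite addrAC subrr add0r.
by rewrite opprD addrA.
Qed.

Lemma nsteps_sorted (V : lmodType R) (U : V -> Prop) (f : seq nat -> V) s : issub U ->
  pairwise ltlex s -> nsteps U (map f s) =
  count (fun a => ~~ `[< addsub U (span (map f (filter (ltlex^~ a) s))) (f a) >]) s.
Proof.
move=> hU; suff h s1 s2 : pairwise ltlex (s1 ++ s2) ->
    nsteps (addsub U (span (map f s1))) (map f s2) =
    count (fun a => ~~ `[< addsub U (span (map f (filter (ltlex^~ a) (s1 ++ s2)))) (f a) >]) s2.
  move=> hs; rewrite -(h [::] s hs); congr nsteps; apply/funext => y; apply/propext; split.
    by apply: addsubl; apply: issub_span.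
  by case=> u hu /eqP; rewrite subr_eq0 => /eqP ->.
elim: s2 s1 => // a s2 ih s1 hs.
have e1 : filter (ltlex^~ a) (s1 ++ a :: s2) = s1.
  move: hs; rewrite pairwise_cat => /and3P[/allrelP h1 _ /= /andP[/allP h2 _]].
  rewrite filter_cat /= ltlex_irr (_ : filter _ s2 = [::]) ?cats0.
    by apply/all_filterP/allP => b hb; apply: h1; rewrite // mem_head.
  apply/eqP; rewrite -[_ == _]negbK -has_filter; apply/hasP => -[b hb ba].
  by have := ltlex_trans (h2 b hb) ba; rewrite ltlex_irr.
rewrite [LHS]/= [RHS]/= e1; congr (_ + _)%N.
by rewrite addsub_rcons // -map_rcons ih cat_rcons.
Qed.

Hypothesis lm : isloc m.
Variables (V : lmodType R) (zs : seq R).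
Hypothesis mzs : forall a, m a <-> span (zs : seq R^o) a.
Local Notation e := (size zs).
Let mz i : (i < e)%N -> m zs`_i.
Proof. by move=> hi; apply/mzs; apply: (span_mem (V := R^o)); apply: mem_nth. Qed.

Definition monos n (g : V) := [seq mono zs a *: g | a <- exps e n].

Lemma monosS n g i x : (i < e)%N -> x \in monos n g -> zs`_i *: x \in monos n.+1 g.
Proof.
move=> hi /mapP[a]; rewrite mem_exps => /andP[/eqP sa /eqP na] ->.
rewrite scalerA -mono_incr //; apply: map_f.
by rewrite mem_exps (size_incr sa hi) sumn_incr_nth na !eqxx.
Qed.

(** A relation that expresses a monomial through smaller ones modulo U n can be
    multiplied by a variable. So the exponents of the redundant monomials form an
    up-set, and the length in question counts its complement in degree n. *)
Lemma evpoly_monos (U : nat -> V -> Prop) g : (forall n, issub (U n)) ->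
  (forall n i x, (i < e)%N -> U n x -> U n.+1 (zs`_i *: x)) ->
  (forall n x a, x \in monos n g -> m a -> U n (a *: x)) ->
  exists2 h, evpoly h & forall n, isLen (U n) (addsub (U n) (span (monos n g))) (h n).
Proof.
move=> hU zU kU.
pose low a := span [seq mono zs b *: g | b <- exps e (sumn a) & ltlex b a].
pose Q a := `[< addsub (U (sumn a)) (low a) (mono zs a *: g) >].
exists (fun n => count (predC Q) (exps e n)).
  apply/count_upset/upset_incr => i b hi sb /asboolP[u hu hl]; apply/asboolP.
  exists (zs`_i *: u); first by rewrite sumn_incr_nth; apply: zU.
  rewrite mono_incr // -scalerA -scalerBr.
  apply: (span_sub (P := fun x => low (incr_nth b i) (zs`_i *: x))) hl.
    exact: (issub_ker (scl V zs`_i) (issub_span _)).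
  move=> x /mapP[a]; rewrite mem_filter mem_exps => /andP[ab /andP[/eqP sa /eqP na]] ->.
  apply: span_mem; rewrite scalerA -mono_incr //; apply: map_f.
  rewrite mem_filter mem_exps ltlex_incr // ?sa ?sb // (size_incr sa hi).
  by rewrite !sumn_incr_nth na !eqxx.
move=> n; have -> : count (predC Q) (exps e n) = nsteps (U n) (monos n g).
  rewrite nsteps_sorted //; last by rewrite -(sorted_pairwise ltlex_trans) exps_sorted.
  apply: eq_in_count => a; rewrite mem_exps => /andP[_ /eqP na].
  by rewrite /= /Q /low na.
by apply: (isLen_steps lm (hU n)); apply: steps_killed => // x a; apply: kU.
Qed.

Definition all_monos n (gs : seq V) := flatten [seq monos n g | g <- gs].

Lemma addsub_cat (U : V -> Prop) s t : issub U ->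
  addsub (addsub U (span s)) (span t) = addsub U (span (s ++ t)).
Proof.
move=> hU; elim/last_ind: t => [|t x ih]; last by rewrite -rcons_cat -!addsub_rcons ?ih //; apply: issub_add hU (issub_span _).
rewrite cats0; apply/funext => y; apply/propext; split=> [[z hz /eqP]|].
  by rewrite subr_eq0 => /eqP ->.
by apply: addsubl; apply: issub_span.
Qed.

Lemma evpoly_all_monos (U : nat -> V -> Prop) gs : (forall n, issub (U n)) ->
  (forall n i x, (i < e)%N -> U n x -> U n.+1 (zs`_i *: x)) ->
  (forall n x a, x \in all_monos n gs -> m a -> U n (a *: x)) ->
  exists2 h, evpoly h & forall n, isLen (U n) (addsub (U n) (span (all_monos n gs))) (h n).
Proof.
elim: gs U => [|g gs ih] U hU zU kU.
  exists (fun _ => 0%N); first exact: evpoly0.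
  move=> n; have -> : addsub (U n) (span (all_monos n [::])) = U n.
    apply/funext => y; apply/propext; split=> [[z hz /eqP]|]; first by rewrite subr_eq0 => /eqP ->.
    by apply: addsubl; apply: issub_span.
  exact: isLen_refl.
have [|h1 e1 l1] := @evpoly_monos U g hU zU.
  by move=> n x a hx; apply: kU; rewrite /all_monos /= mem_cat hx.
have hU1 n : issub (addsub (U n) (span (monos n g))) by apply: issub_add (issub_span _).
have [||h2 e2 l2] := ih (fun n => addsub (U n) (span (monos n g))) hU1.
- move=> n i x hi [u hu hx]; exists (zs`_i *: u); first exact: zU.
  rewrite -scalerBr; apply: (span_sub (P := fun x => span (monos n.+1 g) (zs`_i *: x))) hx.
    exact: (issub_ker (scl V zs`_i) (issub_span _)).
  by move=> y hy; apply/span_mem/monosS.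
- move=> n x a hx ma; apply: addsubl; first exact: issub_span.
  by apply: kU => //; rewrite /all_monos /= mem_cat hx orbT.
exists (fun n => (h1 n + h2 n)%N); first exact: evpolyD.
move=> n; have := l2 n; rewrite addsub_cat // => l2n.
apply: (isLen_add (hU n) (hU1 n) _ _ _ (l1 n) l2n).
- exact: issub_add (issub_span _).
- by move=> y; apply: addsubl; apply: issub_span.
- by rewrite -addsub_cat // => y; apply: addsubl; apply: issub_span.
Qed.

Lemma ipow_monos gs n v : (forall v, span gs v) -> ipow n v -> span (all_monos n gs) v.
Proof.
move=> hgs; elim: n v => [|n ih] v.
  move=> _; apply: span_mono (hgs v) => g hg; apply/flattenP; exists (monos 0 g); first exact: map_f.
  have e0 : g = mono zs (nseq e 0%N) *: g.
    by rewrite (_ : mono _ _ = 1) ?scale1r //; elim: (zs) => //= z r ->; rewrite expr0 mulr1.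
  by rewrite {1}e0; apply: (map_f (fun a => mono zs a *: g)); rewrite mem_exps size_nseq sumn_nseq eqxx.
have hS := issub_span (all_monos n.+1 gs).
apply: (isum_sub hS) => a u /mzs ha /ih hu.
apply: (span_sub (P := fun a : R^o => span (all_monos n.+1 gs) ((a : R) *: u)) _ _ ha).
  exact: (issub_ker (mulv u) hS).
move=> z /(nthP 0)[i hi <-].
apply: (span_sub (P := fun u => span (all_monos n.+1 gs) (zs`_i *: u)) _ _ hu).
  exact: (issub_ker (scl V zs`_i) hS).
move=> y /flattenP[_ /mapP[g hg ->] hy]; apply: span_mem; apply/flattenP.
by exists (monos n.+1 g); [apply: map_f|apply: monosS].
Qed.

Lemma mono_ipow a (g : V) : size a = e -> ipow (sumn a) (mono zs a *: g).
Proof.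
have : forall z, z \in zs -> m z by move=> z hz; apply/mzs; apply: (span_mem (V := R^o)).
elim: (zs) a g => [|z r ih] [|k a] g //= hz [sa].
rewrite -scalerA; apply: ipow_scale; first by apply: hz; rewrite mem_head.
by apply: ih => // y hy; apply: hz; rewrite inE hy orbT.
Qed.

(** V/m^n V is filtered by the m^i V/m^{i+1} V with i < n, and the monomials of
    degree i in the generators of m, applied to those of V, span the i-th step. *)
Lemma hilbert_samuel gs : (forall v : V, span gs v) ->
  exists2 H, evpoly H & forall n, isLen (@ipow V n) (fun _ => True) (H n).
Proof.
move=> hgs; have hI n : issub (@ipow V n) := issub_ipow V n.
have [||h eh lh] := @evpoly_all_monos (fun n => @ipow V n.+1) gs (fun n => hI n.+1).
- by move=> n i x hi hx; apply: isum1 => //; apply: mz.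
- move=> n x a /flattenP[_ /mapP[g _ ->] /mapP[b]]; rewrite mem_exps => /andP[/eqP sb /eqP <-] -> ma.
  by apply: isum1 => //; apply: mono_ipow.
exists (fun n => \sum_(j < n) h j)%N; first exact: evpoly_partial_sum.
elim=> [|n ih]; first by rewrite big_ord0; apply: isLen_refl.
rewrite big_ord_recr /= addnC; apply: (isLen_add (hI n.+1) (hI n)) ih => //.
  by move=> v; apply: ipowS.
have := lh n; have -> // : addsub (@ipow V n.+1) (span (all_monos n gs)) = @ipow V n.
apply/funext => v; apply/propext; split; last first.
  by move=> hv; apply: addsubr; [exact: (hI n.+1)|apply: ipow_monos].
case=> u /ipowS hu hv; rewrite -[v](subrK u); have [_ hD _] := hI n; apply: hD => //.
apply: (span_sub (hI n)) hv => x /flattenP[_ /mapP[g _ ->] /mapP[b]].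
by rewrite mem_exps => /andP[/eqP sb /eqP <-] ->; apply: mono_ipow.
Qed.
End Powers.

(** * Systems of parameters and multiplicity *)

(** As long as xs is shorter than the injective dimension t of the ring, V/(xs)V
    has no socle, because a socle element would kill Ext^t of the residue field. *)
Lemma regular_seq_ex (R : comNzRingType) (J : injective_resolution R) (m : R -> Prop) t
    (V : lmodType R) n : noeth R^o -> isloc m -> ext_bound J t -> ~ van J t (cyclic m) ->
  fgm V -> (forall i, (0 < i)%N -> van J i V) -> (n <= t)%N ->
  exists xs : seq R, [/\ size xs = n, forall x, x \in xs -> m x & Reg xs V].
Proof.
move=> nR lm hJ tm hV vV; elim: n => [|n ih] nt; first by exists [::].
have [xs [sz mxs rxs]] := ih (ltnW nt); have [[im _ _] _] := lm.
have fX : fgm (quo xs V) by apply: fgm_quo.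
have [|x mx rx] := @regular_in_coset R (quo xs V) m 0 nR (noeth_fgm nR fX) im.
  move=> v mv; apply: contrapT => v0; apply: tm.
  apply: (van_residue lm v0 mv); first by apply: (van_quo (a := 0%N)) => //; rewrite add0n sz.
  by apply: hJ => //; apply: fgm_qt.
rewrite add0r in rx; exists (rcons xs x); split; first by rewrite size_rcons sz.
  by move=> y; rewrite mem_rcons inE => /predU1P[->|/mxs].
exact/Reg_rcons.
Qed.

Section Ideals.
Variable R : comNzRingType.
Implicit Types (m Q I : R -> Prop) (V : lmodType R).

Definition ideal_pow m k (a : R) : Prop := ipow m k (a : R^o).

Lemma isidl_pow m k : isidl m -> isidl (ideal_pow m k).
Proof. by move=> hm; apply: (issub_ipow hm R^o k). Qed.

Lemma ipow_add m V k l (v : V) : isidl m -> ipow m (k + l) v ->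
  isum (ideal_pow m k) (@ipow R m V l) v.
Proof.
move=> hm; elim: k v => [|k ih] v.
  by rewrite add0n -[v in isum _ _ v]scale1r => hv; apply: isum1.
have hS : issub (isum (ideal_pow m k.+1) (@ipow R m V l)).
  exact: (issub_isum _ (isidl_pow k.+1 hm)).
apply: (isum_sub hS) => a u ha /ih hu.
apply: (isum_sub (U := fun u => isum (ideal_pow m k.+1) (@ipow R m V l) (a *: u)) _ _ hu).
  exact: (issub_ker (scl V a) hS).
move=> b y hb hy; rewrite scalerA; apply: isum1 => //; exact: isum1.
Qed.

(** If every prime containing Q contains m, a power of m lies in Q: otherwise an
    ideal maximal among those without this property would be prime. *)
Lemma power_in_ideal m Q : noeth R^o -> isidl m -> isidl Q ->
  (forall P, isprime P -> (forall a, Q a -> P a) -> forall a, m a -> P a) ->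
  exists k, forall a, ideal_pow m k a -> Q a.
Proof.
move=> nR hm hQ hP; apply: (@noeth_ind R R^o (fun I => (forall a, Q a -> I a) ->
  exists k, forall a, ideal_pow m k a -> I a) nR _ Q hQ) => // I hI ih QI.
case: (pselect (I 1)) => [I1|I1].
  by exists 0%N => a _; rewrite -[a]mulr1; apply: idlM.
case: (pselect (forall a b, I (a * b) -> I a \/ I b)) => [prI|].
  exists 1%N => a; apply: (isum_sub (U := I : R^o -> Prop) hI) => b u mb _.
  rewrite -[b *: u]/(b * u) mulrC; apply: idlM => //; exact: (hP I).
move=> /existsNP[a /existsNP[b /not_implyP[hab /not_orP[na nb]]]].
have big x : ~ I x -> exists k, forall y, ideal_pow m k y ->
    addsub (I : R^o -> Prop) (span ([:: x] : seq R^o)) y.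
  move=> nx; apply: ih; first by apply: issub_add hI (issub_span _).
  - by move=> y; apply: addsubl; apply: issub_span.
  - by exists x => //; apply: addsubr => //; apply: span_mem; rewrite inE.
  - by move=> y /QI; apply: addsubl; apply: issub_span.
have [k hk] := big a na; have [l hl] := big b nb; exists (k + l)%N => y /(ipow_add hm).
apply: (isum_sub (U := I : R^o -> Prop) hI) => x z /hk[i hi [r _ /eqP e1]] /hl[j hj [r' _ /eqP e2]].
have -> : x *: z = z * i + (r * a * j + r * r' * (a * b)) :> R.
  move: e1 e2; rewrite !subr_eq0 !subr_eq => /eqP e1 /eqP e2.
  have {}e1 : x = r * a + i by exact: e1.
  have {}e2 : (z : R) = r' * b + j by exact: e2.
  by rewrite -[x *: z]/(x * (z : R)) e1 {1}e2 {}e2; ring.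
by have [_ hD _] := hI; apply: (hD); [|apply: hD]; apply: idlM.
Qed.

Lemma ipow_mono m Q V k j (v : V) : isidl m -> isidl Q ->
  (forall a, ideal_pow m k a -> Q a) -> ipow m (k * j) v -> ipow Q j v.
Proof.
move=> hm hQ h; elim: j v => // j ih v; rewrite mulnS => /(ipow_add hm).
by apply: (isum_sub (issub_ipow hQ V j.+1)) => a u /h ha /ih hu; apply: isum1.
Qed.

(** Pigeonhole: a product of a + b factors from (x) + Q contains a factors x or
    b factors from Q. *)
Lemma ipow_split Q Q' x a b V (v : V) : isidl Q -> (forall y, Q' y -> exists r, Q (y - r * x)) ->
  ipow Q' (a + b) v -> addsub (@mulim R V (x ^+ a)) (@ipow R Q V b) v.
Proof.
move=> hQ hQ'; move: {2}(a + b)%N (leqnn (a + b)) => N; elim: N a b v => [|N ih] a b v.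
  rewrite leqn0 addn_eq0 => /andP[/eqP -> /eqP ->] _.
  by apply: addsubr => //; exact: issub_mulim.
have hS a' b' := issub_add (issub_mulim V (x ^+ a')) (issub_ipow hQ V b').
case: a => [|a] hN.
  by move=> _; apply: addsubl; [exact: issub_ipow|exists v; rewrite expr0 scale1r].
case: b hN => [|b] hN; first by move=> _; apply: addsubr => //; exact: issub_mulim.
rewrite addSn; apply: (isum_sub (hS a.+1 b.+1)) => y u /hQ'[r hr] hu.
have [_ hD _] := hS a.+1 b.+1.
rewrite -[y](subrK (r * x)) scalerDl; apply: hD.
  have hu' : ipow Q' (a.+1 + b) u by rewrite addSnnS.
  have [|u1 [v1 ->] h2] := ih a.+1 b u _ hu'; first by move: hN; rewrite !addSn !addnS.
  exists ((y - r * x) *: (x ^+ a.+1 *: v1)).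
    by exists ((y - r * x) *: v1); rewrite !scalerA mulrC.
  by rewrite -scalerBr; apply: isum1.
have [|u1 [v1 ->] h2] := ih a b.+1 u _ hu; first by move: hN; rewrite addSn.
exists ((r * x) *: (x ^+ a *: v1)).
  by exists (r *: v1); rewrite !scalerA exprS; congr (_ *: _); ring.
by rewrite -scalerBr; have [_ _ hZ] := issub_ipow hQ V b.+1; apply: hZ.
Qed.

Definition seq_ideal (xs : seq R) (a : R) : Prop := span (xs : seq R^o) a.

Lemma isidl_seq xs : isidl (seq_ideal xs).
Proof. exact: (issub_span (xs : seq R^o)). Qed.

Lemma ipow_pows (xs : seq R) n V : (forall x, x \in xs -> forall v : V, x ^+ n *: v = 0) ->
  forall v : V, ipow (seq_ideal xs) (size xs * n).+1 v -> v = 0.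
Proof.
elim: xs => [|x xs ih] hx v.
  by apply: (isum_sub issub0) => a u -> _; rewrite scale0r.
have -> : (size (x :: xs) * n).+1 = (n + (size xs * n).+1)%N by rewrite addnS.
move=> h; have [|u [v' ->]] := ipow_split (x := x) (isidl_seq xs) _ h.
  by move=> y [r _ hr]; exists r.
rewrite hx ?mem_head // subr0; apply: ih => y hy.
by apply: hx; rewrite inE hy orbT.
Qed.
End Ideals.

(** ** Lengths of quotients by powers of a regular sequence *)

Section RegularPowers.
Variable R : comNzRingType.
Implicit Types V : lmodType R.

Definition isL V k := isLen (fun x : V => x = 0) (fun _ => True) k.

Lemma isL_ses V' V V'' (f : {linear V' -> V}) (g : {linear V -> V''}) a b :
  ses f g -> isL V' a -> isL V'' b -> isL V (a + b).
Proof.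
move=> [fI gS gf] ha hb; have hI := issub_im f issubT.
apply: (isLen_add issub0 hI issubT) => //.
- by move=> x ->; case: hI.
- have -> : (fun w => exists2 v, True & w = f v) = addsub (fun x : V => x = 0) (fun y => exists2 z, True & y = f z).
    apply/funext => y; apply/propext; split; first by apply: addsubr; exact: issub0.
    by case=> u ->; rewrite subr0.
  apply/(isLen_image (g := id) (f := f)) => //; [by move=> x; exists x|exact: linearD|
    by move=> c x; rewrite linearZ|exact: issub0|].
  congr (isLen _ _ a): ha; apply/funext => z; apply/propext; split=> [->|[_ e]]; first by rewrite linear0.
  by apply: fI; rewrite linear0.
suff : isLen (fun z => True /\ g z = 0) (fun _ : V => True) b.
  congr (isLen _ _ b); apply/funext => v; apply/propext.
  by split=> [[_ /gf[u ->]]|[u _ ->]]; [exists u|split=> //; apply/gf; exists u].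
apply/(isLen_quotient (g := id) (f := g)) => //; [by move=> x; exists x|exact: linearD|by move=> c x; rewrite linearZ|].
by move=> y; have [v <-] := gS y; exists v.
Qed.

(** Snake lemma: dividing by z is exact here because z is regular on V''. *)
Lemma ses_quo xs V' V V'' (f : {linear V' -> V}) (g : {linear V -> V''}) : ses f g ->
  Reg xs V' -> Reg xs V'' -> Reg xs V /\
  exists (f' : {linear quo xs V' -> quo xs V}) (g' : {linear quo xs V -> quo xs V''}), ses f' g'.
Proof.
elim: xs V' V V'' f g => [|z xs ih] V' V V'' f g fg /=; first by split=> //; exists f, g.
move=> [z1 r1] [z2 r2]; have [fI gS gf] := fg.
have zV : reg_on V z.
  move=> v e; have /gf[u eu] : g v = 0 by apply: z2; rewrite -linearZ e linear0.
  rewrite eu; suff -> : u = 0 by rewrite linear0.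
  by apply: z1; apply: fI; rewrite linear0 linearZ -eu.
have [f1 e1] := quo_map [:: z] f; have [g1 e2] := quo_map [:: z] g.
suff fg1 : ses f1 g1 by have [h1 h2] := ih _ _ _ f1 g1 fg1 r1 r2.
split=> [x y e|y|y].
- apply/eqP; rewrite -subr_eq0; apply/eqP; have : f1 (x - y) = 0 by rewrite linearB e subrr.
  have [u <-] := qpi_surj (x - y); rewrite [f1 _]e1 => /qpi0[|v ev]; first exact: issub_mulim.
  apply/qpi0; first exact: issub_mulim.
  have /gf[u' eu] : g v = 0 by apply: z2; rewrite -linearZ -ev (ses0 _ fg).
  by exists u'; apply: fI; rewrite linearZ -eu.
- have [u <-] := qpi_surj y; have [v <-] := gS u.
  by exists (qpi (@mulim R V z) v); rewrite [g1 _]e2.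
have [v <-] := qpi_surj y; rewrite [g1 _]e2; split.
  move=> /qpi0[|w ew]; first exact: issub_mulim.
  have [v2 ev2] := gS w; have /gf[u eu] : g (v - z *: v2) = 0 by rewrite linearB ew linearZ ev2 subrr.
  exists (qpi (@mulim R V' z) u); rewrite [f1 _]e1 -eu linearB; apply/eqP.
  rewrite -subr_eq0 opprB addrC subrK; apply/eqP/qpi0; first exact: issub_mulim.
  by exists v2.
case=> x; have [u <-] := qpi_surj x; rewrite [f1 _]e1 => /eqP; rewrite -subr_eq0 -linearB.
move=> /eqP/qpi0[|w ew]; first exact: issub_mulim.
apply/qpi0; first exact: issub_mulim.
by exists (g w); rewrite -linearZ -ew linearB (ses0 _ fg) subr0.
Qed.

Lemma reg_pow V x n : reg_on V x -> reg_on V (x ^+ n).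
Proof.
move=> hx; elim: n => [|n ih] v; first by rewrite expr0 scale1r.
by rewrite exprS -scalerA => /hx/ih.
Qed.

Lemma ses_pow V x n : reg_on V x -> exists (f : {linear Qt (@mulim R V x) -> Qt (@mulim R V (x ^+ n.+1))})
  (g : {linear Qt (@mulim R V (x ^+ n.+1)) -> Qt (@mulim R V (x ^+ n))}), ses f g.
Proof.
move=> hx; have hn := reg_pow (n := n) hx.
have [|v /qpi0[|u ->]|f ef] := @lin_factor _ _ _ _ (qpi (@mulim R V x))
    (lcomp (qpi (@mulim R V (x ^+ n.+1))) (scl V (x ^+ n))).
- exact: qpi_surj.
- exact: issub_mulim.
- by apply/qpi0; [exact: issub_mulim|exists u; rewrite /= scalerA -exprSr].
have [|v /qpi0[|u ->]|g eg] := @lin_factor _ _ _ _ (qpi (@mulim R V (x ^+ n.+1)))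
    (qpi (@mulim R V (x ^+ n))).
- exact: qpi_surj.
- exact: issub_mulim.
- by apply/qpi0; [exact: issub_mulim|exists (x *: u); rewrite scalerA -exprSr].
exists f, g; split=> [y z e|y|y].
- apply/eqP; rewrite -subr_eq0; apply/eqP; have : f (y - z) = 0 by rewrite linearB e subrr.
  have [u <-] := qpi_surj (y - z); rewrite ef /= => /qpi0[|v ev]; first exact: issub_mulim.
  apply/qpi0; first exact: issub_mulim.
  exists v; apply/eqP; rewrite -subr_eq0; apply/eqP/hn.
  by rewrite scalerBr ev scalerA -exprSr subrr.
- by have [v <-] := qpi_surj y; exists (qpi (@mulim R V (x ^+ n.+1)) v).
have [v <-] := qpi_surj y; rewrite eg; split.
  by move=> /qpi0[|u ->]; [exact: issub_mulim|exists (qpi (@mulim R V x) u); rewrite ef].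
case=> z; have [u <-] := qpi_surj z; rewrite ef /= => /eqP; rewrite -subr_eq0 -linearB.
move=> /eqP/qpi0[|u' e]; first exact: issub_mulim.
apply/qpi0; first exact: issub_mulim.
exists (u + x *: u'); rewrite scalerDr scalerA -exprSr -e addrC subrK //.
Qed.

(** V/x^{n+1}V is an extension of V/x^nV by V/xV. *)
Lemma isL_pow xs V x n c : Reg (x :: xs) V -> isL (quo (x :: xs) V) c ->
  Reg (x ^+ n.+1 :: xs) V /\ isL (quo (x ^+ n.+1 :: xs) V) (n.+1 * c).
Proof.
move=> [hx hr] hc; suff [h1 h2] : Reg xs (Qt (@mulim R V (x ^+ n.+1))) /\
    isL (quo xs (Qt (@mulim R V (x ^+ n.+1)))) (n.+1 * c).
  by split=> //; split=> //; apply: reg_pow.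
elim: n => [|n [h1 h2]]; first by rewrite expr1 mul1n.
have [f [g fg]] := ses_pow n.+1 hx; have [h3 [f' [g' fg']]] := ses_quo fg hr h1.
by split=> //; rewrite mulSn; apply: isL_ses fg' hc h2.
Qed.

Lemma isL_pows xs V n c : Reg xs V -> isL (quo xs V) c ->
  isL (quo [seq x ^+ n.+1 | x <- xs] V) (n.+1 ^ size xs * c).
Proof.
elim: xs V c => [|x xs ih] V c hr hc; first by rewrite mul1n.
have [[_ h1] h2] := isL_pow n hr hc.
by rewrite /= expnSr -mulnA; apply: ih.
Qed.
End RegularPowers.

(** * Positivity of the leading coefficient *)

Lemma poly_bound (q : {poly rat}) d : (size q <= d.+1)%N ->
  exists2 B : rat, 0 <= B & forall n : nat, (0 < n)%N -> `|q.[n%:R]| <= B * n%:R ^+ d.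
Proof.
move=> sq; exists (\sum_(i < size q) `|q`_i|); first by apply: sumr_ge0.
move=> n n0; rewrite horner_coef mulr_suml; apply: le_trans (ler_norm_sum _ _ _) _.
apply: ler_sum => i _; rewrite normrM ler_wpM2l //.
have n1 : 1 <= n%:R :> rat by rewrite ler1n.
rewrite ger0_norm ?exprn_ge0 //; apply: ler_weXn2l => //.
by rewrite -ltnS; apply: leq_trans (ltn_ord i) sq.
Qed.

Lemma no_linear_bound (a B : rat) N : 0 < a -> ~ forall n : nat, (N <= n)%N -> a * n%:R <= B.
Proof.
move=> a0 h; have := h (maxn N (Num.bound (`|B| / a))) (leq_maxl _ _).
rewrite leNgt => /negP; apply; rewrite mulrC -ltr_pdivrMr //.
apply: (@le_lt_trans _ _ (`|B| / a)); first by rewrite ler_pM2r ?invr_gt0 // ler_norm.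
apply: (@lt_le_trans _ _ (Num.bound (`|B| / a))%:R).
  by apply: archi_boundP; rewrite divr_ge0 // ltW.
by rewrite ler_nat leq_maxr.
Qed.

(** At large multiples of k the leading term of p dominates the others, so the
    bounds leave no room for a higher degree or for a coefficient <= 0. *)
Lemma growth_coef (p : {poly rat}) d C k N : (0 < d)%N -> (0 < k)%N ->
  (forall n, (N <= n)%N -> p.[n%:R] <= C%:R * n%:R ^+ d) ->
  (forall n, (N <= n)%N -> n%:R ^+ d <= p.[(k * n)%:R]) -> 0 < p`_d.
Proof.
move=> d0 k0 up low.
have kn n : (n <= k * n)%N by rewrite leq_pmull.
have n0 n : (maxn N 1 <= n)%N -> [/\ (N <= n)%N, (N <= k * n)%N, (0 < k * n)%N & 0 < (k * n)%:R :> rat].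
  rewrite geq_max => /andP[h1 h2]; rewrite ltr0n muln_gt0 k0 h2; split=> //.
  exact: leq_trans h1 (kn n).
have sp : (size p <= d.+1)%N.
  rewrite leqNgt; apply/negP => hs; pose D := (size p).-2.
  have sE : size p = D.+2 by rewrite /D; move: hs; case: (size p) => [|[]].
  have dD : (d <= D)%N by rewrite -2!ltnS -sE.
  pose l := p`_D.+1; have l0 : 0 < `|l|.
    by rewrite normr_gt0 (_ : l = lead_coef p) ?lead_coef_eq0 -?size_poly_gt0 ?sE // /l /lead_coef sE.
  pose q := p - l *: 'X^(D.+1).
  have [|B B0 hB] := @poly_bound q D.
    apply/leq_sizeP => j hj; rewrite coefB coefZ coefXn; case: (eqVneq j D.+1) => [->|jD].
      by rewrite mulr1 subrr.
    rewrite mulr0 subr0; apply: nth_default; rewrite sE ltn_neqAle eq_sym jD; lia.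
  apply: (@no_linear_bound (`|l| * k%:R) (C%:R + B) (maxn N 1)); first by rewrite mulr_gt0 // ltr0n.
  move=> n /n0[h1 h2 h3 x0]; set x := (k * n)%:R in x0.
  have xD : 0 < x ^+ D by rewrite exprn_gt0.
  rewrite -(ler_pM2r xD) mulrDl.
  have -> : `|l| * k%:R * n%:R * x ^+ D = `|l| * x ^+ D.+1 by rewrite exprS /x natrM; ring.
  have e : l * x ^+ D.+1 = p.[x] - q.[x] by rewrite /q !hornerE subKr.
  have -> : `|l| * x ^+ D.+1 = `|p.[x] - q.[x]| by rewrite -e normrM (ger0_norm (ltW (exprn_gt0 _ x0))).
  apply: le_trans (ler_normB _ _) _; apply: lerD; last exact: hB.
  rewrite ger0_norm; last by apply: le_trans (low n h1); rewrite exprn_ge0.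
  apply: le_trans (up _ h2) _; rewrite ler_wpM2l ?ler0n //; apply: ler_weXn2l => //.
  by rewrite ler1n.
case: d d0 up low sp => // d _ up low sp.
pose a := p`_d.+1; pose q := p - a *: 'X^(d.+1).
have [|B B0 hB] := @poly_bound q d.
  apply/leq_sizeP => j hj; rewrite coefB coefZ coefXn; case: (eqVneq j d.+1) => [->|jD].
    by rewrite mulr1 subrr.
  rewrite mulr0 subr0; apply: nth_default; apply: leq_trans sp _; rewrite ltn_neqAle eq_sym jD; lia.
rewrite ltNge; apply/negP => a0; apply: (@no_linear_bound 1 (B * k%:R ^+ d) (maxn N 1)) => // n hn.
have [h1 h2 h3 x0] := n0 n hn; have n1 : 0 < n%:R :> rat by move: hn; rewrite geq_max ltr0n => /andP[].
rewrite mul1r -(ler_pM2r (exprn_gt0 d n1)) -exprS -mulrA -exprMn -natrM.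
apply: le_trans (low n h1) _; apply: le_trans _ (hB _ h3); apply: le_trans _ (ler_norm _).
by rewrite /q !hornerE lerBrDr gerDl mulr_le0_ge0 // exprn_ge0 // ltW.
Qed.

Section HilbertSamuel.
Variables (R : comNzRingType) (m : R -> Prop).
Hypotheses (nR : noeth R^o) (lm : isloc m).
Implicit Types V W : lmodType R.

Let im : isidl m. Proof. by have [[h _ _] _] := lm. Qed.

Lemma hilbert_samuel_function V : fgm V ->
  exists2 H, evpoly H & forall n, isLen (@ipow R m V n) (fun _ => True) (H n).
Proof.
move=> [gs hgs]; have [zs hz] := nR im.
exact: (hilbert_samuel im lm hz hgs).
Qed.

(** With xs a regular sequence generating an ideal that contains a power of m,
    the lengths of V/m^n V are squeezed between those of V/(x_1^n, .., x_d^n)V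
    for comparable n, which are n^d times the length of V/(xs)V. *)
Lemma hilbert_samuel_growth W H xs k : fgm W -> (exists v : W, v <> 0) ->
  (forall x, x \in xs -> m x) -> Reg xs W ->
  (forall a, ideal_pow m k a -> seq_ideal xs a) ->
  (forall n, isLen (@ipow R m W n) (fun _ => True) (H n)) ->
  exists C l, [/\ (0 < l)%N, forall n, (0 < n)%N -> (H n <= C * n ^ size xs)%N &
    forall n, (0 < n)%N -> (n ^ size xs <= H (l * n))%N].
Proof.
move=> hW [v0 nv0] mxs rxs kxs hH; have hI n := issub_ipow im W n.
have [C hC] : exists C, isL (quo xs W) C.
  have [H' _ hH'] := hilbert_samuel_function (fgm_quo xs hW).
  exists (H' k); congr (isLen _ _ _): (hH' k); apply/funext => v; apply/propext.
  split=> [|->]; last by have [] := issub_ipow im (quo xs W) k.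
  rewrite -[k]addn0 => /(ipow_add im); apply: (isum_sub issub0) => a u /kxs ha _.
  apply: quo_ann; apply: (span_sub (P := fun a : R^o => quoP xs R^o a = 0)) ha.
    exact: (issub_ker (quoP xs R^o) issub0).
  by move=> x hx; rewrite -[x]mulr1 -[x * 1]/(x *: (1 : R^o)) quoP_mul.
have C0 : (0 < C)%N.
  rewrite lt0n; apply/eqP => C0; rewrite C0 in hC; apply: nv0.
  have q0 : forall v : quo xs W, v = 0.
    by move=> v; apply: (isLen_eq0 issubT _ hC issub0).
  apply: (nakayama_loc (V := W) (P := fun _ => True) lm issub0 (noeth_fgm nR hW issubT)) => // v _.
  exists v; last by rewrite subrr.
  apply: (quoP_ker (U := isum m (fun _ : W => True)) _ _ (q0 (quoP xs W v))).
    exact: (issub_isum _ im).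
  by move=> x u hx; apply: isum1 => //; apply: mxs.
pose ys n := [seq x ^+ n.+1 | x <- xs].
pose K n (v : W) := quoP (ys n) W v = 0.
have hK n : issub (K n) := issub_ker (quoP (ys n) W) issub0.
have lK n : isLen (K n) (fun _ => True) (n.+1 ^ size xs * C).
  suff : isLen (fun z => True /\ quoP (ys n) W z = 0) (fun _ : W => True) (n.+1 ^ size xs * C).
    by congr (isLen _ _ _); apply/funext => v; apply/propext; split=> [[]|].
  apply/(isLen_quotient (g := id) (f := quoP (ys n) W)) => //; [by move=> x; exists x|
    exact: linearD|by move=> c x; rewrite linearZ| |exact: isL_pows].
  by move=> y; have [v <-] := quoP_surj y; exists v.
exists C, (k * (size xs).+1).+1; split=> // -[//|n] _.
  have le : lesub (K n) (@ipow R m W n.+1).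
    move=> v; apply: (quoP_ker (hI n.+1)) => x u /mapP[y hy ->].
    by have := @ipow_scale R m W y n.+1 0 u (mxs _ hy) I; rewrite addn0.
  have [a [b [_ hb e]]] := isLen_sub (hK n) (hI n.+1) issubT le (fun _ _ => I) (lK n).
  by rewrite (isLen_unique (hH n.+1) hb) mulnC e leq_addl.
have le : lesub (@ipow R m W ((k * (size xs).+1).+1 * n.+1)) (K n).
  move=> v /(ipow_le (i := (k * (size xs * n.+1).+1)%N) im) h.
  have {}h : ipow m (k * (size xs * n.+1).+1) v by apply: h; nia.
  have := ipow_map (isidl_seq xs) (quoP (ys n) W) (ipow_mono im (isidl_seq xs) kxs h).
  apply: ipow_pows => x hx u; have [u' <-] := quoP_surj u; rewrite -linearZ.
  by apply: quoP_mul; apply: (map_f (fun x => x ^+ n.+1)).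
have [a [b [_ hb e]]] := isLen_sub (hI _) (hK n) issubT le (fun _ _ => I) (hH _).
rewrite e (isLen_unique hb (lK n)); apply: leq_trans (leq_addl _ _).
by rewrite leq_pmulr.
Qed.

(** The submodule m^n M + W of M cuts M/m^n M into W/m^n W and mu copies of
    R/m^n. *)
Lemma hilbert_samuel_split (M W : lmodType R) mu HR HW n : miso M ('rV[R]_mu * W)%type ->
  isLen (@ipow R m R^o n) (fun _ => True) HR -> isLen (@ipow R m W n) (fun _ => True) HW ->
  isLen (@ipow R m M n) (fun _ => True) (HW + mu * HR).
Proof.
move=> /miso_split[b [pi [io [rho [pib piio rhoio xE]]]]] hR hW.
have hM := issub_ipow im M n; have hA := issub_ipow im R^o n.
pose JW x := forall j, ipow m n (pi j x).
have hJ : issub JW.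
  have [a0 aD aZ] := hA; split=> [j|x y hx hy j|c x hx j].
  - by rewrite linear0.
  - by rewrite linearD; apply: aD.
  - by rewrite linearZ /=; apply: aZ.
have pisum (z : 'I_mu -> R) i : pi i (\sum_j z j *: b j) = z i.
  rewrite linear_sum (bigD1 i) // linearZ pib eqxx big1.
    by change (z i * 1 + 0 = z i); rewrite mulr1 addr0.
  by move=> j /andP[_ ji]; rewrite linearZ pib eq_sym (negPf ji); exact: scaler0.
have le : lesub (@ipow R m M n) JW by move=> x hx j; apply: ipow_map.
apply: (isLen_add hM hJ issubT le) => //.
  have -> : JW = addsub (@ipow R m M n) (fun y => exists2 z, True & y = io z).
    apply/funext => x; apply/propext; split=> [hx|[u hu [z _ e]] j]; last first.
      by rewrite -[x](subrK u) e linearD piio add0r; apply: ipow_map.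
    exists (\sum_j (pi j x : R) *: b j); last by exists (rho x); rewrite // {1}[x]xE addrC addKr.
    by apply: issub_sum => // j _; apply: (ipow_map im (mulv (b j))).
  apply/(isLen_image (g := id) (f := io)) => //; [by move=> x; exists x|exact: linearD|
    by move=> c x; rewrite linearZ|].
  congr (isLen _ _ _): hW; apply/funext => z; apply/propext; split=> [hz|[_ hz]].
    by split=> //; apply: ipow_map.
  by rewrite -[z]rhoio; apply: ipow_map.
have [|j z hz i|y _|l hl [_ cmp]] := isLen_sum hA issubT (fun _ _ => I) hJ issubT (fun _ _ => I)
  (phi := fun j => mulv (b j)) _ _ _ hR.
- by [].
- have -> : pi i (mulv (b j) z) = ((i == j)%:R : R) *: z.
    transitivity ((z : R) *: pi i (b j)); first exact: linearZ.
    by rewrite pib -[_ *: _]/((z : R) * (i == j)%:R) mulrC.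
  by have [_ _ aZ] := hA; apply: aZ.
- exists (fun j => pi j y); split=> // i.
  by rewrite linearB (pisum (fun j => pi j y)) subrr; have [] := hA.
have -> // : (mu * HR)%N = l.
by rewrite cmp // => z _ hz j; have := hz j; rewrite pisum.
Qed.
End HilbertSamuel.

(** * The multiplicity criterion *)

Lemma powmodP (R : comNzRingType) (m : idealr R) (V : lmodType R) n (x : V) :
  x \in powmod m n <-> ipow (fun a => a \in m) n x.
Proof.
have im : isidl (fun a => a \in m).
  by split; [exact: idealr0|move=> y z; exact: rpredD|move=> a y; exact: idealMr].
elim: n x => // n ih x; have hI := issub_ipow im V n.+1; split=> [/asboolP h|].
  by apply/(mspanP x hI); apply: h => _ [a [u [ha /ih hu ->]]]; apply/(mspanP _ hI); apply: isum1.
apply: (isum_sub (issub_submod (smul m (powmod m n)))) => a u ha /ih hu.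
by apply/asboolP => U; apply; exists a, u.
Qed.

Lemma mlength_powmod (R : comNzRingType) (m : idealr R) (V : lmodType R) n k :
  isLen (@ipow R (fun a => a \in m) V n) (fun _ => True) k ->
  mlength (modquot (powmod (V := V) m n)) = k.
Proof.
move=> hk; pose q : {linear V -> _} := mproj (powmod m n : submodClosed V).
apply: mlengthE; apply/(isLen_quotient (g := id) (f := q) (Z := fun _ => True)) => //;
  [by move=> x; exists x|exact: linearD|by move=> c x; rewrite linearZ| |].
  by move=> y; exists (repr y) => //; exact: mprojK.
congr (isLen _ _ k): hk; apply/funext => x; apply/propext.
by split=> [/powmodP h|[_ /mproj0 h]]; [split=> //; apply/mproj0|apply/powmodP].
Qed.

Lemma hilbert_samuel_polyP (R : comNzRingType) (m : idealr R) (V : lmodType R) H :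
  evpoly H -> (forall n, isLen (@ipow R (fun a => a \in m) V n) (fun _ => True) (H n)) ->
  exists N, forall n, (N <= n)%N ->
    (xget 0 (hilbert_samuel_poly m V : set _)).[n%:R] = (H n)%:R.
Proof.
move=> [p [N hp]] hH; case: xgetP => [q _ [K hq]|no].
  by exists K => n hn; rewrite hq // (mlength_powmod (hH n)).
by case: (no p); exists N => n hn; rewrite -hp // (mlength_powmod (hH n)).
Qed.

Lemma van_prod (R : comNzRingType) (J : injective_resolution R) (V W : lmodType R) i :
  van J i V -> van J i W -> van J i (V * W)%type.
Proof.
have h : ses (injl V W) (projr V W).
  split=> [u v [->]|v|[u v]] //; first by exists (0, v).
  by split=> [/= ->|[u' [_ ->]]]; [exists u|].
by move=> h1 h2; apply: (van_middle h).
Qed.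

Section Multiplicity.
Variables (O : idomainType) (varpi : O) (hO : dvr_uniformizer varpi).
Variables (A : comAlgType O) (m : idealr A) (lam : {lrmorphism A -> O^o}).
Hypotheses (hA : in_CO lam m) (hG : gorenstein A).
Variable F : free_resolution (O_mod lam).
Local Notation mm := (fun a : A => a \in m).

Let nR : noeth A^o. Proof. by have [nA _ _ _ _] := hA; apply: noetherianP. Qed.
Let lm : isloc mm. Proof. by have [_ lA _ _ _] := hA; apply: isloc_local. Qed.

(** A sequence regular on A x M is regular on both factors: on A it generates an
    ideal containing a power of m, since a prime above it is m. *)
Lemma parameters_ex (M : lmodType A) : max_cohen_macaulay m M ->
  exists xs k, [/\ size xs = krull_dim A, (0 < size xs)%N, forall x, x \in xs -> x \in m, Reg xs M &
    forall a, ideal_pow mm k a -> seq_ideal xs a].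
Proof.
move=> hM; have [J [vs [ys [s d]]]] := mcm_data_ex hO hA hG F hM.
have hJ := md_bound d; have [im _ _] := proj1 lm.
have vV i : (0 < i)%N -> van J i (A^o * M)%type.
  case: i => // i _; apply: van_prod; first exact: van_ring.
  apply: (van_depth nR lm hJ (md_vs d) (md_fgm d) (md_reg d)).
  by rewrite addSn ltnS leq_addl.
have tm : ~ van J (size vs) (cyclic mm) by rewrite (md_size d); apply: md_top d.
have [xs [sx mxs rxs]] := regular_seq_ex nR lm hJ tm (fgm_prod (fgm_ring A) (md_fgm d)) vV (leqnn _).
have rA : Reg xs A^o by apply: (Reg_retract (f := injl A^o M) (g := projl A^o M)) rxs.
have rM : Reg xs M by apply: (Reg_retract (f := injr A^o M) (g := projr A^o M)) rxs.
have [|k hk] := power_in_ideal nR im (isidl_seq xs).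
  move=> P pP hP; apply: (prime_over_sop nR lm (J := J) _ rA pP); first by rewrite sx.
  by move=> x hx; apply: hP; apply: (span_mem (V := A^o)).
exists xs, k; split=> //; last by rewrite sx (md_size d).
by rewrite sx (md_dim d).
Qed.

(** A nonzero W in M = A^mu + W would add a positive amount to the
    multiplicity, because a system of parameters is regular on it. *)
Lemma free_of_multiplicity (M : lmodType A) mu (W : lmodType A) : max_cohen_macaulay m M ->
  miso M ('rV[A]_mu * W)%type ->
  hs_multiplicity m M <= mu%:R * hs_multiplicity m A^o -> fin_free M.
Proof.
move=> hM iso mult; have [hfM _] := mcm_regular_seq hM.
have [xs [k [sx x0 mxs rM kxs]]] := parameters_ex hM.
have [n [pi [io [rho [pin piio rhoio xE]]]]] := miso_split iso.
suff W0 (x : W) : x = 0.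
  have [f hf] := rV_linear n; exists mu, f; exists (fun x => \row_j (pi j x : A)) => [v|x].
    apply/rowP => i; rewrite mxE hf linear_sum (bigD1 i) // linearZ pin eqxx big1.
      by change (v 0 i * 1 + 0 = v 0 i); rewrite mulr1 addr0.
    by move=> j /andP[_ ji]; rewrite linearZ pin eq_sym (negPf ji); exact: scaler0.
  rewrite hf [RHS]xE (W0 (rho x)) linear0 addr0; apply: eq_bigr => j _; by rewrite mxE.
apply: contrapT => nx; have fW : fgm W.
  by apply: (fgm_surj (f := rho)) hfM => y; exists (io y).
have [HA eA lA] := hilbert_samuel_function nR lm (fgm_ring A).
have [HM eM lM] := hilbert_samuel_function nR lm hfM.
have [HW _ lW] := hilbert_samuel_function nR lm fW.
have HE i : HM i = (HW i + mu * HA i)%N.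
  exact: isLen_unique (lM i) (hilbert_samuel_split lm iso (lA i) (lW i)).
have rW := Reg_retract rhoio rM.
have [C [l [l0 up low]]] := hilbert_samuel_growth nR lm fW (ex_intro _ x nx) mxs rW kxs lW.
have [NA hpA] := hilbert_samuel_polyP eA lA; have [NM hpM] := hilbert_samuel_polyP eM lM.
move: mult; rewrite /hs_multiplicity; set pM := xget _ _ in hpM *; set pA := xget _ _ in hpA *.
rewrite mulrCA ler_pM2l; last by rewrite ltr0n fact_gt0.
pose p := pM - mu%:R *: pA.
have hp i : (maxn NA NM <= i)%N -> p.[i%:R] = (HW i)%:R.
  by rewrite geq_max => /andP[hi hi']; rewrite /p !hornerE hpA // hpM // HE natrD natrM addrK.
have := @growth_coef p (size xs) C l (maxn (maxn NA NM) 1) x0 l0.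
have pE : p`_(size xs) = pM`_(krull_dim A) - mu%:R * pA`_(krull_dim A) by rewrite coefB coefZ sx.
rewrite pE subr_gt0 ltNge => h le; move: h; rewrite le => /(_ _ _)/negP; apply=> //.
  move=> i; rewrite geq_max => /andP[hi i0]; rewrite hp // -natrX -natrM ler_nat.
  exact: up.
move=> i; rewrite geq_max => /andP[hi i0]; rewrite hp; last by apply: leq_trans hi (leq_pmull _ l0).
by rewrite -natrX ler_nat; apply: low.
Qed.
End Multiplicity.

Theorem theorem2 (O : idomainType) (varpi : O) (hO : dvr_uniformizer varpi)
    (A : comAlgType O) (m : idealr A) (lam : {lrmorphism A -> O^o})
    (hA : in_CO lam m) (hG : gorenstein A)
    (F : free_resolution (O_mod lam))
    (M : lmodType A) (hM : max_cohen_macaulay m M)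
    (mu : nat) (hmu : mu = mrank (locmod (ker_ideal lam) M))
    (hmu0 : mu <> 0%N) :
  (wiles_defect F M = mu%:Z * wiles_defect F A^o <->
     exists W : lmodType A,
       miso M ('rV[A]_mu * W)%type /\
       (forall w : locmod (ker_ideal lam) W, w = 0)) /\
  (wiles_defect F M = mu%:Z * wiles_defect F A^o ->
     hs_multiplicity m M <= mu%:R * hs_multiplicity m A^o ->
     fin_free M).
Proof.
split; first split.
- move=> e; have [W [iso tors]] := free_summand_of_defect hO hA hG hM hmu e.
  by exists W; split=> //; apply/locmod_eq0.
- case=> W [iso /locmod_eq0 tors].
  exact: (defect_of_free_summand hO hA hG F hM hmu iso tors).
move=> e le; have [W [iso _]] := free_summand_of_defect hO hA hG hM hmu e.
exact: (free_of_multiplicity hO hA hG F hM iso le).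
Qed.
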